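(* For a smooth flow on an oriented closed $3$-dimensional manifold, being flat, being positively twisted and being negatively twisted are mutually exclusive properties.
   Context: A smooth flow (not necessarily Anosov) on an oriented closed $3$-manifold is called positively twisted if it admits a positive Birkhoff section, negatively twisted if it admits a negative Birkhoff section, and flat if it admits a global section, i.e. a Birkhoff section without boundary. Partial section: a subset $S\subset M$ which is the image of a smooth immersion $\iota:\widehat S\to M$ of a compact surface such that $\iota|_{\mathrm{Int}\,\widehat S}$ is an embedding transverse to the flow and $\iota(\partial\widehat S)$ is a finite union of closed orbits (denoted $\partial S$). The parametrization lifts to an immersion into the blow-up of $M$ along $\partial S$ (each closed orbit replaced by its unit normal bundle). The interior of $S$ is oriented by the orientation of $M$ and the co-orientation by the flow; each boundary component of $\widehat S$ gets the boundary orientation (outward normal first). The multiplicity of a boundary component is the degree of the covering of the closed orbit (oriented by the flow) onto which it is mapped; the component is positive (resp. negative) if the multiplicity is $>0$ (resp. $<0$). A partial section is positive (resp. negative) if its boundary is non-empty and all its boundary components are positive (resp. negative). A Birkhoff section is a partial section $S$ such that $\bigcup_{t\in[0,T]}\phi_t(S)=M$ for some $T>0$. *)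

(* Defs.v *)
From HB Require Import structures.
From mathcomp Require Import all_boot all_order all_algebra.
From mathcomp Require Import all_classical all_reals all_analysis.

Set Implicit Arguments.
Unset Strict Implicit.
Unset Printing Implicit Defensive.

Import Order.TTheory GRing.Theory Num.Theory.
Import numFieldNormedType.Exports.

Local Open Scope classical_set_scope.
Local Open Scope ring_scope.

Section SmoothMaps.
Variables (R : realType) (V W : normedModType R).

(* C^k on an open set U of a finite-dimensional space: differentiability
   together with C^(k-1) directional derivatives. *)
Fixpoint Ck (k : nat) (U : set V) (f : V -> W) : Prop :=
  if k is k'.+1 then
    (forall x, U x -> differentiable f x) /\
    (forall v, Ck k' U (fun x => 'D_v f x))
  else forall x, U x -> {for x, continuous f}.

(* Smoothness on an arbitrary subset: local existence of smooth extensions.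
   This is what smoothness up to the boundary of a half-plane means. *)
Definition smooth_on (A : set V) (f : V -> W) : Prop :=
  forall x, A x -> exists (U : set V) (g : V -> W),
    [/\ open U, U x, forall k, Ck k U g & forall y, U y -> A y -> g y = f y].

End SmoothMaps.

(* J is the Jacobian at u of a local smooth extension of f : A -> R^m.  It is
   unique when A is a relatively open subset of R^n or of a closed half-space.
   Matrices act on row vectors: row i of J is the i-th partial derivative. *)
Definition jacobian_on (R : realType) (n m : nat) (A : set 'rV[R]_n)
    (f : 'rV[R]_n -> 'rV[R]_m) (u : 'rV[R]_n) (J : 'M[R]_(n, m)) : Prop :=
  exists (U : set 'rV[R]_n) (g : 'rV[R]_n -> 'rV[R]_m),
    [/\ open U, U u, forall k, Ck k U g,
        forall y, U y -> A y -> g y = f y & J = 'J g u].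

(* A partial homeomorphism; cinv is only meaningful on cfwd @` cdom. *)
Record chart (R : realType) (n : nat) (M : topologicalType) := Chart {
  cdom : set M;
  cfwd : M -> 'rV[R]_n;
  cinv : 'rV[R]_n -> M }.

Section Manifolds.
Variable R : realType.

(* Charts modelled on H: the whole space, or a closed half-space for manifolds
   with boundary. *)
Record is_chart n (M : topologicalType) (H : set 'rV[R]_n) (c : chart R n M)
    : Prop := {
  chart_open : open (cdom c);
  chart_image : exists2 O, open O & cfwd c @` cdom c = O `&` H;
  chart_cancel : forall x, cdom c x -> cinv c (cfwd c x) = x;
  chart_fwd_cont : {within cdom c, continuous (cfwd c)};
  chart_inv_cont : {within cfwd c @` cdom c, continuous (cinv c)} }.

(* Coordinate expression of f in the charts c, d, and its domain when f is
   restricted to U. *)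
Definition rep n m (M N : topologicalType) (c : chart R n M) (d : chart R m N)
    (f : M -> N) : 'rV[R]_n -> 'rV[R]_m :=
  cfwd d \o f \o cinv c.

Definition repdom n m (M N : topologicalType) (U : set M) (c : chart R n M)
    (d : chart R m N) (f : M -> N) : set 'rV[R]_n :=
  cfwd c @` (cdom c `&` U `&` f @^-1` cdom d).

Definition tangent_matrix n m (M N : topologicalType) (U : set M)
    (c : chart R n M) (d : chart R m N) (f : M -> N) (x : M)
    (J : 'M[R]_(n, m)) : Prop :=
  jacobian_on (repdom U c d f) (rep c d f) (cfwd c x) J.

Definition compatible n (M : topologicalType) (c d : chart R n M) : Prop :=
  smooth_on (repdom setT c d idfun) (rep c d idfun) /\
  smooth_on (repdom setT d c idfun) (rep d c idfun).

(* A smooth atlas modelled on H whose coordinate changes have positive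
   Jacobian determinant, i.e. a smooth structure with an orientation. *)
Record oriented_atlas n (M : topologicalType) (H : set 'rV[R]_n)
    (A : set (chart R n M)) : Prop := {
  atlas_chart : forall c, A c -> is_chart H c;
  atlas_cover : forall x, exists2 c, A c & cdom c x;
  atlas_smooth : forall c d, A c -> A d -> compatible c d;
  atlas_oriented : forall c d x J, A c -> A d -> cdom c x -> cdom d x ->
    tangent_matrix setT c d idfun x J -> 0 < \det J }.

(* Second countability follows from compactness and the existence of charts. *)
Record compact_oriented_manifold n (M : topologicalType) (H : set 'rV[R]_n)
    (A : set (chart R n M)) : Prop := {
  manifold_hausdorff : hausdorff_space M;
  manifold_compact : compact [set: M];
  manifold_atlas : oriented_atlas H A }.

Definition closed_oriented_3manifold (M : topologicalType)
    (A : set (chart R 3 M)) : Prop :=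
  compact_oriented_manifold setT A.

Definition half_plane : set 'rV[R]_2 := [set u : 'rV[R]_2 | u 0 0 <= 0].

Definition compact_oriented_surface (S : topologicalType)
    (A : set (chart R 2 S)) : Prop :=
  compact_oriented_manifold half_plane A.

Definition bd (S : topologicalType) (A : set (chart R 2 S)) : set S :=
  [set x | exists c, [/\ A c, cdom c x & cfwd c x 0 0 = 0]].

Definition boundary_component (S : topologicalType) (A : set (chart R 2 S))
    (C : set S) : Prop :=
  exists2 x, bd A x & C = connected_component (bd A) x.

Definition smooth_map_on n m (M N : topologicalType) (A : set (chart R n M))
    (B : set (chart R m N)) (U : set M) (f : M -> N) : Prop :=
  {within U, continuous f} /\
  forall c d, A c -> B d -> smooth_on (repdom U c d f) (rep c d f).

Definition smooth_immersion_on n m (M N : topologicalType)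
    (A : set (chart R n M)) (B : set (chart R m N)) (U : set M) (f : M -> N)
    : Prop :=
  smooth_map_on A B U f /\
  forall c d x J, A c -> B d -> U x -> cdom c x -> cdom d (f x) ->
    tangent_matrix U c d f x J -> \rank J = n.

Definition id_chart n : chart R n 'rV[R]_n := Chart setT id id.

Section Flow.
Variables (M : topologicalType) (A : set (chart R 3 M)) (phi : R -> M -> M).

Record smooth_flow : Prop := {
  flow0 : forall x, phi 0 x = x;
  flowD : forall s t x, phi (s + t) x = phi s (phi t x);
  flow_cont : continuous (fun z : R * M => phi z.1 z.2);
  flow_smooth : forall c d, A c -> A d ->
    smooth_on
      [set z : R * 'rV[R]_3 | exists x,
         [/\ cdom c x, cfwd c x = z.2 & cdom d (phi z.1 x)]]
      (fun z : R * 'rV[R]_3 => cfwd d (phi z.1 (cinv c z.2))) }.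

Definition velocity (d : chart R 3 M) (x : M) : 'rV[R]_3 :=
  derive1 (fun t : R => cfwd d (phi t x)) 0.

(* In particular x is not a rest point. *)
Definition minimal_period (x : M) (T : R) : Prop :=
  [/\ 0 < T, phi T x = x & forall t, 0 < t < T -> phi t x <> x].

Definition closed_orbit (G : set M) : Prop :=
  exists x T, minimal_period x T /\ G = range (fun t => phi t x).

(* Local model of the blow-up along the axis {w = 0} of R x R^2: the manifold
   of (z, r, n) with r >= 0 and n a unit vector of R^2, with projection
   (z, r, n) |-> (z, r n); the axis is replaced by its unit normal bundle. *)
Definition blowup_model : set 'rV[R]_4 :=
  [set b : 'rV[R]_4 | 0 <= b 0 1 /\ b 0 2 ^+ 2 + b 0 3 ^+ 2 = 1].

Definition blowdown (b : 'rV[R]_4) : 'rV[R]_3 :=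
  \row_(j < 3) if j == 0 then b 0 0
               else if j == 1 then b 0 1 * b 0 2 else b 0 1 * b 0 3.

(* A chart of the smooth structure of M (of either orientation) in which G is
   the axis. *)
Definition adapted_chart (G : set M) (e : chart R 3 M) : Prop :=
  [/\ is_chart setT e, forall d, A d -> compatible e d &
      forall p, cdom e p -> G p <-> cfwd e p 0 1 = 0 /\ cfwd e p 0 2 = 0].

Section PartialSection.
Variables (S : topologicalType) (B : set (chart R 2 S)) (iota : S -> M).

(* iota lifts to an immersion into the blow-up of M along iota (bd S),
   expressed in the polar coordinates given by adapted charts.  An immersion
   to R x [0, oo[ x S^1 is the same as an immersion to R^4 with values
   there. *)
Definition lifts_to_blowup : Prop :=
  forall e, adapted_chart (iota @` bd B) e ->
    exists l : S -> 'rV[R]_4,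
      (forall y, cdom e (iota y) ->
         blowup_model (l y) /\ blowdown (l y) = cfwd e (iota y)) /\
      smooth_immersion_on B [set id_chart 4] (iota @^-1` cdom e) l.

(* ps_oriented says that the orientation of S given by B is the one induced by
   the orientation of M and the flow (flow direction first, equivalently last,
   in dimension 3); transversality determines it, so it is not extra data.
   With ps_immersion and ps_injective, ps_embedding makes iota an embedding of
   the interior. *)
Record partial_section : Prop := {
  ps_surface : compact_oriented_surface B;
  ps_immersion : smooth_immersion_on B A setT iota;
  ps_injective : forall x y, ~ bd B x -> ~ bd B y -> iota x = iota y -> x = y;
  ps_embedding : forall U : set S, open U -> U `<=` ~` bd B ->
    exists2 V : set M, open V & iota @` U = V `&` iota @` (~` bd B);
  ps_transverse : forall c d x J, B c -> A d -> ~ bd B x ->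
    cdom c x -> cdom d (iota x) -> tangent_matrix setT c d iota x J ->
    ~~ (velocity d (iota x) <= J)%MS;
  ps_oriented : forall c d x J, B c -> A d -> ~ bd B x ->
    cdom c x -> cdom d (iota x) -> tangent_matrix setT c d iota x J ->
    0 < \det (col_mx (velocity d (iota x)) J : 'M[R]_3);
  ps_boundary : exists F : set (set M),
    [/\ finite_set F, forall G, F G -> closed_orbit G &
        iota @` bd B = \bigcup_(G in F) G];
  ps_blowup : lifts_to_blowup }.

(* A 1-periodic parametrization of the circle C in the boundary, with the
   boundary orientation: in a positive chart modelled on {u_0 <= 0} the
   outward normal is the 0-th basis vector, so the boundary is oriented by the
   next one. *)
Definition positive_parametrization (C : set S) (g : R -> S) : Prop :=
  [/\ continuous g, range g = C,
      forall s t, g s = g t <-> exists k : int, s - t = k%:~R &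
      forall c s, B c -> cdom c (g s) ->
        derivable (cfwd c \o g) s 1 /\ 0 < derive1 (cfwd c \o g) s 0 1].

(* The degree of iota restricted to C, onto the closed orbit of p of period T,
   read on a lift theta : R -> R to universal covers. *)
Definition multiplicity (C : set S) (m : int) : Prop :=
  exists (g : R -> S) (p : M) (T : R) (theta : R -> R),
    [/\ positive_parametrization C g, minimal_period p T, continuous theta,
        forall s, iota (g s) = phi (theta s) p &
        forall s, theta (s + 1) = theta s + m%:~R * T].

Definition positive_section : Prop :=
  bd B !=set0 /\
  forall C, boundary_component B C -> exists2 m, multiplicity C m & 0 < m.

Definition negative_section : Prop :=
  bd B !=set0 /\
  forall C, boundary_component B C -> exists2 m, multiplicity C m & m < 0.

Definition birkhoff_section : Prop :=
  partial_section /\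
  exists2 T : R, 0 < T & \bigcup_(t in `[0, T]) (phi t @` range iota) = setT.

End PartialSection.

Definition flat : Prop :=
  exists (S : topologicalType) (B : set (chart R 2 S)) (iota : S -> M),
    birkhoff_section B iota /\ bd B = set0.

Definition positively_twisted : Prop :=
  exists (S : topologicalType) (B : set (chart R 2 S)) (iota : S -> M),
    birkhoff_section B iota /\ positive_section B iota.

Definition negatively_twisted : Prop :=
  exists (S : topologicalType) (B : set (chart R 2 S)) (iota : S -> M),
    birkhoff_section B iota /\ negative_section B iota.

End Flow.
End Manifolds.

(* Main.v *)
From HB Require Import structures.
From mathcomp Require Import all_boot all_order all_algebra.
From mathcomp Require Import all_classical all_reals all_analysis.
From mathcomp Require Import zify ring lra.
Require Import Defs.
Set Implicit Arguments.
Unset Strict Implicit.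
Unset Printing Implicit Defensive.

Import Order.TTheory GRing.Theory Num.Theory.
Import numFieldNormedType.Exports.

Local Open Scope classical_set_scope.
Local Open Scope ring_scope.

(** Two Birkhoff sections S1 and S2 are given, where the boundary of S2 is not
    empty and has the sign eps, and the boundary of S1 is empty or has the sign
    - eps; all the cases of the theorem are of this form.

    The section S1 defines a function with values in R / Z on M minus the closed
    orbits that carry its boundary (its axis): the phase, which is the fraction,
    between two successive hits of S1 by an orbit, of the time that has elapsed.
    It is continuous off the axis (phase_zc), it increases along orbits at a
    definite rate because return times are bounded (orbit_growth), and around an
    axis orbit it winds as many times as there are sheets of S1 ending there,
    with the sign of the boundary of S1 (phase_arg).  This last point is local:
    along each sheet the phase has the same jump as the argument of a plane
    coordinate transverse to the axis.

    The phase of S1 is pulled back to S2, after S2 has been pushed off its own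
    boundary.  The result is a circle-valued function on a compact oriented
    surface with boundary, with finitely many singularities, the points where
    the interior of S2 crosses the axis of S1.  For such functions the sum of
    the residues at the singularities equals the sum of the windings along the
    boundary circles (surface_stokes).  But the two sums have opposite signs.

    The residues have the sign of S1, or do not exist, because the interior of
    S2 is positively transverse to the flow (crossings).

    The windings have the sign eps (winding_positive).  Indeed a boundary circle
    of S2, slightly pushed, follows a closed orbit for a time of sign eps while
    it turns around it by some angle.  The phase of S2 does not vary along it,
    since the pushed circle lies on S2; for this phase, therefore, following the
    flow, which counts positively for positive times, is compensated by turning,
    which counts with the sign eps of S2.  The phase of S1 counts following the
    flow alike, and turning with the opposite sign: for S1 the two contributions
    have the same sign, eps.  It does not matter whether the closed orbit also
    belongs to the axis of S1.  The argument needs long loops, since the local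
    comparisons hold up to bounded errors, so the circle is followed many times.

    Circle-valued functions are real functions that are continuous modulo Z,
    and their variations are read on lifts along intervals and rectangles.
    Stokes' theorem follows from the residue theorem in a rectangle by emptying
    the discs of a finite cover one after the other.  Smoothness is used through
    strict differentiability, for the inverse function theorem, and through the
    fact that a plane map of positive determinant changes arguments by a bounded
    amount (arg_linear). *)

(** * Functions with values in the circle *)

Lemma isintD (R : realType) (x y : R) : x \is a Num.int -> y \is a Num.int -> x + y \is a Num.int.
Proof. exact: rpredD. Qed.

Lemma isintN (R : realType) (x : R) : x \is a Num.int -> - x \is a Num.int.
Proof. by rewrite rpredN. Qed.

Lemma isintM (R : realType) (x y : R) : x \is a Num.int -> y \is a Num.int -> x * y \is a Num.int.
Proof. exact: rpredM. Qed.

(* Membership goals in the subring of integers are closed by zit, up to t. *)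
Ltac zit t := repeat first [assumption | t | apply: isintD | apply: isintN | apply: isintM | apply: rpred0 | apply: rpred1 | apply: intr_int].
Ltac zi := zit fail.

(* Linear arithmetic only needs the order relations and equations of the
   context. *)
Ltac purge := repeat match goal with
  | H : ?P |- _ => lazymatch type of P with Prop => lazymatch P with
      | is_true _ => fail | _ = _ => fail | _ /\ _ => fail | _ \/ _ => fail
      | smooth_flow _ _ => fail | closed_oriented_3manifold _ => fail
      | oriented_atlas _ _ => fail | partial_section _ _ _ _ => fail
      | birkhoff_section _ _ _ _ => fail | _ => clear H end end
  end.
Ltac slra := purge; lra.
Ltac snra := purge; nra.

Section RelativeContinuity.
Variables (T U : topologicalType).

(** Relative continuity in a form that is directly usable pointwise; it is
    equivalent to continuity for the subspace topology. *)
Definition mapc (A : set T) (f : T -> U) : Prop :=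
  forall x, A x -> forall V, nbhs (f x) V -> \forall y \near x, A y -> V (f y).

Lemma mapcP (A : set T) (f : T -> U) : {within A, continuous f} <-> mapc A f.
Proof.
by split=> [/subspace_continuousP|] h; first exact: h; apply/subspace_continuousP.
Qed.

Lemma mapc_sub (A B : set T) (f : T -> U) : A `<=` B -> mapc B f -> mapc A f.
Proof.
move=> AB h x Ax V hV; have := h x (AB _ Ax) V hV; apply: filterS => y hy Ay.
exact: hy (AB _ Ay).
Qed.

Lemma mapc_cont (A : set T) (f : T -> U) : continuous f -> mapc A f.
Proof.
move=> h x Ax V hV; have h2 : nbhs x (f @^-1` V) by exact: h.
by apply: filterS h2 => y hy _.
Qed.

Lemma mapc_eq (A : set T) (f g : T -> U) :
  (forall x, A x -> f x = g x) -> mapc A f -> mapc A g.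
Proof.
move=> fg h x Ax V; rewrite -fg // => /(h x Ax).
by apply: filterS => y hy Ay; rewrite -fg //; exact: hy.
Qed.

Lemma mapc_local (A : set T) (f : T -> U) :
  (forall x, A x -> exists2 W, nbhs x W & mapc (A `&` W) f) -> mapc A f.
Proof.
move=> h x Ax V hV; have [W hW hc] := h x Ax.
have := hc x (conj Ax (nbhs_singleton hW)) V hV.
by apply: filterS2 hW => y Wy hy Ay; apply: hy.
Qed.

Lemma mapc_closedU (A B : set T) (f : T -> U) : closed A -> closed B ->
  mapc A f -> mapc B f -> mapc (A `|` B) f.
Proof.
move=> cA cB fA fB x ABx V hV.
have key (C : set T) : closed C -> mapc C f -> \forall y \near x, C y -> V (f y).
  move=> cC fC; have [Cx|nCx] := pselect (C x); first exact: fC.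
  have : nbhs x (~` C) by apply: open_nbhs_nbhs; split=> //; exact: closed_openC.
  by apply: filterS => y nCy /nCy.
by apply: filterS2 (key A cA fA) (key B cB fB) => y h1 h2 [/h1|/h2].
Qed.

End RelativeContinuity.

Lemma mapc_comp (T U V : topologicalType) (A : set T) (B : set U)
    (f : T -> U) (g : U -> V) :
  (forall x, A x -> B (f x)) -> mapc A f -> mapc B g -> mapc A (g \o f).
Proof.
move=> AB hf hg x Ax W hW.
have := hf x Ax _ (hg _ (AB _ Ax) W hW).
by apply: filterS => y hy Ay; apply: hy => //; exact: AB.
Qed.

Lemma mapc_pair (T U V : topologicalType) (A : set T) (f : T -> U) (g : T -> V) :
  mapc A f -> mapc A g -> mapc A (fun x => (f x, g x)).
Proof.
move=> hf hg x Ax W [[W1 W2] [/= h1 h2] hW].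
by apply: filterS2 (hf x Ax _ h1) (hg x Ax _ h2) => y k1 k2 Ay; apply: hW; split; [apply: k1|apply: k2].
Qed.

Section RealRel.
Variables (R : realType) (T : topologicalType).
Implicit Types (A : set T) (f g : T -> R).

Lemma mapcR A f : mapc A f <-> forall x, A x -> forall e : R, 0 < e ->
  \forall y \near x, A y -> `|f y - f x| < e.
Proof.
split=> h x Ax.
  move=> e e0; apply: filterS (h x Ax _ (nbhsx_ballx (f x) e e0)) => y hy Ay.
  by have := hy Ay; rewrite -ball_normE /= distrC.
move=> V /nbhs_ballP[e e0 hV]; apply: filterS (h x Ax e e0) => y hy Ay.
by apply: hV; rewrite -ball_normE /= distrC; exact: hy.
Qed.

Lemma mapcD A f g : mapc A f -> mapc A g -> mapc A (fun x => f x + g x).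
Proof.
move=> /mapcR hf /mapcR hg; apply/mapcR => x Ax e e0.
have e2 : 0 < e / 2 by slra.
apply: filterS2 (hf x Ax _ e2) (hg x Ax _ e2) => y h1 h2 Ay.
by have := h1 Ay; have := h2 Ay; rewrite !ltr_norml; slra.
Qed.

Lemma mapcN A f : mapc A f -> mapc A (fun x => - f x).
Proof.
move=> /mapcR hf; apply/mapcR => x Ax e e0.
apply: filterS (hf x Ax _ e0) => y h1 Ay.
by have := h1 Ay; rewrite !ltr_norml; slra.
Qed.

Lemma mapcB A f g : mapc A f -> mapc A g -> mapc A (fun x => f x - g x).
Proof. by move=> hf hg; apply: mapcD => //; exact: mapcN. Qed.

Lemma mapc_cst A (a : R) : mapc A (fun _ => a).
Proof. by apply: mapc_cont; exact: cst_continuous. Qed.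

Lemma mapcM A f g : mapc A f -> mapc A g -> mapc A (fun x => f x * g x).
Proof.
move=> hf hg; apply: (@mapc_comp _ _ _ A setT (fun x => (f x, g x)) (fun p => p.1 * p.2)) => //.
  exact: mapc_pair.
apply: mapc_cont => p; exact: mul_continuous.
Qed.

End RealRel.

Section ZCont.
Variable R : realType.
Notation isint r := (r \is a @Num.int R).

Definition znear (e r : R) : Prop := exists2 k, isint k & `|r - k| < e.

Lemma znearN e r : znear e r -> znear e (- r).
Proof. by move=> [k ik h]; exists (- k); rewrite ?rpredN // -opprD normrN. Qed.

Lemma znearD e1 e2 r1 r2 : znear e1 r1 -> znear e2 r2 -> znear (e1 + e2) (r1 + r2).
Proof.
move=> [k ik h] [l il h']; exists (k + l); first exact: rpredD.
by move: h h'; rewrite !ltr_norml; slra.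
Qed.

Lemma int_small (r : R) : isint r -> `|r| < 1 -> r = 0.
Proof.
move=> /intrP[n ->]; rewrite -intr_norm -(mulr1z 1) ltr_int => h.
by have -> : n = 0 by lia.
Qed.

Section T.
Variable T : topologicalType.
Implicit Types (A B : set T) (f g h : T -> R).

(** A function with values in R / Z is handled as a real function, of which
    any choice of representatives is allowed to jump by integers; zc is the
    continuity of the induced map to the circle. *)
Definition zc A f : Prop := forall x, A x -> forall e : R, 0 < e ->
  \forall y \near x, A y -> znear e (f y - f x).

(** A real lift of the circle-valued function f. *)
Definition islift A f h : Prop := mapc A h /\ forall x, A x -> isint (f x - h x).

Lemma zc_mapc A f : mapc A f -> zc A f.
Proof.
move=> /mapcR hf x Ax e e0; apply: filterS (hf x Ax e e0) => y hy Ay.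
by exists 0; rewrite ?rpred0 // subr0; exact: hy.
Qed.

Lemma zc_congr A f g : (forall x, A x -> isint (g x - f x)) -> zc A f -> zc A g.
Proof.
move=> fg hf x Ax e e0; apply: filterS (hf x Ax e e0) => y hy Ay.
have [k ik hk] := hy Ay.
exists (k + (g y - f y) - (g x - f x)).
  by zit ltac:(exact: fg).
suff -> : g y - g x - (k + (g y - f y) - (g x - f x)) = f y - f x - k by [].
ring.
Qed.

Lemma zcD A f g : zc A f -> zc A g -> zc A (fun x => f x + g x).
Proof.
move=> hf hg x Ax e e0; have e2 : 0 < e / 2 by slra.
apply: filterS2 (hf x Ax _ e2) (hg x Ax _ e2) => y h1 h2 Ay.
rewrite [e]splitr (_ : _ - _ = (f y - f x) + (g y - g x)); last by ring.
by apply: znearD; [apply: h1|apply: h2].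
Qed.

Lemma zcN A f : zc A f -> zc A (fun x => - f x).
Proof.
move=> hf x Ax e e0; apply: filterS (hf x Ax e e0) => y h1 Ay.
by rewrite -opprD; apply: znearN; exact: h1.
Qed.

Lemma zcB A f g : zc A f -> zc A g -> zc A (fun x => f x - g x).
Proof. by move=> hf hg; apply: zcD => //; exact: zcN. Qed.

Lemma zcMn A f (n : nat) : zc A f -> zc A (fun x => n%:R * f x).
Proof.
move=> hf; elim: n => [|n IH].
  by apply: (zc_congr (f := fun=> 0)) => [x _|]; rewrite ?mul0r ?subrr ?rpred0 //; apply: zc_mapc; exact: mapc_cst.
apply: zc_congr (zcD IH hf) => x _.
by rewrite -natr1 mulrDl mul1r subrr rpred0.
Qed.

Lemma zcMz A f (z : int) : zc A f -> zc A (fun x => z%:~R * f x).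
Proof.
move=> hf; case: z => n; first exact: (zcMn n hf).
apply: zc_congr (zcN (zcMn n.+1 hf)) => x _.
by rewrite NegzE mulrNz mulNr subrr rpred0.
Qed.

Lemma zc_sub A B f : A `<=` B -> zc B f -> zc A f.
Proof.
move=> AB h x Ax e e0; have := h x (AB _ Ax) e e0; apply: filterS => y hy Ay.
exact: hy (AB _ Ay).
Qed.

Lemma zc_local A f :
  (forall x, A x -> exists2 W, nbhs x W & zc (A `&` W) f) -> zc A f.
Proof.
move=> h x Ax e e0; have [W hW hc] := h x Ax.
have := hc x (conj Ax (nbhs_singleton hW)) e e0.
by apply: filterS2 hW => y Wy hy Ay; apply: hy.
Qed.

End T.

Lemma zc_comp (T U : topologicalType) (A : set T) (B : set U) (g : T -> U) (f : U -> R) :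
  (forall x, A x -> B (g x)) -> mapc A g -> zc B f -> zc A (f \o g).
Proof.
move=> AB hg hf x Ax e e0.
have := hg x Ax _ (hf _ (AB _ Ax) e e0).
by apply: filterS => y hy Ay; apply: hy => //; exact: AB.
Qed.

(** The representative modulo Z in [-1/2, 1/2[. *)
Definition rnd (r : R) : R := r - (Num.floor (r + 1 / 2))%:~R.

Lemma rnd_int r : isint (r - rnd r).
Proof. by rewrite /rnd opprB addrCA subrr addr0 intr_int. Qed.

Lemma rnd_bound r : - (1/2) <= rnd r < 1/2.
Proof.
rewrite /rnd; have := floor_le_tmp (r + 1/2); have := floorD1_gt (r + 1/2).
by rewrite intrD; slra.
Qed.

Lemma rnd_unique r s : isint (r - s) -> - (1/2) <= s < 1/2 -> rnd r = s.
Proof.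
move=> irs hs; have hb := rnd_bound r.
suff : rnd r - s = 0 by slra.
apply: int_small; last by rewrite ltr_norml; slra.
have -> : rnd r - s = (r - s) - (r - rnd r) by ring.
by zit ltac:(exact: rnd_int).
Qed.

(** The representative in [-1/2, 1/2[ jumps only where f crosses 1/2. *)
Lemma zc_rnd (T : topologicalType) (A : set T) (f : T -> R) : zc A f ->
  (forall x, A x -> ~ isint (f x + 1/2)) -> islift A f (rnd \o f).
Proof.
move=> hf hn; split; last by move=> x _; exact: rnd_int.
apply/mapcR => x Ax e e0 /=.
have hb := rnd_bound (f x).
have hb0 : - (1/2) < rnd (f x).
  rewrite lt_neqAle; have /andP[-> _] := hb; rewrite andbT.
  apply/eqP => h; apply: (hn x Ax).
  by have := rnd_int (f x); rewrite -h (_ : _ - _ = f x + 1/2); last by ring.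
set e' := Num.min e (Num.min (rnd (f x) + 1/2) (1/2 - rnd (f x))).
have e'0 : 0 < e' by rewrite !lt_min; slra.
apply: filterS (hf x Ax _ e'0) => y hy Ay; have [k ik] := hy Ay.
rewrite !lt_min => /and3P[h1 h2 h3].
rewrite (_ : rnd (f y) = rnd (f x) + (f y - f x - k)).
  by rewrite addrC addKr.
apply: rnd_unique; last by move: h2 h3; rewrite !ltr_norml; slra.
rewrite (_ : _ - _ = (f x - rnd (f x)) + k); last by ring.
by zit ltac:(exact: rnd_int).
Qed.

(** A lift is unique up to an integer constant for this reason. *)
Lemma connected_int (T : topologicalType) (A : set T) (k : T -> R) :
  connected A -> mapc A k -> (forall x, A x -> isint (k x)) ->
  forall x y, A x -> A y -> k x = k y.
Proof.
move=> cA /mapcP kc ki x y Ax Ay.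
have : connected (k @` A) by exact: connected_continuous_connected.
move=> /connected_intervalP iv.
wlog lt : x y Ax Ay / k x < k y.
  move=> wl; case: (ltgtP (k x) (k y)) => // h; first exact: wl.
  exact/esym/wl.
have [n hn] : exists n : int, k x = n%:~R by apply/intrP; exact: ki.
have : (k @` A) (k x + Num.min (1/2) (k y - k x)).
  apply: (iv (k x) (k y)); [by exists x|by exists y|].
  rewrite ltW /=; first by rewrite -lerBrDl ge_min lexx orbT.
  by rewrite ltrDl lt_min; slra.
set m := Num.min _ _.
have m01 : 0 < m < 1 by rewrite lt_min gt_min; slra.
move=> [z Az kz]; have := ki z Az; rewrite kz => h.
have : m = 0.
  apply: int_small; last by rewrite ltr_norml; slra.
  have -> : m = k x + m - k x by ring.
  by zit ltac:(exact: ki).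
slra.
Qed.

Lemma islift_unique (T : topologicalType) (A : set T) (f h h' : T -> R) :
  connected A -> islift A f h -> islift A f h' ->
  forall x y, A x -> A y -> h y - h x = h' y - h' x.
Proof.
move=> cA [hc hi] [hc' hi'] x y Ax Ay.
have := @connected_int T A (fun x => h x - h' x) cA (mapcB hc hc') _ x y Ax Ay.
suff hk : forall z, A z -> isint (h z - h' z) by move=> /(_ hk) /eqP; rewrite -subr_eq0 => /eqP ?; slra.
move=> z Az; rewrite (_ : _ - _ = (f z - h' z) - (f z - h z)); last by ring.
by zit ltac:(first [exact: hi'|exact: hi]).
Qed.

(** Two lifts differ on the connected overlap by a constant integer, by which
    one of them is shifted. *)
Lemma islift_glue (T : topologicalType) (A B : set T) (f h k : T -> R) (z : T) :
  closed A -> closed B -> connected (A `&` B) -> A z -> B z ->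
  islift A f h -> islift B f k -> exists l, islift (A `|` B) f l.
Proof.
move=> cA cB cAB Az Bz lh lk.
pose l x := if pselect (A x) then h x else k x + (h z - k z).
have eA x : A x -> l x = h x by rewrite /l; case: pselect.
have ABA : A `&` B `<=` A by move=> ? [].
have ABB : A `&` B `<=` B by move=> ? [].
have eB x : B x -> l x = k x + (h z - k z).
  move=> Bx; rewrite /l; case: pselect => // Ax.
  have := @islift_unique T (A `&` B) f h k cAB _ _ x z (conj Ax Bx) (conj Az Bz).
  have l1 : islift (A `&` B) f h.
    by split; [exact: mapc_sub lh.1|move=> ? /ABA; exact: lh.2].
  have l2 : islift (A `&` B) f k.
    by split; [exact: mapc_sub lk.1|move=> ? /ABB; exact: lk.2].
  by move=> /(_ l1 l2) /=; slra.
exists l; split.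
  apply: mapc_closedU => //.
    by apply: mapc_eq lh.1 => x /eA.
  apply: (mapc_eq (f := fun x => k x + (h z - k z))) => [x /eB //|].
  by apply: mapcD; [exact: lk.1|exact: mapc_cst].
move=> x [Ax|Bx]; first by rewrite eA //; exact: lh.2.
rewrite eB // (_ : _ - _ = (f x - k x) - (f z - k z) + (f z - h z)); last by ring.
by zit ltac:(first [exact: lk.2|exact: lh.2]).
Qed.

End ZCont.

Notation isint r := (r \is a Num.int).

(** * Lifts on intervals and rectangles *)

Section Cousin.
Variable R : realType.

(** Cousin's principle, a form of the compactness of [a, b] adapted to
    properties of intervals: it replaces subdivision arguments. *)
Lemma cousin (P : R -> R -> Prop) (a b : R) : a <= b ->
  (forall u v w, a <= u -> u <= v -> v <= w -> w <= b -> P u v -> P v w -> P u w) ->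
  (forall x, a <= x <= b -> exists2 d : R, 0 < d & forall u v, a <= u -> u <= x ->
     x <= v -> v <= b -> x - d < u -> v < x + d -> P u v) ->
  P a b.
Proof.
move=> ab Pcat Ploc.
pose E := [set t | a <= t <= b /\ P a t].
have Ea : E a.
  split; first by rewrite lexx.
  have [|d d0 h] := Ploc a; first by rewrite lexx.
  by apply: h => //; slra.
have ubE : ubound E b by move=> t [/andP[]].
have hsE : has_sup E by split; [exists a|exists b].
set s := sup E.
have sa : a <= s by apply: sup_upper_bound.
have sb : s <= b by apply: ge_sup => //; exists a.
have [|d d0 hd] := Ploc s; first by rewrite sa.
have [t [/andP[at_ tb] Pt] ts] : exists2 t, E t & s - d < t by apply: sup_adherent.
have tles : t <= s by apply: sup_upper_bound => //; split => //; rewrite at_.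
have Ps v : s <= v -> v <= b -> v < s + d -> P a v.
  move=> sv vb vd; apply: (Pcat a t v) => //; first exact: le_trans sv.
  exact: hd.
have [sltb|] := ltP s b; last first.
  by move=> bs; apply: Ps; slra.
set v := Num.min b (s + d / 2).
have sv : s < v by rewrite lt_min sltb /=; slra.
have : E v.
  split; first by rewrite ge_min lexx andbT (le_trans sa) // ltW.
  apply: Ps; [exact: ltW|by rewrite ge_min lexx|].
  by rewrite gt_min; apply/orP; right; slra.
move=> /(sup_upper_bound hsE); rewrite -/s; slra.
Qed.

(** The points where f is at least f u have a supremum, which belongs to them by
    continuity and could be moved to the right if it were less than b. *)
Lemma right_increasing (f : R -> R) (a b : R) : a < b ->
  mapc [set x | a <= x <= b] f ->
  (forall x, a <= x < b -> exists2 d : R, 0 < d & forall y, x < y -> y < x + d -> y <= b -> f x < f y) ->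
  f a < f b.
Proof.
move=> ab /mapcR fc floc.
have key u : a <= u < b -> f u <= f b.
  move=> /andP[au ub].
  pose E := [set t | u <= t <= b /\ f u <= f t].
  have Eu : E u by split; rewrite ?lexx // ltW.
  have ubE : ubound E b by move=> t [/andP[]].
  have hsE : has_sup E by split; [exists u|exists b].
  set s := sup E.
  have sa : u <= s by apply: sup_upper_bound.
  have sb : s <= b by apply: ge_sup => //; exists u.
  have Es : f u <= f s.
    rewrite leNgt; apply/negP => h.
    have as_ : a <= s <= b by slra.
    have fus : 0 < f u - f s by slra.
    have /nbhs_ballP[d d0 hd] := fc s as_ _ fus.
    have [t Et ts] : exists2 t, E t & s - d < t by apply: sup_adherent.
    have tles : t <= s by apply: sup_upper_bound.
    have [/andP[ut tb] fut] := Et.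
    have : `|f t - f s| < f u - f s.
      apply: hd; last by rewrite /=; slra.
      by rewrite /ball /= ltr_norml; slra.
    by rewrite ltr_norml; slra.
  have [sltb|] := ltP s b; last by move=> bs; have <- : s = b by slra.
  have [|d d0 hd] := floc s; first by slra.
  set v := Num.min b (s + d / 2).
  have sv : s < v by rewrite lt_min sltb /=; slra.
  have vb : v <= b by rewrite ge_min lexx.
  have vd : v < s + d by rewrite gt_min; apply/orP; right; slra.
  have : E v by split; [slra|have := hd v sv vd vb; slra].
  by move=> /(sup_upper_bound hsE); rewrite -/s; slra.
have [|d d0 hd] := floc a; first by slra.
set v := Num.min ((a + b) / 2) (a + d / 2).
have av : a < v by rewrite lt_min; slra.
have vb : v < b by rewrite gt_min; apply/orP; left; slra.
have vd : v < a + d by rewrite gt_min; apply/orP; right; slra.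
have := hd v av vd (ltW vb); have := key v; slra.
Qed.

Definition itv (a b : R) : set R := [set x | a <= x <= b].
Definition rect (a b c d : R) : set (R * R) := [set p | a <= p.1 <= b /\ c <= p.2 <= d].

Lemma itvE a b : itv a b = `[a, b]%classic.
Proof. by apply/seteqP; split=> x; rewrite /itv /= in_itv. Qed.

Lemma closed_itv a b : closed (itv a b).
Proof. rewrite itvE; exact: itv_closed. Qed.

Lemma compact_itv a b : compact (itv a b).
Proof. rewrite itvE; exact: segment_compact. Qed.

Lemma connected_itv a b : connected (itv a b).
Proof. rewrite itvE; exact: segment_connected. Qed.

Lemma rectE a b c d : rect a b c d = itv a b `*` itv c d.
Proof. by []. Qed.

Lemma compact_rect a b c d : compact (rect a b c d).
Proof. by rewrite rectE; apply: compact_setX; exact: compact_itv. Qed.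

Lemma closed_rect a b c d : closed (rect a b c d).
Proof.
by apply: compact_closed; [exact: norm_hausdorff|exact: compact_rect].
Qed.

Lemma connected_convex (V : normedModType R) (A : set V) :
  (forall x y t, A x -> A y -> 0 <= t <= 1 -> A (x + t *: (y - x))) -> connected A.
Proof.
move=> cv; have [->|/set0P[x Ax]] := eqVneq A set0; first exact: connected0.
rewrite (_ : A = \bigcup_(y in A) ((fun t : R => x + t *: (y - x)) @` itv 0 1)).
  apply: bigcup_connected => [|y Ay].
    by exists x => y Ay; exists 0; rewrite /itv /= ?lexx ?ler01 // scale0r addr0.
  apply: connected_continuous_connected; first exact: connected_itv.
  apply: continuous_subspaceT => t.
  by apply: cvgD; [exact: cvg_cst|apply: cvgZr_tmp; exact: cvg_id].
apply/seteqP; split=> [y Ay|_ [y Ay [t t01 <-]]]; last exact: cv.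
by exists y => //; exists 1; rewrite /itv /= ?lexx ?ler01 // scale1r subrKC.
Qed.

Lemma connected_rect a b c d : connected (rect a b c d).
Proof.
apply: connected_convex => p q t [p1 p2] [q1 q2] t01.
by split=> /=; rewrite /GRing.scale /=; snra.
Qed.

(** Close to x the function stays within 1/4 of f x modulo Z, so that the
    representative of f - f x closest to 0 is continuous. *)
Lemma zc_near_lift (T : topologicalType) (A : set T) (f : T -> R) x : zc A f -> A x ->
  exists2 W, nbhs x W & exists h, islift (A `&` W) f h.
Proof.
move=> hf Ax; have e4 : 0 < 1/4 :> R by slra.
have hW := hf x Ax _ e4.
exists [set y | A y -> znear (1/4) (f y - f x)] => //.
have AW : A `&` [set y | A y -> znear (1/4) (f y - f x)] `<=` A by move=> ? [].
have h1 : zc (A `&` [set y | A y -> znear (1/4) (f y - f x)]) (fun y => f y - f x).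
  by apply: zcB; [exact: zc_sub hf|apply: zc_mapc; exact: mapc_cst].
have [|hc hi] := zc_rnd h1.
  move=> y [Ay /(_ Ay) [k ik hk]] ih.
  have : isint (f y - f x - k + 1/2).
    by rewrite (_ : _ + _ = f y - f x + 1/2 - k); [zi|ring].
  move=> /int_small; move: hk; rewrite !ltr_norml => hk.
  by move=> h; have := h ltac:(slra); slra.
exists (fun y => rnd (f y - f x) + f x); split.
  by apply: mapcD hc _; exact: mapc_cst.
move=> y hy; have := hi y hy => /=.
by rewrite (_ : f y - (_ + _) = f y - f x - rnd (f y - f x)) //; ring.
Qed.

Lemma islift_sub (T : topologicalType) (A B : set T) (f h : T -> R) :
  A `<=` B -> islift B f h -> islift A f h.
Proof. by move=> AB [hc hi]; split; [exact: mapc_sub hc|move=> x /AB; exact: hi]. Qed.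

Lemma lift_itv a b (f : R -> R) : a <= b -> zc (itv a b) f ->
  exists h, islift (itv a b) f h.
Proof.
move=> ab hf.
apply: (@cousin (fun u v => exists h, islift (itv u v) f h)) ab _ _.
  move=> u v w au uv vw wb [h hl] [k kl].
  have e : itv u w = itv u v `|` itv v w.
    apply/seteqP; split=> x; rewrite /itv /=; last by case; slra.
    by case: (leP x v) => xv ?; [left|right]; slra.
  rewrite e; apply: (islift_glue (z := v) _ _ _ _ _ hl kl).
  - exact: closed_itv.
  - exact: closed_itv.
  - rewrite (_ : _ `&` _ = itv v v); first exact: connected_itv.
    by apply/seteqP; split=> x; rewrite /itv /=; slra.
  - by rewrite /itv /=; slra.
  - by rewrite /itv /=; slra.
move=> x xab; have [W /nbhs_ballP[d d0 hW] [h hl]] := zc_near_lift hf xab.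
exists d => // u v au ux xv vb du vd; exists h; apply: islift_sub hl => y.
rewrite /itv /= => yuv; split; first by slra.
by apply: hW; rewrite /ball /= ltr_norml; slra.
Qed.

(** Cousin's principle is used twice: local lifts are glued along a vertical
    segment into a lift on a thin strip, then the strips are glued. *)
Lemma lift_rect a b c d (f : R * R -> R) : a <= b -> c <= d -> zc (rect a b c d) f ->
  exists h, islift (rect a b c d) f h.
Proof.
move=> ab cd hf.
have strip x0 : a <= x0 <= b -> exists2 r : R, 0 < r &
    exists h, islift (rect (Num.max a (x0 - r)) (Num.min b (x0 + r)) c d) f h.
  move=> x0ab.
  apply: (@cousin (fun u v => exists2 r : R, 0 < r &
    exists h, islift (rect (Num.max a (x0 - r)) (Num.min b (x0 + r)) u v) f h)) cd _ _.
    move=> u v w cu uv vw wd [r r0 [h hl]] [s s0 [k kl]].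
    pose q := Num.min r s; have q0 : 0 < q by rewrite lt_min r0.
    have qr : q <= r by rewrite ge_min lexx.
    have qs : q <= s by rewrite ge_min lexx orbT.
    exists q => //.
    set A := Num.max _ _; set B := Num.min _ _.
    have Ax : A <= x0 by rewrite ge_max; slra.
    have Bx : x0 <= B by rewrite le_min; slra.
    have sub r' x : q <= r' -> A <= x <= B -> Num.max a (x0 - r') <= x <= Num.min b (x0 + r').
      by rewrite /A /B !ge_max !le_min; slra.
    have hl' : islift (rect A B u v) f h.
      by apply: islift_sub hl => p [p1 p2]; split => //; exact: sub.
    have kl' : islift (rect A B v w) f k.
      by apply: islift_sub kl => p [p1 p2]; split => //; exact: sub.
    have e : rect A B u w = rect A B u v `|` rect A B v w.
      apply/seteqP; split=> p; rewrite /rect /=; last by case=> -[-> ?]; split=> //; slra.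
      by case: (leP p.2 v) => pv [-> ?]; [left|right]; split=> //; slra.
    rewrite e; apply: (islift_glue (z := (x0, v)) _ _ _ _ _ hl' kl').
    - exact: closed_rect.
    - exact: closed_rect.
    - rewrite (_ : _ `&` _ = rect A B v v); first exact: connected_rect.
      by apply/seteqP; split=> p; rewrite /rect /=; slra.
    - by rewrite /rect /=; slra.
    - by rewrite /rect /=; slra.
  move=> y ycd; have xy : rect a b c d (x0, y) by split.
  have [W /nbhs_ballP[e e0 hW] [h hl]] := zc_near_lift hf xy.
  exists e => // u v cu uy yv vd eu ve; exists (e/2); first by slra.
  exists h; apply: islift_sub hl => p [p1 p2].
  move: p1; rewrite ge_max le_min => p1.
  split; first by split; slra.
  by apply: hW; split; rewrite /ball /= ltr_norml; slra.
apply: (@cousin (fun u v => exists h, islift (rect u v c d) f h)) ab _ _.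
  move=> u v w au uv vw wb [h hl] [k kl].
  have e : rect u w c d = rect u v c d `|` rect v w c d.
    apply/seteqP; split=> p; rewrite /rect /=; last by case=> -[? ->]; split=> //; slra.
    by case: (leP p.1 v) => pv [? ->]; [left|right]; split=> //; slra.
  rewrite e; apply: (islift_glue (z := (v, c)) _ _ _ _ _ hl kl).
  - exact: closed_rect.
  - exact: closed_rect.
  - rewrite (_ : _ `&` _ = rect v v c d); first exact: connected_rect.
    by apply/seteqP; split=> p; rewrite /rect /=; slra.
  - by rewrite /rect /=; slra.
  - by rewrite /rect /=; slra.
move=> x xab; have [r r0 [h hl]] := strip x xab.
exists r => // u v au ux xv vb ru vr; exists h; apply: islift_sub hl => p [p1 p2].
by split=> //; rewrite ge_max le_min; slra.
Qed.

End Cousin.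

(** * Variation along an interval *)

Section Variation.
Variable R : realType.
Implicit Types (f g h : R -> R) (a b c d : R).

(** The variation of a circle-valued function along [a, b]; it is additive,
    invariant under reparametrization, and an integer on loops. *)
Definition zvar a b f : R :=
  let h := xget (fun=> 0) [set h | islift (itv a b) f h] in h b - h a.

Lemma itv_l a b : a <= b -> itv a b a. Proof. by rewrite /itv /= lexx. Qed.
Lemma itv_r a b : a <= b -> itv a b b. Proof. by rewrite /itv /= lexx => ->. Qed.

Lemma zvarE a b f h : a <= b -> islift (itv a b) f h -> zvar a b f = h b - h a.
Proof.
move=> ab hl; rewrite /zvar; case: xgetP => [k -> kl|/(_ h)//].
apply: islift_unique kl hl _ _ _ _; [exact: connected_itv|exact: itv_l|exact: itv_r].
Qed.

Lemma zvar_cont a b f : a <= b -> mapc (itv a b) f -> zvar a b f = f b - f a.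
Proof.
by move=> ab hf; apply: zvarE => //; split=> // x _; rewrite subrr; apply: rpred0.
Qed.

Lemma zvar_cat a b c f : a <= b -> b <= c -> zc (itv a c) f ->
  zvar a b f + zvar b c f = zvar a c f.
Proof.
move=> ab bc hf; have [h hl] := lift_itv (le_trans ab bc) hf.
rewrite (zvarE (le_trans ab bc) hl) (@zvarE a b f h) ?(@zvarE b c f h) //.
- by slra.
- by apply: islift_sub hl => x; rewrite /itv /=; slra.
- by apply: islift_sub hl => x; rewrite /itv /=; slra.
Qed.

Lemma zvarD a b f g : a <= b -> zc (itv a b) f -> zc (itv a b) g ->
  zvar a b (fun x => f x + g x) = zvar a b f + zvar a b g.
Proof.
move=> ab /(lift_itv ab)[h hl] /(lift_itv ab)[k kl].
rewrite (zvarE ab hl) (zvarE ab kl) (@zvarE a b _ (fun x => h x + k x)) //; first by slra.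
split; first exact: mapcD hl.1 kl.1.
move=> x hx; have -> : f x + g x - (h x + k x) = (f x - h x) + (g x - k x) by ring.
by zit ltac:(first [exact: hl.2|exact: kl.2]).
Qed.

Lemma zvarN a b f : a <= b -> zc (itv a b) f -> zvar a b (fun x => - f x) = - zvar a b f.
Proof.
move=> ab /(lift_itv ab)[h hl].
rewrite (zvarE ab hl) (@zvarE a b _ (fun x => - h x)) //; first by slra.
split; first exact: mapcN hl.1.
move=> x hx; have -> : - f x - - h x = - (f x - h x) by ring.
by zit ltac:(exact: hl.2).
Qed.

Lemma zvarM a b f (z : int) : a <= b -> zc (itv a b) f ->
  zvar a b (fun x => z%:~R * f x) = z%:~R * zvar a b f.
Proof.
move=> ab /(lift_itv ab)[h hl].
rewrite (zvarE ab hl) (@zvarE a b _ (fun x => z%:~R * h x)) //; first by slra.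
split; first by apply: mapcM hl.1; exact: mapc_cst.
move=> x hx; rewrite -mulrBr.
by zit ltac:(exact: hl.2).
Qed.

(** A lift of g is a lift of f: the variation only depends on values modulo
    Z, whatever representatives are chosen. *)
Lemma zvar_congr a b f g : (forall x, itv a b x -> isint (f x - g x)) -> zvar a b f = zvar a b g.
Proof.
move=> fg; rewrite /zvar (_ : [set h | islift (itv a b) f h] = [set h | islift (itv a b) g h]) //.
apply/seteqP; split=> h /= [hc hi]; split=> // x hx.
  have -> : g x - h x = (f x - h x) - (f x - g x) by ring.
  by zit ltac:(first [exact: hi|exact: fg]).
have -> : f x - h x = (g x - h x) + (f x - g x) by ring.
by zit ltac:(first [exact: hi|exact: fg]).
Qed.

Lemma zvar_int0 a b f : a <= b -> (forall x, itv a b x -> isint (f x)) -> zvar a b f = 0.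
Proof.
move=> ab hf; rewrite (@zvarE a b f (fun=> 0)) ?subrr //.
by split; [exact: mapc_cst|move=> x /hf; rewrite subr0].
Qed.

Lemma islift_comp (T U : topologicalType) (A : set T) (B : set U) (s : T -> U) (f h : U -> R) :
  (forall x, A x -> B (s x)) -> mapc A s -> islift B f h -> islift A (f \o s) (h \o s).
Proof.
by move=> AB sc [hc hi]; split; [exact: mapc_comp hc|move=> x /AB; exact: hi].
Qed.

Lemma zvar_comp (U : topologicalType) (B : set U) c d (s : R -> U) (f h : U -> R) :
  c <= d -> (forall x, itv c d x -> B (s x)) -> mapc (itv c d) s -> islift B f h ->
  zvar c d (f \o s) = h (s d) - h (s c).
Proof. by move=> cd sB sc hl; exact: (zvarE cd (islift_comp sB sc hl)). Qed.

Lemma zvar_reparam a b c d (s : R -> R) f : c <= d -> a <= b -> s c = a -> s d = b ->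
  (forall x, itv c d x -> itv a b (s x)) -> mapc (itv c d) s -> zc (itv a b) f ->
  zvar c d (f \o s) = zvar a b f.
Proof.
move=> cd ab sa sb si sc /(lift_itv ab)[h hl].
by rewrite (zvar_comp cd si sc hl) (zvarE ab hl) sa sb.
Qed.

Lemma mapc_addl (A : set R) a : mapc A (fun x => x + a).
Proof. by apply: mapcD; [apply: mapc_cont => x; exact: cvg_id|exact: mapc_cst]. Qed.

Lemma mapc_id (T : topologicalType) (A : set T) : mapc A id.
Proof. by apply: mapc_cont => x; exact: cvg_id. Qed.

Lemma zvar_shift a b t f : a <= b -> zc (itv (a + t) (b + t)) f ->
  zvar (a + t) (b + t) f = zvar a b (fun x => f (x + t)).
Proof.
move=> ab hf; apply/esym; apply: (@zvar_reparam (a + t) (b + t) a b (fun x => x + t) f) => //.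
- by slra.
- by move=> x; rewrite /itv /=; slra.
- exact: mapc_addl.
Qed.

(** The variation over a period does not depend on the base point. *)
Lemma zvar_periodic f : zc setT f -> (forall s, isint (f (s + 1) - f s)) ->
  forall s, zvar s (s + 1) f = zvar 0 1 f.
Proof.
move=> hf hp s.
have zf a b : zc (itv a b) f by apply: zc_sub hf.
wlog s0 : s / 0 <= s.
  move=> wl; have [/wl//|sn] := leP 0 s.
  have [n ns] : exists n : nat, - s <= n%:R.
    exists (Num.bound (- s)); apply/ltW; apply: archi_boundP; slra.
  have hn : forall n : nat, zvar (s + n%:R) (s + n%:R + 1) f = zvar s (s + 1) f.
    elim=> [|m IH]; first by rewrite addr0.
    rewrite -IH (_ : s + m.+1%:R = s + m%:R + 1); last by rewrite -natr1; ring.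
    rewrite [LHS]zvar_shift; [|by slra|exact: zf].
    by apply: zvar_congr => x _; exact: hp.
  by rewrite -(hn n) wl //; slra.
have s1 : 0 <= s + 1 by slra.
have h1 := @zvar_cat 0 s (s + 1) f s0 ltac:(slra) (zf _ _).
have h2 := @zvar_cat 0 1 (s + 1) f ler01 ltac:(slra) (zf _ _).
have h3 : zvar 1 (s + 1) f = zvar 0 s f.
  rewrite -{1}(add0r 1) [LHS]zvar_shift; [|by slra|exact: zf].
  by apply: zvar_congr => x _; exact: hp.
by slra.
Qed.

Lemma zvar_periodicn f : zc setT f -> (forall s, isint (f (s + 1) - f s)) ->
  forall n : nat, zvar 0 n%:R f = n%:R * zvar 0 1 f.
Proof.
move=> hf hp; elim=> [|n IH].
  rewrite mul0r; have [h hl] := lift_itv (lexx 0) (zc_sub (@subsetT _ (itv 0 0)) hf).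
  by rewrite (zvarE _ hl) ?subrr.
rewrite -(@zvar_cat 0 n%:R n.+1%:R) //.
- by rewrite IH -{1}natr1 zvar_periodic // -natr1; ring.
- by rewrite ler_nat.
- exact: zc_sub hf.
Qed.

Lemma mapc_hor (A : set R) (y : R) : mapc A (fun x => (x, y)).
Proof. by apply: mapc_pair; [exact: mapc_id|exact: mapc_cst]. Qed.

Lemma mapc_ver (A : set R) (x : R) : mapc A (fun y => (x, y)).
Proof. by apply: mapc_pair; [exact: mapc_cst|exact: mapc_id]. Qed.

(** A circle-valued function without singularity lifts on the rectangle, so
    its total variation around the rectangle vanishes. *)
Lemma zvar_rect a b c d (f : R * R -> R) : a <= b -> c <= d -> zc (rect a b c d) f ->
  zvar a b (fun x => f (x, c)) + zvar c d (fun y => f (b, y)) =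
  zvar c d (fun y => f (a, y)) + zvar a b (fun x => f (x, d)).
Proof.
move=> ab cd /(lift_rect ab cd)[h hl].
have e y : itv c d y -> zvar a b (fun x => f (x, y)) = h (b, y) - h (a, y).
  move=> hy; apply: (zvar_comp (s := fun x => (x, y)) ab _ _ hl) => //.
  exact: mapc_hor.
have e' x : itv a b x -> zvar c d (fun y => f (x, y)) = h (x, d) - h (x, c).
  move=> hy; apply: (zvar_comp (s := fun y => (x, y)) cd _ _ hl) => //.
  exact: mapc_ver.
rewrite !e ?e'; [slra|..]; by [exact: itv_l|exact: itv_r].
Qed.

End Variation.

(** * The argument of a plane vector *)

Section Angle.
Variable R : realType.
Implicit Types (x y t : R).

(** Angles are measured in turns, so that arguments are defined modulo 1. *)
Definition cs t : R := cos (pi *+ 2 * t).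
Definition sn t : R := sin (pi *+ 2 * t).

Lemma pi2_gt0 : 0 < pi *+ 2 :> R.
Proof. by rewrite pmulrn_rgt0 // pi_gt0. Qed.

Lemma cs_cont : continuous cs.
Proof.
move=> t; apply: (@continuous_comp _ _ _ (fun t => pi *+ 2 * t) cos).
  by apply: cvgM; [exact: cvg_cst|exact: cvg_id].
exact: continuous_cos.
Qed.

Lemma sn_cont : continuous sn.
Proof.
move=> t; apply: (@continuous_comp _ _ _ (fun t => pi *+ 2 * t) sin).
  by apply: cvgM; [exact: cvg_cst|exact: cvg_id].
exact: continuous_sin.
Qed.

Lemma csD1 t : cs (t + 1) = cs t.
Proof. by rewrite /cs mulrDr mulr1 cosD2pi. Qed.

Lemma snD1 t : sn (t + 1) = sn t.
Proof. by rewrite /sn mulrDr mulr1 sinD2pi. Qed.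

Lemma csDn t (n : nat) : cs (t + n%:R) = cs t.
Proof. by elim: n => [|n IH]; rewrite ?addr0 // -natr1 addrA csD1. Qed.

Lemma csDz t z : isint z -> cs (t + z) = cs t.
Proof.
move=> /intrP[[] n ->]; first exact: csDn.
by rewrite -(csDn (t + _) n.+1) NegzE mulrNz subrK.
Qed.

Lemma cs2sn2 t : cs t ^+ 2 + sn t ^+ 2 = 1.
Proof. exact: cos2Dsin2. Qed.

Lemma csB s t : cs (s - t) = cs s * cs t + sn s * sn t.
Proof. by rewrite /cs mulrBr cosB. Qed.

Lemma snB s t : sn (s - t) = sn s * cs t - cs s * sn t.
Proof. by rewrite /sn mulrBr sinB. Qed.

Lemma csN t : cs (- t) = cs t. Proof. by rewrite /cs mulrN cosN. Qed.
Lemma snN t : sn (- t) = - sn t. Proof. by rewrite /sn mulrN sinN. Qed.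
Lemma cs0 : cs 0 = 1. Proof. by rewrite /cs mulr0 cos0. Qed.
Lemma sn0 : sn 0 = 0. Proof. by rewrite /sn mulr0 sin0. Qed.
Lemma cs_half : cs (1/2) = -1.
Proof. by rewrite /cs (_ : pi *+ 2 * (1/2) = pi) ?cospi // -mulr_natl; field. Qed.
Lemma sn_half : sn (1/2) = 0.
Proof. by rewrite /sn (_ : pi *+ 2 * (1/2) = pi) ?sinpi // -mulr_natl; field. Qed.

Lemma cs_lt s t : 0 <= s <= 1/2 -> 0 <= t <= 1/2 -> (cs s < cs t) = (t < s).
Proof.
have h0 : pi *+ 2 = 2 * pi :> R by rewrite mulr_natl.
have h1 := pi_gt0 R.
move=> hs ht; rewrite /cs ltr_cos ?in_itv /=.
- by rewrite ltr_pM2l ?pi2_gt0.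
- by rewrite h0; snra.
- by rewrite h0; snra.
Qed.

Lemma cs_near e t : 0 < e -> e <= 1/2 -> cs e < cs t -> znear e t.
Proof.
move=> e0 e2 h; exists (t - rnd t); first exact: rnd_int.
have -> : t - (t - rnd t) = rnd t by ring.
move: h; rewrite -{1}(@csDz t (- (t - rnd t))); last by rewrite rpredN rnd_int.
have -> : t + - (t - rnd t) = rnd t by ring.
have hb := rnd_bound t.
have -> : cs (rnd t) = cs `|rnd t| by case: (ger0P (rnd t)) => // _; rewrite csN.
rewrite cs_lt //; first slra.
by rewrite normr_ge0 /= ler_norml; slra.
Qed.

Lemma cs_eq1 t : cs t = 1 -> isint t.
Proof.
move=> h; have hb := rnd_bound t.
have key : `|rnd t| = 0.
  have h1 : cs `|rnd t| = 1.
    have -> : cs `|rnd t| = cs (rnd t) by case: (ger0P (rnd t)) => // _; rewrite csN.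
    rewrite -h -(@csDz t (- (t - rnd t))); last by rewrite rpredN rnd_int.
    by congr cs; ring.
  apply/eqP; rewrite eq_le normr_ge0 andbT leNgt; apply/negP => h2.
  have : cs `|rnd t| < cs 0.
    rewrite cs_lt //; first by rewrite normr_ge0 /= ler_norml; slra.
    by rewrite lexx /=; slra.
  by rewrite h1 cs0 ltxx.
move/normr0_eq0: key => key.
by have := rnd_int t; rewrite key subr0.
Qed.

Definition rad x y : R := Num.sqrt (x ^+ 2 + y ^+ 2).

Lemma rad2 x y : rad x y ^+ 2 = x ^+ 2 + y ^+ 2.
Proof. by rewrite sqr_sqrtr // addr_ge0 // sqr_ge0. Qed.

Lemma rad_ge0 x y : 0 <= rad x y. Proof. exact: sqrtr_ge0. Qed.

Lemma rad_gt0 x y : (x, y) <> (0, 0) -> 0 < rad x y.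
Proof.
move=> h; rewrite lt_neqAle rad_ge0 andbT eq_sym; apply/eqP => r0.
have := rad2 x y; rewrite r0 => e.
move/eqP: e; rewrite expr0n /= eq_sym paddr_eq0 ?sqr_ge0 // !sqrf_eq0.
by move=> /andP[/eqP x0 /eqP y0]; apply: h; rewrite x0 y0.
Qed.

Lemma polar_exists x y : (x, y) <> (0, 0) ->
  exists t, [/\ 0 <= t < 1, x = rad x y * cs t & y = rad x y * sn t].
Proof.
move=> xy0; have r0 := rad_gt0 xy0; have r2 := rad2 x y.
set r := rad x y in r0 r2 *.
pose u := x / r; pose v := y / r.
have uv1 : u ^+ 2 + v ^+ 2 = 1.
  by rewrite /u /v !expr_div_n -mulrDl -r2 divff // expf_neq0 // gt_eqF.
have xu : x = r * u by rewrite /u mulrC divfK // gt_eqF.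
have yv : y = r * v by rewrite /v mulrC divfK // gt_eqF.
have u1 : -1 <= u <= 1 by snra.
have p0 := pi_gt0 R; have h0 : pi *+ 2 = 2 * pi :> R by rewrite mulr_natl.
have [a01 ca] := acos_def u1.
have sv2 : sin (acos u) ^+ 2 = v ^+ 2 by rewrite sin2cos2 ca; slra.
have sa0 := sin_ge0_pi a01.
have p20 : pi *+ 2 != 0 :> R by rewrite gt_eqF // pi2_gt0.
have [v0|v0] := leP 0 v.
  exists (acos u / (pi *+ 2)); split.
  - by rewrite divr_ge0 ?(ltW pi2_gt0) //= ?ltr_pdivrMr ?pi2_gt0 // ?h0; slra.
  - by rewrite /cs (mulrC (pi *+ 2)) divfK // ca.
  - by rewrite /sn (mulrC (pi *+ 2)) divfK // yv; congr (_ * _); snra.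
exists (1 - acos u / (pi *+ 2)).
have a0 : 0 < acos u.
  rewrite lt_neqAle eq_sym; have /andP[-> _] := a01; rewrite andbT.
  by apply/eqP => a0; move: sv2; rewrite a0 sin0; snra.
split.
- rewrite subr_ge0 ler_pdivrMr ?pi2_gt0 // ltrBlDr ltrDl divr_gt0 ?pi2_gt0 //.
  by rewrite andbT h0; slra.
- by rewrite addrC csD1 csN /cs (mulrC (pi *+ 2)) divfK // ca.
- rewrite addrC snD1 snN /sn (mulrC (pi *+ 2)) divfK // yv; congr (_ * _); snra.
Qed.

(** The angle of a plane vector, as a fraction of a turn in [0, 1[. *)
Definition arg x y : R :=
  xget 0 [set t | [/\ 0 <= t < 1, x = rad x y * cs t & y = rad x y * sn t]].

Lemma argP x y : (x, y) <> (0, 0) ->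
  [/\ 0 <= arg x y < 1, x = rad x y * cs (arg x y) & y = rad x y * sn (arg x y)].
Proof.
by move=> /polar_exists[t ht]; rewrite /arg; case: xgetP => [s -> //|/(_ t)].
Qed.

Lemma arg_uniq x y r t : 0 < r -> x = r * cs t -> y = r * sn t -> isint (arg x y - t).
Proof.
move=> r0 xe ye; have e1 := cs2sn2 t.
have xy0 : (x, y) <> (0, 0).
  move=> [x0 y0]; move/eqP: xe; rewrite x0 eq_sym mulf_eq0 gt_eqF //= => /eqP c0.
  by move/eqP: ye; rewrite y0 eq_sym mulf_eq0 gt_eqF //= => /eqP s0; snra.
have [a01 xa ya] := argP xy0; have q0 := rad_gt0 xy0.
have rr : rad x y = r.
  have := rad2 x y; rewrite {2}xe {2}ye !exprMn -mulrDr e1 mulr1 => /eqP.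
  by rewrite eqrXn2 ?ltW // => /eqP.
rewrite rr in xa ya.
apply: cs_eq1; rewrite csB.
have -> : cs (arg x y) = cs t by apply: (mulfI (lt0r_neq0 r0)); rewrite -xa.
have -> : sn (arg x y) = sn t by apply: (mulfI (lt0r_neq0 r0)); rewrite -ya.
by rewrite -!expr2.
Qed.

Lemma arg_conj x y : (x, y) <> (0, 0) -> isint (arg x (- y) + arg x y).
Proof.
move=> h; have [_ xa ya] := argP h.
rewrite -[arg x y in X in _ + X]opprK; apply: (arg_uniq (rad_gt0 h)).
  by rewrite csN.
by rewrite snN mulrN -ya.
Qed.

Lemma arg_eq0 x y : (x, y) <> (0, 0) -> arg x y = 0 -> 0 < x /\ y = 0.
Proof.
move=> h a0; have [_ xa ya] := argP h; have r0 := rad_gt0 h.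
rewrite a0 cs0 mulr1 in xa; rewrite a0 sn0 mulr0 in ya.
by split=> //; rewrite xa.
Qed.

Lemma arg_pos x y : 0 < x -> y = 0 -> arg x y = 0.
Proof.
move=> x0 y0; have h : (x, y) <> (0, 0) by move=> [e _]; rewrite e ltxx in x0.
have [a01 _ _] := argP h.
have := @arg_uniq x y x 0 x0; rewrite cs0 sn0 mulr1 mulr0 subr0 => /(_ erefl y0) hi.
by apply: int_small => //; rewrite ger0_norm; slra.
Qed.

Lemma dot_arg x y x' y' : (x, y) <> (0, 0) -> (x', y') <> (0, 0) ->
  x * x' + y * y' = rad x y * rad x' y' * cs (arg x' y' - arg x y).
Proof.
move=> /argP[_ + +] /argP[_ + +].
move: (rad x y) (arg x y) (rad x' y') (arg x' y') => r a r' a' -> -> -> ->.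
by rewrite csB; ring.
Qed.

Lemma cross_arg x y x' y' : (x, y) <> (0, 0) -> (x', y') <> (0, 0) ->
  x * y' - x' * y = rad x y * rad x' y' * sn (arg x' y' - arg x y).
Proof.
move=> /argP[_ + +] /argP[_ + +].
move: (rad x y) (arg x y) (rad x' y') (arg x' y') => r a r' a' -> -> -> ->.
by rewrite snB; ring.
Qed.

Lemma rad_cont : continuous (fun p : R * R => rad p.1 p.2).
Proof.
move=> p; apply: (@continuous_comp _ _ _ (fun p : R * R => p.1 ^+ 2 + p.2 ^+ 2) Num.sqrt).
  apply: cvgD; apply: cvgM; (exact: cvg_fst || exact: cvg_snd).
exact: sqrt_continuous.
Qed.

(** The argument is continuous modulo Z although its representative jumps
    along the positive half-axis. *)
Lemma arg_zc : zc [set p : R * R | p <> (0, 0)] (fun p => arg p.1 p.2).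
Proof.
move=> [x y] /= h e e0; have r0 := rad_gt0 h.
pose e' := Num.min e (1/2).
have e'0 : 0 < e' by rewrite lt_min e0 /=; slra.
have e'2 : e' <= 1/2 by rewrite ge_min lexx orbT.
have ce : cs e' < 1 by rewrite -cs0 cs_lt; slra.
pose q (p : R * R) := x * p.1 + y * p.2 - rad x y * rad p.1 p.2 * cs e'.
have qc : continuous q.
  move=> p; apply: cvgB; first by apply: cvgD; apply: cvgM;
    [exact: cvg_cst|exact: cvg_fst|exact: cvg_cst|exact: cvg_snd].
  apply: cvgM; last exact: cvg_cst.
  by apply: cvgM; [exact: cvg_cst|exact: rad_cont].
have q0 : 0 < q (x, y).
  by rewrite /q /= (dot_arg h h) subrr cs0 mulr1 -{1}(mulr1 (_ * _)) -mulrBr !mulr_gt0 //; slra.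
have : nbhs (x, y) (q @^-1` [set z | 0 < z]).
  by apply: qc; apply: open_nbhs_nbhs; split => //; exact: open_gt.
apply: filterS => -[x' y'] /= hq h'.
have r'0 := rad_gt0 h'.
have : znear e' (arg x' y' - arg x y).
  apply: cs_near => //; move: hq; rewrite /q /= (dot_arg h h') -mulrBr pmulr_rgt0 ?mulr_gt0 //.
  slra.
move=> [k ik hk]; exists k => //; apply: (lt_le_trans hk).
by rewrite ge_min lexx.
Qed.

(** Two plane vector fields that never point in opposite directions turn
    alike: the difference of their angles avoids the half-integers. *)
Lemma arg_liftP (T : topologicalType) (A : set T) (x y x' y' : T -> R) :
  mapc A x -> mapc A y -> mapc A x' -> mapc A y' ->
  (forall p, A p -> (x p, y p) <> (0, 0)) -> (forall p, A p -> (x' p, y' p) <> (0, 0)) ->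
  (forall p, A p -> x p * y' p - x' p * y p = 0 -> 0 <= x p * x' p + y p * y' p) ->
  exists h, islift A (fun p => arg (x' p) (y' p) - arg (x p) (y p)) h /\ forall p, `|h p| <= 1/2.
Proof.
move=> cx cy cx' cy' n n' anti.
have z : zc A (fun p => arg (x' p) (y' p) - arg (x p) (y p)).
  apply: zcB.
    exact: (zc_comp (g := fun p => (x' p, y' p)) n' (mapc_pair cx' cy') arg_zc).
  exact: (zc_comp (g := fun p => (x p, y p)) n (mapc_pair cx cy) arg_zc).
exists (fun p => rnd (arg (x' p) (y' p) - arg (x p) (y p))); split; last first.
  by move=> p; rewrite ler_norml; have := rnd_bound (arg (x' p) (y' p) - arg (x p) (y p)); slra.
apply: (zc_rnd z) => p Ap hi.
set d := arg _ _ - _ in hi.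
have cd : cs d = -1.
  by rewrite -cs_half -(@csDz _ (- (d + 1/2))) ?rpredN // -[RHS]csN; congr cs; slra.
have sd : sn d = 0.
  have := cs2sn2 d; rewrite cd; snra.
have h1 := cross_arg (n p Ap) (n' p Ap); have h2 := dot_arg (n p Ap) (n' p Ap).
move: h1 h2; rewrite -/d cd sd mulr0 => h1 h2; have := anti p Ap h1.
have r1 := rad_gt0 (n p Ap); have r2 := rad_gt0 (n' p Ap).
by rewrite h2; have := mulr_gt0 r1 r2; slra.
Qed.

Lemma arg_opp x y : (x, y) <> (0, 0) -> isint (arg (- x) (- y) - arg x y - 1/2).
Proof.
move=> h; have [_ xa ya] := argP h.
have -> : arg (- x) (- y) - arg x y - 1/2 = arg (- x) (- y) - (arg x y - - (1/2) ) by ring.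
apply: (arg_uniq (rad_gt0 h)).
  by rewrite csB csN snN cs_half sn_half {1}xa; ring.
by rewrite snB csN snN cs_half sn_half {1}ya; ring.
Qed.

(** The same for fields that never point in the same direction, after
    reversing one of them. *)
Lemma arg_liftN (T : topologicalType) (A : set T) (x y x' y' : T -> R) :
  mapc A x -> mapc A y -> mapc A x' -> mapc A y' ->
  (forall p, A p -> (x p, y p) <> (0, 0)) -> (forall p, A p -> (x' p, y' p) <> (0, 0)) ->
  (forall p, A p -> x p * y' p - x' p * y p = 0 -> x p * x' p + y p * y' p <= 0) ->
  exists h, islift A (fun p => arg (x' p) (y' p) - arg (x p) (y p)) h /\ forall p, `|h p| <= 1.
Proof.
move=> cx cy cx' cy' n n' anti.
have n2 p : A p -> (- x p, - y p) <> (0, 0).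
  by move=> /n h [e1 e2]; apply: h; congr (_, _); slra.
have [|h [hl hb]] := arg_liftP (mapcN cx) (mapcN cy) cx' cy' n2 n'.
  by move=> p Ap e; have := anti p Ap ltac:(slra); slra.
exists (fun p => h p + 1/2); split; last first.
  by move=> p; have := hb p; rewrite !ler_norml; slra.
split; first by apply: mapcD hl.1 _; exact: mapc_cst.
move=> p Ap.
rewrite (_ : _ - _ = (arg (x' p) (y' p) - arg (- x p) (- y p) - h p) + (arg (- x p) (- y p) - arg (x p) (y p) - 1/2)); last by ring.
by zit ltac:(first [exact: hl.2|apply: arg_opp; exact: n]).
Qed.

End Angle.

(** * The turning of linear maps *)

Section AngleLinear.
Variable R : realType.

(** A map L with positive determinant and nonnegative trace has no negative
    eigenvalue; quantitatively, the determinant of L + k is at least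
    det L + k ^ 2 for k >= 0, and Cramer's formulas bound the vector. *)
Lemma linear_not_opposite (a b c d : R) : 0 < a * d - b * c -> 0 <= a + d ->
  exists2 eta : R, 0 < eta & forall x y e1 e2 k : R, (x, y) <> (0, 0) -> 0 <= k ->
    `|e1| <= eta * (`|x| + `|y|) -> `|e2| <= eta * (`|x| + `|y|) ->
    a * x + b * y + e1 = - k * x -> c * x + d * y + e2 = - k * y -> False.
Proof.
move=> D0 t0.
pose C := `|a| + `|b| + `|c| + `|d|.
have C0 : 0 <= C by rewrite !addr_ge0.
pose D := a * d - b * c.
pose eta := Num.min (1/2) (D / (2 * (C + 1))).
have eta0 : 0 < eta.
  by rewrite lt_min; apply/andP; split; [slra|apply: divr_gt0; [exact: D0|slra]].
have eta2 : eta <= 1/2 by rewrite ge_min lexx.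
have etaD : eta * (C + 1) <= D / 2.
  have h : eta <= D / (2 * (C + 1)) by rewrite ge_min lexx orbT.
  have -> : D / 2 = D / (2 * (C + 1)) * (C + 1) by field; slra.
  by rewrite ler_wpM2r //; slra.
exists eta => // x y e1 e2 k xy0 k0 h1 h2 E1 E2.
set N := `|x| + `|y| in h1 h2.
have N0 : 0 < N.
  rewrite lt_neqAle addr_ge0 // andbT eq_sym paddr_eq0 // !normr_eq0.
  by apply/negP => /andP[/eqP x0 /eqP y0]; apply: xy0; rewrite x0 y0.
pose D' := (a + k) * (d + k) - b * c.
have D'D : D + k ^+ 2 <= D'.
  have -> : D' = D + k ^+ 2 + k * (a + d) by rewrite /D' /D; ring.
  by rewrite lerDl mulr_ge0.
have D'0 : 0 <= D' by have := sqr_ge0 k; rewrite /D in D'D *; slra.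
have Ex : x * D' = b * e2 - (d + k) * e1.
  have -> : e1 = - k * x - a * x - b * y by slra.
  have -> : e2 = - k * y - c * x - d * y by slra.
  by rewrite /D'; ring.
have Ey : y * D' = c * e1 - (a + k) * e2.
  have -> : e1 = - k * x - a * x - b * y by slra.
  have -> : e2 = - k * y - c * x - d * y by slra.
  by rewrite /D'; ring.
have bnd u v e e' : `|e| <= eta * N -> `|e'| <= eta * N ->
    `|u * e - v * e'| <= (`|u| + `|v|) * (eta * N).
  move=> he he'; apply: (le_trans (ler_normB _ _)); rewrite !normrM mulrDl.
  by apply: lerD; apply: ler_wpM2l.
have Nx : `|x| * D' <= (`|b| + `|d + k|) * (eta * N).
  by rewrite -{1}(ger0_norm D'0) -normrM Ex; exact: bnd.
have Ny : `|y| * D' <= (`|c| + `|a + k|) * (eta * N).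
  by rewrite -{1}(ger0_norm D'0) -normrM Ey; exact: bnd.
have ND : N * D' <= (C + 2 * k) * (eta * N).
  rewrite /N mulrDl; apply: (le_trans (lerD Nx Ny)); rewrite -mulrDl.
  apply: ler_wpM2r; first by rewrite mulr_ge0 // ltW.
  have := ler_normD d k; have := ler_normD a k; rewrite (ger0_norm k0) /C; slra.
have : D' <= (C + 2 * k) * eta.
  by rewrite -(ler_pM2l N0) (le_trans ND) // mulrA mulrC.
have : 2 * k <= 1 + k ^+ 2 by have := sqr_ge0 (1 - k); snra.
move=> hk hD.
have : (C + 2 * k) * eta <= (C + 1) * eta + k ^+ 2 * eta.
  by rewrite -mulrDl ler_wpM2r //; slra.
have : k ^+ 2 * eta <= k ^+ 2 * (1/2) by rewrite ler_wpM2l // sqr_ge0.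
have := sqr_ge0 k; rewrite /D in etaD D'D; slra.
Qed.

(** A plane map of positive determinant turns each vector by a bounded
    amount, because L w is never opposite to w, or else -L w never is; this
    persists for maps close to L.  This is where orientations enter: the
    argument of a coordinate is replaced by that of another coordinate with the
    same orientation. *)
Lemma arg_linear (a b c d : R) : 0 < a * d - b * c -> exists2 eta : R, 0 < eta &
  forall (T : topologicalType) (A : set T) (x y x' y' : T -> R),
  mapc A x -> mapc A y -> mapc A x' -> mapc A y' ->
  (forall p, A p -> (x p, y p) <> (0, 0)) ->
  (forall p, A p -> `|x' p - (a * x p + b * y p)| <= eta * (`|x p| + `|y p|)) ->
  (forall p, A p -> `|y' p - (c * x p + d * y p)| <= eta * (`|x p| + `|y p|)) ->
  (forall p, A p -> (x' p, y' p) <> (0, 0)) /\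
  exists h, islift A (fun p => arg (x' p) (y' p) - arg (x p) (y p)) h /\ forall p, `|h p| <= 1.
Proof.
move=> D0.
have coll (x y x' y' : R) : (x, y) <> (0, 0) -> x * y' - x' * y = 0 ->
    exists2 k, x' = k * x /\ y' = k * y & (0 <= k) = (0 <= x * x' + y * y').
  move=> /rad_gt0 r0 cr; have r2 := rad2 x y; set r := rad x y in r0 r2.
  have q0 : 0 < r ^+ 2 by rewrite exprn_gt0.
  exists ((x * x' + y * y') / r ^+ 2); last by rewrite pmulr_lge0 // invr_gt0.
  have hk : (x * x' + y * y') / r ^+ 2 * r ^+ 2 = x * x' + y * y' by rewrite divfK ?gt_eqF.
  have e1 : y * (x * y' - x' * y) = 0 by rewrite cr mulr0.
  have e2 : x * (x * y' - x' * y) = 0 by rewrite cr mulr0.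
  set k := _ / _ in hk *; have hk' : r ^+ 2 * k = x * x' + y * y' by rewrite mulrC.
  by split; apply: (mulfI (lt0r_neq0 q0)); rewrite mulrA hk' r2; slra.
have [t0|t0] := leP 0 (a + d).
  have [eta e0 he] := linear_not_opposite D0 t0.
  exists eta => // T A x y x' y' cx cy cx' cy' n h1 h2.
  have n' p : A p -> (x' p, y' p) <> (0, 0).
    move=> Ap [z1 z2].
    apply: (he (x p) (y p) (x' p - (a * x p + b * y p)) (y' p - (c * x p + d * y p)) 0) => //;
      rewrite ?z1 ?z2; first [exact: n|exact: h1|exact: h2|ring|idtac].
    - by have := h1 p Ap; rewrite z1.
    - by have := h2 p Ap; rewrite z2.
  split=> //.
  have [|h [hl hb]] := arg_liftP cx cy cx' cy' n n'; last first.
    by exists h; split=> // p; apply: (le_trans (hb p)); slra.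
  move=> p Ap cr; rewrite leNgt; apply/negP => dt.
  have [k [k1 k2] ks] := coll _ _ _ _ (n p Ap) cr.
  have k0 : k < 0 by rewrite ltNge ks -ltNge.
  apply: (he (x p) (y p) (x' p - (a * x p + b * y p)) (y' p - (c * x p + d * y p)) (- k)) => //.
  - exact: n.
  - slra.
  - exact: h1.
  - exact: h2.
  - by rewrite k1; ring.
  - by rewrite k2; ring.
have D0' : 0 < (- a) * (- d) - (- b) * (- c) by snra.
have t0' : 0 <= - a + - d by slra.
have [eta e0 he] := linear_not_opposite D0' t0'.
exists eta => // T A x y x' y' cx cy cx' cy' n h1 h2.
have key p k : A p -> 0 <= k -> x' p = k * x p -> y' p = k * y p -> False.
  move=> Ap k0 k1 k2.
  apply: (he (x p) (y p) (- (x' p - (a * x p + b * y p))) (- (y' p - (c * x p + d * y p))) k) => //.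
  - exact: n.
  - by rewrite normrN; exact: h1.
  - by rewrite normrN; exact: h2.
  - by rewrite k1; ring.
  - by rewrite k2; ring.
have n' p : A p -> (x' p, y' p) <> (0, 0).
  by move=> Ap [z1 z2]; apply: (key p 0 Ap) => //; rewrite mul0r.
split=> //.
apply: arg_liftN => // p Ap cr; rewrite leNgt; apply/negP => dt.
have [k [k1 k2] ks] := coll _ _ _ _ (n p Ap) cr.
by apply: (key p k Ap) => //; rewrite ks ltW.
Qed.

(** A function of the angle and of the radius that takes the same value at
    the two ends of the angular interval descends to the plane. *)
Lemma polar_cont (B : set (R * R)) (K : R * R -> R) : mapc B K ->
  (forall r, B (0, r) -> B (1, r) -> K (0, r) = K (1, r)) ->
  mapc [set p : R * R | [/\ p <> (0, 0), B (arg p.1 p.2, rad p.1 p.2) &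
                         arg p.1 p.2 = 0 -> B (1, rad p.1 p.2)]]
    (fun p => K (arg p.1 p.2, rad p.1 p.2)).
Proof.
move=> Kc K01; apply/mapcR => -[x y] [/= p0 Bp B1] e e0.
have [/andP[a0 a1] _ _] := argP p0.
set p := (x, y).
set t := arg x y in a0 a1 Bp B1 *; set r := rad x y in Bp B1 *.
have near_of s : B (s, r) -> exists2 d : R, 0 < d & forall s' r', B (s', r') ->
    `|s' - s| < d -> `|r' - r| < d -> `|K (s', r') - K (s, r)| < e.
  move=> Bs; have /mapcR /(_ _ Bs _ e0) /nbhs_ballP[d d0 hd] := Kc.
  exists d => // s' r' B' h1 h2; apply: hd => //.
  by split; rewrite /ball /= distrC.
have [d d0 hd] := near_of t Bp.
have [d1 d10 hd1] : exists2 d1 : R, 0 < d1 & t = 0 -> forall s' r', B (s', r') ->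
    `|s' - 1| < d1 -> `|r' - r| < d1 -> `|K (s', r') - K (t, r)| < e.
  have [tz|tn] := eqVneq t 0; last by exists 1 => // tz; rewrite tz eqxx in tn.
  have [d1 d10 hd1] := near_of 1 (B1 tz); exists d1 => // _.
  by rewrite tz K01 -?tz //; exact: B1.
pose d2 := if t == 0 then 1/2 else t.
have d20 : 0 < d2.
  by rewrite /d2; have [tz|tn] := eqVneq t 0; [slra|rewrite lt_neqAle eq_sym tn].
set q := Num.min (Num.min d d1) (Num.min d2 (1 - t)).
have q0 : 0 < q by rewrite !lt_min d0 d10 d20 /= subr_gt0.
have [qd qd1 qd2 qt] : [/\ q <= d, q <= d1, q <= d2 & q <= 1 - t].
  by split; rewrite !ge_min lexx ?orbT.
have hr : \forall p' \near p, `|rad p'.1 p'.2 - r| < q.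
  have /mapcR := mapc_cont (A := setT) (@rad_cont R).
  by move=> /(_ p I q q0); apply: filterS => z /(_ I).
have ha := arg_zc p0 q0.
apply: filterS2 hr ha => -[x' y'] /= hr ha [p0' Bp' _].
have [k ik hk] := ha p0'; have [/andP[a0' a1'] _ _] := argP p0'.
set t' := arg x' y' in a0' a1' hk Bp' *; rewrite -/t in hk.
have [k0|kn] := eqVneq k 0.
  by apply: hd => //; [rewrite k0 subr0 in hk|]; apply: lt_le_trans qd.
have tz : t = 0 /\ k = 1.
  have k1 : k <= -1 \/ 1 <= k.
    have : 1 <= `|k| by rewrite leNgt; apply/negP => /(int_small ik) kz; rewrite kz eqxx in kn.
    by rewrite ler_normr => /orP[h|h]; [right|left]; slra.
  move: hk; rewrite ltr_norml => /andP[hk1 hk2].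
  case: k1 => k1; first by move: qt; slra.
  have t0 : t = 0.
    apply/eqP; rewrite -[_ == _]negbK; apply/negP => tn.
    by move: qd2; rewrite /d2 (negbTE tn); slra.
  split=> //; move: (ik) => /int_small.
  have ki : isint (k - 1) by zi.
  have := int_small ki; rewrite ltr_norml => h; have := h ltac:(slra); slra.
apply: (hd1 tz.1) => //; last exact: lt_le_trans qd1.
by move: hk; rewrite tz.1 tz.2 subr0 => hk; apply: lt_le_trans qd1.
Qed.

End AngleLinear.

(** * Residues in the plane *)

Section Residue.
Variable R : realType.
Implicit Types (f g : R * R -> R) (p q : R * R).

Definition argq q p : R := arg (p.1 - q.1) (p.2 - q.2).
Definition radq q p : R := rad (p.1 - q.1) (p.2 - q.2).
Definition pdisc q (r : R) : set (R * R) := [set p | p <> q /\ radq q p < r].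

(** Near q and off q, the function f winds n times around q: n is the residue of
    f at q. *)
Definition pres f q (n : int) : Prop :=
  exists2 r : R, 0 < r & exists h, islift (pdisc q r) (fun p => f p - n%:~R * argq q p) h.

Lemma subq0 p q : p <> q -> (p.1 - q.1, p.2 - q.2) <> (0, 0).
Proof.
by case: p q => x y [a b] h /= [h1 h2]; apply: h; congr (_, _); slra.
Qed.

Lemma mapcT (T U : topologicalType) (h : T -> U) : mapc setT h -> continuous h.
Proof. by move=> hc x V hV; apply: filterS (hc x I V hV) => y /(_ I). Qed.

Lemma mapc_fst (T U : topologicalType) (A : set (T * U)) : mapc A fst.
Proof. by apply: mapc_cont => p; exact: cvg_fst. Qed.

Lemma mapc_snd (T U : topologicalType) (A : set (T * U)) : mapc A snd.
Proof. by apply: mapc_cont => p; exact: cvg_snd. Qed.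

Lemma shift_cont q : continuous (fun p => (p.1 - q.1, p.2 - q.2)).
Proof.
by apply: mapcT; apply: mapc_pair; apply: mapcB; by [exact: mapc_cst|exact: mapc_fst|exact: mapc_snd].
Qed.

Lemma argq_zc q : zc [set p | p <> q] (argq q).
Proof.
apply: (zc_comp (g := fun p => (p.1 - q.1, p.2 - q.2)) _ _ (@arg_zc R)).
  by move=> p /subq0.
by apply: mapc_cont; exact: shift_cont.
Qed.

Lemma radq_cont q : continuous (radq q).
Proof.
move=> p; apply: (@continuous_comp _ _ _ (fun p => (p.1 - q.1, p.2 - q.2)) (fun p => rad p.1 p.2)).
  exact: shift_cont.
exact: rad_cont.
Qed.

Lemma rad_polar (r t : R) : 0 <= r -> rad (r * cs t) (r * sn t) = r.
Proof.
by move=> r0; rewrite /rad !exprMn -mulrDr cs2sn2 mulr1 sqrtr_sqr ger0_norm.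
Qed.

Lemma rad00 : rad 0 0 = 0 :> R.
Proof. by rewrite /rad expr0n /= addr0 sqrtr0. Qed.

Lemma radq_gt0 p q : p <> q -> 0 < radq q p.
Proof. by move=> /subq0 /rad_gt0. Qed.

Lemma radqq q : radq q q = 0. Proof. by rewrite /radq !subrr rad00. Qed.

Lemma pdisc_nbhs q r : 0 < r -> nbhs q [set p | radq q p < r].
Proof.
move=> r0; have : nbhs (radq q q) [set z | z < r].
  by rewrite radqq; apply: open_nbhs_nbhs; split => //; exact: open_lt.
by move=> h; exact: (radq_cont h).
Qed.

(* p is read as polar coordinates around q *)
Definition ptq q (p : R * R) : R * R := (q.1 + p.2 * cs p.1, q.2 + p.2 * sn p.1).

Lemma ptq_cont q : continuous (ptq q).
Proof.
apply: mapcT; apply: mapc_pair; apply: mapcD; try exact: mapc_cst; apply: mapcM; try exact: mapc_snd.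
  by apply: (mapc_comp (B := setT) _ (@mapc_fst _ _ _)) => //; apply: mapc_cont; exact: cs_cont.
by apply: (mapc_comp (B := setT) _ (@mapc_fst _ _ _)) => //; apply: mapc_cont; exact: sn_cont.
Qed.

Lemma radq_ptq q p : 0 <= p.2 -> radq q (ptq q p) = p.2.
Proof. by move=> h; rewrite /radq /ptq /= !(addrC q.1) !(addrC q.2) !addrK rad_polar. Qed.

Lemma ptqK q p : p <> q -> ptq q (argq q p, radq q p) = p.
Proof.
move=> /subq0 /argP[_]; rewrite /ptq -/(argq q p) -/(radq q p) /= => <- <-.
by case: p => x y /=; congr (_, _); slra.
Qed.

Lemma argq_bound p q : p <> q -> 0 <= argq q p < 1.
Proof. by move=> /subq0 /argP[]. Qed.

Lemma ptq1 q r : ptq q (1, r) = ptq q (0, r).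
Proof. by rewrite /ptq /= -(add0r 1) csD1 snD1. Qed.

Lemma polar_contq (B : set (R * R)) (K : R * R -> R) q (D : set (R * R)) : mapc B K ->
  (forall r, B (0, r) -> B (1, r) -> K (0, r) = K (1, r)) ->
  (forall p, D p -> [/\ p <> q, B (argq q p, radq q p) & argq q p = 0 -> B (1, radq q p)]) ->
  mapc D (fun p => K (argq q p, radq q p)).
Proof.
move=> Kc K01 hD.
apply: (mapc_comp (f := fun p => (p.1 - q.1, p.2 - q.2)) _ _ (polar_cont Kc K01)).
  by move=> p /hD[pq b1 b2]; split => //; exact: subq0.
by apply: mapc_cont; exact: shift_cont.
Qed.

(** Read in polar coordinates around q, the function lifts on rectangles; the
    lift gains a constant integer over one turn, which is the residue. *)
Lemma pres_exists f q r0 : 0 < r0 -> zc (pdisc q r0) f -> exists n, pres f q n.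
Proof.
move=> r00 fz; pose r := r0 / 2; have r_gt0 : 0 < r by rewrite /r; slra.
have rr0 : r < r0 by rewrite /r; slra.
pose G := f \o ptq q.
have Gz s : 0 < s -> zc (rect 0 1 s r) G.
  move=> s0; apply: zc_comp fz; last by apply: mapc_cont; exact: ptq_cont.
  move=> p [_ /andP[h1 h2]]; split; last by rewrite radq_ptq; slra.
  move=> e; have : radq q (ptq q p) = 0 by rewrite e radqq.
  by rewrite radq_ptq; slra.
have /choice[hh hhP] : forall s, exists h, 0 < s <= r ->
    islift (rect 0 1 s r) G h /\ h (0, r) = G (0, r).
  move=> s; have [/andP[s0 sr]|n] := boolP (0 < s <= r); last by exists (fun=> 0).
  have [h hl] := lift_rect ler01 sr (Gz s s0).
  have h0 : rect 0 1 s r (0, r) by rewrite /rect /=; slra.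
  exists (fun p => h p + (G (0, r) - h (0, r))) => _; split; last by ring.
  split; first by apply: mapcD hl.1 _; exact: mapc_cst.
  move=> p hp; rewrite (_ : _ - _ = (G p - h p) - (G (0, r) - h (0, r))); last by ring.
  by zit ltac:(exact: hl.2).
have compat s s' p : 0 < s' -> s' <= s -> rect 0 1 s r p -> hh s' p = hh s p.
  move=> s'0 ss hp; have [p1 p2] := hp.
  have [l1 e1] := hhP s ltac:(slra); have [l2 e2] := hhP s' ltac:(slra).
  have l2' : islift (rect 0 1 s r) G (hh s').
    by apply: islift_sub l2 => z [z1 z2]; split => //; slra.
  have hr : rect 0 1 s r (0, r) by rewrite /rect /=; slra.
  have := islift_unique (@connected_rect R _ _ _ _) l1 l2' hr hp.
  by rewrite e1 e2; slra.
pose H p := hh p.2 p.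
pose B := [set p : R * R | 0 <= p.1 <= 1 /\ 0 < p.2 <= r].
have HB s p : 0 < s -> s <= p.2 -> B p -> H p = hh s p.
  by move=> s0 sp [h1 h2]; rewrite /H -(@compat p.2 s) //; split=> //; slra.
have Hc : mapc B H.
  apply: mapc_local => p [p1 p2]; have s0 : 0 < p.2 / 2 by slra.
  exists [set z : R * R | p.2 / 2 < z.2].
    have h : nbhs p.2 [set z | p.2 / 2 < z].
      by apply: open_nbhs_nbhs; split; [exact: open_gt|rewrite /=; slra].
    by apply: filterS (mapc_snd (I : setT p) h) => z /(_ I).
  have [l1 _] := hhP (p.2/2) ltac:(slra).
  apply: (mapc_eq (f := hh (p.2 / 2))) => [z [Bz /= pz]|].
    by rewrite (HB (p.2 / 2)) // ltW.
  by apply: mapc_sub l1.1 => z [[z1 z2] /= pz]; split=> //; slra.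
have Hint s : 0 < s <= r -> H (1, s) - H (0, s) = H (1, r) - H (0, r) /\ isint (H (1, s) - H (0, s)).
  move=> hs; have [l1 _] := hhP s hs.
  have ii t : itv s r t -> isint (hh s (1, t) - hh s (0, t)).
    move=> ht; have r1 : rect 0 1 s r (1, t) by split=> //=; slra.
    have r2 : rect 0 1 s r (0, t) by split=> //=; slra.
    rewrite (_ : _ - _ = (G (0, t) - hh s (0, t)) - (G (1, t) - hh s (1, t))).
      by zit ltac:(exact: l1.2).
    by rewrite /G /= ptq1; ring.
  have e t : itv s r t -> H (1, t) - H (0, t) = hh s (1, t) - hh s (0, t).
    move=> /andP[ht1 ht2]; rewrite !(HB s) //=; try slra; split; rewrite /=; slra.
  have sr : itv s r s by rewrite /itv /=; slra.
  have sr' : itv s r r by rewrite /itv /=; slra.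
  split; last by rewrite e //; exact: ii.
  rewrite !e //; apply: (connected_int (k := fun t => hh s (1, t) - hh s (0, t)) (@connected_itv R s r)) => //.
  apply: mapcB; apply: (mapc_comp (B := rect 0 1 s r) _ _ l1.1); try exact: mapc_ver.
    by move=> t ht; rewrite /rect /=; move: ht; rewrite /itv /=; slra.
  by move=> t ht; rewrite /rect /=; move: ht; rewrite /itv /=; slra.
have [n hn] : exists n : int, H (1, r) - H (0, r) = n%:~R.
  by apply/intrP; apply: (Hint r _).2; slra.
exists n; exists r => //.
pose K p := H p - n%:~R * p.1.
exists (fun p => K (argq q p, radq q p)); split.
  apply: (polar_contq (B := B)).
  - apply: mapcB => //; apply: mapcM; first exact: mapc_cst.
    by apply: mapc_cont => p; exact: cvg_fst.
  - by move=> s [_ /= hs] _; rewrite /K /=; have [h1 _] := Hint s hs; slra.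
  - move=> p [pq pr]; have a01 := argq_bound pq; have rp := radq_gt0 pq.
    by split => //; [|move=> _]; split; rewrite /=; slra.
move=> p [pq pr]; have a01 := argq_bound pq; have rp := radq_gt0 pq.
rewrite /K /= (_ : _ - _ = f p - H (argq q p, radq q p)); last by ring.
have [l1 _] := hhP (radq q p) ltac:(slra).
rewrite /H /= -{1}(ptqK pq); apply: l1.2.
by split; rewrite /=; slra.
Qed.

Lemma presD f g q m n : pres f q m -> pres g q n -> pres (fun p => f p + g p) q (m + n).
Proof.
move=> [r r0 [h hl]] [s s0 [k kl]]; exists (Num.min r s); first by rewrite lt_min r0.
exists (fun p => h p + k p); split.
  by apply: mapcD; [apply: mapc_sub hl.1|apply: mapc_sub kl.1] => p [pq];
    rewrite lt_min => /andP[h1 h2].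
move=> p [pq]; rewrite lt_min => /andP[h1 h2].
rewrite intrD (_ : _ - _ = (f p - m%:~R * argq q p - h p) + (g p - n%:~R * argq q p - k p)); last by ring.
by zit ltac:(first [exact: hl.2|exact: kl.2]).
Qed.

Lemma presN f q m : pres f q m -> pres (fun p => - f p) q (- m).
Proof.
move=> [r r0 [h hl]]; exists r => //; exists (fun p => - h p); split; first exact: mapcN hl.1.
move=> p hp; rewrite mulrNz (_ : _ - _ = - (f p - m%:~R * argq q p - h p)); last by ring.
by zit ltac:(exact: hl.2).
Qed.

Lemma radq_ge p q : `|p.1 - q.1| <= radq q p /\ `|p.2 - q.2| <= radq q p.
Proof.
have rq := rad2 (p.1 - q.1) (p.2 - q.2); have r1 := rad_ge0 (p.1 - q.1) (p.2 - q.2).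
rewrite -/(radq q p) in rq r1.
by split; rewrite -(ler_pXn2r (n := 2)) ?nnegrE // rq real_normK ?num_real // ?lerDl ?lerDr sqr_ge0.
Qed.

Lemma pdisc_ball p q r : radq q p < r -> ball q r p.
Proof.
by move=> h; have [h1 h2] := radq_ge p q; split; rewrite /ball /= distrC; slra.
Qed.

Lemma pres_near f g q n : (\forall p \near q, p <> q -> isint (g p - f p)) -> pres f q n -> pres g q n.
Proof.
move=> /nbhs_ballP[d d0 hd] [r r0 [h hl]].
exists (Num.min r d); first by rewrite lt_min r0.
have sub p : pdisc q (Num.min r d) p -> pdisc q r p /\ ball q d p.
  by move=> [pq]; rewrite lt_min => /andP[h1 h2]; split=> //; exact: pdisc_ball.
exists h; split; first by apply: mapc_sub hl.1 => p /sub[].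
move=> p hp; have [h1 h2] := sub p hp.
rewrite (_ : _ - _ = (g p - f p) + (f p - n%:~R * argq q p - h p)); last by ring.
by zit ltac:(first [exact: hl.2|apply: (hd p h2); exact: hp.1]).
Qed.

Lemma pres0 f q (W : set (R * R)) : nbhs q W -> zc W f -> pres f q 0.
Proof.
move=> hW fz; have [V hV [h hl]] := zc_near_lift fz (nbhs_singleton hW).
have /nbhs_ballP[d d0 hd] : nbhs q (W `&` V) by exact: filterI.
exists d => //; exists h.
have sub : pdisc q d `<=` W `&` V by move=> p [_ /pdisc_ball /hd].
split; first exact: mapc_sub hl.1.
by move=> p /sub hp; rewrite mul0r subr0; exact: hl.2.
Qed.

(** A multiple of the argument with a lift around q would be constant along a
    small circle, on which it gains the multiplicity. *)
Lemma pres_uniq f q m n : pres f q m -> pres f q n -> m = n.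
Proof.
move=> /presN hm hn; have := presD hn hm; move=> [r r0 [h hl]].
suff : n - m = 0 by move=> /eqP; rewrite subr_eq0 => /eqP.
set k := n - m in hl *.
pose s := r / 2.
have hs (p : R) : pdisc q r (ptq q (p, s)).
  split; last by rewrite radq_ptq /s /=; slra.
  by move=> e; have := radqq q; rewrite -{2}e radq_ptq /s /=; slra.
have hc : mapc (itv 0 1) (fun t => h (ptq q (t, s)) + k%:~R * t).
  apply: mapcD; last by apply: mapcM; [exact: mapc_cst|exact: mapc_id].
  apply: (mapc_comp (f := fun t => ptq q (t, s)) _ _ hl.1) => //.
  by apply: (mapc_comp (B := setT) _ (@mapc_hor _ _ s)) => //; apply: mapc_cont; exact: ptq_cont.
have hi t : itv 0 1 t -> isint (h (ptq q (t, s)) + k%:~R * t).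
  move=> ht; have := hl.2 _ (hs t).
  have : isint (argq q (ptq q (t, s)) - t).
    apply: (@arg_uniq _ _ _ s); rewrite /ptq /s //=; first slra.
    - ring.
    - ring.
  move=> i1 i2.
  rewrite (_ : _ + _ = - ((f (ptq q (t, s)) + - f (ptq q (t, s))) - k%:~R * argq q (ptq q (t, s)) - h (ptq q (t, s))) - k%:~R * (argq q (ptq q (t, s)) - t)); last by ring.
  by zi.
have := connected_int (@connected_itv R 0 1) hc hi (itv_l ler01) (itv_r ler01).
rewrite ptq1 mulr0 mulr1 addr0 => e.
by apply/eqP; rewrite -(intr_eq0 R); apply/eqP; slra.
Qed.

End Residue.

(** * The residue theorem in a rectangle *)

Section PlanarResidue.
Variable R : realType.
Implicit Types (f g : R * R -> R) (p q : R * R).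

Definition clamp (x : R) : R := Num.max 0 (Num.min 1 x).

Lemma clamp_bound x : 0 <= clamp x <= 1.
Proof. by rewrite /clamp le_max lexx /= ge_max ge_min lexx ler01. Qed.

Lemma clamp_le0 x : x <= 0 -> clamp x = 0.
Proof. by move=> h; rewrite /clamp; apply/max_idPl; rewrite ge_min h orbT. Qed.

Lemma clamp_ge1 x : 1 <= x -> clamp x = 1.
Proof. by move=> h; rewrite /clamp (min_idPl h); apply/max_idPr; exact: ler01. Qed.

Lemma clamp_mid x : 0 <= x <= 1 -> clamp x = x.
Proof. by move=> /andP[h0 h1]; rewrite /clamp (min_idPr h1); apply/max_idPr. Qed.

Lemma clamp_lip x y : `|clamp x - clamp y| <= `|x - y|.
Proof.
rewrite /clamp !maxEle !minEle.
by case: (leP 1 x) => ?; case: (leP 1 y) => ?; repeat case: ifP => ?;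
  rewrite ler_norml; case: (ger0P (x - y)); slra.
Qed.

Lemma mapc_clamp (T : topologicalType) (A : set T) (f : T -> R) : mapc A f -> mapc A (clamp \o f).
Proof.
move=> /mapcR hf; apply/mapcR => x Ax e e0; apply: filterS (hf x Ax e e0) => y hy Ay.
by apply: le_lt_trans (clamp_lip _ _) _; exact: hy.
Qed.

Lemma mapcV (T : topologicalType) (A : set T) (f : T -> R) : mapc A f -> (forall x, A x -> f x != 0) ->
  mapc A (fun x => (f x)^-1).
Proof.
move=> hf n x Ax V hV; have := hf x Ax _ (inv_continuous (n x Ax) hV).
by apply: filterS => y hy Ay; exact: hy Ay.
Qed.

(** A circle-valued function with a single singularity, a simple one at q, whose
    non-integer values are confined to a sector with vertex q opening to the
    right: it is the building block with which singularities are removed. *)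
Definition wedge q p : R :=
  if p.1 <= q.1 then 0 else clamp ((p.2 - q.2) / (p.1 - q.1) + 1/2).

Lemma wedge_top q p : p.1 - q.1 <= p.2 - q.2 -> isint (wedge q p).
Proof.
move=> h; rewrite /wedge; case: leP => h1; first exact: rpred0.
rewrite clamp_ge1 ?rpred1 // -lerBlDr ler_pdivlMr; slra.
Qed.

Lemma wedge_bot q p : p.2 - q.2 <= - (p.1 - q.1) -> isint (wedge q p).
Proof.
move=> h; rewrite /wedge; case: leP => h1; first exact: rpred0.
rewrite clamp_le0 ?rpred0 // -lerBrDr ler_pdivrMr; slra.
Qed.

Lemma wedge_cont q : mapc [set p | q.1 < p.1] (wedge q).
Proof.
apply: (mapc_eq (f := clamp \o (fun p => (p.2 - q.2) * (p.1 - q.1)^-1 + 1/2))).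
  by move=> p /= h; rewrite /wedge leNgt h.
apply: mapc_clamp; apply: mapcD; last exact: mapc_cst.
apply: mapcM; first by apply: mapcB; [exact: mapc_snd|exact: mapc_cst].
apply: mapcV; first by apply: mapcB; [exact: mapc_fst|exact: mapc_cst].
by move=> p /= h; rewrite subr_eq0 gt_eqF.
Qed.

Lemma open_near (T : topologicalType) (f : T -> R) x c : continuous f -> f x < c ->
  nbhs x [set y | f y < c].
Proof.
move=> fc h; have h2 : nbhs (f x) [set z | z < c].
  by apply: open_nbhs_nbhs; split=> //; exact: open_lt.
exact: (fc x _ h2).
Qed.

Lemma open_near2 (T : topologicalType) (f : T -> R) x c : continuous f -> c < f x ->
  nbhs x [set y | c < f y].
Proof.
move=> fc h; have h2 : nbhs (f x) [set z | c < z].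
  by apply: open_nbhs_nbhs; split=> //; exact: open_gt.
exact: (fc x _ h2).
Qed.

Lemma cont_fst : continuous (@fst R R). Proof. by move=> p; exact: cvg_fst. Qed.
Lemma cont_snd : continuous (@snd R R). Proof. by move=> p; exact: cvg_snd. Qed.

Lemma zc_int (T : topologicalType) (A : set T) (f : T -> R) : (forall x, A x -> isint (f x)) -> zc A f.
Proof.
move=> h; apply: (zc_congr (f := fun=> 0)).
  by move=> x /h; rewrite subr0.
by apply: zc_mapc; exact: mapc_cst.
Qed.

Lemma wedge_zc q : zc [set p | p <> q] (wedge q).
Proof.
apply: zc_local => p pq /=.
have [h|h|h] := ltgtP p.1 q.1.
- exists [set z | z.1 < q.1]; first exact: (open_near cont_fst).
  by apply: zc_int => z [_ /= /ltW zq]; rewrite /wedge zq rpred0.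
- exists [set z | q.1 < z.1]; first exact: (open_near2 cont_fst).
  by apply: zc_mapc; apply: mapc_sub (@wedge_cont q) => z [].
have [h2|h2|h2] := ltgtP p.2 q.2.
- exists [set z | q.1 - q.2 < z.2 * (-1) + z.1 * (-1) + (q.1 + q.1)]; last first.
    by apply: zc_int => z [_ /= hz]; apply: wedge_bot; slra.
  apply: (open_near2 (f := fun z : R * R => z.2 * (-1) + z.1 * (-1) + (q.1 + q.1))); last by rewrite h; slra.
  apply: mapcT; apply: mapcD; last exact: mapc_cst.
  by apply: mapcD; (apply: mapcM; last exact: mapc_cst); [exact: mapc_snd|exact: mapc_fst].
- exists [set z | q.2 - q.1 < z.2 + z.1 * (-1)]; last first.
    by apply: zc_int => z [_ /= hz]; apply: wedge_top; slra.
  apply: (open_near2 (f := fun z : R * R => z.2 + z.1 * (-1))); last by rewrite h; slra.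
  by apply: mapcT; apply: mapcD; [exact: mapc_snd|apply: mapcM; [exact: mapc_fst|exact: mapc_cst]].
- by exfalso; apply: pq; case: p q h h2 => ? ? [? ?] /= -> ->.
Qed.

Lemma sn_pos_half (t : R) : 0 <= t < 1 -> (0 < sn t -> 0 < t < 1/2) /\ (sn t < 0 -> 1/2 < t).
Proof.
move=> ht.
have pos (u : R) : 0 <= u <= 1/2 -> 0 <= sn u.
  move=> hu; rewrite /sn; apply: sin_ge0_pi; have := pi_gt0 R.
  have h0 : pi *+ 2 = 2 * pi :> R by rewrite mulr_natl.
  by rewrite h0; snra.
have shift (u : R) : sn u = - sn (u - 1/2) by rewrite snB cs_half sn_half; ring.
split=> h; last first.
  by rewrite ltNge; apply/negP => t2; have := pos t; slra.
apply/andP; split.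
  by rewrite lt_neqAle; have /andP[-> _] := ht; rewrite andbT; apply/eqP => t0; move: h; rewrite -t0 sn0 ltxx.
by rewrite ltNge; apply/negP => t2; have := shift t; have := pos (t - 1/2); slra.
Qed.

(** The difference of the wedge and of the argument is never an integer, hence
    it lifts: the wedge winds once around its vertex. *)
Lemma wedge_lift q : exists h, islift [set p | p <> q] (fun p => wedge q p - argq q p) h.
Proof.
have zz : zc [set p | p <> q] (fun p => wedge q p - argq q p - 1/2).
  apply: zcB; last by apply: zc_mapc; exact: mapc_cst.
  by apply: zcB; [exact: wedge_zc|exact: argq_zc].
have [|hc hi] := zc_rnd zz; last first.
  exists (fun p => rnd (wedge q p - argq q p - 1/2) + 1/2); split.
    by apply: mapcD hc _; exact: mapc_cst.
  by move=> p pq; rewrite opprD addrA addrAC; exact: hi.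
move=> p pq /=; rewrite subrK => /int_small.
have a01 := argq_bound pq; have r0 := radq_gt0 pq.
have [_ xe ye] := argP (subq0 pq); rewrite -/(argq q p) -/(radq q p) in xe ye.
have [s1 s2] := sn_pos_half a01.
rewrite /wedge; case: (leP p.1 q.1) => h1.
  have [a0|an] := eqVneq (argq q p) 0.
    by have [h2 _] := arg_eq0 (subq0 pq) a0; slra.
  rewrite sub0r normrN ger0_norm; last by slra.
  by move=> h; have := h ltac:(slra) => /eqP; rewrite oppr_eq0 (negbTE an).
have cb := clamp_bound ((p.2 - q.2) / (p.1 - q.1) + 1/2).
have [h2|h2|h2] := ltgtP (p.2 - q.2) 0.
- have sl : sn (argq q p) < 0 by rewrite -(pmulr_rlt0 _ r0) -ye.
  have al := s2 sl; have le2 : clamp ((p.2 - q.2) / (p.1 - q.1) + 1/2) <= 1/2.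
    have h3 : (p.2 - q.2) / (p.1 - q.1) <= 0 by rewrite ler_pdivrMr; slra.
    by rewrite /clamp ge_max ge_min; apply/andP; split; [slra|apply/orP; right; slra].
  by rewrite ltr_norml => h; have := h ltac:(slra); slra.
- have sl : 0 < sn (argq q p) by rewrite -(pmulr_rgt0 _ r0) -ye.
  have al := s1 sl; have le2 : 1/2 <= clamp ((p.2 - q.2) / (p.1 - q.1) + 1/2).
    have h3 : 0 <= (p.2 - q.2) / (p.1 - q.1) by rewrite divr_ge0; slra.
    by rewrite /clamp le_max le_min; apply/orP; right; apply/andP; split; slra.
  by rewrite ltr_norml => h; have := h ltac:(slra); slra.
- rewrite /argq h2 (@arg_pos _ (p.1 - q.1) 0) //; last by slra.
  rewrite mul0r add0r clamp_mid; last by slra.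
  by rewrite subr0 ger0_norm; [move=> h; have := h ltac:(slra); slra|slra].
Qed.

Lemma wedge_pres q (z : int) : pres (fun p => z%:~R * wedge q p) q z.
Proof.
have [h hl] := wedge_lift q; exists 1 => //; exists (fun p => z%:~R * h p).
have sub : pdisc q 1 `<=` [set p | p <> q] by move=> p [].
split; first by apply: mapcM; [exact: mapc_cst|exact: mapc_sub hl.1].
move=> p [pq _]; rewrite -!mulrBr; zit ltac:(exact: hl.2).
Qed.

Lemma wedge_pres0 q q' (z : int) : q' <> q -> pres (fun p => z%:~R * wedge q p) q' 0.
Proof.
move=> h; apply: (pres0 (W := [set p | p <> q])); last exact: zcMz (@wedge_zc q).
have r0 := radq_gt0 h.
by apply: filterS (open_near2 (@radq_cont _ q) r0) => p /= + pq; rewrite pq radqq ltxx.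
Qed.

Lemma pres_lift (f g : R * R -> R) q : pres (fun p => f p - g p) q 0 ->
  exists2 r : R, 0 < r & exists h, islift (pdisc q r) (fun p => f p - g p) h.
Proof.
move=> [r r0 [h hl]]; exists r => //; exists h; split; first exact: hl.1.
by move=> p hp; have := hl.2 p hp; rewrite mul0r subr0.
Qed.

Lemma pres_sub (f g : R * R -> R) q m n k : k = m - n ->
  pres f q m -> pres g q n -> pres (fun p => f p - g p) q k.
Proof. by move=> -> h1 /presN h2; exact: presD. Qed.

(** By induction on the number of singularities.  A singularity q of residue
    n is removed by subtracting n times the wedge at q, which changes neither
    the integrality on the three sides nor the other residues, and which
    contributes exactly n to the variation along the right side.  Without
    singularity the function lifts on the rectangle. *)
Lemma planar_residue (a c d : R) (n : R * R -> int) : a < 0 -> c < d ->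
  forall (E : seq (R * R)) (f : R * R -> R), uniq E ->
  (forall q, q \in E -> [/\ a < q.1, q.1 < 0, c < q.2 + q.1 & q.2 - q.1 < d]) ->
  zc (rect a 0 c d `\` [set` E]) f -> (forall q, q \in E -> pres f q (n q)) ->
  (forall p, rect a 0 c d p -> p.1 = a \/ p.2 = c \/ p.2 = d -> isint (f p)) ->
  zvar c d (fun y => f (0, y)) = (\sum_(q <- E) n q)%:~R.
Proof.
move=> a0 cd; elim=> [|q E IH] f.
  move=> _ _ fz _ fs; rewrite big_nil mulr0z.
  have fz' : zc (rect a 0 c d) f by apply: zc_sub fz => p hp; split=> //; rewrite /= in_nil.
  have := zvar_rect (ltW a0) (ltW cd) fz'.
  rewrite (@zvar_int0 _ c d (fun y => f (a, y))) ?(ltW cd) //; last first.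
    by move=> y hy; apply: fs; [split => //=; slra|left].
  rewrite (@zvar_int0 _ a 0 (fun y => f (y, c))) ?(ltW a0) //; last first.
    by move=> y hy; apply: fs; [split => //=; slra|right; left].
  rewrite (@zvar_int0 _ a 0 (fun y => f (y, d))) ?(ltW a0) //; last first.
    by move=> y hy; apply: fs; [split => //=; slra|right; right].
  slra.
move=> /= /andP[qE uE] hE fz fp fs.
have [qa q0 qc qd] := hE q (mem_head _ _).
pose w p := (n q)%:~R * wedge q p.
have [|r r0 [h hl]] := @pres_lift f w q.
  by apply: (pres_sub (m := n q) (n := n q)); [rewrite subrr|exact: fp (mem_head _ _)|exact: wedge_pres].
have [r' [r'0 r'r r'q r'E]] : exists r' : R, [/\ 0 < r', r' <= r,
    (forall p, radq q p < r' -> [/\ a < p.1, p.1 < 0, c < p.2 & p.2 < d]) &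
    forall q', q' \in E -> r' <= radq q q'].
  have [s s0 hs] : exists2 s : R, 0 < s & forall q', q' \in E -> s <= radq q q'.
    elim: (E) qE => [|e E' IHE] hq; first by exists 1.
    move: hq; rewrite inE negb_or => /andP[/eqP qe /IHE[s s0 hs]].
    have e0 : 0 < radq q e by apply: radq_gt0 => ee; apply: qe.
    exists (Num.min s (radq q e)); first by rewrite lt_min s0.
    by move=> q'; rewrite inE => /orP[/eqP ->|/hs ?]; rewrite ge_min ?lexx ?orbT // ; apply/orP; left.
  pose t := Num.min (Num.min (q.1 - a) (- q.1)) (Num.min (q.2 - c) (d - q.2)).
  exists (Num.min (Num.min r s) t); split.
  - by rewrite !lt_min r0 s0 /=; slra.
  - by rewrite !ge_min lexx.
  - move=> p; rewrite !lt_min => /and3P[/andP[_ _] /andP[t1 t2] /andP[t3 t4]].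
    by have [] := radq_ge p q; rewrite !ler_norml => *; split; slra.
  - by move=> q' /hs h'; rewrite !ge_min h' orbT.
(* near q, f - w differs from its lift h by integers; the bump makes the
   difference with h disappear away from q *)
pose bump p := clamp (2 - 3 * (radq q p / r')).
have bump1 p : radq q p < r' / 3 -> bump p = 1.
  move=> hp; apply: clamp_ge1; have : radq q p / r' < 1/3 by rewrite ltr_pdivrMr; slra.
  slra.
have bump0 p : r' * (2/3) <= radq q p -> bump p = 0.
  move=> hp; apply: clamp_le0; have : 2/3 <= radq q p / r' by rewrite ler_pdivlMr; slra.
  slra.
have bumpc : continuous bump.
  apply: mapcT; apply: mapc_clamp; apply: mapcB; first exact: mapc_cst.
  apply: mapcM; first exact: mapc_cst.
  by apply: mapcM; [apply: mapc_cont; exact: radq_cont|exact: mapc_cst].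
pose g p := if p == q then 0 else f p - w p - bump p * h p.
have gout p : r' * (2/3) <= radq q p -> g p = f p - w p.
  rewrite /g; case: eqP => [->|_]; first by rewrite radqq; slra.
  by move=> /bump0 ->; rewrite mul0r subr0.
have gin p : radq q p < r' / 3 -> isint (g p).
  move=> hp; rewrite /g; case: eqP => [_|pq]; first exact: rpred0.
  rewrite bump1 // mul1r; apply: hl.2; split=> //; slra.
have wz : zc [set p | p <> q] w by apply: zcMz; exact: wedge_zc.
have side p : rect a 0 c d p -> p.1 = a \/ p.2 = c \/ p.2 = d -> r' <= radq q p.
  move=> hp hs; rewrite leNgt; apply/negP => /r'q[]; slra.
have wside p : rect a 0 c d p -> p.1 = a \/ p.2 = c \/ p.2 = d -> isint (w p).
  move=> [hp1 hp2] hs; apply: isintM; first exact: intr_int.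
  case: hs => [e|[e|e]].
  - by rewrite /wedge ifT ?rpred0 // e ltW.
  - by apply: wedge_bot; slra.
  - by apply: wedge_top; slra.
have gz : zc (rect a 0 c d `\` [set` E]) g.
  apply: zc_local => p [hp pE].
  have [pr|pr] := ltP (radq q p) (r' / 3).
    exists [set z | radq q z < r' / 3]; first exact: open_near (@radq_cont _ q) pr.
    by apply: zc_int => z [_ /= /gin].
  have pq : p <> q by move=> e; move: pr; rewrite e radqq; slra.
  have nE z : z <> q -> ~ [set` E] z -> ~ [set` q :: E] z.
    by move=> zq zE; rewrite /= inE => /orP[/eqP|].
  have [pr2|pr2] := ltP (radq q p) r'.
    exists [set z | r' / 4 < radq q z /\ radq q z < r'].
      apply: filterI; first by apply: (open_near2 (@radq_cont _ q)); slra.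
      exact: (open_near (@radq_cont _ q)).
    have zq z : r' / 4 < radq q z -> z <> q by move=> + e; rewrite e radqq; slra.
    apply: (zc_congr (f := fun p => f p - w p - bump p * h p)).
      by move=> z [_ /= [/zq z1 _]]; rewrite /g; case: eqP => // _; rewrite subrr rpred0.
    apply: zcB; first apply: zcB.
    - by apply: zc_sub fz => z [[z1 z2] /= [/zq z3 _]]; split => //; exact: nE.
    - by apply: zc_sub wz => z [_ /= [/zq]].
    apply: zc_mapc; apply: mapcM; first exact: mapc_cont.
    by apply: mapc_sub hl.1 => z [_ /= [/zq z1 z2]]; split => //; slra.
  exists [set z | r' * (2/3) < radq q z]; first by apply: (open_near2 (@radq_cont _ q)); slra.
  have zq z : r' * (2/3) < radq q z -> z <> q by move=> + e; rewrite e radqq; slra.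
  apply: (zc_congr (f := fun p => f p - w p)).
    by move=> z [_ /= /ltW z1]; rewrite gout // subrr rpred0.
  apply: zcB.
    by apply: zc_sub fz => z [[z1 z2] /= /zq z3]; split => //; exact: nE.
  by apply: zc_sub wz => z [_ /= /zq].
have := IH g uE _ gz _ _.
rewrite big_cons intrD => <-.
- have e : zvar c d (fun y => g (0, y)) = zvar c d (fun y => f (0, y) - w (0, y)).
    apply: zvar_congr => y hy; rewrite gout ?subrr ?rpred0 //.
    apply: (@le_trans _ _ r'); first slra.
    by rewrite leNgt; apply/negP => /r'q[_ /=]; rewrite ltxx.
  rewrite e.
  have zw : mapc (itv c d) (fun y => wedge q (0, y)).
    by apply: (mapc_comp (B := [set p | q.1 < p.1]) _ (@mapc_ver R _ 0) (@wedge_cont q)).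
  have zf : zc (itv c d) (fun y => f (0, y)).
    apply: (zc_comp (g := fun y => (0, y)) _ (@mapc_ver R _ 0) fz) => y hy; split.
      by split => //=; slra.
    by rewrite /= => /hE[] /=; slra.
  have zw2 : mapc (itv c d) (fun y => w (0, y)) by apply: mapcM => //; exact: mapc_cst.
  rewrite (zvarD (ltW cd) zf (zcN (zc_mapc zw2))) (zvarN (ltW cd) (zc_mapc zw2)) (zvar_cont (ltW cd) zw2).
  rewrite /w /wedge /= leNgt q0 /= clamp_ge1; last first.
    by rewrite -lerBlDr ler_pdivlMr; slra.
  rewrite clamp_le0; last by rewrite -lerBrDr ler_pdivrMr; slra.
  by rewrite mulr0 subr0 mulr1; slra.
- by move=> q' q'E; apply: hE; rewrite inE q'E orbT.
- move=> q' q'E; have q'q : q' <> q by move=> e; rewrite -e q'E in qE.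
  have hr := r'E q' q'E.
  apply: (pres_near (f := fun p => f p - w p)); last first.
    apply: (pres_sub (m := n q') (n := 0)); [by rewrite subr0| |exact: wedge_pres0].
    by apply: fp; rewrite inE q'E orbT.
  have hr2 : r' * (2/3) < radq q q' by slra.
  by apply: filterS (open_near2 (@radq_cont _ q) hr2) => p /= /ltW /gout -> _; rewrite subrr rpred0.
- move=> p hp hs; rewrite gout; last by have := side p hp hs; slra.
  by apply: rpredB; [exact: fs|exact: wside].
Qed.

End PlanarResidue.

(** * Cutting off a circle-valued function along a circle *)

Section PlanarCut.
Variable R : realType.
Implicit Types (f g : R * R -> R) (p q o : R * R).

Lemma zc_closedU_rel (T : topologicalType) (A B D : set T) (f : T -> R) : closed A -> closed B ->
  zc (A `&` D) f -> zc (B `&` D) f -> zc ((A `|` B) `&` D) f.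
Proof.
move=> cA cB fA fB x [ABx Dx] e e0.
have key (C : set T) : closed C -> zc (C `&` D) f ->
    \forall y \near x, C y -> D y -> znear e (f y - f x).
  move=> cC fC; have [Cx|nCx] := pselect (C x).
    by apply: filterS (fC x (conj Cx Dx) e e0) => y hy Cy Dy; exact: hy.
  have : nbhs x (~` C) by apply: open_nbhs_nbhs; split=> //; exact: closed_openC.
  by apply: filterS => y nCy /nCy.
by apply: filterS2 (key A cA fA) (key B cB fB) => y h1 h2 [[/h1 h|/h2 h] /h].
Qed.

Lemma closed_le_cont (T : topologicalType) (h : T -> R) c : continuous h -> closed [set x | h x <= c].
Proof. by move=> hc; exact: (closed_comp (fun x _ => hc x) (@closed_le _ c)). Qed.

Lemma closed_ge_cont (T : topologicalType) (h : T -> R) c : continuous h -> closed [set x | c <= h x].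
Proof. by move=> hc; exact: (closed_comp (fun x _ => hc x) (@closed_ge _ c)). Qed.

Section Cut.
Variables (o : R * R) (f : R * R -> R) (r1 r2 : R) (N : nat).
Hypotheses (r10 : 0 < r1) (r12 : r1 < r2) (N0 : (0 < N)%N).
Variable H : R * R -> R.

Let rng := [set p | r1 <= radq o p /\ radq o p <= r2].
Let mu (r : R) := (r - r1) / (r2 - r1).
Let rho (m : R) := r1 + m * (r2 - r1).
Let G p := f (ptq o (p.1, rho p.2)).
Hypothesis Hl : islift (rect 0 1 0 1) G H.

Let nd (i : nat) : R := i%:R / N%:R.
Let md (i : nat) : R := (i%:R + 1/2) / N%:R.
Let rd (x : R) := x - rnd x.
Let k (i : nat) : R := rd (H (nd i, 0)).

Let NR0 : 0 < N%:R :> R. Proof. by rewrite ltr0n. Qed.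

Let rdi x : isint (rd x). Proof. exact: rnd_int. Qed.

Let rd_int x : isint x -> rd x = x.
Proof. by move=> h; rewrite /rd (@rnd_unique R x 0) ?subr0 //; lra. Qed.

Let rd_add x z : isint z -> rd (x + z) = rd x + z.
Proof.
move=> h; rewrite /rd (@rnd_unique R (x + z) (rnd x)) ?rnd_bound //; first by ring.
by rewrite addrAC; apply: isintD => //; exact: rnd_int.
Qed.

(** The step at the middle of the i-th cell, smoothed over a width that shrinks
    with the second coordinate; it is discontinuous only at the point (md i, 0). *)
Definition stp (i : nat) (p : R * R) : R :=
  if p.2 <= 0 then (if md i < p.1 then 1 else 0) else clamp (N%:R * (p.1 - md i) / p.2 + 1/2).

Let mdE i : N%:R * md i = i%:R + 1/2.
Proof. by rewrite /md mulrC divfK // gt_eqF. Qed.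

Let ndE i : N%:R * nd i = i%:R.
Proof. by rewrite /nd mulrC divfK // gt_eqF. Qed.

Let leN (a b : R) : (N%:R * a <= N%:R * b) = (a <= b).
Proof. by rewrite ler_pM2l. Qed.
Let ltN (a b : R) : (N%:R * a < N%:R * b) = (a < b).
Proof. by rewrite ltr_pM2l. Qed.

Lemma stp0 i p : p.2 <= 1 -> p.1 <= nd i -> stp i p = 0.
Proof.
move=> p1; rewrite -leN ndE => h; rewrite /stp; case: (leP p.2 0) => h2.
  by rewrite ltNge -leN mdE; have -> : N%:R * p.1 <= i%:R + 1/2 by lra.
apply: clamp_le0; rewrite -lerBrDr ler_pdivrMr // mulrBr mdE; nra.
Qed.

Lemma stp1 i p : p.2 <= 1 -> nd i.+1 <= p.1 -> stp i p = 1.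
Proof.
move=> p1; rewrite -leN ndE -natr1 => h; rewrite /stp; case: (leP p.2 0) => h2.
  by rewrite -ltN mdE; have -> : i%:R + 1/2 < N%:R * p.1 by lra.
apply: clamp_ge1; rewrite -lerBlDr ler_pdivlMr // mulrBr mdE; nra.
Qed.

Lemma stp_int i t : isint (stp i (t, 0)).
Proof. by rewrite /stp /= lexx; case: (_ < _); [exact: rpred1|exact: rpred0]. Qed.

Lemma stp_cont i : mapc [set p : R * R | 0 <= p.2 /\ p <> (md i, 0)] (stp i).
Proof.
apply: mapc_local => -[t m] [/= m0 np].
have [mp|mn] := ltP 0 m.
  exists [set p : R * R | 0 < p.2]; first exact: (open_near2 (@cont_snd R)).
  pose c := @clamp R \o (fun p : R * R => N%:R * (p.1 - md i) * p.2^-1 + 1/2).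
  have hh p : ([set p : R * R | 0 <= p.2 /\ p <> (md i, 0)] `&` [set p : R * R | 0 < p.2]) p -> c p = stp i p.
    by move=> [_ /= h]; rewrite /stp leNgt h.
  apply: (mapc_eq hh); rewrite /c; apply: mapc_clamp; apply: mapcD; last exact: mapc_cst.
  apply: mapcM; last by apply: mapcV; [exact: mapc_snd|move=> p [_ /= /gt_eqF ->]].
  by apply: mapcM; [exact: mapc_cst|apply: mapcB; [exact: mapc_fst|exact: mapc_cst]].
have mz : m = 0 by lra.
have lin (a b : R) : continuous (fun p : R * R => a * p.1 + b * p.2).
  by apply: mapcT; apply: mapcD; (apply: mapcM; first exact: mapc_cst); [exact: mapc_fst|exact: mapc_snd].
have [h|h|h] := ltgtP t (md i).
- exists [set p : R * R | N%:R * p.1 + (1/2) * p.2 < N%:R * md i].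
    by apply: (open_near (lin _ _)); rewrite /= mz mulr0 addr0 ltN.
  apply: (mapc_eq (f := fun=> 0)); last exact: mapc_cst.
  move=> p [[/= p0 _] hp]; rewrite /stp; case: (leP p.2 0) => h2.
    by rewrite ltNge -leN; have -> : N%:R * p.1 <= N%:R * md i by lra.
  by rewrite clamp_le0 // -lerBrDr ler_pdivrMr // mulrBr; lra.
- exists [set p : R * R | N%:R * md i < N%:R * p.1 + (-(1/2)) * p.2].
    by apply: (open_near2 (lin _ _)); rewrite /= mz mulr0 addr0 ltN.
  apply: (mapc_eq (f := fun=> 1 : R)); last exact: mapc_cst.
  move=> p [[/= p0 _] hp]; rewrite /stp; case: (leP p.2 0) => h2.
    by rewrite -ltN; have -> : N%:R * md i < N%:R * p.1 by lra.
  by rewrite clamp_ge1 // -lerBlDr ler_pdivlMr // mulrBr; lra.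
- by exfalso; apply: np; rewrite h mz.
Qed.

(** An interpolation, by steps, of the nearest integers to the lift H at the
    subdivision points of the inner circle. *)
Definition kap (p : R * R) : R := k 0 + \sum_(0 <= i < N) (k i.+1 - k i) * stp i p.

(** On the inner circle (second coordinate 0) this is H up to integers, and on the
    outer one (second coordinate 1) it vanishes. *)
Definition ringf (p : R * R) : R := (1 - p.2) * (H p - kap p).

Lemma mapc_sum (T : topologicalType) (A : set T) (F : nat -> T -> R) s :
  (forall i, i \in s -> mapc A (F i)) -> mapc A (fun x => \sum_(i <- s) F i x).
Proof.
elim: s => [|i s IH] h.
  by apply: (mapc_eq (f := fun=> 0)); [move=> x _; rewrite big_nil|exact: mapc_cst].
apply: (mapc_eq (f := fun x => F i x + \sum_(i <- s) F i x)).
  by move=> x _; rewrite big_cons.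
apply: mapcD; first by apply: h; rewrite mem_head.
by apply: IH => j js; apply: h; rewrite inE js orbT.
Qed.

Definition bad : set (R * R) := [set p | exists2 i, (i < N)%N & p = (md i, 0)].

Lemma ringf_cont : mapc (rect 0 1 0 1 `\` bad) ringf.
Proof.
have sub : rect 0 1 0 1 `\` bad `<=` rect 0 1 0 1 by move=> ? [].
apply: mapcM; first by apply: mapcB; [exact: mapc_cst|exact: mapc_snd].
apply: mapcB; first exact: mapc_sub Hl.1.
apply: mapcD; first exact: mapc_cst.
apply: mapc_sum => i; rewrite mem_index_iota => /andP[_ iN].
apply: mapcM; first exact: mapc_cst.
apply: mapc_sub (@stp_cont i) => p [[_ /andP[p0 _]] nb]; split=> // e.
by apply: nb; exists i.
Qed.

Lemma H01 m : 0 <= m <= 1 -> H (1, m) - H (0, m) = H (1, 0) - H (0, 0) /\ isint (H (1, m) - H (0, m)).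
Proof.
have hi y : itv 0 1 y -> isint (H (1, y) - H (0, y)).
  move=> hy; have r1' : rect 0 1 0 1 (1, y) by split=> //=; lra.
  have r0' : rect 0 1 0 1 (0, y) by split=> //=; lra.
  rewrite (_ : _ - _ = (G (0, y) - H (0, y)) - (G (1, y) - H (1, y))).
    by zit ltac:(exact: Hl.2).
  by rewrite /G /= ptq1; ring.
move=> hm; split; last exact: hi.
apply: (connected_int (k := fun y => H (1, y) - H (0, y)) (@connected_itv R 0 1)) => //.
  apply: mapcB; apply: (mapc_comp (B := rect 0 1 0 1) _ _ Hl.1); try exact: mapc_ver.
    by move=> y hy; split=> //=; lra.
  by move=> y hy; split=> //=; lra.
by rewrite /itv /=; lra.
Qed.

(** H and kap gain the same integer over one turn. *)
Lemma ringf01 m : 0 <= m <= 1 -> ringf (0, m) = ringf (1, m).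
Proof.
move=> hm; have [e1 _] := H01 hm.
have z01 : 0 <= (0 : R) <= 1 by rewrite lexx ler01.
have [_ i0] := H01 z01.
rewrite /ringf /=; congr (_ * _).
have k0 : kap (0, m) = k 0.
  rewrite /kap big1_seq ?addr0 // => i /andP[_]; rewrite mem_index_iota => /andP[_ iN].
  by rewrite stp0 ?mulr0 //=; [lra|rewrite -leN ndE mulr0].
have k1 : kap (1, m) = k N.
  rewrite /kap big_nat (eq_bigr (fun i => k i.+1 - k i)).
    by rewrite -big_nat telescope_sumr // subrKC.
  move=> i iN; rewrite stp1 ?mulr1 //=; first lra.
  by rewrite -leN ndE mulr1 ler_nat.
rewrite k0 k1 /k /nd divff ?gt_eqF // mul0r.
have -> : H (1, 0) = H (0, 0) + (H (1, 0) - H (0, 0)) by ring.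
by rewrite rd_add //; lra.
Qed.

(** The values on a ring free of singularities suffice to interpolate between f
    inside and 0 outside, at the cost of the new singularities cutJ. *)
Definition cutf p : R :=
  if radq o p <= r1 then f p else if r2 <= radq o p then 0
  else ringf (argq o p, mu (radq o p)).

Definition cutJ : seq (R * R) := undup [seq ptq o (md i, r1) | i <- iota 0 N].

Let mu01 r : r1 <= r -> r <= r2 -> 0 <= mu r <= 1.
Proof.
by move=> h1 h2; have h12 := r12; rewrite /mu divr_ge0 ?ler_pdivrMr /=; lra.
Qed.

Let muK r : rho (mu r) = r.
Proof. by rewrite /rho /mu divfK ?subrKC // gt_eqF // subr_gt0. Qed.

Let pto p : r1 <= radq o p -> p <> o.
Proof. by move=> + e; have h10 := r10; rewrite e radqq; lra. Qed.

Lemma ringf_polar_cont :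
  mapc (rng `\` [set` cutJ]) (fun p => ringf (argq o p, mu (radq o p))).
Proof.
pose B := [set p : R * R | rect 0 1 0 1 (p.1, mu p.2) /\ ~ bad (p.1, mu p.2)].
apply: (polar_contq (B := B) (K := fun p => ringf (p.1, mu p.2))).
- apply: (mapc_comp (f := fun p => (p.1, mu p.2)) _ _ ringf_cont) => //.
  apply: mapc_pair; first exact: mapc_fst.
  by apply: mapcM; [apply: mapcB; [exact: mapc_snd|exact: mapc_cst]|exact: mapc_cst].
- by move=> r [[_ h] _] _; exact: ringf01.
move=> p [[p1 p2] pJ]; have pn := pto p1; have ab := argq_bound pn.
split=> //.
- split; first by split; [rewrite /=; lra|exact: mu01].
  move=> [i iN [ae m0]]; apply: pJ; rewrite /= mem_undup; apply/mapP; exists i; first by rewrite mem_iota.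
  by rewrite -[LHS](ptqK pn) ae -(muK (radq o p)) m0 /rho mul0r addr0.
- move=> _; split; first by split; [rewrite /=; lra|exact: mu01].
  move=> [i iN [] /= e _]; have : N%:R * md i = N%:R * 1 by rewrite e.
  rewrite mdE mulr1 => e2; have : (i.+1 <= N)%N by [].
  by rewrite -(ler_nat R) -natr1; lra.
Qed.

Lemma cutf_zc (D : set (R * R)) : zc ([set p | radq o p <= r1] `&` D) f -> zc (D `\` [set` cutJ]) cutf.
Proof.
move=> fz.
have c1 := closed_le_cont (c := r1) (@radq_cont R o).
have c2 := closed_ge_cont (c := r1) (@radq_cont R o).
have c3 := closed_le_cont (c := r2) (@radq_cont R o).
have c4 := closed_ge_cont (c := r2) (@radq_cont R o).
have cr : closed rng by apply: closedI.
pose D' := D `\` [set` cutJ].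
have z1 : zc ([set p | radq o p <= r1] `&` D') cutf.
  apply: (zc_congr (f := f)) => [p [/= h _]|]; first by rewrite /cutf h subrr rpred0.
  by apply: zc_sub fz => p [h [h1 _]].
have z2 : zc (rng `&` D') cutf.
  apply: (zc_congr (f := fun p => ringf (argq o p, mu (radq o p)))); last first.
    by apply: zc_mapc; apply: mapc_sub ringf_polar_cont => p [h [h1 h2]].
  move=> p [[p1 p2] _]; rewrite /cutf; have pn := pto p1; have ab := argq_bound pn.
  case: (leP (radq o p) r1) => h1.
    have e1 : radq o p = r1 by lra.
    rewrite e1 /mu subrr mul0r /ringf subr0 mul1r.
    rewrite (_ : _ - _ = kap (argq o p, 0) + (f p - H (argq o p, 0))); last by rewrite /=; ring.
    apply: isintD.
      rewrite /kap; apply: isintD; first exact: rdi.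
      apply: rpred_sum => i _; apply: isintM; last exact: stp_int.
      by apply: isintD; [exact: rdi|apply: isintN; exact: rdi].
    rewrite (_ : f p = G (argq o p, 0)); last by rewrite /G /rho /= mul0r addr0 -e1 ptqK.
    by apply: Hl.2; split; rewrite /=; lra.
  case: (leP r2 (radq o p)) => h2; last by rewrite subrr rpred0.
  have -> : radq o p = r2 by lra.
  by rewrite /mu divff ?gt_eqF ?subr_gt0 // /ringf subrr mul0r subrr rpred0.
have z3 : zc ([set p | r2 <= radq o p] `&` D') cutf.
  apply: zc_int => p [/= h _]; rewrite /cutf h.
  have h12 := r12.
  by have -> : (radq o p <= r1) = false by apply/negbTE; rewrite -ltNge; lra.
have c12 : closed ([set p | radq o p <= r1] `|` rng) by exact: closedU.
have := zc_closedU_rel c12 c4 (zc_closedU_rel c1 cr z1 z2) z3.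
apply: zc_sub => p hp; split=> //.
have [h|h] := leP (radq o p) r1; first by left; left.
have [h2|h2] := leP r2 (radq o p); first by right.
by left; right; split; exact: ltW.
Qed.

Lemma cutJ_rad q : q \in cutJ -> radq o q = r1.
Proof.
by rewrite mem_undup => /mapP[i _ ->]; rewrite radq_ptq // /= ltW.
Qed.

(** With 4 dividing N, no middle of a cell is a quarter turn: the new
    singularities avoid the vertical line through the centre, which is the
    boundary line when the centre is a boundary point. *)
Lemma cutJ_x q : (4 %| N)%N -> q \in cutJ -> q.1 != o.1.
Proof.
move=> /dvdnP[m Nm]; rewrite mem_undup => /mapP[i _ ->] /=.
rewrite -subr_eq0 addrAC subrr add0r mulf_eq0 gt_eqF //=; apply/eqP => c0.
have s2 := cs2sn2 (md i).
have c1 : cs (md i - (1/2 - md i)) = 1.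
  rewrite csB csB snB cs_half sn_half c0; rewrite c0 in s2; nra.
have /intrP[z hz] := cs_eq1 c1.
have : N%:R * (md i - (1/2 - md i)) = N%:R * z%:~R by rewrite hz.
rewrite mulrBr mulrBr !mdE Nm natrM => e.
have e2 : (2 * i%:R + 1 : R) = 2 * m%:R + 4 * (m%:R * z%:~R) by lra.
have e3 : ((2 * i%:Z + 1)%:~R : R) = (2 * m%:Z + 4 * (m%:Z * z))%:~R.
  by rewrite !(intrD, intrM, mulrz_nat).
by have := intr_inj e3; lia.
Qed.

(** Where f is integer-valued over a whole cell around p, the lift is constant on
    the cell and kap agrees with it. *)
Lemma cutf_int p : rng p ->
  (forall s m, `|s - argq o p| <= 1 / N%:R -> 0 <= m <= 1 -> isint (f (ptq o (s, rho m)))) ->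
  isint (cutf p).
Proof.
move=> [p1 p2] hf; have pn := pto p1; have ab := argq_bound pn.
have fp : isint (f p).
  rewrite -[p](ptqK pn) -(muK (radq o p)); apply: hf; last exact: mu01.
  by rewrite subrr normr0 divr_ge0 // ltW.
rewrite /cutf; case: (leP (radq o p) r1) => h1 //.
case: (leP r2 (radq o p)) => h2; first exact: rpred0.
set t := argq o p in hf ab *; set m := mu _.
have hm : 0 <= m <= 1 by exact: mu01.
have nt0 : 0 <= N%:R * t by rewrite mulr_ge0 // ?(ltW NR0); lra.
set i := Num.truncn (N%:R * t).
have /andP[i1 i2] := truncn_itv nt0; rewrite -/i in i1 i2.
have iN : (i < N)%N.
  by rewrite -(ltr_nat R) (le_lt_trans i1) // -[X in _ < X]mulr1 ltN; lra.
have it : nd i <= t by rewrite -leN ndE.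
have ti : t < nd i.+1 by rewrite -ltN ndE.
have di : nd i.+1 - nd i = 1 / N%:R by rewrite /nd -natr1; ring.
pose C := rect (nd i) (nd i.+1) 0 1.
have n0 : 0 <= nd i by rewrite divr_ge0 // ltW.
have n1 : nd i.+1 <= 1 by rewrite -leN ndE mulr1 ler_nat.
have Cs : C `<=` rect 0 1 0 1 by move=> z [z1 z2]; split=> //; lra.
have Hi z : C z -> isint (H z).
  move=> Cz; have [z1 z2] := Cz.
  rewrite (_ : H z = G z - (G z - H z)); last by ring.
  apply: isintD; last by apply: isintN; apply: Hl.2; exact: Cs.
  by apply: hf => //; rewrite ler_norml; lra.
have Hc := connected_int (@connected_rect R _ _ _ _) (mapc_sub Cs Hl.1) Hi.
have C1 : C (t, m) by split=> //=; lra.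
have C2 : C (nd i, 0) by split=> //=; lra.
have C3 : C (nd i.+1, 0) by split=> //=; lra.
have ki : k i = H (t, m) by rewrite /k rd_int; [exact: Hc|exact: Hi].
have ki1 : k i.+1 = H (t, m) by rewrite /k rd_int; [exact: Hc|exact: Hi].
have : kap (t, m) = H (t, m).
  rewrite /kap (@big_cat_nat _ _ _ i 0%N N) ?(ltnW iN) //=.
  rewrite [X in _ + (_ + X)]big1_seq ?addr0; last first.
    move=> j /andP[_]; rewrite mem_index_iota => /andP[].
    rewrite leq_eqVlt => /orP[/eqP <- _|ij _]; first by rewrite ki ki1 subrr mul0r.
    rewrite stp0 ?mulr0 //=; first lra.
    by apply: (le_trans (ltW ti)); rewrite -leN !ndE ler_nat.
  rewrite big_nat (eq_bigr (fun i => k i.+1 - k i)); last first.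
    move=> j ji; rewrite stp1 ?mulr1 //=; first lra.
    by apply: le_trans it; rewrite -leN !ndE ler_nat.
  by rewrite -big_nat telescope_sumr // subrKC.
by rewrite /ringf => ->; rewrite subrr mulr0 rpred0.
Qed.

End Cut.

End PlanarCut.

(** * Circle-valued functions on surfaces with boundary *)

Section SurfaceData.
Variables (R : realType) (S : topologicalType).

Record hchart := HChart { hdom : set S; hfwd : S -> R * R; hinv : R * R -> S }.

Record hchart_ok (c : hchart) : Prop := {
  hopen : open (hdom c);
  himage : exists2 U, open U & hfwd c @` hdom c = U `&` [set p : R * R | p.1 <= 0];
  hcancel : forall x, hdom c x -> hinv c (hfwd c x) = x;
  hfwd_cont : mapc (hdom c) (hfwd c);
  hinv_cont : mapc (hfwd c @` hdom c) (hinv c) }.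

Definition himg (c : hchart) := hfwd c @` hdom c.

(** A compact surface with boundary, reduced to what residues and windings
    need: charts that rotate alike around interior points (s_turn) stand for the
    orientation, and the boundary circles, listed by g, climb in each chart
    (s_climb), which is their orientation as a boundary. *)
Record surface (Ch : set hchart) (bdry : set S) (m : nat) (g : nat -> R -> S) : Prop := {
  s_haus : hausdorff_space S;
  s_comp : compact [set: S];
  s_chart : forall c, Ch c -> hchart_ok c;
  s_cover : forall x, exists2 c, Ch c & hdom c x;
  s_bdry : forall c x, Ch c -> hdom c x -> (bdry x <-> (hfwd c x).1 = 0);
  s_turn : forall c c' q, Ch c -> Ch c' -> hdom c q -> hdom c' q -> ~ bdry q ->
    exists2 W, nbhs q W & exists h, islift (W `\ q)
      (fun y => argq (hfwd c' q) (hfwd c' y) - argq (hfwd c q) (hfwd c y)) h;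
  s_loop : forall i, (i < m)%N -> continuous (g i);
  s_loop1 : forall i s t, (i < m)%N -> (g i s = g i t <-> isint (s - t));
  s_loopb : forall i s, (i < m)%N -> bdry (g i s);
  s_disj : forall i j s t, (i < m)%N -> (j < m)%N -> g i s = g j t -> i = j;
  s_bcover : forall x, bdry x -> exists i s, (i < m)%N /\ g i s = x;
  s_climb : forall c i s, Ch c -> (i < m)%N -> hdom c (g i s) -> exists2 d : R, 0 < d &
    forall s', s < s' -> s' < s + d -> (hfwd c (g i s)).2 < (hfwd c (g i s')).2 }.

Variables (Ch : set hchart) (bdry : set S) (m : nat) (g : nat -> R -> S).
Implicit Types (b : S -> R) (q x y : S) (c : hchart) (n : int).
Hypothesis Sok : surface Ch bdry m g.

Lemma s_inj c x y : Ch c -> hdom c x -> hdom c y -> hfwd c x = hfwd c y -> x = y.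
Proof.
move=> /(s_chart Sok) ok cx cy e.
by rewrite -(hcancel ok cx) e (hcancel ok cy).
Qed.

Lemma himgK c p : Ch c -> himg c p -> hdom c (hinv c p) /\ hfwd c (hinv c p) = p.
Proof. by move=> /(s_chart Sok) ok [x cx <-]; rewrite (hcancel ok cx). Qed.

Lemma himg_le0 c p : Ch c -> himg c p -> p.1 <= 0.
Proof.
by move=> /(s_chart Sok) ok hp; have [U _ e] := himage ok; move: hp; rewrite /himg e => -[].
Qed.

Lemma himg_near c p : Ch c -> himg c p -> \forall p' \near p, p'.1 <= 0 -> himg c p'.
Proof.
move=> /(s_chart Sok) ok hp; have [U Uo e] := himage ok.
have : nbhs p U by apply: open_nbhs_nbhs; split=> //; move: hp; rewrite /himg e => -[].
by apply: filterS => p' Up' h; rewrite /himg e.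
Qed.

Lemma himg_near_int c p : Ch c -> himg c p -> p.1 < 0 -> nbhs p (himg c).
Proof.
move=> cC hp p0; apply: filterS2 (himg_near cC hp) (open_near (@cont_fst R) p0) => p' h1 h2.
by apply: h1; exact: ltW.
Qed.

Lemma hdom_nbhs c x : Ch c -> hdom c x -> nbhs x (hdom c).
Proof. by move=> /(s_chart Sok) ok cx; apply: open_nbhs_nbhs; split=> //; exact: hopen ok. Qed.

Lemma hfwd_int c x : Ch c -> hdom c x -> ~ bdry x -> (hfwd c x).1 < 0.
Proof.
move=> cC cx nb; rewrite lt_neqAle; apply/andP; split; last by apply: (himg_le0 cC); exists x.
by apply/eqP => h; apply: nb; apply/(s_bdry Sok cC cx).
Qed.

(** The residue of a circle-valued function on the surface, read in a chart. *)
Definition sres_in (c : hchart) (b : S -> R) (q : S) (n : int) : Prop :=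
  exists2 W, nbhs q W & exists h, islift (W `\ q)
    (fun y => b y - n%:~R * argq (hfwd c q) (hfwd c y)) h.

Definition sres (b : S -> R) (q : S) (n : int) : Prop := exists c, [/\ Ch c, hdom c q & sres_in c b q n].

(** The charts rotating alike, the residue does not depend on the chart. *)
Lemma sres_any c b q n : Ch c -> hdom c q -> ~ bdry q -> sres b q n -> sres_in c b q n.
Proof.
move=> cC cq nb [c' [cC' cq' [W hW [h hl]]]].
have [V hV [k kl]] := s_turn Sok cC' cC cq' cq nb.
exists (W `&` V); first exact: filterI.
have s1 : (W `&` V) `\ q `<=` W `\ q by move=> y [[]].
have s2 : (W `&` V) `\ q `<=` V `\ q by move=> y [[]].
exists (fun y => h y - n%:~R * k y); split.
  apply: mapcB; first exact: mapc_sub hl.1.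
  by apply: mapcM; [exact: mapc_cst|exact: mapc_sub kl.1].
move=> y hy; rewrite (_ : _ - _ = (b y - n%:~R * argq (hfwd c' q) (hfwd c' y) - h y) -
  n%:~R * (argq (hfwd c q) (hfwd c y) - argq (hfwd c' q) (hfwd c' y) - k y)); last by ring.
by zit ltac:(first [apply: hl.2; exact: s1|apply: kl.2; exact: s2]).
Qed.

Lemma sres_pres c b q n : Ch c -> hdom c q -> ~ bdry q -> sres b q n ->
  pres (b \o hinv c) (hfwd c q) n.
Proof.
move=> cC cq nb /(sres_any cC cq nb)[W hW [h hl]].
have cimg : himg c (hfwd c q) by exists q.
have hq := hcancel (s_chart Sok cC) cq.
have W' : nbhs (hinv c (hfwd c q)) (W `&` hdom c).
  by rewrite hq; apply: filterI => //; exact: hdom_nbhs.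
have n1 := hinv_cont (s_chart Sok cC) cimg W'.
have n2 := himg_near_int cC cimg (hfwd_int cC cq nb).
have /nbhs_ballP[d d0 hd] : nbhs (hfwd c q) ([set y | himg c y -> (W `&` hdom c) (hinv c y)] `&` himg c).
  exact: filterI.
have key p : pdisc (hfwd c q) d p -> himg c p /\ (W `\ q) (hinv c p).
  move=> [pq /pdisc_ball /hd[h1 h2]]; split=> //; have [h3 h4] := himgK cC h2.
  by split; [exact: (h1 h2).1|move=> e; apply: pq; rewrite -h4 e].
exists d => //; exists (h \o hinv c); split.
  apply: (mapc_comp _ _ hl.1); first by move=> p /key[].
  by apply: mapc_sub (hinv_cont (s_chart Sok cC)) => p /key[].
move=> p /key[h1 h2]; have [h3 h4] := himgK cC h1.
by have := hl.2 _ h2; rewrite /= h4.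
Qed.

Lemma pres_sres c (f : R * R -> R) b q n : Ch c -> hdom c q ->
  (\forall y \near q, y <> q -> isint (b y - f (hfwd c y))) ->
  pres f (hfwd c q) n -> sres b q n.
Proof.
move=> cC cq bf [r r0 [h hl]]; exists c; split=> //.
have n1 := hfwd_cont (s_chart Sok cC) cq (pdisc_nbhs (hfwd c q) r0).
have n2 := hdom_nbhs cC cq.
exists ([set y | hdom c y -> radq (hfwd c q) (hfwd c y) < r] `&` hdom c `&`
        [set y | y <> q -> isint (b y - f (hfwd c y))]).
  by apply: filterI => //; apply: filterI.
set W := _ `&` _.
have key y : (W `\ q) y -> [/\ hdom c y, pdisc (hfwd c q) r (hfwd c y) & isint (b y - f (hfwd c y))].
  move=> [[[h1 h2] h3] h4]; split=> //; last exact: h3.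
  by split; [move=> e; apply: h4; exact: s_inj e|exact: h1].
exists (h \o hfwd c); split.
  apply: (mapc_comp _ _ hl.1); first by move=> p /key[].
  by apply: mapc_sub (hfwd_cont (s_chart Sok cC)) => p /key[].
move=> y /key[h1 h2 h3] /=.
rewrite (_ : _ - _ = (b y - f (hfwd c y)) + (f (hfwd c y) - n%:~R * argq (hfwd c q) (hfwd c y) - h (hfwd c y))); last by ring.
by zit ltac:(exact: hl.2).
Qed.

Lemma sresD b b' q n n' : ~ bdry q -> sres b q n -> sres b' q n' ->
  sres (fun y => b y + b' y) q (n + n').
Proof.
move=> nb h1 h2; have [c [cC cq _]] := h1; exists c; split=> //.
have [W hW [h hl]] := sres_any cC cq nb h1; have [V hV [k kl]] := sres_any cC cq nb h2.
exists (W `&` V); first exact: filterI.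
have s1 : (W `&` V) `\ q `<=` W `\ q by move=> y [[]].
have s2 : (W `&` V) `\ q `<=` V `\ q by move=> y [[]].
exists (fun y => h y + k y); split.
  by apply: mapcD; [exact: mapc_sub hl.1|exact: mapc_sub kl.1].
move=> y hy; rewrite intrD (_ : _ - _ = (b y - n%:~R * argq (hfwd c q) (hfwd c y) - h y) +
  (b' y - n'%:~R * argq (hfwd c q) (hfwd c y) - k y)); last by ring.
by zit ltac:(first [apply: hl.2; exact: s1|apply: kl.2; exact: s2]).
Qed.

Lemma sresN b q n : sres b q n -> sres (fun y => - b y) q (- n).
Proof.
move=> [c [cC cq [W hW [h hl]]]]; exists c; split=> //; exists W => //.
exists (fun y => - h y); split; first exact: mapcN hl.1.
move=> y hy; rewrite mulrNz (_ : _ - _ = - (b y - n%:~R * argq (hfwd c q) (hfwd c y) - h y)); last by ring.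
by zit ltac:(exact: hl.2).
Qed.

Lemma sres0 b q (W : set S) : nbhs q W -> zc W b -> sres b q 0.
Proof.
move=> hW bz; have [c cC cq] := s_cover Sok q; exists c; split=> //.
have [V hV [h hl]] := zc_near_lift bz (nbhs_singleton hW).
exists (W `&` V); first exact: filterI.
exists h; split; first by apply: mapc_sub hl.1 => y [].
by move=> y [hy _]; rewrite mul0r subr0; exact: hl.2.
Qed.

Lemma sres_uniq b q n n' : ~ bdry q -> sres b q n -> sres b q n' -> n = n'.
Proof.
move=> nb h1 h2; have [c [cC cq _]] := h1.
by apply: (pres_uniq (sres_pres cC cq nb h1) (sres_pres cC cq nb h2)).
Qed.

(** Circle-valued functions with finitely many singularities, all of them in the
    interior: the objects of Stokes' theorem. *)
Record sing (b : S -> R) (L : seq S) (n : S -> int) : Prop := {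
  sing_uniq : uniq L;
  sing_int : forall q, q \in L -> ~ bdry q;
  sing_zc : zc (~` [set` L]) b;
  sing_res : forall q, q \in L -> sres b q (n q) }.

Lemma finite_far (L : seq S) q : q \notin L -> nbhs q (~` [set` L]).
Proof.
move=> qL; apply: open_nbhs_nbhs; split; last by apply/negP.
apply: closed_openC; have : compact [set` L] by exact: finite_compact.
exact: compact_closed (s_haus Sok).
Qed.

(** Points of residue 0 may be added to the list of singularities, so that two
    functions can be given the same list. *)
Lemma sing_extend b L (n : S -> int) L' : sing b L n -> uniq L' -> {subset L <= L'} ->
  (forall q, q \in L' -> ~ bdry q) ->
  let n' q := if q \in L then n q else 0 in
  sing b L' n' /\ \sum_(q <- L') n' q = \sum_(q <- L) n q.
Proof.
move=> [uL iL zL rL] uL' sub iL' n'; split; first split=> //.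
- by apply: zc_sub zL => y /= h1 h2; apply: h1; exact: sub.
- move=> q qL'; rewrite /n'; case: ifPn => [|qL]; first exact: rL.
  exact: sres0 (finite_far qL) zL.
rewrite /n' -big_mkcond /= -big_filter; apply: perm_big.
apply: uniq_perm => //; first exact: filter_uniq.
by move=> q; rewrite mem_filter; have [/sub ->|] := boolP (q \in L).
Qed.

(** The defect in Stokes' theorem; it is additive in b. *)
Definition total b (L : seq S) (n : S -> int) : R :=
  (\sum_(q <- L) n q)%:~R - \sum_(i < m) zvar 0 1 (b \o g i).

Lemma loop_zc b L (n : S -> int) i (A : set R) : sing b L n -> (i < m)%N -> zc A (b \o g i).
Proof.
move=> bs im; apply: (zc_comp _ _ (sing_zc bs)).
  by move=> s _ /= h; apply: (sing_int bs h); exact: (s_loopb Sok).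
by apply: mapc_cont; exact: (s_loop Sok).
Qed.

Lemma total_sub b L (n : S -> int) b1 L1 (n1 : S -> int) : sing b L n -> sing b1 L1 n1 ->
  exists L2 (n2 : S -> int), sing (fun y => b y - b1 y) L2 n2 /\
    total (fun y => b y - b1 y) L2 n2 = total b L n - total b1 L1 n1.
Proof.
move=> bs bs1; pose L2 := undup (L ++ L1).
have iL2 q : q \in L2 -> ~ bdry q.
  by rewrite mem_undup mem_cat => /orP[]; [exact: (sing_int bs)|exact: (sing_int bs1)].
have s1 : {subset L <= L2} by move=> q h; rewrite mem_undup mem_cat h.
have s2 : {subset L1 <= L2} by move=> q h; rewrite mem_undup mem_cat h orbT.
have [e1 t1] := sing_extend bs (undup_uniq _) s1 iL2.
have [e2 t2] := sing_extend bs1 (undup_uniq _) s2 iL2.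
set n' := (fun q => if q \in L then n q else 0) in e1 t1.
set n1' := (fun q => if q \in L1 then n1 q else 0) in e2 t2.
exists L2, (fun q => n' q - n1' q); split.
  split=> //; first exact: undup_uniq.
  - by apply: zcB; [exact: sing_zc e1|exact: sing_zc e2].
  - move=> q qL; apply: sresD; [exact: iL2|exact: (sing_res e1)|].
    by apply: sresN; exact: (sing_res e2).
rewrite /total -t1 -t2 sumrB intrB.
rewrite (eq_bigr (fun i : 'I_m => zvar 0 1 (b \o g i) - zvar 0 1 (b1 \o g i))).
  by rewrite sumrB; ring.
move=> i _; have im := ltn_ord i.
have z1 := loop_zc (A := itv 0 1) bs im; have z2 := loop_zc (A := itv 0 1) bs1 im.
by rewrite -zvarN ?ler01 // -zvarD ?ler01 //; exact: zcN.
Qed.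

Lemma total_int b L (n : S -> int) : (forall y, isint (b y)) -> sing b L n -> total b L n = 0.
Proof.
move=> bi bs; rewrite /total big1_seq ?mulr0z; last first.
  move=> q /= /(@id _) qL; apply: (sres_uniq (sing_int bs qL) (sing_res bs qL)).
  by apply: (sres0 (W := setT)); [exact: filterT|exact: zc_int].
rewrite big1 ?subrr // => i _; apply: zvar_int0; first exact: ler01.
by move=> x _; exact: bi.
Qed.

End SurfaceData.

(** * Variation along an arc of a boundary circle *)

Section BoundaryArc.
Variables (R : realType) (S : topologicalType).

(** The circle minus a small arc around x is the image of a compact interval,
    hence closed: points close to x have parameters close to that of x. *)
Lemma loop_inverse (g : R -> S) : hausdorff_space S -> continuous g ->
  (forall s t, g s = g t <-> isint (s - t)) ->
  exists eta : S -> R, (forall x, range g x -> g (eta x) = x) /\ zc (range g) eta.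
Proof.
move=> hS gc g1.
have /choice[eta he] : forall x, exists s, range g x -> g s = x.
  by move=> x; have [[s _ <-]|n] := pselect (range g x); [exists s|exists 0 => /n].
exists eta; split=> // x gx e e0.
pose e' := Num.min e (1/2); have e'0 : 0 < e' by rewrite lt_min e0 /=; slra.
have e'2 : e' <= 1/2 by rewrite ge_min lexx orbT.
have e'e : e' <= e by rewrite ge_min lexx.
pose K := g @` itv (eta x + e') (eta x + 1 - e').
have cK : closed K.
  apply: compact_closed => //; apply: continuous_compact; last exact: compact_itv.
  exact: continuous_subspaceT.
have nK : ~ K x.
  move=> [s /andP[s1 s2] gs]; have /g1 i : g s = g (eta x) by rewrite gs he.
  have /int_small : isint (s - eta x - 1) by zi.
  by move=> h; have h1 : s - eta x - 1 = 0 by [apply: h; rewrite ltr_norml; slra]; slra.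
have : nbhs x (~` K) by apply: open_nbhs_nbhs; split=> //; exact: closed_openC.
apply: filterS => y nKy gy.
set d := eta y - eta x.
exists (d - rnd d); first exact: rnd_int.
have -> : d - (d - rnd d) = rnd d by ring.
apply: (lt_le_trans _ e'e); rewrite ltNge; apply/negP => h.
apply: nKy; have hb := rnd_bound d.
have gd s : isint (s - d) -> g (eta x + s) = y.
  by move=> hs; rewrite -(he y gy); apply/g1; have -> : eta x + s - eta y = s - d by rewrite /d; ring.
have ir : isint (rnd d - d) by rewrite -opprB rpredN rnd_int.
move: h; rewrite ler_normr => /orP[h|h].
  by exists (eta x + rnd d); [rewrite /itv /=; slra|exact: gd].
exists (eta x + (rnd d + 1)); first by rewrite /itv /=; slra.
apply: gd; have -> : rnd d + 1 - d = (rnd d - d) + 1 by ring.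
by zi.
Qed.

Lemma continuous_inj_mono (f : R -> R) (c d : R) : c < d -> mapc (itv c d) f ->
  (forall x y, itv c d x -> itv c d y -> f x = f y -> x = y) ->
  (forall x y, itv c d x -> itv c d y -> x < y -> f x < f y) \/
  (forall x y, itv c d x -> itv c d y -> x < y -> f y < f x).
Proof.
move=> cd fc fi.
have ie x : (x \in `[c, d]%R) = (c <= x <= d) by rewrite in_itv.
have fc' : {within [set` `[c, d]%R], continuous f}.
  by apply/mapcP; apply: mapc_sub fc => x /=; rewrite ie.
have fi' : {in `[c, d]%R &, injective f}.
  by move=> x y; rewrite !ie => hx hy; exact: fi.
have [h|h] := itv_continuous_inj_mono fc' fi'; [left|right] => x y hx hy xy.
  by rewrite h ?ie.
by rewrite h ?ie.
Qed.

Lemma itv_ivt (f : R -> R) (c d v : R) : c <= d -> mapc (itv c d) f -> itv (f c) (f d) v ->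
  exists2 x, itv c d x & f x = v.
Proof.
move=> cd fc /andP[v1 v2].
have fc' : {within `[c, d], continuous f}.
  by apply/mapcP; apply: mapc_sub fc => x /=; rewrite in_itv.
have [|x] := @IVT R f c d v cd fc'; first by rewrite ge_min v1 /= le_max v2 orbT.
by rewrite in_itv => hx <-; exists x.
Qed.

(** The circle g is cut at an end of the arc sigma.  Off the arc, beta is
    integer-valued and does not vary; along the arc the two parametrizations
    differ by a monotone change of parameter, which is increasing because g
    climbs along sigma. *)
Lemma arc_variation (g : R -> S) (sigma : R -> S) (beta : S -> R) (c d : R) :
  hausdorff_space S -> continuous g -> (forall s t, g s = g t <-> isint (s - t)) ->
  c < d -> mapc (itv c d) sigma ->
  (forall x y, itv c d x -> itv c d y -> sigma x = sigma y -> x = y) ->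
  (forall y, itv c d y -> range g (sigma y)) ->
  zc (range g) beta ->
  (forall s, (forall y, c < y < d -> g s <> sigma y) -> isint (beta (g s))) ->
  (forall y s, itv c d y -> g s = sigma y -> exists2 e : R, 0 < e &
     forall s' y', s < s' -> s' < s + e -> itv c d y' -> g s' = sigma y' -> y < y') ->
  zvar 0 1 (beta \o g) = zvar c d (beta \o sigma).
Proof.
move=> hS gc g1 cd sc si sr bz bi climb.
have [eta [ek ez]] := loop_inverse hS gc g1.
have [T [Tc Ti]] := lift_itv (ltW cd) (zc_comp sr sc ez).
have gT y : itv c d y -> g (T y) = sigma y.
  move=> hy; rewrite -[RHS]ek; last exact: sr.
  by apply/g1; rewrite -opprB rpredN; exact: Ti.
have Tinj x y : itv c d x -> itv c d y -> isint (T x - T y) -> x = y.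
  by move=> hx hy h; apply: si => //; rewrite -!gT //; apply/g1.
have cc : itv c d c by exact: itv_l (ltW cd).
have dd : itv c d d by exact: itv_r (ltW cd).
have mono : forall x y, itv c d x -> itv c d y -> x < y -> T x < T y.
  have [//|dec] := continuous_inj_mono cd Tc (fun x y hx hy e => Tinj x y hx hy (eq_ind_r (fun z => isint (z - T y)) (eq_ind_r (fun z => isint z) (rpred0 _) (subrr _)) e)).
  exfalso.
  have [e e0 he] := climb d (T d) dd (gT d dd).
  have Tcd := dec c d cc dd cd.
  have [y [y1 y2 yT]] : exists y, [/\ itv c d y, y < d & T y < T d + e].
    have /mapcR /(_ d dd e e0) /nbhs_ballP[r r0 hr] := Tc.
    have r0' : 0 < r by [].
    pose y := Num.max c (d - r / 2).
    have y1 : itv c d y by rewrite /itv /= le_max lexx /= ge_max ltW //=; slra.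
    have yd : y < d by rewrite gt_max cd /=; slra.
    have yr : d - r < y by rewrite lt_max; apply/orP; right; slra.
    exists y; split=> //.
    have := hr y _ y1; rewrite ltr_norml => h; have := h _; rewrite /ball /= ltr_norml.
    by move=> /(_ ltac:(slra)); slra.
  have := he (T y) y (dec y d y1 dd y2) yT y1 (gT y y1); slra.
have Tlt : T c < T d by exact: mono.
have T1 : T d < T c + 1.
  rewrite ltNge; apply/negP => h.
  have : itv (T c) (T d) (T c + 1) by rewrite /itv /=; slra.
  move=> /(itv_ivt (ltW cd) Tc)[y hy Ty].
  have yc : y = c by apply: Tinj => //; rewrite Ty addrAC subrr add0r rpred1.
  by move: Ty; rewrite yc; slra.
have bgz A : zc A (beta \o g).
  by apply: (zc_comp _ _ bz); [move=> s _; exists s|exact: mapc_cont].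
have per : forall s, isint ((beta \o g) (s + 1) - (beta \o g) s).
  move=> s /=; have -> : g (s + 1) = g s by apply/g1; rewrite addrAC subrr add0r rpred1.
  by rewrite subrr rpred0.
rewrite -(zvar_periodic (bgz _) per (T c)) -(@zvar_cat _ (T c) (T d) (T c + 1)) ?(ltW Tlt) ?(ltW T1) //.
rewrite [X in _ + X]zvar_int0 ?(ltW T1) // ?addr0; last first.
  move=> s /andP[s1 s2]; apply: bi => y ycd e.
  have hy : itv c d y by rewrite /itv /=; slra.
  have /g1 : g s = g (T y) by rewrite gT.
  have t1 := mono c y cc hy ltac:(slra); have t2 := mono y d hy dd ltac:(slra).
  by move=> /int_small; rewrite ltr_norml => h; have := h ltac:(slra); slra.
rewrite -(@zvar_reparam _ (T c) (T d) c d T (beta \o g)) ?(ltW cd) ?(ltW Tlt) //.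
  by apply: zvar_congr => y hy /=; rewrite gT // subrr rpred0.
move=> y /andP[y1 y2]; rewrite /itv /=; apply/andP; split.
  by have [->|yc] := eqVneq y c; [|apply/ltW/mono => //; [rewrite /itv /= y1|rewrite lt_neqAle eq_sym yc]].
by have [->|yd] := eqVneq y d; [|apply/ltW/mono => //; [rewrite /itv /= y1|rewrite lt_neqAle yd]].
Qed.

End BoundaryArc.

(** * Half-discs on a surface with boundary *)

Section PlaneFacts.
Variable R : realType.

(** Uniform continuity of the sine and of the cosine. *)
Lemma cs_close (e : R) : 0 < e -> exists2 h : R, 0 < h & forall s t : R, `|s - t| <= h ->
  `|cs s - cs t| < e /\ `|sn s - sn t| < e.
Proof.
move=> e0.
have c0 : cs (0 : R) = 1 by exact: cs0.
have hV : nbhs (cs (0 : R)) [set z : R | 1 - e ^+ 2 / 2 < z].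
  apply: open_nbhs_nbhs; split; first exact: open_gt.
  by rewrite /= c0; have := exprn_gt0 2 e0; slra.
have /nbhs_ballP[d d0 hd] := @cs_cont R 0 _ hV.
have d0' : 0 < d by [].
exists (d / 2); first slra.
move=> s t st; have : 1 - e ^+ 2 / 2 < cs (s - t).
  by apply: hd; rewrite /ball /= sub0r normrN; slra.
rewrite csB => h; have s2 := cs2sn2 s; have t2 := cs2sn2 t.
have key : (cs s - cs t) ^+ 2 + (sn s - sn t) ^+ 2 < e ^+ 2.
  have -> : (cs s - cs t) ^+ 2 + (sn s - sn t) ^+ 2 = (cs s ^+ 2 + sn s ^+ 2) + (cs t ^+ 2 + sn t ^+ 2) - 2 * (cs s * cs t + sn s * sn t) by ring.
  rewrite s2 t2; slra.
have q1 := sqr_ge0 (cs s - cs t); have q2 := sqr_ge0 (sn s - sn t).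
by split; rewrite -(ltr_pXn2r (n := 2)) ?nnegrE // ?ltW // real_normK ?num_real //; slra.
Qed.

Lemma avoid_finite (l : seq R) (a b : R) : a < b -> exists u v,
  [/\ a < u, u < v, v < b & forall x, x \in l -> ~~ (u <= x <= v)].
Proof.
elim: l a b => [|x l IH] a b ab.
  by exists (a + (b - a) / 3), (a + (b - a) * (2/3)); split; [slra|slra|slra|].
have [u [v [h1 h2 h3 h4]]] := IH a b ab.
have [xu|xu] := ltP x ((u + v) / 2).
  exists (v - (v - u) / 4), v; split=> //; try slra.
  move=> y; rewrite inE => /orP[/eqP ->|/h4 h].
    by rewrite negb_and -ltNge; apply/orP; left; slra.
  by apply: contra h => /andP[h5 h6]; slra.
exists u, (u + (v - u) / 4); split=> //; try slra.
move=> y; rewrite inE => /orP[/eqP ->|/h4 h].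
  by rewrite negb_and -!ltNge; apply/orP; right; slra.
by apply: contra h => /andP[h5 h6]; slra.
Qed.

(** The reflection of the plane onto the left half-plane: with it a function on a
    half-disc is extended to the disc, to which the planar cut applies. *)
Definition foldp (p : R * R) : R * R := (- `|p.1|, p.2).

Lemma foldp_id p : p.1 <= 0 -> foldp p = p.
Proof. by case: p => x y /= h; rewrite /foldp /= ler0_norm ?opprK. Qed.

Lemma foldp_le0 p : (foldp p).1 <= 0.
Proof. by rewrite /= oppr_le0. Qed.

Lemma foldp_rad o r p : o.1 = 0 \/ r < - o.1 -> radq o p <= r -> radq o (foldp p) = radq o p.
Proof.
move=> [z0 _|h hp]; first by rewrite /radq /rad /= z0 !subr0 sqrrN real_normK ?num_real.
rewrite foldp_id //; have [] := radq_ge p o; rewrite ler_norml; slra.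
Qed.

Lemma foldp_cont : continuous foldp.
Proof.
apply: mapcT; apply: mapc_pair; last exact: mapc_snd.
apply: mapcN; apply: (mapc_comp (B := setT) _ (@mapc_fst _ _ _)) => //.
by apply: mapc_cont; exact: norm_continuous.
Qed.

Lemma finite_gap (F : seq (R * R)) p : exists2 r : R, 0 < r & forall q, q \in F -> q <> p -> r <= radq p q.
Proof.
elim: F => [|x F [r r0 hr]]; first by exists 1.
have [->|/eqP xp] := eqVneq x p.
  by exists r => // q; rewrite inE => /orP[/eqP -> //|]; exact: hr.
exists (Num.min r (radq p x)); first by rewrite lt_min r0 radq_gt0.
move=> q; rewrite inE ge_min => /orP[/eqP -> _|qF qp]; first by rewrite lexx orbT.
by rewrite hr.
Qed.

End PlaneFacts.

Section Stokes.
Variables (R : realType) (S : topologicalType).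
Variables (Ch : set (hchart R S)) (bdry : set S) (m : nat) (g : nat -> R -> S).
Hypothesis Sok : surface Ch bdry m g.
Implicit Types (b : S -> R) (c : hchart R S) (o : R * R) (r s : R).

(** The alternative on o.1 makes the reflection foldp preserve the distance to o
    in the disc. *)
Definition good c o r : Prop :=
  [/\ Ch c, 0 < r, o.1 = 0 \/ 2 * r < - o.1 &
      forall p : R * R, p.1 <= 0 -> radq o p <= 2 * r -> himg c p].

Definition dop c o s : set S := [set y | hdom c y /\ radq o (hfwd c y) < s].
Definition dcl c o s : set S := [set y | hdom c y /\ radq o (hfwd c y) <= s].

Lemma good_cover x : exists c o r, good c o r /\ dop c o r x.
Proof.
have [c cC cx] := s_cover Sok x.
have ci : himg c (hfwd c x) by exists x.
set o := hfwd c x in ci *.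
have /nbhs_ballP[d d0 hd] := himg_near Sok cC ci.
have d0' : 0 < d by [].
have o0 := himg_le0 Sok cC ci.
pose r := if o.1 == 0 then d / 4 else Num.min (d / 4) (- o.1 / 4).
have r0 : 0 < r.
  rewrite /r; have [e|ne] := eqVneq o.1 0; first slra.
  have on : o.1 < 0 by rewrite lt_neqAle ne.
  by rewrite lt_min; slra.
have rd : r <= d / 4 by rewrite /r; case: ifP => // _; rewrite ge_min lexx.
exists c, o, r; split; last by split => //; rewrite radqq.
split=> //.
  have [e|ne] := eqVneq o.1 0; [by left|right].
  have on : o.1 < 0 by rewrite lt_neqAle ne.
  have : r <= - o.1 / 4 by rewrite /r (negbTE ne) ge_min lexx orbT.
  slra.
by move=> p p0 pr; apply: hd => //; apply: pdisc_ball; slra.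
Qed.

Lemma dop_nbhs c o s y : Ch c -> dop c o s y -> nbhs y (dop c o s).
Proof.
move=> cC [cy ry]; have ok := s_chart Sok cC.
have h : nbhs (hfwd c y) [set p | radq o p < s] := open_near (@radq_cont R o) ry.
have := hfwd_cont ok cy h.
by apply: filterS2 (hdom_nbhs Sok cC cy) => z cz hz; split => //; exact: hz.
Qed.

Lemma halfdisc_compact o s : compact [set p : R * R | p.1 <= 0 /\ radq o p <= s].
Proof.
apply: (@subclosed_compact _ _ (rect (o.1 - s) (o.1 + s) (o.2 - s) (o.2 + s))).
- apply: closedI; first exact: closed_le_cont (@cont_fst R).
  exact: closed_le_cont (@radq_cont R o).
- exact: compact_rect.
- by move=> p [_ pr]; have [] := radq_ge p o; rewrite !ler_norml => ? ?; split; slra.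
Qed.

Lemma dcl_closed c o r s : good c o r -> s <= 2 * r -> closed (dcl c o s).
Proof.
move=> [cC r0 _ hi] sr; have ok := s_chart Sok cC.
apply: compact_closed; first exact: s_haus Sok.
have -> : dcl c o s = hinv c @` [set p : R * R | p.1 <= 0 /\ radq o p <= s].
  apply/seteqP; split=> [y [cy ry]|_ [p [p0 pr] <-]].
    exists (hfwd c y); last by rewrite (hcancel ok cy).
    by split=> //; apply: (himg_le0 Sok cC); exists y.
  have [h1 h2] := himgK Sok cC (hi p p0 (le_trans pr sr)).
  by split=> //; rewrite h2.
apply: continuous_compact; last exact: halfdisc_compact.
apply/mapcP; apply: mapc_sub (hinv_cont ok) => p [p0 pr].
by apply: hi => //; exact: le_trans sr.
Qed.

(** The circles of the boundary meet the disc along one segment, which a single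
    one of them describes. *)
Lemma bdry_total c o r s b1 (b1p : R * R -> R) (cc dd : R) : good c o r -> 0 < s -> s < 2 * r ->
  (forall y, dop c o (2 * r) y -> b1 y = b1p (hfwd c y)) ->
  (forall y, ~ dop c o s y -> isint (b1 y)) ->
  (forall p, s <= radq o p -> isint (b1p p)) ->
  zc (itv cc dd) (fun y => b1p (0, y)) ->
  cc <= o.2 - 2 * r -> o.2 + 2 * r <= dd ->
  (forall i, (i < m)%N -> zc (range (g i)) b1) ->
  \sum_(i < m) zvar 0 1 (b1 \o g i) = zvar cc dd (fun y => b1p (0, y)).
Proof.
move=> [cC r0 oc hi] s0 sr bE bI pI pz ccl ddl bz.
have cd : cc <= dd by slra.
have [z0|ol] := oc; last first.
  have far y : s <= radq o (0, y).
    by have [] := radq_ge (0, y) o; rewrite /= ler_norml; slra.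
  rewrite (zvar_int0 cd) => [|y _]; last by apply: pI.
  apply: big1 => i _; apply: zvar_int0; first exact: ler01.
  move=> t _ /=; apply: bI => -[cg rg].
  have /(s_bdry Sok cC cg) e := s_loopb Sok t (ltn_ord i).
  have := far (hfwd c (g i t)).2; rewrite -e -surjective_pairing; slra.
pose w := (s + 2 * r) / 2.
have rad0 y : radq o (0, y) = `|y - o.2|.
  by rewrite /radq /rad /= z0 subrr expr0n /= add0r sqrtr_sqr.
pose sg y := hinv c (0, y).
have si y : `|y - o.2| <= 2 * r -> hdom c (sg y) /\ hfwd c (sg y) = (0, y).
  by move=> hy; apply: (himgK Sok cC); apply: hi; rewrite ?rad0.
have wi y : itv (o.2 - w) (o.2 + w) y -> `|y - o.2| <= 2 * r.
  by rewrite /itv /= ler_norml /w; slra.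
have sb y : itv (o.2 - w) (o.2 + w) y -> bdry (sg y).
  by move=> /wi /si[h1 h2]; apply/(s_bdry Sok cC h1); rewrite h2.
have sc : mapc (itv (o.2 - w) (o.2 + w)) sg.
  apply: (mapc_comp (B := himg c) _ (@mapc_ver R _ 0)); last exact: hinv_cont (s_chart Sok cC).
  by move=> y /wi hy; apply: hi; rewrite ?rad0.
have sinj x y : itv (o.2 - w) (o.2 + w) x -> itv (o.2 - w) (o.2 + w) y -> sg x = sg y -> x = y.
  by move=> /wi /si[_ h1] /wi /si[_ h2] e; have [] : ((0 : R), x) = (0, y) by rewrite -h1 -h2 e.
(* a boundary point of the disc lies on the segment *)
have onseg i t : (i < m)%N -> dop c o s (g i t) -> exists2 y, o.2 - w < y < o.2 + w & g i t = sg y.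
  move=> im [cg rg]; have /(s_bdry Sok cC cg) e := s_loopb Sok t im.
  exists (hfwd c (g i t)).2.
    by move: rg; rewrite (surjective_pairing (hfwd c (g i t))) e rad0 /= ltr_norml /w; slra.
  by rewrite /sg -e -surjective_pairing (hcancel (s_chart Sok cC) cg).
have /choice[ix hix] : forall y, exists i, itv (o.2 - w) (o.2 + w) y -> (i < m)%N /\ range (g i) (sg y).
  move=> y; have [hy|n] := pselect (itv (o.2 - w) (o.2 + w) y); last by exists 0%N.
  by have [i [t [im e]]] := s_bcover Sok (sb y hy); exists i => _; split=> //; exists t.
have rcl i : (i < m)%N -> closed (range (g i)).
  move=> im; apply: compact_closed; first exact: s_haus Sok.
  have -> : range (g i) = g i @` itv 0 1.
    apply/seteqP; split=> _ [t _ <-]; last by exists t.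
    exists (t - (Num.floor t)%:~R).
      by have := floor_le_tmp t; have := floorD1_gt t; rewrite intrD /itv /=; slra.
    by apply/(s_loop1 Sok _ _ im); rewrite addrAC subrr add0r rpredN intr_int.
  apply: continuous_compact; last exact: compact_itv.
  by apply: continuous_subspaceT; exact: (s_loop Sok).
have ixc : mapc (itv (o.2 - w) (o.2 + w)) (fun y => (ix y)%:R : R).
  move=> y hy V hV; have [im [t _ tE]] := hix y hy.
  have far k : (forall j, (j < k)%N -> (j < m)%N -> j != ix y ->
      \forall z \near y, itv (o.2 - w) (o.2 + w) z -> ~ range (g j) (sg z)).
    move=> j _ jm ji; have nr : ~ range (g j) (sg y).
      by move=> [t' _ tE']; move/eqP: ji; apply; apply: (s_disj Sok jm im (s := t') (t := t)); rewrite tE'.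
    have : nbhs (sg y) (~` range (g j)).
      by apply: open_nbhs_nbhs; split=> //; apply: closed_openC; exact: rcl.
    by move=> /(sc y hy).
  have all k : (k <= m)%N -> \forall z \near y, itv (o.2 - w) (o.2 + w) z ->
      forall j, (j < k)%N -> j != ix y -> ~ range (g j) (sg z).
    elim: k => [|k IH] km; first by apply: filterE => z _ j; rewrite ltn0.
    have [e|ne] := eqVneq k (ix y).
      apply: filterS (IH (ltnW km)) => z hz iz j; rewrite ltnS leq_eqVlt => /orP[/eqP ->|].
        by rewrite e eqxx.
      exact: hz.
    apply: filterS2 (IH (ltnW km)) (far m k km km ne) => z h1 h2 iz j.
    by rewrite ltnS leq_eqVlt => /orP[/eqP -> _|]; [exact: h2|exact: h1].
  apply: filterS (all m (leqnn m)) => z hz iz; have [zm zr] := hix z iz.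
  have -> : ix z = ix y by apply/eqP; apply: contraT => ne; case: (hz iz (ix z) zm ne).
  exact: nbhs_singleton hV.
have ixE y : itv (o.2 - w) (o.2 + w) y -> ix y = ix o.2.
  move=> hy; have ho : itv (o.2 - w) (o.2 + w) o.2 by rewrite /itv /= /w; slra.
  have := connected_int (@connected_itv R _ _) ixc (fun y _ => _) hy ho.
  by move=> h; apply/eqP; rewrite -(eqr_nat R); apply/eqP/h => z; exact: natr_int.
have ho : itv (o.2 - w) (o.2 + w) o.2 by rewrite /itv /= /w; slra.
have [i0m _] := hix _ ho; set i0 := ix o.2 in i0m ixE.
rewrite (bigD1 (Ordinal i0m)) //= big1 ?addr0; last first.
  move=> i ii0; apply: zvar_int0; first exact: ler01.
  move=> t _ /=; apply: bI => /(onseg i t (ltn_ord i))[y hy gy].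
  have hy' : itv (o.2 - w) (o.2 + w) y by rewrite /itv /=; slra.
  have [_ [t' _ e]] := hix y hy'; rewrite ixE // in e.
  move/eqP: ii0; apply; apply: val_inj => /=.
  by apply: (s_disj Sok (ltn_ord i) i0m (s := t) (t := t')); rewrite gy e.
have w0 : 0 < w by rewrite /w; slra.
have h1 : cc <= o.2 - w by rewrite /w; slra.
have h2 : o.2 + w <= dd by rewrite /w; slra.
have z1 : zc (itv cc (o.2 + w)) (fun y => b1p (0, y)).
  by apply: zc_sub pz => y; rewrite /itv /=; slra.
rewrite -(zvar_cat (b := o.2 + w) _ h2 pz) ?ltW //; last by slra.
rewrite -(zvar_cat (b := o.2 - w) h1 _ z1); last by slra.
rewrite (@zvar_int0 _ cc _ _ h1) => [|y hy]; last first.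
  apply: pI; rewrite rad0 ler_normr; apply/orP; right; move: hy; rewrite /itv /= /w; slra.
rewrite (@zvar_int0 _ _ dd _ h2) => [|y hy]; last first.
  apply: pI; rewrite rad0 ler_normr; apply/orP; left; move: hy; rewrite /itv /= /w; slra.
rewrite add0r addr0.
rewrite (@arc_variation _ _ (g i0) sg b1 (o.2 - w) (o.2 + w)) //.
- apply: zvar_congr => y hy /=; have [c1 c2] := si y (wi y hy).
  rewrite bE ?c2 ?subrr ?rpred0 //; split=> //; rewrite c2 rad0.
  by move: hy; rewrite /itv /= /w ltr_norml; slra.
- exact: s_haus Sok.
- exact: (s_loop Sok).
- by move=> t t'; exact: (s_loop1 Sok).
- slra.
- by move=> y hy; rewrite -(ixE y hy); exact: (hix y hy).2.
- exact: bz.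
- move=> t ht; apply: bI => /(onseg i0 t i0m)[y hy gy].
  by case: (ht y hy).
- move=> y t hy e; have [c1 c2] := si y (wi y hy).
  have cg : hdom c (g i0 t) by rewrite e.
  have [d d0 hd] := s_climb Sok cC i0m cg; exists d => // t' y' tt' t'd hy' e'.
  by have := hd t' tt' t'd; rewrite e e' c2 (si y' (wi y' hy')).2.
Qed.

End Stokes.

(** * Stokes' theorem for circle-valued functions *)

Section StokesCut.
Variables (R : realType) (S : topologicalType).
Variables (Ch : set (hchart R S)) (bdry : set S) (m : nat) (g : nat -> R -> S).
Hypothesis Sok : surface Ch bdry m g.
Implicit Types (b : S -> R) (c : hchart R S) (o : R * R) (r s : R) (n : S -> int).

(** The finite subcover, stated with neighbourhoods instead of open sets. *)
Lemma compact_finite_cover (T : topologicalType) (K : set T) (U : T -> set T) : compact K ->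
  (forall x, K x -> nbhs x (U x)) -> exists s : seq T, forall x, K x -> exists2 y, y \in s & U y x.
Proof.
move=> /compact_near_coveringP Kc KU.
pose F : set_system (seq T) := [set P | exists s0 : seq T, forall s : seq T, {subset s0 <= s} -> P s].
have FF : Filter F.
  split; first by exists [::].
    move=> P Q [s hs] [t ht]; exists (s ++ t) => r hr; split; [apply: hs|apply: ht] => x xs; apply: hr.
      by rewrite mem_cat xs.
    by rewrite mem_cat xs orbT.
  by move=> P Q PQ [s hs]; exists s => r /hs; exact: PQ.
suff H : forall x, K x -> \forall x' \near x & s \near F, exists2 y, y \in s & U y x'.
  have [s hs] := Kc (seq T) F (fun (s : seq T) x => exists2 y, y \in s & U y x) FF H.
  by exists s; exact: hs.
move=> x Kx; exists (U x, [set s' : seq T | x \in s']).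
  by split => /=; [exact: KU|exists [:: x] => s'; apply; rewrite inE].
by move=> [y s] /= [Uy xs]; exists x.
Qed.

Lemma leq4S (k : nat) : (k <= 4 * k.+1)%N.
Proof. lia. Qed.

Lemma polar_close (r1 r2 x y e : R) : `|x| <= 1 -> 0 <= r2 -> `|x - y| <= e ->
  `|r1 * x - r2 * y| <= `|r1 - r2| + r2 * e.
Proof.
move=> x1 r0 xy; have -> : r1 * x - r2 * y = (r1 - r2) * x + r2 * (x - y) by ring.
apply: (le_trans (ler_normD _ _)); rewrite !normrM (ger0_norm r0); apply: lerD.
  by rewrite ler_piMr.
exact: ler_wpM2l.
Qed.

Lemma foldp_ball (p p' : R * R) (d : R) : 0 < d -> p.1 <= 0 -> `|p'.1 - p.1| <= d / 2 ->
  `|p'.2 - p.2| <= d / 2 -> ball p d (foldp p').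
Proof.
move=> d0 p0; rewrite !ler_norml => /andP[h1 h2] /andP[h3 h4].
split; rewrite /ball /= /foldp /= ltr_norml; last slra.
by case: (ger0P p'.1) => ?; slra.
Qed.

Lemma radq_box (p o : R * R) (r T : R) : o.1 <= 0 -> p.1 < 0 -> radq o p <= 2 * r ->
  T = 4 * r + `|o.1| + 1 ->
  [/\ o.1 - T < p.1, p.1 < 0, o.2 - T < p.2 + p.1 & p.2 - p.1 < o.2 + T].
Proof.
move=> o0 p0 rp ->; have [] := radq_ge p o; rewrite !ler_norml (ler0_norm o0) => /andP[? ?] /andP[? ?].
by split; slra.
Qed.

(** A Lebesgue number of the covering of the disc by Z and the complement of K,
    in the chart. *)
Lemma lebesgue_number c o r (K Z : set S) : good Ch c o r -> closed K -> open Z -> K `<=` Z ->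
  exists2 d : R, 0 < d & forall p p' : R * R, p.1 <= 0 -> radq o p <= 2 * r -> K (hinv c p) ->
    p'.1 <= 0 -> radq o p' <= 2 * r -> ball p d p' -> Z (hinv c p').
Proof.
move=> [cC r0 _ hi] cK oZ KZ; have ok := s_chart Sok cC.
pose D := [set p : R * R | p.1 <= 0 /\ radq o p <= 2 * r].
have Dc : compact D by exact: halfdisc_compact.
pose P (d : R) (p : R * R) := D p -> K (hinv c p) -> forall p', D p' -> ball p d p' -> Z (hinv c p').
have ic p : D p -> forall V, nbhs (hinv c p) V -> \forall p' \near p, D p' -> V (hinv c p').
  move=> [p0 pr] V hV; have := hinv_cont ok (hi p p0 pr) hV.
  by apply: filterS => p' h [p0' pr']; exact: h (hi p' p0' pr').
have : \forall d \near (0 : R)^'+, D `<=` P d.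
  apply: ((compact_near_coveringP D).1 Dc R (at_right (0 : R)) P) => p Dp.
  have [Kp|nK] := pselect (K (hinv c p)).
    have hZ : nbhs (hinv c p) Z by apply: open_nbhs_nbhs; split => //; exact: KZ.
    have /nbhs_ballP[e e0 he] := ic p Dp Z hZ.
    have e0' : 0 < e by [].
    exists (ball p (e / 2), [set d | d < e / 2]).
      split; first by apply: nbhsx_ballx; slra.
      by apply: nbhs_right_lt; slra.
    move=> [p' d] /= [pp' de] _ _ p'' Dp'' b2; apply: he => //.
    by apply: (ball_split pp'); apply: le_ball b2; exact: ltW.
  have hK : nbhs (hinv c p) (~` K) by apply: open_nbhs_nbhs; split => //; exact: closed_openC.
  have h := ic p Dp _ hK.
  exists ([set p' | D p' -> ~ K (hinv c p')], setT); first by split => //; exact: filterT.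
  by move=> [p' d] /= [h' _] Dp' Kp'; case: (h' Dp' Kp').
move=> h; have [d [hd d0]] : exists d, D `<=` P d /\ 0 < d.
  have h2 : \forall d \near (0 : R)^'+, D `<=` P d /\ 0 < d.
    by apply: filterI => //; exact: nbhs_right_gt.
  by have [e he] := @filter_ex _ _ (at_right_proper_filter (0 : R)) _ h2; exists e.
by exists d => // p p' p0 pr Kp p0' pr' bp; apply: (hd p).
Qed.

(** One disc can be emptied.  The function is cut off along a thin ring free of
    singularities; the result has only finitely many new singularities, and its
    total vanishes by the residue theorem in the chart, where it is carried by
    the disc.  The ring is thin and finely subdivided, so that the places K where
    b is already integer-valued remain so. *)
Lemma cut_step c o r b L n (ra rb : R) (K Z : set S) : good Ch c o r ->
  sing Ch bdry b L n -> 0 < ra -> ra < rb -> rb <= 2 * r ->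
  closed K -> open Z -> K `<=` Z -> (forall y, Z y -> isint (b y)) ->
  exists b1 L1 (n1 : S -> int), [/\ sing Ch bdry b1 L1 n1, total m g b1 L1 n1 = 0,
    forall y, dcl c o ra y -> isint (b y - b1 y) & forall y, K y -> isint (b1 y)].
Proof.
move=> gd bs ra0 rab rbr cK oZ KZ bZ.
have [cC r0 oc hi] := gd; have ok := s_chart Sok cC.
(* a ring free of singularities *)
have [u [v0 [u1 u2 v1 Lfree0]]] := avoid_finite [seq radq o (hfwd c q) | q <- L] rab.
have [d d0 hd] := lebesgue_number gd cK oZ KZ.
pose v := Num.min v0 (u + d / 4).
have uv : u < v by rewrite lt_min u2 /=; slra.
have vv0 : v <= v0 by rewrite ge_min lexx.
have vd : v <= u + d / 4 by rewrite ge_min lexx orbT.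
have u0 : 0 < u by slra.
have Lfree q : q \in L -> u <= radq o (hfwd c q) -> radq o (hfwd c q) <= v -> False.
  by move=> qL h1 h2; have := Lfree0 _ (map_f _ qL); rewrite h1 (le_trans h2 vv0).
have oc' s : s <= 2 * r -> o.1 = 0 \/ s < - o.1 by case: oc => h; [left|right; slra].
have frad p : radq o p <= 2 * r -> radq o (foldp p) = radq o p.
  by move=> hp; apply: (foldp_rad (r := 2 * r)).
have fimg p : radq o p <= 2 * r -> himg c (foldp p).
  by move=> hp; apply: hi; [exact: foldp_le0|rewrite frad].
pose f p := b (hinv c (foldp p)).
pose Lin := [seq q <- L | `[< hdom c q /\ radq o (hfwd c q) < u >]].
have Linp q : q \in Lin -> [/\ q \in L, hdom c q & radq o (hfwd c q) < u].
  by rewrite mem_filter => /andP[/asboolP[h1 h2] h3].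
have finj p q : radq o p <= 2 * r -> hinv c (foldp p) = q -> hdom c q /\ hfwd c q = foldp p.
  by move=> hp <-; exact: (himgK Sok cC (fimg p hp)).
have fz (A : set (R * R)) : (forall p, A p -> radq o p <= 2 * r /\ hinv c (foldp p) \notin L) -> zc A f.
  move=> hA; apply: (zc_comp (g := fun p => hinv c (foldp p)) _ _ (sing_zc bs)).
    by move=> p /hA[_ h]; apply/negP.
  apply: (mapc_comp (f := @foldp R) (B := himg c)).
  - by move=> p /hA[h _]; exact: fimg.
  - by apply: mapc_cont; exact: foldp_cont.
  - exact: hinv_cont ok.
(* the subdivision is fine enough for a cell to stay in Z around a point of K;
   a multiple of 4 keeps the new singularities off the boundary line *)
have e0 : 0 < d / (8 * r) by rewrite divr_gt0 //; slra.
have [h h0 hcs] := cs_close e0.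
pose M := (Num.bound (1 / h)).+1; pose N := (4 * M)%N.
have N0 : (0 < N)%N by [].
have Nh : 1 / N%:R <= h.
  have NR : 0 < N%:R :> R by rewrite ltr0n.
  have b1 : 1 / h < (Num.bound (1 / h))%:R by apply: archi_boundP; rewrite divr_ge0 // ltW.
  have b2 : (Num.bound (1 / h))%:R <= N%:R :> R by rewrite ler_nat; exact: leq4S.
  by rewrite ler_pdivrMr // mulrC -ler_pdivrMr //; slra.
have [H Hl] : exists H, islift (rect 0 1 0 1) (fun p => f (ptq o (p.1, u + p.2 * (v - u)))) H.
  apply: lift_rect; rewrite ?ler01 //.
  have rz : zc [set p | u <= radq o p /\ radq o p <= v] f.
    apply: fz => p [p1 p2]; have p3 : radq o p <= 2 * r by slra.
    split=> //; apply/negP => qL; have [_ e] := finj p _ p3 erefl.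
    by apply: (Lfree _ qL); rewrite e frad.
  apply: (zc_comp (g := fun p : R * R => ptq o (p.1, u + p.2 * (v - u))) _ _ rz).
    move=> p [_ /andP[p1 p2]]; rewrite /= radq_ptq /=; first by split; snra.
    by snra.
  apply: (mapc_comp (f := fun p : R * R => (p.1, u + p.2 * (v - u))) (B := setT)) => //.
    apply: mapc_pair; first exact: mapc_fst.
    by apply: mapcD; [exact: mapc_cst|apply: mapcM; [exact: mapc_snd|exact: mapc_cst]].
  by apply: mapc_cont; exact: ptq_cont.
pose b1p := cutf o f u v N H.
pose J := cutJ o u N.
pose D := [set p : R * R | ~ (exists2 q, q \in Lin & foldp p = hfwd c q)].
have b1z : zc (D `\` [set` J]) b1p.
  apply: cutf_zc => //; apply: fz => p [/= p1 pD]; have p3 : radq o p <= 2 * r by slra.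
  split=> //; apply/negP => qL; have [cq e] := finj p _ p3 erefl.
  apply: pD; exists (hinv c (foldp p)) => //; rewrite mem_filter qL andbT; apply/asboolP.
  split=> //; rewrite ltNge; apply/negP => hu.
  by apply: (Lfree _ qL) => //; rewrite e frad //; slra.
have b1in p : radq o p <= u -> b1p p = f p by rewrite /b1p /cutf => ->.
have b1out p : v <= radq o p -> b1p p = 0.
  by move=> hp; rewrite /b1p /cutf hp ifF //; apply/negbTE; rewrite -ltNge; slra.
have Jneg p : p \in J -> p.1 <= 0 -> p.1 < 0.
  move=> pJ p0; rewrite lt_neqAle p0 andbT; case: oc => [z|z].
    by rewrite -z; apply: (cutJ_x u0 uv N0 (dvdn_mulr M (dvdnn 4)) pJ).
  have pr := cutJ_rad u0 pJ; have [] := radq_ge p o; rewrite ler_norml pr => h1 _.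
  by apply/eqP => pz; slra.
pose b1 y := if pselect (dop c o (2 * r) y) then b1p (hfwd c y) else 0.
have b1E y : dop c o (2 * r) y -> b1 y = b1p (hfwd c y) by rewrite /b1; case: pselect.
have b1Z y : ~ dop c o v y -> isint (b1 y).
  move=> ny; have [yd|yd] := pselect (dop c o (2 * r) y); last first.
    by have -> : b1 y = 0; [rewrite /b1; case: pselect|exact: rpred0].
  rewrite b1E //; have [cy _] := yd.
  by rewrite b1out ?rpred0 // leNgt; apply/negP => h'; apply: ny.
pose L1 := undup (Lin ++ [seq hinv c p | p <- J & p.1 < 0]).
have Jr p : p \in J -> radq o p = u by exact: cutJ_rad.
have L1p q : q \in L1 -> [/\ hdom c q, radq o (hfwd c q) <= u & ~ bdry q].
  rewrite mem_undup mem_cat => /orP[/Linp[h1 h2 h3]|/mapP[p]].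
    by split; rewrite ?ltW //; exact: (sing_int bs).
  rewrite mem_filter => /andP[p0 pJ] ->.
  have pi : himg c p by apply: hi; [exact: ltW|rewrite Jr //; slra].
  have [h1 h2] := himgK Sok cC pi; rewrite h2 Jr //; split => //.
  by move=> /(s_bdry Sok cC h1); rewrite h2 => e; rewrite e ltxx in p0.
have L1D y : hdom c y -> radq o (hfwd c y) <= 2 * r -> y \notin L1 -> (D `\` [set` J]) (hfwd c y).
  move=> cy ry yL; have y0 : (hfwd c y).1 <= 0 by apply: (himg_le0 Sok cC); exists y.
  split.
    move=> [q qL]; rewrite foldp_id // => e; have [_ cq _] := Linp q qL.
    have yq := s_inj Sok cC cy cq e; move/negP: yL; apply.
    by rewrite mem_undup mem_cat yq qL.
  move=> /= pJ; move/negP: yL; apply; rewrite mem_undup mem_cat; apply/orP; right.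
  apply/mapP; exists (hfwd c y); last by rewrite (hcancel ok cy).
  by rewrite mem_filter pJ andbT; exact: Jneg.
have v2r : v < 2 * r by slra.
have b1s : zc (~` [set` L1]) b1.
  apply: zc_local => y yL; have [yd|nd] := pselect (dop c o (2 * r) y).
    exists (dop c o (2 * r)); first exact: (dop_nbhs Sok cC yd).
    apply: (zc_congr (f := b1p \o hfwd c)) => [z [_ /b1E ->]|]; first by rewrite subrr rpred0.
    apply: (zc_comp _ _ b1z).
      by move=> z [/negP zL [cz rz]]; apply: L1D => //; exact: ltW.
    by apply: mapc_sub (hfwd_cont ok) => z [_ []].
  exists (~` dcl c o v).
    apply: open_nbhs_nbhs; split; first by apply: closed_openC; apply: (dcl_closed Sok gd); slra.
    by move=> [cy ry]; apply: nd; split=> //; slra.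
  by apply: zc_int => z [_ nz]; apply: b1Z => -[cz rz]; apply: nz; split=> //; exact: ltW.
have res q : q \in L1 -> exists k, pres b1p (hfwd c q) k.
  move=> qL; have [cq rq nb] := L1p q qL; have q0 := hfwd_int Sok cC cq nb.
  have [s s0 hs] := finite_gap (J ++ [seq hfwd c q | q <- Lin]) (hfwd c q).
  have r2 : radq o (hfwd c q) < 2 * r by slra.
  have /nbhs_ballP[t t0 ht] : nbhs (hfwd c q) ([set p | p.1 < 0] `&` [set p | radq o p < 2 * r]).
    by apply: filterI; [exact: (open_near (@cont_fst R))|exact: (open_near (@radq_cont R o))].
  have t0' : 0 < t by [].
  apply: (@pres_exists _ _ _ (Num.min s t)); first by rewrite lt_min s0.
  apply: zc_sub b1z => p [pq]; rewrite lt_min => /andP[ps pt].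
  have [/= p0 pr] := ht p (pdisc_ball pt).
  have nF x : x \in J ++ [seq hfwd c q | q <- Lin] -> p <> x.
    by move=> xF e; have := hs x xF; rewrite -e => /(_ pq); slra.
  split.
    move=> [q' qL' e]; rewrite foldp_id in e; last exact: ltW.
    by apply: (nF p) => //; rewrite e mem_cat map_f ?orbT.
  by move=> pJ; apply: (nF p) => //; rewrite mem_cat pJ.
have /choice[n1 hn1] : forall q, exists k, q \in L1 -> pres b1p (hfwd c q) k.
  move=> q; have [qL|nq] := boolP (q \in L1); last by exists 0.
  by have [k hk] := res q qL; exists k.
have sg1 : sing Ch bdry b1 L1 n1.
  split=> //; first exact: undup_uniq.
  - by move=> q /L1p[].
  - move=> q qL; have [cq rq nb] := L1p q qL.
    apply: (pres_sres Sok cC cq _ (hn1 q qL)).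
    have dq : dop c o (2 * r) q by split=> //; slra.
    by apply: filterS (dop_nbhs Sok cC dq) => y /b1E -> _; rewrite subrr rpred0.
exists b1, L1, n1; split=> //.
- pose T := 4 * r + `|o.1| + 1.
  have T0 : 0 < T by rewrite /T; have := normr_ge0 o.1; slra.
  have on1 := ler_norm o.1; have on2 := ler_norm (- o.1); rewrite normrN in on2.
  have o0 : o.1 <= 0 by case: oc; slra.
  have En q : q \in [seq hfwd c q | q <- L1] -> exists2 q', q' \in L1 & q = hfwd c q'.
    by move=> /mapP.
  have rectz : zc (rect (o.1 - T) 0 (o.2 - T) (o.2 + T) `\` [set` [seq hfwd c q | q <- L1]]) b1p.
    apply: zc_sub b1z => p [[/andP[_ p0] _] pE]; split.
      move=> [q qL]; rewrite foldp_id // => e; apply: pE; rewrite /= e map_f //.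
      by rewrite mem_undup mem_cat qL.
    move=> pJ; apply: pE; have pn := Jneg p pJ p0.
    have pi : himg c p by apply: hi => //; rewrite Jr //; slra.
    have [_ <-] := himgK Sok cC pi; apply: map_f.
    by rewrite mem_undup mem_cat; apply/orP; right; apply: map_f; rewrite mem_filter pn.
  have := @planar_residue R (o.1 - T) (o.2 - T) (o.2 + T) (n1 \o hinv c) _ _
    [seq hfwd c q | q <- L1] b1p _ _ rectz _ _.
  rewrite big_map; have -> : \sum_(j <- L1) (n1 \o hinv c) (hfwd c j) = \sum_(q <- L1) n1 q.
    rewrite big_seq [RHS]big_seq; apply: eq_bigr => q /L1p[cq _ _] /=.
    by rewrite (hcancel ok cq).
  move=> pr; rewrite /total -pr.
  + rewrite (@bdry_total _ _ _ _ _ _ Sok c o r v b1 b1p (o.2 - T) (o.2 + T)) ?subrr //.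
    * slra.
    * by move=> p /b1out ->; exact: rpred0.
    * apply: (zc_comp (g := fun y => (0, y)) _ (@mapc_ver R _ 0) rectz) => y /andP[y1 y2]; split.
        by split; rewrite /=; slra.
      move=> /En[q qL e]; have [cq _ nb] := L1p q qL.
      by apply: nb; apply/(s_bdry Sok cC cq); rewrite -e.
    * rewrite /T; have := normr_ge0 o.1; slra.
    * rewrite /T; have := normr_ge0 o.1; slra.
    * move=> i im; apply: zc_sub b1s => _ [t _ <-] /= gL.
      by have [_ _ nb] := L1p _ gL; apply: nb; exact: (s_loopb Sok).
  + slra.
  + slra.
  + rewrite map_inj_in_uniq ?undup_uniq // => q q' /L1p[cq _ _] /L1p[cq' _ _].
    exact: (s_inj Sok cC).
  + move=> _ /En[q qL ->]; have [cq rq nb] := L1p q qL; have q0 := hfwd_int Sok cC cq nb.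
    by apply: (radq_box o0 q0 _ (erefl T)); apply: (le_trans rq); slra.
  + move=> _ /En[q qL ->]; have [cq _ _] := L1p q qL.
    by rewrite /= (hcancel ok cq); exact: hn1.
  + move=> p hp hs; rewrite b1out ?rpred0 //.
    have [] := radq_ge p o; rewrite !ler_norml /T in hs *; slra.
- move=> y [cy ry]; have y0 : (hfwd c y).1 <= 0 by apply: (himg_le0 Sok cC); exists y.
  rewrite b1E; last by split=> //; slra.
  by rewrite b1in /f ?foldp_id ?(hcancel ok cy) ?subrr ?rpred0 //; slra.
- move=> y Ky; have [yd|nd] := pselect (dop c o v y); last exact: b1Z.
  have [cy ry] := yd; have y0 : (hfwd c y).1 <= 0 by apply: (himg_le0 Sok cC); exists y.
  rewrite b1E; last by split=> //; slra.
  have [yu|yu] := ltP (radq o (hfwd c y)) u.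
    by rewrite b1in /f ?foldp_id ?(hcancel ok cy) //; [apply: bZ; exact: KZ|exact: ltW].
  apply: cutf_int => //; first by split=> //; exact: ltW.
  move=> s k hs hk; set p := hfwd c y in y0 ry yu hs *.
  set p' := ptq o _; have rp' : radq o p' = u + k * (v - u) by rewrite radq_ptq //=; snra.
  have rp'2 : radq o p' <= 2 * r by rewrite rp'; snra.
  apply: bZ; apply: (hd p (foldp p')) => //.
  + slra.
  + by rewrite /p (hcancel ok cy).
  + exact: foldp_le0.
  + by rewrite frad.
  have pn : p <> o by move=> e; rewrite e radqq in yu; slra.
  have [c1 c2] := hcs s (argq o p) (le_trans hs Nh).
  have rho0 : `|u + k * (v - u) - radq o p| <= d / 4.
    by rewrite ler_norml; move: ry yu yd => ? ? [_ ?]; snra.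
  have pr0 : 0 <= radq o p by rewrite rad_ge0.
  have e8 : radq o p * (d / (8 * r)) <= d / 4.
    have -> : d / 4 = (2 * r) * (d / (8 * r)) by field; slra.
    by apply: ler_wpM2r; [exact: ltW|rewrite /p; slra].
  have b1' := @polar_close (u + k * (v - u)) (radq o p) (cs s) (cs (argq o p)) _ (cos_max _) pr0 (ltW c1).
  have b2' := @polar_close (u + k * (v - u)) (radq o p) (sn s) (sn (argq o p)) _ (sin_max _) pr0 (ltW c2).
  have p1E : p.1 = o.1 + radq o p * cs (argq o p) by rewrite -{1}(ptqK pn).
  have p2E : p.2 = o.2 + radq o p * sn (argq o p) by rewrite -{1}(ptqK pn).
  have q1 : `|p'.1 - p.1| <= d / 2 by rewrite p1E /p' /= opprD addrACA subrr add0r; slra.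
  have q2 : `|p'.2 - p.2| <= d / 2 by rewrite p2E /p' /= opprD addrACA subrr add0r; slra.
  exact: foldp_ball.
Qed.

(** The discs of a finite cover are emptied one after the other: subtracting the
    cut-off function, whose total is zero, makes the function integer-valued on
    one more disc.  The discs already treated shrink a little at each step, from
    the radius l to (1 + l) / 2, and remain larger than the covering discs.  A
    function that is everywhere integer-valued has total zero. *)
Theorem surface_stokes b L n : sing Ch bdry b L n ->
  (\sum_(q <- L) n q)%:~R = \sum_(i < m) zvar 0 1 (b \o g i).
Proof.
move=> bs; apply/eqP; rewrite -subr_eq0; apply/eqP; rewrite -/(total m g b L n).
pose disc := (hchart R S * (R * R) * R)%type.
pose gdisc (D : disc) := good Ch D.1.1 D.1.2 D.2.
pose O (D : disc) (l : R) := dop D.1.1 D.1.2 (l * D.2).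
have /choice[dx hdx] : forall x, exists D : disc, gdisc D /\ O D 1 x.
  move=> x; have [c [ctr [r [h1 h2]]]] := good_cover Sok x.
  by exists (c, ctr, r); split => //; rewrite /O /= mul1r.
have [ds dsg dsc] : exists2 ds : seq disc, (forall D, List.In D ds -> gdisc D) &
    forall x, exists D, List.In D ds /\ O D 1 x.
  have [|F hF] := @compact_finite_cover S setT (fun x => O (dx x) 1) (s_comp Sok).
    by move=> x _; have [[cC _ _ _] h2] := hdx x; exact: (dop_nbhs Sok cC h2).
  exists [seq dx x | x <- F].
    by move=> D /List.in_map_iff[x [<- _]]; have [] := hdx x.
  move=> x; have [y yF xy] := hF x I.
  exists (dx y); split=> //; apply: List.in_map.
  by elim: F yF {hF} => [//|z l IH]; rewrite inE => /orP[/eqP ->|/IH]; [left|right].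
suff key : forall (todo done : seq disc), (forall D, List.In D todo -> gdisc D) ->
    (forall D, List.In D done -> gdisc D) ->
    (forall x, exists D, (List.In D todo \/ List.In D done) /\ O D 1 x) ->
    forall (l : R) b L n, 1 < l -> l <= 2 -> sing Ch bdry b L n ->
    (forall D, List.In D done -> forall y, O D l y -> isint (b y)) -> total m g b L n = 0.
  apply: (key ds [::] dsg _ _ 2) => //.
  - by move=> x; have [D [D1 D2]] := dsc x; exists D; split=> //; left.
  - slra.
elim=> [|D todo IH] done tg dg dc l b0 L0 n0 l1 l2 bs0 bi.
  apply: (total_int Sok _ bs0) => y; have [D [[//|D1] D2]] := dc y.
  apply: (bi D D1); have [_ r0 _ _] := dg D D1.
  by case: D2 => cy ry; split => //; apply: (lt_le_trans ry); rewrite ler_wpM2r ?(ltW r0) // ltW.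
pose l' := (1 + l) / 2.
pose K := \bigcup_(i in `I_(size done)) dcl (nth D done i).1.1 (nth D done i).1.2 (l' * (nth D done i).2).
pose Z := \bigcup_(i in `I_(size done)) O (nth D done i) l.
have nthI i : (i < size done)%N -> List.In (nth D done i) done.
  elim: (done) i => [//|a s IHs] [|i] /=; first by left.
  by move=> h; right; exact: IHs.
have cK : closed K.
  rewrite /K; apply: closed_bigcup => // i hi.
  have gi := dg _ (nthI i hi); have [_ r0 _ _] := gi.
  by apply: (dcl_closed Sok gi); apply: ler_wpM2r; rewrite ?ltW // /l'; slra.
have oZ : open Z.
  apply: bigcup_open => i hi; rewrite openE => y hy.
  have [cC _ _ _] := dg _ (nthI i hi); exact: (dop_nbhs Sok cC hy).
have KZ : K `<=` Z.
  move=> y [i hi [cy ry]]; exists i => //; split=> //; apply: (le_lt_trans ry).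
  have [_ r0 _ _] := dg _ (nthI i hi).
  by rewrite ltr_pM2r // /l'; slra.
have bZ y : Z y -> isint (b0 y).
  by move=> [i hi hy]; apply: (bi (nth D done i)) => //; exact: nthI.
have gD : gdisc D by apply: tg; left.
have [_ r0 _ _] := gD.
have [b1 [L1 [n1 [s1 t1 e1 k1]]]] := @cut_step D.1.1 D.1.2 D.2 b0 L0 n0 (l' * D.2) (l * D.2) K Z gD bs0
  ltac:(rewrite /l'; snra) ltac:(rewrite /l'; snra) ltac:(snra) cK oZ KZ bZ.
have [L2 [n2 [s2 t2]]] := total_sub Sok bs0 s1.
rewrite t1 subr0 in t2; rewrite -t2.
apply: (IH (D :: done) _ _ _ l' _ _ _ _ _ s2).
- by move=> D' h; apply: tg; right.
- by move=> D' [<-|]; [exact: gD|exact: dg].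
- move=> x; have [D' [[[h|h]|h] h2]] := dc x; exists D'; split=> //; [right; left|left|right; right] => //.
- by rewrite /l'; slra.
- by rewrite /l'; slra.
- move=> D' [<-|h] y Oy.
    by apply: e1; case: Oy => cy ry; split=> //; exact: ltW.
  have [i hi iD] : exists2 i, (i < size done)%N & nth D done i = D'.
    elim: (done) h => [//|a s IHs] /= [->|/IHs[i hi <-]]; first by exists 0%N.
    by exists i.+1.
  have Ky : K y by exists i => //; rewrite iD; case: Oy => cy ry; split=> //; exact: ltW.
  by apply: isintD; [apply: bZ; exact: KZ|apply: isintN; exact: k1].
Qed.

End StokesCut.

(** * Strict differentiability and the inverse function theorem *)

(** Row vectors form a complete space, as the inverse function theorem needs. *)
HB.instance Definition _ (R : realType) (n : nat) :=
  Uniform_isComplete.Build (matrix R 1 n) (@cauchy_cvg (matrix R 1 n)).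

Section StrictDifferentiability.
Variable R : realType.
Implicit Types V W Z : normedModType R.

(** A bounded additive map, hence a bounded linear one. *)
Definition blin V W (A : V -> W) : Prop := (forall h k, A (h - k) = A h - A k) /\
  exists2 C : R, 0 < C & forall h, `|A h| <= C * `|h|.

(** Strict differentiability of f at u with derivative A.  It follows from the
    continuity of the partial derivatives, is stable under composition, and is
    all that the inverse function theorem needs. *)
Definition sdiff V W (f : V -> W) (u : V) (A : V -> W) : Prop :=
  forall e : R, 0 < e -> exists2 r : R, 0 < r & forall x y, `|x - u| < r -> `|y - u| < r ->
    `|f x - f y - A (x - y)| <= e * `|x - y|.

Lemma blin0 V W (A : V -> W) : blin A -> A 0 = 0.
Proof. by move=> [h _]; rewrite -(subrr 0) h subrr. Qed.

Lemma blin_comp V W Z (A : V -> W) (B : W -> Z) : blin A -> blin B -> blin (B \o A).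
Proof.
move=> [a1 [C C0 a2]] [b1 [D D0 b2]]; split=> [h k|]; first by rewrite /= a1 b1.
exists (D * C); first exact: mulr_gt0.
by move=> h /=; apply: (le_trans (b2 _)); rewrite -mulrA ler_wpM2l // ltW.
Qed.

Lemma sdiff_lip V W (f : V -> W) u A : blin A -> sdiff f u A -> exists2 C : R, 0 < C &
  exists2 r : R, 0 < r & forall x y, `|x - u| < r -> `|y - u| < r -> `|f x - f y| <= C * `|x - y|.
Proof.
move=> [_ [C C0 Ab]] /(_ 1 ltr01)[r r0 h]; exists (1 + C); first by rewrite addr_gt0.
exists r => // x y xr yr; rewrite -(subrK (A (x - y)) (f x - f y)).
by apply: (le_trans (ler_normD _ _)); rewrite mulrDl lerD // h.
Qed.

Lemma sdiff_congr V W (f g : V -> W) u A : (\forall x \near u, f x = g x) -> sdiff f u A -> sdiff g u A.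
Proof.
move=> /nbhs_ballP[d d0 hd] fs e /fs[r r0 h]; have d0' : 0 < d by [].
exists (Num.min r d); first by rewrite lt_min r0.
have gf x : `|x - u| < d -> g x = f x.
  by move=> xd; rewrite -hd // -ball_normE /ball_ /= distrC.
by move=> x y; rewrite !lt_min => /andP[x1 x2] /andP[y1 y2]; rewrite !gf //; exact: h.
Qed.

Lemma sdiff_eqA V W (f : V -> W) u A B : (forall h, A h = B h) -> sdiff f u A -> sdiff f u B.
Proof. by move=> AB fs e /fs[r r0 h]; exists r => // x y xr yr; rewrite -AB; exact: h. Qed.

Lemma sdiff_comp V W Z (f : V -> W) (g : W -> Z) u A B : blin A -> blin B ->
  sdiff f u A -> sdiff g (f u) B -> sdiff (g \o f) u (B \o A).
Proof.
move=> lA lB fs gs e e0; have [C C0 [r r0 fl]] := sdiff_lip lA fs.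
have [B1 [D D0 Bb]] := lB.
have e1 : 0 < e / (2 * D) by rewrite divr_gt0 // mulr_gt0.
have e2 : 0 < e / (2 * C) by rewrite divr_gt0 // mulr_gt0.
have [r1 r10 h1] := fs _ e1; have [r2 r20 h2] := gs _ e2.
exists (Num.min r (Num.min r1 (r2 / C))); first by rewrite !lt_min r0 r10 divr_gt0.
move=> x y; rewrite !lt_min => /and3P[x1 x2 x3] /and3P[y1 y2 y3].
have u0 : `|u - u| < r by rewrite subrr normr0.
have fr z : `|z - u| < r -> `|z - u| < r2 / C -> `|f z - f u| < r2.
  by move=> zr zr2; apply: (le_lt_trans (fl _ _ zr u0)); rewrite mulrC -ltr_pdivlMr.
have -> : (g \o f) x - (g \o f) y - (B \o A) (x - y) =
    (g (f x) - g (f y) - B (f x - f y)) + B (f x - f y - A (x - y)).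
  by rewrite /= (B1 (f x - f y)) addrA subrK.
apply: (le_trans (ler_normD _ _)).
have k1 := h2 _ _ (fr x x1 x3) (fr y y1 y3).
have k2 := fl _ _ x1 y1; have k3 := h1 _ _ x2 y2; have k4 := Bb (f x - f y - A (x - y)).
have m1 : e / (2 * C) * (C * `|x - y|) = e / 2 * `|x - y| by field; rewrite gt_eqF.
have m2 : D * (e / (2 * D) * `|x - y|) = e / 2 * `|x - y| by field; rewrite gt_eqF.
have n1 : e / (2 * C) * `|f x - f y| <= e / (2 * C) * (C * `|x - y|) by rewrite ler_wpM2l // ltW.
have n2 : D * `|f x - f y - A (x - y)| <= D * (e / (2 * D) * `|x - y|) by rewrite ler_wpM2l // ltW.
rewrite m1 in n1; rewrite m2 in n2; slra.
Qed.

Lemma sdiff_cont V W (f : V -> W) u A : blin A -> sdiff f u A -> exists2 r : R, 0 < r &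
  mapc [set x | `|x - u| < r] f.
Proof.
move=> lA fs; have [C C0 [r r0 h]] := sdiff_lip lA fs; exists r => // x xr Z /nbhs_ballP[d d0 hd].
have d0' : 0 < d by [].
apply/nbhs_ballP; exists (d / C); first by rewrite /= divr_gt0.
move=> y; rewrite -ball_normE /ball_ /= => xy yr; apply: hd; rewrite -ball_normE /ball_ /=.
by apply: (le_lt_trans (h _ _ xr yr)); rewrite mulrC -ltr_pdivlMr.
Qed.

(** The inverse function theorem.  The iteration takes place in the target space,
    whose completeness it uses. *)
Lemma sdiff_invertible V (W : completeNormedModType R) (f : V -> W) u A A' :
  blin A -> blin A' -> (forall h, A' (A h) = h) -> (forall k, A (A' k) = k) -> sdiff f u A ->
  exists2 r : R, 0 < r & exists2 C : R, 0 < C &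
    (forall x y, `|x - u| < r -> `|y - u| < r -> `|x - y| <= C * `|f x - f y|) /\
    forall rho, 0 < rho -> exists2 s : R, 0 < s &
      forall w, `|w - f u| < s -> exists2 x, `|x - u| < rho & f x = w.
Proof.
move=> lA [A'1 [C C0 A'b]] A'A AA' fs; have lA' : blin A' by split=> //; exists C.
have e0 : 0 < 1 / (2 * C) by rewrite divr_gt0 // mulr_gt0.
have [r r0 h] := fs _ e0; exists r => //; exists (2 * C); first by rewrite mulr_gt0.
split=> [x y xr yr|rho rho0].
  have k1 := h x y xr yr; have k2 := A'b (f x - f y - A (x - y)).
  have k3 : `|A' (f x - f y)| <= C * `|f x - f y| by exact: A'b.
  have e : x - y = A' (f x - f y) - A' (f x - f y - A (x - y)).
    by rewrite -A'1 subKr A'A.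
  have k4 : `|x - y| <= `|A' (f x - f y)| + `|A' (f x - f y - A (x - y))|.
    by rewrite {1}e; apply: (le_trans (ler_normB _ _)).
  have k5 : C * `|f x - f y - A (x - y)| <= C * (1 / (2 * C) * `|x - y|) by rewrite ler_wpM2l // ltW.
  have m : C * (1 / (2 * C) * `|x - y|) = `|x - y| / 2 by field; rewrite gt_eqF.
  rewrite m in k5; slra.
pose d := Num.min r rho / (2 * C); have d0 : 0 < d by rewrite divr_gt0 ?mulr_gt0 // lt_min r0.
exists (d / 2); first by rewrite divr_gt0.
move=> w wd; pose U := [set k : W | `|k| <= d].
have Ur k : U k -> `|u + A' k - u| < Num.min r rho.
  move=> Uk; rewrite addrAC subrr add0r; apply: (le_lt_trans (A'b k)).
  have -> : Num.min r rho = 2 * C * d by rewrite /d; field; rewrite gt_eqF.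
  have : C * `|k| <= C * d by rewrite ler_wpM2l // ltW.
  have : 0 < C * d by rewrite mulr_gt0.
  slra.
pose Tf k := k + (w - f (u + A' k)).
have Td k l : U k -> U l -> `|Tf k - Tf l| <= 1 / 2 * `|k - l|.
  move=> Uk Ul; have := Ur k Uk; have := Ur l Ul; rewrite !lt_min => /andP[l1 _] /andP[k1 _].
  have := h _ _ k1 l1; have -> : u + A' k - (u + A' l) = A' (k - l).
    by rewrite A'1 opprD addrACA subrr add0r.
  rewrite AA' => k2.
  have -> : Tf k - Tf l = - (f (u + A' k) - f (u + A' l) - (k - l)).
    rewrite /Tf opprB opprD addrACA; congr (_ + _).
    by rewrite !opprB addrC subrKA.
  rewrite normrN; apply: (le_trans k2).
  have k3 := A'b (k - l).
  have m : 1 / 2 * `|k - l| = 1 / (2 * C) * (C * `|k - l|) by field; rewrite gt_eqF.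
  by rewrite m ler_wpM2l // ltW.
have U0 : U 0 by rewrite /U /= normr0 ltW.
have TU k : U k -> U (Tf k).
  move=> Uk; rewrite /U /= -(subrK (Tf 0) (Tf k)); apply: (le_trans (ler_normD _ _)).
  have T0 : Tf 0 = w - f u by rewrite /Tf (blin0 lA') addr0 add0r.
  have := Td k 0 Uk U0; rewrite subr0 T0 => k1.
  have Uk' : `|k| <= d by exact: Uk.
  slra.
pose TF := mkfun (TU : {homo Tf : k / U k >-> U k}).
have ctr : is_contraction TF.
  exists (1 / 2)%:nng; split; first by rewrite /=; slra.
  by move=> [k l] [Uk Ul]; exact: Td.
have cU : closed U.
  have -> : U = (fun k : W => `|k|) @^-1` [set x : R | x <= d] by [].
  by apply: closed_comp => [k _|]; [exact: norm_continuous|exact: closed_le].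
have [k Uk ek] := banach_fixed_point ctr cU (ex_intro _ 0 U0).
exists (u + A' k); first by have := Ur k Uk; rewrite lt_min => /andP[].
apply/esym/eqP; rewrite -subr_eq0; apply/eqP/(addrI k); rewrite addr0; exact: esym ek.
Qed.

(** The relation between increments is read backwards, with the Lipschitz
    constant of the inverse. *)
Lemma sdiff_inverse V W (f : V -> W) (g : W -> V) w A A' (s C : R) : blin A' ->
  (forall h, A' (A h) = h) -> 0 < s -> 0 < C ->
  (forall x y, `|x - w| < s -> `|y - w| < s -> `|g x - g y| <= C * `|x - y|) ->
  (forall x, `|x - w| < s -> f (g x) = x) -> sdiff f (g w) A -> sdiff g w A'.
Proof.
move=> lA' A'A s0 C0 gl fg fs e e0; have [A'1 [D D0 A'b]] := lA'.
have e1 : 0 < e / (D * C) by rewrite divr_gt0 // mulr_gt0.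
have [r r0 h] := fs _ e1; exists (Num.min s (r / C)); first by rewrite lt_min s0 divr_gt0.
move=> x y; rewrite !lt_min => /andP[x1 x2] /andP[y1 y2].
have w0 : `|w - w| < s by rewrite subrr normr0.
have gr z : `|z - w| < s -> `|z - w| < r / C -> `|g z - g w| < r.
  by move=> z1 z2; apply: (le_lt_trans (gl _ _ z1 w0)); rewrite mulrC -ltr_pdivlMr.
have := h _ _ (gr _ x1 x2) (gr _ y1 y2); rewrite !fg // => k1.
have -> : g x - g y - A' (x - y) = - A' (x - y - A (g x - g y)).
  by rewrite (A'1 (x - y)) A'A opprB.
rewrite normrN; apply: (le_trans (A'b _)); have k2 := gl _ _ x1 y1.
have k3 : e / (D * C) * `|g x - g y| <= e / (D * C) * (C * `|x - y|) by rewrite ler_wpM2l // ltW.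
have m : e * `|x - y| = D * (e / (D * C) * (C * `|x - y|)) by field; rewrite !gt_eqF.
by rewrite m ler_wpM2l ?(ltW D0) //; slra.
Qed.

Lemma row_norm_ge n (u : 'rV[R]_n) j : `|u 0 j| <= `|u|.
Proof.
rewrite [leRHS]/Num.Def.normr /= mx_normrE; exact: (@le_bigmax _ _ _ _ (fun i => `|u i.1 i.2|) (0, j)).
Qed.

Lemma row_norm_le n (u : 'rV[R]_n) (e : R) : 0 <= e -> (forall j, `|u 0 j| <= e) -> `|u| <= e.
Proof.
move=> e0 h; rewrite [leLHS]/Num.Def.normr /= mx_normrE bigmax_le // => -[i j] _ /=.
by rewrite ord1.
Qed.

Lemma row_norm_lt n (u : 'rV[R]_n) (e : R) : 0 < e -> (forall j, `|u 0 j| < e) -> `|u| < e.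
Proof.
move=> e0 h; rewrite [ltLHS]/Num.Def.normr /= mx_normrE bigmax_lt // => -[i j] _ /=.
by rewrite ord1.
Qed.

Lemma blin_mulmx n m (A : 'M[R]_(n, m)) : blin (fun h : 'rV[R]_n => h *m A).
Proof.
split=> [h k|]; first by rewrite mulmxBl.
pose C := \sum_i \sum_j `|A i j|.
have C0 : 0 <= C by apply: sumr_ge0 => i _; apply: sumr_ge0.
exists (C + 1); first slra.
move=> h; apply: (@le_trans _ _ (C * `|h|)); last by rewrite ler_wpM2r //; slra.
apply: row_norm_le => [|j]; first exact: mulr_ge0.
rewrite mxE; apply: (le_trans (ler_norm_sum _ _ _)).
rewrite mulr_suml; apply: ler_sum => i _; rewrite normrM mulrC.
apply: ler_pM => //; last exact: row_norm_ge.
by rewrite (bigD1 j) //= lerDl; apply: sumr_ge0.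
Qed.

Lemma conv_lt (t a b r : R) : 0 <= t -> t <= 1 -> a < r -> b < r -> (1 - t) * a + t * b < r.
Proof.
move=> t0 t1 ar br; pose m := Num.max a b.
have am : a <= m by rewrite le_max lexx.
have bm : b <= m by rewrite le_max lexx orbT.
have mr : m < r by rewrite gt_max ar.
by apply: le_lt_trans mr; snra.
Qed.

(** The mean value theorem, applied to each coordinate along a segment in the
    direction v on which the derivative is nearly constant. *)
Lemma C1_dir V m (f : V -> 'rV[R]_m) (U : set V) u v : open U -> U u -> Ck 1 U f ->
  forall e : R, 0 < e -> exists2 r : R, 0 < r & forall x (c : R), `|x - u| < r ->
    `|x + c *: v - u| < r -> `|f (x + c *: v) - f x - c *: 'D_v f u| <= e * `|c|.
Proof.
move=> oU Uu [fd fc] e e0; have Dc : {for u, continuous (fun x => 'D_v f x)} := fc v u Uu.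
have : nbhs u (U `&` [set x | `|'D_v f u - 'D_v f x| < e]).
  apply: filterI; first by apply: open_nbhs_nbhs.
  by move/cvgrPdist_lt: Dc; apply.
move=> /nbhs_ballP[r r0 hr]; exists r => //.
have hr' x : `|x - u| < r -> U x /\ `|'D_v f u - 'D_v f x| < e.
  by move=> xr; apply: hr; rewrite -ball_normE /ball_ /= distrC.
have key x c : 0 <= c -> `|x - u| < r -> `|x + c *: v - u| < r ->
    `|f (x + c *: v) - f x - c *: 'D_v f u| <= e * c.
  move=> c0 xr yr; apply: row_norm_le => [|j]; first by rewrite mulr_ge0 // ltW.
  have seg s : 0 <= s -> s <= c -> `|x + s *: v - u| < r.
    move=> s0 sc; have [c00|c1] := eqVneq c 0.
      by have -> : s = 0; [slra|rewrite scale0r addr0].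
    have cp : 0 < c by rewrite lt_neqAle eq_sym c1.
    have -> : x + s *: v - u = (1 - s / c) *: (x - u) + (s / c) *: (x + c *: v - u).
      rewrite [x + s *: v - u]addrAC [x + c *: v - u]addrAC (scalerDr (s / c) (x - u) (c *: v)) scalerA divfK // addrA -scalerDl subrK scale1r.
      by [].
    have t0 : 0 <= s / c by rewrite divr_ge0.
    have t1 : s / c <= 1 by rewrite ler_pdivrMr // mul1r.
    set t := s / c in t0 t1 *; apply: (le_lt_trans (ler_normD _ _)).
    have -> : `|(1 - t) *: (x - u)| = (1 - t) * `|x - u| by rewrite normrZ ger0_norm ?subr_ge0.
    have -> : `|t *: (x + c *: v - u)| = t * `|x + c *: v - u| by rewrite normrZ ger0_norm.
    exact: conv_lt.
  pose phi s := f (x + s *: v) 0 j; pose dphi s := 'D_v f (x + s *: v) 0 j.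
  have der s : 0 <= s -> s <= c -> is_derive s 1 phi (dphi s).
    move=> s0 sc; have [Uy _] := hr' _ (seg s s0 sc); set y := x + s *: v in Uy.
    have fv : derivable f y v by exact/diff_derivable/fd.
    have fj := (derivable_mxP f y v).1 fv 0 j.
    have dE : 'D_v f y 0 j = 'D_v (fun z => f z 0 j) y by rewrite derive_mx // mxE.
    have E : (fun h : R => h^-1 *: (phi (h *: 1 + s) - phi s)) =
             (fun h : R => h^-1 *: (f (h *: v + y) 0 j - f y 0 j)).
      apply/funext => h; congr (_ *: (f _ 0 j - _)).
      by rewrite /y addrCA -scalerDl [h *: 1]mulr1.
    apply: DeriveDef; first by rewrite /derivable E.
    by rewrite /dphi -/y dE /derive E.
  have phc : {within `[0, c], continuous phi}.
    apply: derivable_within_continuous => s; rewrite in_itv /= => /andP[s0 sc].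
    by have [] := der s s0 sc.
  have [|xi] := @MVT_segment R phi dphi 0 c c0 _ phc.
    by move=> s; rewrite in_itv /= => /andP[s0 sc]; apply: der; exact: ltW.
  rewrite in_itv /= => /andP[x0 xc]; rewrite subr0 => E.
  have -> : (f (x + c *: v) - f x - c *: 'D_v f u) 0 j = (dphi xi - 'D_v f u 0 j) * c.
    by rewrite !mxE mulrBl -E /phi scale0r addr0 [c * _]mulrC.
  rewrite normrM (ger0_norm c0) ler_wpM2r //.
  have [_ /ltW] := hr' _ (seg xi x0 xc); rewrite distrC; apply: le_trans.
  by apply: le_trans (row_norm_ge _ j); rewrite !mxE.
move=> x c xr yr; have [c0|c0] := leP 0 c; first by rewrite (ger0_norm c0); exact: key.
have := key (x + c *: v) (- c); rewrite scaleNr addrK => /(_ _ yr xr).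
rewrite (ltr0_norm c0) => k; rewrite -normrN.
have -> : - (f (x + c *: v) - f x - c *: 'D_v f u) = f x - f (x + c *: v) - - (c *: 'D_v f u).
  by rewrite !opprB opprK addrC.
by rewrite -scaleNr; apply: k; slra.
Qed.

(** The increment is split along a path parallel to the directions v. *)
Lemma C1_path V m (f : V -> 'rV[R]_m) (U : set V) u (v : nat -> V) n : open U -> U u -> Ck 1 U f ->
  forall e : R, 0 < e -> exists2 r : R, 0 < r & forall x (c : nat -> R),
    (forall k, (k <= n)%N -> `|x + \sum_(i < k) c i *: v i - u| < r) ->
    `|f (x + \sum_(i < n) c i *: v i) - f x - \sum_(i < n) c i *: 'D_(v i) f u| <= e * \sum_(i < n) `|c i|.
Proof.
move=> oU Uu fC e e0; elim: n => [|n [r r0 IH]].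
  by exists 1 => // x c _; rewrite !big_ord0 addr0 subrr subr0 normr0 mulr0.
have [r1 r10 h] := C1_dir (v n) oU Uu fC e0; exists (Num.min r r1); first by rewrite lt_min r0.
move=> x c hx; rewrite !big_ord_recr /= addrA.
set y := x + \sum_(i < n) _; set D := \sum_(i < n) _.
have k1 : `|f y - f x - D| <= e * \sum_(i < n) `|c i|.
  by apply: IH => k kn; have := hx k (leqW kn); rewrite lt_min => /andP[].
have k2 : `|f (y + c n *: v n) - f y - c n *: 'D_(v n) f u| <= e * `|c n|.
  apply: h; first by have := hx n (leqnSn n); rewrite lt_min => /andP[].
  by have := hx n.+1 (leqnn _); rewrite lt_min big_ord_recr /= addrA => /andP[].
have -> : f (y + c n *: v n) - f x - (D + c n *: 'D_(v n) f u) =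
    (f y - f x - D) + (f (y + c n *: v n) - f y - c n *: 'D_(v n) f u).
  by apply/eqP; rewrite -subr_eq0; apply/eqP; set a := f _; set b := f _; set d := _ *: _;
     apply/rowP => j; rewrite !mxE; ring.
by apply: (le_trans (ler_normD _ _)); rewrite mulrDr lerD.
Qed.

Lemma row_partial n (h : 'rV[R]_n.+1) k (j : 'I_n.+1) :
  (\sum_(i < k) h 0 (inord i) *: delta_mx 0 (inord i) : 'rV[R]_n.+1) 0 j =
  if (k <= n.+1)%N then (if (j < k)%N then h 0 j else 0) else (\sum_(i < k) h 0 (inord i) *: delta_mx 0 (inord i) : 'rV[R]_n.+1) 0 j.
Proof.
case: ifP => // kn; elim: k kn => [|k IH] kn; first by rewrite big_ord0 mxE.
rewrite big_ord_recr /= mxE IH; last exact: ltnW.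
rewrite !mxE eqxx /= ltnS.
have -> : (j == inord k) = (j == k :> nat) by rewrite -val_eqE /= inordK.
case: ltngtP => [||e]; rewrite ?mulr0 ?addr0 //.
by rewrite -e inord_val mulr1 add0r.
Qed.

Lemma half_bound (e p q a b m : R) : 0 < e -> p <= e / 2 * a -> q <= e / 2 * b -> a <= m -> b <= m ->
  p + q <= e * m.
Proof. snra. Qed.

Lemma mean_le n (c : nat -> R) (N e : R) : 0 <= e -> (forall i : 'I_n.+1, `|c i| <= N) ->
  e / n.+1%:R * \sum_(i < n.+1) `|c i| <= e * N.
Proof.
move=> e0 h; rewrite -mulrA ler_wpM2l // ler_pdivrMl //.
apply: (@le_trans _ _ (\sum_(i < n.+1) N)); first by apply: ler_sum => i _; exact: h.
by rewrite big_const_ord iter_addr_0 mulr_natl.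
Qed.

(** The path from y to x follows the coordinate axes one by one. *)
Lemma C1_row n m (f : 'rV[R]_n.+1 -> 'rV[R]_m) (U : set 'rV[R]_n.+1) u :
  open U -> U u -> Ck 1 U f -> sdiff f u (fun h => h *m 'J f u).
Proof.
move=> oU Uu fC e e0; pose v i : 'rV[R]_n.+1 := delta_mx 0 (inord i).
have e1 : 0 < e / n.+1%:R by rewrite divr_gt0.
have [r r0 H] := @C1_path _ _ f U u v n.+1 oU Uu fC _ e1.
exists r => // y x yr xr; pose c i := (y - x) 0 (inord i).
have P k (kn : (k <= n.+1)%N) j : (\sum_(i < k) c i *: v i) 0 j = if (j < k)%N then (y - x) 0 j else 0.
  by rewrite row_partial kn.
have -> : (y - x) *m 'J f u = \sum_(i < n.+1) c i *: 'D_(v i) f u.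
  rewrite {1}(_ : y - x = \sum_(i < n.+1) c i *: v i).
    rewrite mulmx_suml; apply: eq_bigr => i _; rewrite -scalemxAl deriveEjacobian //.
    exact: fC.1.
  by apply/rowP => j; rewrite P // ltn_ord.
have E : y = x + \sum_(i < n.+1) c i *: v i.
  by apply/rowP => j; rewrite mxE P // ltn_ord !mxE; ring.
rewrite {1}E; apply: le_trans (H x c _) _.
  move=> k kn; apply: row_norm_lt => // j; rewrite 2!mxE P // !mxE.
  case: ifP => _; first by have := le_lt_trans (row_norm_ge (y - u) j) yr; rewrite !mxE; rewrite addrCA subrr addr0.
  by have := le_lt_trans (row_norm_ge (x - u) j) xr; rewrite !mxE addr0.
by apply: mean_le => [|i]; [exact: ltW|exact: row_norm_ge].
Qed.

Lemma pair_norm V W (p : V * W) : `|p| = Num.max `|p.1| `|p.2|.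
Proof. by []. Qed.

Lemma C1_pair n m (f : R * 'rV[R]_n.+1 -> 'rV[R]_m) U u t : open U -> U (t, u) -> Ck 1 U f ->
  sdiff f (t, u) (fun h => h.1 *: 'D_(1, 0) f (t, u) + \sum_(i < n.+1) h.2 0 i *: 'D_(0, delta_mx 0 i) f (t, u)).
Proof.
move=> oU Uu fC e e0; have e2 : 0 < e / 2 by rewrite divr_gt0.
have [r1 r10 H1] := C1_dir ((1 : R), (0 : 'rV[R]_n.+1)) oU Uu fC e2.
pose v i : R * 'rV[R]_n.+1 := (0, delta_mx 0 (inord i)).
have e1 : 0 < e / 2 / n.+1%:R by rewrite divr_gt0.
have [r2 r20 H2] := @C1_path _ _ f U (t, u) v n.+1 oU Uu fC _ e1.
exists (Num.min r1 r2); first by rewrite lt_min r10.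
move=> [b y] [a x]; rewrite !pair_norm /= !lt_min !gt_max => /andP[/andP[b1 y1] /andP[b2 y2]].
move=> /andP[/andP[a1 x1] /andP[a2 x2]].
have k1 := H1 (a, y) (b - a); have E1 : (a, y) + (b - a) *: ((1 : R), (0 : 'rV[R]_n.+1)) = (b, y).
  by congr pair => /=; rewrite ?scaler0 ?addr0 // [_ *: _]mulr1 addrC subrK.
rewrite E1 !pair_norm /= !gt_max a1 y1 b1 in k1; have {}k1 := k1 isT isT.
pose c i := (y - x) 0 (inord i).
have S k : \sum_(i < k) c i *: v i = (0, \sum_(i < k) c i *: delta_mx 0 (inord i)).
  elim: k => [|k IH]; first by rewrite !big_ord0.
  by rewrite !big_ord_recr /= IH; congr pair; rewrite /= [_ *: 0]mulr0 addr0.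
have P k (kn : (k <= n.+1)%N) j : (\sum_(i < k) c i *: delta_mx 0 (inord i) : 'rV[R]_n.+1) 0 j = if (j < k)%N then (y - x) 0 j else 0.
  by rewrite row_partial kn.
have E2 : (a, x) + \sum_(i < n.+1) c i *: v i = (a, y).
  rewrite S; congr pair; rewrite /= ?addr0 //.
  by apply/rowP => j; rewrite mxE P // ltn_ord !mxE; ring.
have k2 := H2 (a, x) c; rewrite E2 in k2.
have {}k2 : `|f (a, y) - f (a, x) - \sum_(i < n.+1) c i *: 'D_(v i) f (t, u)| <= e / 2 / n.+1%:R * \sum_(i < n.+1) `|c i|.
  apply: k2 => k kn; rewrite S pair_norm /= addr0 gt_max a2 /=.
  apply: row_norm_lt => // j; rewrite 2!mxE P // !mxE.
  case: ifP => _; first by have := le_lt_trans (row_norm_ge (y - u) j) y2; rewrite !mxE; rewrite addrCA subrr addr0.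
  by have := le_lt_trans (row_norm_ge (x - u) j) x2; rewrite !mxE addr0.
have sE : \sum_(i < n.+1) (y - x) 0 i *: 'D_(0, delta_mx 0 i) f (t, u) = \sum_(i < n.+1) c i *: 'D_(v i) f (t, u).
  by apply: eq_bigr => i _; rewrite /c /v inord_val.
rewrite sE; set D1 := 'D_(1, 0) f (t, u) in k1 *; set D2 := \sum_(i < n.+1) _ in k2 *.
have -> : f (b, y) - f (a, x) - ((b - a) *: D1 + D2) =
    (f (b, y) - f (a, y) - (b - a) *: D1) + (f (a, y) - f (a, x) - D2).
  by apply/rowP => j; rewrite !mxE; ring.
apply: (le_trans (ler_normD _ _)).
have k3 : e / 2 / n.+1%:R * \sum_(i < n.+1) `|c i| <= e / 2 * `|y - x|.
  by apply: mean_le => [|i]; [exact: ltW|exact: row_norm_ge].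
have m1 : `|b - a| <= Num.max `|b - a| `|y - x| by rewrite le_max lexx.
have m2 : `|y - x| <= Num.max `|b - a| `|y - x| by rewrite le_max lexx orbT.
exact: (half_bound e0 k1 (le_trans k2 k3) m1 m2).
Qed.

End StrictDifferentiability.

(** * Frames and flow boxes *)

Section Frames.
Variable R : realType.

Definition frame (J : 'M[R]_(2, 3)) (v : 'rV[R]_3) : 'rV[R]_2 * R -> 'rV[R]_3 :=
  fun p => p.1 *m J + p.2 *: v.

Definition framemx (v : 'rV[R]_3) (J : 'M[R]_(2, 3)) : 'M[R]_3 := col_mx v J.

Definition coframe (J : 'M[R]_(2, 3)) (v : 'rV[R]_3) : 'rV[R]_3 -> 'rV[R]_2 * R :=
  fun w => let z : 'rV[R]_(1 + 2) := w *m invmx (framemx v J) in (rsubmx z, lsubmx z 0 0).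

Lemma frameE J v p : frame J v p = (row_mx (p.2%:M : 'rV_1) p.1 : 'rV[R]_3) *m framemx v J.
Proof. rewrite /frame /framemx; apply: etrans (esym (@mul_row_col R 1 1 2 3 p.2%:M p.1 v J)).
by rewrite mul_scalar_mx addrC. Qed.

Lemma coframeK J v : \det (framemx v J) != 0 -> forall k, frame J v (coframe J v k) = k.
Proof.
move=> d0 k; have u : framemx v J \in unitmx by rewrite unitmxE unitfE.
rewrite frameE /coframe /=; set z := k *m _.
have -> : (lsubmx (z : 'rV_(1 + 2)) 0 0)%:M = lsubmx (z : 'rV_(1 + 2)) by rewrite -mx11_scalar.
by rewrite hsubmxK /z mulmxKV.
Qed.

Lemma frameK J v : \det (framemx v J) != 0 -> forall p, coframe J v (frame J v p) = p.
Proof.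
move=> d0 [a t]; have u : framemx v J \in unitmx by rewrite unitmxE unitfE.
by rewrite /coframe frameE mulmxK //= row_mxKr row_mxKl mxE eqxx mulr1n.
Qed.

Lemma blin_frame J v : blin (frame J v).
Proof.
have [J1 [C C0 Jb]] := blin_mulmx J; split=> [h k|].
  by rewrite /frame /= J1 scalerBl opprD addrACA.
exists (C + `|v|); first by rewrite ltr_pwDl.
move=> [a t]; rewrite /frame pair_norm /= mulrDl; apply: (le_trans (ler_normD _ _)); apply: lerD.
  by apply: (le_trans (Jb a)); rewrite ler_wpM2l ?(ltW C0) // le_max lexx.
by rewrite normrZ mulrC ler_wpM2l // le_max lexx orbT.
Qed.

Lemma blin_coframe J v : blin (coframe J v).
Proof.
have [J1 [C C0 Jb]] := blin_mulmx (invmx (framemx v J)); split=> [h k|].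
  rewrite /coframe J1; congr pair; last by rewrite !mxE.
  by apply/rowP => j; rewrite !mxE.
exists C => // w; rewrite /coframe pair_norm /= ge_max; apply/andP; split.
  apply: le_trans (Jb w); apply: row_norm_le => // j; rewrite mxE; exact: row_norm_ge.
by apply: le_trans (Jb w); rewrite mxE; exact: row_norm_ge.
Qed.

(** The two coordinates transverse to v in the frame (v, N). *)
Definition normal_mx (v : 'rV[R]_3) (N : 'M[R]_(2, 3)) : 'M[R]_(3, 2) :=
  @rsubmx R 3 1 2 (invmx (framemx v N)).

(** The velocity direction being divided out, the frame determinant becomes a
    two-dimensional one. *)
Lemma det_framemx (v : 'rV[R]_3) (N J : 'M[R]_(2, 3)) : \det (framemx v N) != 0 ->
  \det (framemx v J) = \det (J *m normal_mx v N) * \det (framemx v N).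
Proof.
move=> d0; have u : framemx v N \in unitmx by rewrite unitmxE unitfE.
set I := invmx (framemx v N).
have e1 : v *m I = row_mx 1%:M 0 :> 'M[R]_(1, 1 + 2).
  have e : col_mx (v *m I) (N *m I) = col_mx (row_mx 1%:M 0) (row_mx 0 1%:M) :> 'M[R]_(1 + 2, 1 + 2).
    rewrite -(@mul_col_mx R 1 2 3 (1 + 2) v N I); apply: etrans (mulmxV u) _.
    exact: (@scalar_mx_block R 1 2 1).
  by have [] := eq_col_mx e.
rewrite -{1}[framemx v J](mulmxKV u) det_mulmx -/I; congr (_ * _).
have -> : framemx v J *m I = block_mx 1%:M 0 (@lsubmx R 2 1 2 (J *m I)) (@rsubmx R 2 1 2 (J *m I)) :> 'M[R]_(1 + 2).
  by rewrite /framemx (@mul_col_mx R 1 2 3 (1 + 2) v J I) e1 /block_mx hsubmxK.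
by rewrite (@det_lblock R 1 2) det1 mul1r /normal_mx -/I (@mulmx_rsub R 2 3 1 2).
Qed.

Lemma det3 (M : 'M[R]_3) : \det M =
  M 0 0 * (M 1 1 * M 2 2 - M 1 2 * M 2 1) - M 0 1 * (M 1 0 * M 2 2 - M 1 2 * M 2 0)
  + M 0 2 * (M 1 0 * M 2 1 - M 1 1 * M 2 0).
Proof.
pose f (i j : nat) := M (inord i) (inord j).
have E i j : M i j = f i j by rewrite /f !inord_val.
rewrite (expand_det_row _ 0) !big_ord_recl big_ord0 addr0 /cofactor.
rewrite !(expand_det_row _ 0) !big_ord_recl !big_ord0 !addr0 /cofactor !det_mx11 !mxE !E /= /bump /=.
rewrite !(addn0, add0n, add1n).
have -> : (1 %% 3 = 1)%N by [].
have -> : ((1 + 1) %% 3 = 2)%N by [].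
ring.
Qed.

Lemma det2 (M : 'M[R]_2) : \det M = M 0 0 * M 1 1 - M 0 1 * M 1 0.
Proof.
rewrite (expand_det_row _ 0) !big_ord_recl big_ord0 addr0 /cofactor !det_mx11 !mxE /=.
rewrite expr0 expr1 mul1r mulN1r mulrN; congr (M _ _ * M _ _ - M _ _ * M _ _); exact: val_inj.
Qed.

End Frames.

Section Charts.
Variable R : realType.

Lemma chart_fwd_near n (M : topologicalType) (H : set 'rV[R]_n) (c : chart R n M) x V :
  is_chart H c -> cdom c x -> nbhs (cfwd c x) V -> \forall y \near x, cdom c y /\ V (cfwd c y).
Proof.
move=> ok cx hV; have /mapcP h := chart_fwd_cont ok.
have cn : nbhs x (cdom c) by apply: open_nbhs_nbhs; split => //; exact: chart_open ok.
by apply: filterS2 cn (h x cx V hV) => y cy; split=> //; auto.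
Qed.

Lemma chart_inv_near n (M : topologicalType) (H : set 'rV[R]_n) (c : chart R n M) x V :
  is_chart H c -> cdom c x -> nbhs x V ->
  \forall u \near cfwd c x, H u -> [/\ cdom c (cinv c u), cfwd c (cinv c u) = u & V (cinv c u)].
Proof.
move=> ok cx hV; have /mapcP h := chart_inv_cont ok; have [Q Qo e] := chart_image ok.
have ix : (cfwd c @` cdom c) (cfwd c x) by exists x.
have On : nbhs (cfwd c x) Q.
  by apply: open_nbhs_nbhs; split => //; move: ix; rewrite e => -[].
have hV' : nbhs (cinv c (cfwd c x)) V by rewrite (chart_cancel ok cx).
apply: filterS2 On (h _ ix V hV') => u Ou hu Hu.
have iu : (cfwd c @` cdom c) u by rewrite e.
by have [y cy yu] := iu; split; rewrite -?yu ?(chart_cancel ok cy) //; rewrite -yu in hu iu;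
   have := hu iu; rewrite (chart_cancel ok cy).
Qed.

Lemma near_norm (V : normedModType R) (u : V) (r : R) : 0 < r -> \forall w \near u, `|w - u| < r.
Proof.
by move=> r0; apply/nbhs_ballP; exists r => // w; rewrite -ball_normE /ball_ /= distrC.
Qed.

Lemma norm_near (V : normedModType R) (u : V) (P : set V) : (\forall w \near u, P w) ->
  exists2 r : R, 0 < r & forall w, `|w - u| < r -> P w.
Proof.
move=> /nbhs_ballP[r r0 h]; exists r => // w wr; apply: h.
by rewrite -ball_normE /ball_ /= distrC.
Qed.

Section FlowCharts.
Variables (M : topologicalType) (A : set (chart R 3 M)) (phi : R -> M -> M).
Hypothesis AM : oriented_atlas setT A.
Hypothesis hphi : smooth_flow A phi.
Implicit Types (d : chart R 3 M) (p : M).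

Lemma flow_near t x V : nbhs (phi t x) V -> exists2 P : set R, nbhs t P & exists2 Q : set M, nbhs x Q &
  forall t' y, P t' -> Q y -> V (phi t' y).
Proof.
move=> hV; have [[P Q] /= [hP hQ] PQ] := @flow_cont _ _ _ _ hphi (t, x) V hV.
by exists P => //; exists Q => // t' y Pt Qy; apply: (PQ (t', y)).
Qed.

Lemma flow_near0 (x : M) V : nbhs x V -> exists2 P : set R, nbhs (0 : R) P & exists2 Q : set M, nbhs x Q &
  forall t' y, P t' -> Q y -> V (phi t' y).
Proof. by move=> hV; apply: flow_near; rewrite (flow0 hphi). Qed.

Definition flow_in d (z : R * 'rV[R]_3) : 'rV[R]_3 := cfwd d (phi z.1 (cinv d z.2)).

Lemma flow_in_near d p V : A d -> cdom d p -> nbhs p V -> exists2 r : R, 0 < r &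
  forall t u, `|t| < r -> `|u - cfwd d p| < r ->
    [/\ cdom d (cinv d u), cfwd d (cinv d u) = u, cdom d (phi t (cinv d u)) & V (phi t (cinv d u))].
Proof.
move=> dA dp hV; have ok := atlas_chart AM dA.
have dn : nbhs p (cdom d) by apply: open_nbhs_nbhs; split => //; exact: chart_open ok.
have [P hP [Q hQ PQ]] := flow_near0 (filterI dn hV).
have [r1 r10 h1] := norm_near hP.
have [r2 r20 h2] := norm_near (chart_inv_near ok dp hQ).
exists (Num.min r1 r2); first by rewrite lt_min r10.
move=> t u; rewrite !lt_min => /andP[t1 _] /andP[_ u2].
have [a b c] := h2 u u2 I.
have P1 : P t by apply: h1; rewrite subr0.
by have [h3 h4] := PQ t (cinv d u) P1 c; split.
Qed.

(** At time 0 the derivative in the space directions is the identity, since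
    the flow is the identity; only the time direction has to be named. *)
Lemma flow_chart_sdiff d p : A d -> cdom d p ->
  sdiff (flow_in d) (0, cfwd d p) (fun h => h.1 *: velocity phi d p + h.2).
Proof.
move=> dA dp; have ok := atlas_chart AM dA; set u0 := cfwd d p.
have [r r0 hr] := flow_in_near dA dp filterT.
have hD t u : `|t| < r -> `|u - u0| < r ->
    [set z : R * 'rV[R]_3 | exists x, [/\ cdom d x, cfwd d x = z.2 & cdom d (phi z.1 x)]] (t, u).
  by move=> tr ur; have [h1 h2 h3 _] := hr t u tr ur; exists (cinv d u).
have z0 : `|(0 : R)| < r by rewrite normr0.
have u00 : `|u0 - u0| < r by rewrite subrr normr0.
have [U [g [Uo Uu gC gf]]] := flow_smooth hphi dA dA (hD 0 u0 z0 u00).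
have gs := C1_pair Uo Uu (gC 1).
have Un : nbhs ((0 : R), u0) U by apply: open_nbhs_nbhs.
have nE : \forall z \near ((0 : R), u0), g z = flow_in d z.
  apply: filterS2 Un (near_norm ((0 : R), u0) r0) => -[t u] Uz.
  by rewrite pair_norm /= subr0 gt_max => /andP[tr ur]; apply: gf => //; exact: hD.
have vE : 'D_(1, 0) g (0, u0) = velocity phi d p.
  rewrite (near_eq_derive _ nE) /derive /velocity /derive1.
  apply: congr1; apply: (congr1 (fun k => fmap k _)); apply/funext => s; congr (_ *: (_ - _)).
    by rewrite /flow_in /= scaler0 add0r (chart_cancel ok dp) [s *: 1]mulr1.
  by rewrite /flow_in /= (chart_cancel ok dp).
have dE (i : 'I_3) : 'D_(0, delta_mx 0 i) g (0, u0) = delta_mx 0 i.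
  rewrite (near_eq_derive _ nE).
  have -> : 'D_(0, delta_mx 0 i) (flow_in d) (0, u0) = 'D_(delta_mx 0 i) (fun u => flow_in d (0, u)) u0.
    rewrite /derive; apply: congr1; apply: (congr1 (fun k => fmap k _)); apply/funext => s; congr (_ *: (_ - _)).
    by rewrite /= /shift /=; congr (flow_in d (_, _)); rewrite addr0; exact: mulr0.
  have nE2 : \forall u \near u0, flow_in d (0, u) = id u.
    apply: filterS (near_norm u0 r0) => u ur; have [_ h2 _ _] := hr 0 u z0 ur.
    by rewrite /flow_in /= (flow0 hphi).
  by rewrite (near_eq_derive _ nE2) derive_id.
apply: sdiff_eqA (sdiff_congr nE gs) => h.
by rewrite vE (eq_bigr _ (fun i _ => congr1 _ (dE i))) -row_sum_delta.
Qed.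

Lemma velocity_flow d p : A d -> cdom d p -> forall e : R, 0 < e -> \forall t \near (0 : R),
  `|cfwd d (phi t p) - cfwd d p - t *: velocity phi d p| <= e * `|t|.
Proof.
move=> dA dp e e0; have ok := atlas_chart AM dA.
have [r r0 h] := flow_chart_sdiff dA dp e0.
apply: filterS (near_norm (0 : R) r0) => t; rewrite subr0 => tr.
have := h (t, cfwd d p) (0, cfwd d p).
have n0 : `|(0 : R)| < r by rewrite normr0.
have n1 : `|(0 : 'rV[R]_3)| < r by rewrite normr0.
rewrite !pair_norm /= /flow_in /= !subrr !subr0 !gt_max tr n0 n1 => /(_ isT isT).
rewrite (chart_cancel ok dp) (flow0 hphi) addr0.
have -> : Num.max `|t| `|(0 : 'rV[R]_3)| = `|t| by apply/max_idPl; rewrite normr0.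
by [].
Qed.

Lemma flow_disc_sdiff d p (g : 'rV[R]_2 -> 'rV[R]_3) a0 J : A d -> cdom d p -> g a0 = cfwd d p ->
  sdiff g a0 (fun h => h *m J) ->
  sdiff (fun q : 'rV[R]_2 * R => flow_in d (q.2, g q.1)) (a0, 0) (frame J (velocity phi d p)).
Proof.
move=> dA dp g0 gs; set v := velocity phi d p; set u0 := cfwd d p in g0 *.
pose L (q : 'rV[R]_2 * R) : R * 'rV[R]_3 := (q.2, g q.1).
pose LA (h : 'rV[R]_2 * R) : R * 'rV[R]_3 := (h.2, h.1 *m J).
have lL : blin LA.
  have [J1 [C C0 Jb]] := blin_mulmx J; split=> [h k|]; first by rewrite /LA /= J1.
  exists (C + 1); first by rewrite addr_gt0.
  move=> [a t]; rewrite /LA !pair_norm /= ge_max; apply/andP; split.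
    rewrite mulrDl mul1r; apply: (@le_trans _ _ (Num.max `|a| `|t|)); first by rewrite le_max lexx orbT.
    by rewrite lerDr mulr_ge0 ?(ltW C0) // le_max normr_ge0.
  apply: (le_trans (Jb a)); apply: ler_pM => //; [exact: ltW|lra|by rewrite le_max lexx].
have Ls : sdiff L (a0, 0) LA.
  move=> e e0; have [r r0 h] := gs _ e0; exists r => //.
  move=> [a t] [b s]; rewrite !pair_norm /= !gt_max => /andP[a1 _] /andP[b1 _].
  rewrite subrr normr0 ge_max mulr_ge0 ?(ltW e0) ?le_max ?normr_ge0 //=.
  apply: (le_trans (h a b a1 b1)); rewrite ler_wpM2l ?(ltW e0) //.
  by rewrite le_max lexx.
have lF : blin (fun h : R * 'rV[R]_3 => h.1 *: v + h.2).
  split=> [h k|]; first by rewrite /= scalerBl opprD addrACA.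
  exists (`|v| + 1); first by rewrite ltr_wpDl.
  move=> [t w]; rewrite pair_norm /=; apply: (le_trans (ler_normD _ _)); rewrite mulrDl mul1r normrZ.
  apply: lerD; last by rewrite le_max lexx orbT.
  by rewrite mulrC ler_wpM2l // le_max lexx.
have Fs := flow_chart_sdiff dA dp; rewrite -/u0 -g0 in Fs.
have := sdiff_comp lL lF Ls Fs; apply: sdiff_eqA => -[a t] /=.
by rewrite /frame /= addrC.
Qed.

(** The map (a, t) to phi t (g a) is strictly differentiable with derivative the
    frame (J, v), hence locally invertible; G is the inverse in the chart d. *)
Lemma flow_box d p (g : 'rV[R]_2 -> 'rV[R]_3) a0 J : A d -> cdom d p -> g a0 = cfwd d p ->
  sdiff g a0 (fun h => h *m J) -> \det (framemx (velocity phi d p) J) != 0 ->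
  exists G : 'rV[R]_3 -> 'rV[R]_2 * R,
  [/\ G (cfwd d p) = (a0, 0), sdiff G (cfwd d p) (coframe J (velocity phi d p)) &
   forall r0 : R, 0 < r0 -> exists r : R, [/\ 0 < r, r <= r0 & exists2 N, nbhs p N &
     [/\ N `<=` cdom d, mapc N (G \o cfwd d),
       forall x, N x -> [/\ `|(G (cfwd d x)).1 - a0| < r, `|(G (cfwd d x)).2| < r &
                          x = phi (G (cfwd d x)).2 (cinv d (g (G (cfwd d x)).1))] &
       forall x a t, N x -> `|a - a0| < r -> `|t| < r -> x = phi t (cinv d (g a)) ->
         G (cfwd d x) = (a, t)]]].
Proof.
move=> dA dp g0 gs; set v := velocity phi d p => D0; have ok := atlas_chart AM dA.
set u0 := cfwd d p in g0 *.
pose L (q : 'rV[R]_2 * R) : R * 'rV[R]_3 := (q.2, g q.1).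
pose Phi := flow_in d \o L.
have Ps : sdiff Phi (a0, 0) (frame J v) by exact: flow_disc_sdiff.
have P0 : Phi (a0, 0) = u0 by rewrite /Phi /flow_in /L /= g0 (chart_cancel ok dp) (flow0 hphi).
have [r1 r10 [C C0 [inj sur]]] := sdiff_invertible (blin_frame J v) (blin_coframe J v) (frameK D0) (coframeK D0) Ps.
rewrite P0 in sur.
have /choice[G hG] : forall w, exists q : 'rV[R]_2 * R, (exists2 q', `|q' - (a0, 0)| < r1 & Phi q' = w) ->
    `|q - (a0, 0)| < r1 /\ Phi q = w.
  move=> w; have [[q h1 h2]|n] := pselect (exists2 q', `|q' - (a0, 0)| < r1 & Phi q' = w).
    by exists q.
  by exists (a0, 0).
have [s s0 hs] := sur r1 r10.
have GP w : `|w - u0| < s -> `|G w - (a0, 0)| < r1 /\ Phi (G w) = w by move=> /hs[q q1 q2]; apply: hG; exists q.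
have u0s : `|u0 - u0| < s by rewrite subrr normr0.
have uniq q q' : `|q - (a0, 0)| < r1 -> `|q' - (a0, 0)| < r1 -> Phi q = Phi q' -> q = q'.
  move=> h1 h2 e; have := inj _ _ h1 h2; rewrite e subrr normr0 mulr0 normr_le0 subr_eq0.
  by move/eqP.
have a00 : `|(a0, (0 : R)) - (a0, 0)| < r1 by rewrite subrr normr0.
have G0 : G u0 = (a0, 0).
  by have [h1 h2] := GP u0 u0s; apply: uniq => //; rewrite h2.
exists G; have Gs : sdiff G u0 (coframe J v).
  apply: (@sdiff_inverse R _ _ Phi G u0 (frame J v) _ s C (blin_coframe J v) (frameK D0) s0 C0).
  - move=> x y xs ys; have [x1 x2] := GP x xs; have [y1 y2] := GP y ys.
    by have := inj _ _ x1 y1; rewrite x2 y2.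
  - by move=> x /GP[].
  - by rewrite G0.
split=> // r0 r00.
have [s1 s10 Gc] := sdiff_cont (blin_coframe J v) Gs.
have [r2 r20 hr2] := flow_in_near dA dp filterT.
have [C2 C20 [r3 r30 gl]] := sdiff_lip (blin_mulmx J) gs.
pose r := Num.min (Num.min r0 r1) (Num.min r2 (Num.min r3 (r2 / C2))).
have rp : 0 < r by rewrite !lt_min r00 r10 r20 r30 divr_gt0.
have rle : [/\ r <= r0, r <= r1, r <= r2, r <= r3 & r <= r2 / C2].
  by rewrite /r !ge_min !lexx !orbT.
have [rr0 rr1 rr2 rr3 rr4] := rle.
have bP a t : `|a - a0| < r -> `|t| < r -> cdom d (phi t (cinv d (g a))).
  move=> ar tr; have [|_ _ //] := hr2 t (g a) (lt_le_trans tr rr2).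
  rewrite -/u0 -g0; apply: (le_lt_trans (gl a a0 _ _)); first exact: lt_le_trans ar rr3.
    by rewrite subrr normr0.
  by rewrite mulrC -ltr_pdivlMr //; apply: lt_le_trans ar rr4.
have [s2 s20 hs2] := sur r rp.
exists r; split=> //.
pose sm := Num.min s (Num.min s1 s2).
have smp : 0 < sm by rewrite !lt_min s0 s10.
have [sms sms1 sms2] : [/\ sm <= s, sm <= s1 & sm <= s2] by rewrite /sm !ge_min !lexx !orbT.
exists [set x | cdom d x /\ `|cfwd d x - u0| < sm].
  exact: (chart_fwd_near ok dp (near_norm u0 smp)).
have pr (a : 'rV[R]_2) (t : R) : `|(a, t) - (a0, 0)| < r <-> `|a - a0| < r /\ `|t| < r.
  by rewrite pair_norm /= subr0 gt_max; split=> [/andP|[-> ->]].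
split.
- by move=> x [].
- apply: (mapc_comp (B := [set w | `|w - u0| < s1])) => //; last first.
    by have /mapcP h := chart_fwd_cont ok; apply: mapc_sub h => x [].
  by move=> x [_ h]; exact: lt_le_trans h sms1.
- move=> x [dx xs]; have [q q1 q2] := hs2 _ (lt_le_trans xs sms2).
  have [x1 x2] := GP _ (lt_le_trans xs sms).
  have qE : q = G (cfwd d x) by apply: uniq => //; [exact: lt_le_trans q1 rr1|rewrite x2].
  rewrite qE in q1 q2; case: (G (cfwd d x)) q1 q2 => a t /pr[ar tr] q2; split=> //=.
  by rewrite -(chart_cancel ok dx) -q2 /Phi /flow_in /L /= (chart_cancel ok) //; exact: bP.
- move=> x a t [dx xs] ar tr xE; have [x1 x2] := GP _ (lt_le_trans xs sms).
  apply: uniq => //; first by apply: lt_le_trans rr1; apply/pr.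
  by rewrite x2 /Phi /flow_in /L /= -xE.
Qed.

End FlowCharts.
End Charts.

(** * Partial sections and their axis *)

Section SurfaceCharts.
Variables (R : realType) (S : topologicalType) (B : set (chart R 2 S)).
Hypothesis BS : oriented_atlas (@half_plane R) B.
Implicit Types (c : chart R 2 S) (x y : S).

Lemma cfwd_le0 c x : B c -> cdom c x -> cfwd c x 0 0 <= 0.
Proof.
move=> cB cx; have [U _ e] := chart_image (atlas_chart BS cB).
have : (cfwd c @` cdom c) (cfwd c x) by exists x.
by rewrite e => -[].
Qed.

Lemma coord_near n (u : 'rV[R]_n) j (P : set R) : nbhs (u 0 j) P -> nbhs u [set w : 'rV[R]_n | P (w 0 j)].
Proof.
move=> /norm_near[r r0 h]; apply: filterS (near_norm u r0) => w wr; apply: h.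
by apply: le_lt_trans wr; have := row_norm_ge (w - u) j; rewrite !mxE.
Qed.

Lemma half_near (u : 'rV[R]_2) : u 0 0 < 0 -> nbhs u [set w : 'rV[R]_2 | w 0 0 < 0].
Proof. by move=> u0; apply: (coord_near (P := [set t | t < 0])); exact: lt_nbhsl. Qed.

(** Being on the boundary does not depend on the chart: the transition map is
    locally invertible in the plane, so it cannot send an interior point of the
    half-plane to its edge without leaving the half-plane. *)
Lemma bd_chart c x : B c -> cdom c x -> (bd B x <-> cfwd c x 0 0 = 0).
Proof.
move=> cB cx; split=> [[c' [cB' cx' x0]]|x0]; last by exists c.
have [lt0|gt0|//] := ltgtP (cfwd c x 0 0) 0; last by have := cfwd_le0 cB cx; lra.
have ok := atlas_chart BS cB; have ok' := atlas_chart BS cB'.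
have [[sm _]] := (atlas_smooth BS cB cB', I); set u := cfwd c x in lt0.
have uD : repdom setT c c' idfun u by exists x.
have [U [g [Uo Uu gC gf]]] := sm u uD.
have ux : cinv c u = x by exact: chart_cancel ok _ cx.
have cn' : nbhs x (cdom c') by apply: open_nbhs_nbhs; split => //; exact: chart_open ok'.
have Dn : \forall w \near u, [/\ U w, repdom setT c c' idfun w & cdom c' (cinv c w)].
  have Un : nbhs u U by apply: open_nbhs_nbhs.
  apply: filterS3 Un (half_near lt0) (chart_inv_near ok cx cn') => w Uw w0 h.
  have [h1 h2 h3] := h (ltW w0); split=> //; exists (cinv c w) => //.
have J0 : 0 < \det ('J g u).
  by apply: (atlas_oriented BS cB cB' cx cx'); exists U, g.
have Ju : 'J g u \in unitmx by rewrite unitmxE unitfE gt_eqF.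
have gs := C1_row Uo Uu (gC 1).
have [r r0 [C C0 [_ sur]]] := @sdiff_invertible R _ _ g u _ (fun h => h *m invmx ('J g u))
  (blin_mulmx _) (blin_mulmx _) (fun h => mulmxK Ju h) (fun h => mulmxKV Ju h) gs.
have [rho rho0 hrho] := norm_near Dn.
have [s s0 hs] := sur rho rho0.
pose w := g u + (s / 2) *: delta_mx 0 0.
have gu : g u = cfwd c' x by rewrite gf // /rep /= ux.
have [|y yr yw] := hs w.
  rewrite /w addrAC subrr add0r; apply: row_norm_lt => // j; rewrite !mxE eqxx /=.
  case: (j == 0); rewrite ?mulr1 ?mulr0 ?normr0 // gtr0_norm; lra.
have [Uy Dy cy'] := hrho y yr.
have := cfwd_le0 cB' cy'; rewrite -[cfwd c' _](gf y Uy Dy) yw /w gu !mxE x0 !eqxx mulr1; lra.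
Qed.

Lemma int_coord c x : B c -> cdom c x -> ~ bd B x -> cfwd c x 0 0 < 0.
Proof.
move=> cB cx nb; rewrite lt_neqAle cfwd_le0 // andbT; apply/eqP => h.
by apply: nb; apply/(bd_chart cB cx).
Qed.

Lemma open_int : open (~` bd B).
Proof.
rewrite openE => x nx; have [c cB cx] := atlas_cover BS x.
apply: filterS (chart_fwd_near (atlas_chart BS cB) cx (half_near (int_coord cB cx nx))) => y [cy y0].
have y0' : cfwd c y 0 0 < 0 by [].
by move/(bd_chart cB cy) => e; rewrite e ltxx in y0'.
Qed.

Lemma bd_closed : closed (bd B).
Proof. by rewrite -[bd B]setCK; apply: open_closedC; exact: open_int. Qed.

Lemma bd_adherent x V : bd B x -> nbhs x V -> exists2 y, V y & ~ bd B y.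
Proof.
move=> xb hV; have [c cB cx] := atlas_cover BS x; have x0 := (bd_chart cB cx).1 xb.
have ok := atlas_chart BS cB; have [r r0 h] := norm_near (chart_inv_near ok cx hV).
pose w := cfwd c x - (r / 2) *: delta_mx 0 0.
have w0 : w 0 0 < 0 by rewrite !mxE x0 !eqxx mulr1; lra.
have [|cw wE Vw] := h w _ (ltW w0).
  rewrite /w addrAC subrr add0r normrN; apply: row_norm_lt => // j; rewrite !mxE eqxx /=.
  case: (j == 0); rewrite ?mulr1 ?mulr0 ?normr0 // gtr0_norm; lra.
exists (cinv c w) => // /(bd_chart cB cw); by rewrite wE => e; rewrite e ltxx in w0.
Qed.

End SurfaceCharts.

Section Sections.
Variables (R : realType) (M : topologicalType) (A : set (chart R 3 M)) (phi : R -> M -> M).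
Hypothesis hM : closed_oriented_3manifold A.
Hypothesis hphi : smooth_flow A phi.
Let AM := manifold_atlas hM.
Implicit Types (d : chart R 3 M) (p x : M).

Lemma flowK s x : phi (- s) (phi s x) = x.
Proof. by rewrite -(flowD hphi) addNr (flow0 hphi). Qed.

Lemma flowNK s x : phi s (phi (- s) x) = x.
Proof. by rewrite -(flowD hphi) addrN (flow0 hphi). Qed.

Lemma flow_cont_at t : continuous (phi t).
Proof.
move=> x V hV; have [P hP [Q hQ PQ]] := flow_near hphi hV.
by apply: filterS hQ => y Qy; apply: PQ => //; exact: nbhs_singleton.
Qed.

Lemma orbit_cont x : continuous (fun t => phi t x).
Proof.
move=> t V hV; have [P hP [Q hQ PQ]] := flow_near hphi hV.
by apply: filterS hP => y Qy; apply: PQ => //; exact: nbhs_singleton.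
Qed.

Variables (S : topologicalType) (B : set (chart R 2 S)) (iota : S -> M).
Hypothesis ps : partial_section A phi B iota.
Let BS := manifold_atlas (ps_surface ps).

(** The union of the closed orbits that carry the boundary of the section. *)
Definition axis : set M := iota @` bd B.

Lemma iota_cont : continuous iota.
Proof.
by have [[h _] _] := ps_immersion ps; apply/continuous_subspace_setT.
Qed.

(** A smooth extension g of the coordinate expression of iota. *)
Definition extends (c : chart R 2 S) d (U : set 'rV[R]_2) (g : 'rV[R]_2 -> 'rV[R]_3) : Prop :=
  [/\ open U, forall k, Ck k U g & forall u, U u -> repdom setT c d iota u -> g u = rep c d iota u].

Lemma extends_rank c d y U g : B c -> A d -> cdom c y -> cdom d (iota y) -> extends c d U g ->
  U (cfwd c y) -> \rank ('J g (cfwd c y)) = 2%N.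
Proof.
move=> cB dA cy dy [Uo gC gf] Uu; have [_ rk] := ps_immersion ps.
by apply: (rk c d y) => //; exists U, g.
Qed.

Lemma extends_det c d y U g : B c -> A d -> cdom c y -> cdom d (iota y) -> ~ bd B y -> extends c d U g ->
  U (cfwd c y) -> 0 < \det (framemx (velocity phi d (iota y)) ('J g (cfwd c y))).
Proof.
move=> cB dA cy dy nb [Uo gC gf] Uu; apply: (ps_oriented ps cB dA nb cy dy).
by exists U, g.
Qed.

Lemma section_chart c d y : B c -> A d -> cdom c y -> cdom d (iota y) ->
  exists (U : set 'rV[R]_2) (g : 'rV[R]_2 -> 'rV[R]_3),
  [/\ extends c d U g, U (cfwd c y) & exists2 r : R, 0 < r & forall a, `|a - cfwd c y| < r -> U a /\ (a 0 0 <= 0 ->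
     [/\ cdom c (cinv c a), cfwd c (cinv c a) = a, cdom d (iota (cinv c a)) & g a = cfwd d (iota (cinv c a))])].
Proof.
move=> cB dA cy dy; have [[_ sm] _] := ps_immersion ps; have ok := atlas_chart BS cB.
have yD : repdom setT c d iota (cfwd c y) by exists y.
have [U [g [Uo Uu gC gf]]] := sm c d cB dA (cfwd c y) yD.
exists U, g; split => //.
have dn : nbhs (iota y) (cdom d).
  by apply: open_nbhs_nbhs; split => //; exact: chart_open (atlas_chart AM dA).
have Un : nbhs (cfwd c y) U by apply: open_nbhs_nbhs.
have [r r0 h] := norm_near (filterI Un (chart_inv_near ok cy (iota_cont dn))).
exists r => // a ar; have [Ua h2] := h a ar; split=> // a0; have [h3 h4 h5] := h2 a0.
by split=> //; rewrite gf //= /rep /=; exists (cinv c a).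
Qed.

(** If the image of an interior point y were that of a boundary point z, then
    interior points close to z would have images close to iota y, against the
    embedding property near y. *)
Lemma axis_int y : ~ bd B y -> ~ axis (iota y).
Proof.
move=> ny [z zb e]; have yz : y != z by apply/eqP => h; apply: ny; rewrite h.
have := manifold_hausdorff (ps_surface ps); rewrite open_hausdorff => /(_ y z yz).
move=> [[U0 U1] /= [yU0 zU1] [oU0 oU1 /eqP dis0]].
have dis : U0 `&` U1 `<=` set0 by rewrite dis0.
rewrite !inE in yU0 zU1.
have oU : open (U0 `&` ~` bd B) by apply: openI => //; exact: (open_int BS).
have [|V oV VE] := ps_embedding ps oU; first by move=> ? [].
have yV : V (iota y).
  have : (iota @` (U0 `&` ~` bd B)) (iota y) by exists y.
  by rewrite VE => -[].
have zn : nbhs z (U1 `&` iota @^-1` V).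
  apply: filterI; first exact: open_nbhs_nbhs.
  by apply: iota_cont; rewrite e; exact: open_nbhs_nbhs.
have [w [wU1 wV] nw] := bd_adherent BS zb zn.
have : (iota @` (U0 `&` ~` bd B)) (iota w) by rewrite VE; split => //; exists w.
move=> [w' [w'U0 nw'] ew]; have ww := ps_injective ps nw' nw ew.
by apply: (dis w); split=> //; rewrite -ww.
Qed.

Lemma axis_closed : closed axis.
Proof.
apply: compact_closed; first exact: (manifold_hausdorff hM).
apply: continuous_compact; first by apply: continuous_subspaceT; exact: iota_cont.
apply: (subclosed_compact (bd_closed BS) (manifold_compact (ps_surface ps))).
by [].
Qed.

Lemma range_closed : closed (range iota).
Proof.
apply: compact_closed; first exact: (manifold_hausdorff hM).
apply: continuous_compact; first by apply: continuous_subspaceT; exact: iota_cont.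
exact: (manifold_compact (ps_surface ps)).
Qed.

(** The axis is a union of orbits. *)
Lemma axis_flow t x : axis x -> axis (phi t x).
Proof.
have [F [_ FG FE]] := ps_boundary ps; rewrite /axis FE => -[G GF Gx].
exists G => //; have [z [T [_ GE]]] := FG G GF.
move: Gx; rewrite GE => -[s _ <-]; exists (t + s) => //; exact: (flowD hphi).
Qed.

Lemma axis_flowN t x : ~ axis x -> ~ axis (phi t x).
Proof. by move=> nx /(axis_flow (- t)); rewrite flowK. Qed.

Lemma range_axis x : range iota x -> ~ axis x -> exists2 y, ~ bd B y & iota y = x.
Proof. by move=> [y _ <-] nx; exists y => // yb; apply: nx; exists y. Qed.

(** In the flow box of the section at an interior point, the section is the disc
    of time 0.  By the embedding property no other part of the section comes
    near, so each nearby orbit hits once, at a time that depends continuously on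
    the point. *)
Lemma hit_box c d y0 (g : 'rV[R]_2 -> 'rV[R]_3) J : B c -> A d -> cdom c y0 -> cdom d (iota y0) ->
  ~ bd B y0 -> sdiff g (cfwd c y0) (fun h => h *m J) ->
  \det (framemx (velocity phi d (iota y0)) J) != 0 ->
  (\forall a \near cfwd c y0, [/\ cdom c (cinv c a), cfwd c (cinv c a) = a, cdom d (iota (cinv c a)) &
      g a = cfwd d (iota (cinv c a))]) ->
  forall e : R, 0 < e -> exists delta : R, [/\ 0 < delta, delta <= e & exists2 N, nbhs (iota y0) N & exists h : M -> R,
    [/\ mapc N h, h (iota y0) = 0,
      forall x, N x -> `|h x| < delta /\ exists2 a, `|a - cfwd c y0| < delta & x = phi (- h x) (iota (cinv c a)) &
      forall x s, N x -> `|s| < delta -> (range iota (phi s x) <-> s = h x)]].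
Proof.
move=> cB dA cy dy nb gs D0 gn e e0; have ok := atlas_chart BS cB; set a0 := cfwd c y0 in gs gn *.
have [r1 r10 hr1] := norm_near gn.
have y0E : cinv c a0 = y0 by exact: chart_cancel ok _ cy.
have g0 : g a0 = cfwd d (iota y0).
  by have [|_ _ _ ->] := hr1 a0; rewrite ?subrr ?normr0 // y0E.
have [G [G0 Gs box]] := flow_box AM hphi dA dy g0 gs D0.
have [|r [r0 rle [Nb Nbn [Nd Gc Nx Nu]]]] := box (Num.min r1 e); first by rewrite lt_min r10.
have [rr1 re] : r <= r1 /\ r <= e by move: rle; rewrite le_min => /andP[].
pose W := [set y | cdom c y /\ `|cfwd c y - a0| < r] `&` ~` bd B.
have Wn : nbhs y0 W^°.
  apply: open_nbhs_nbhs; split; first exact: open_interior.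
  apply: filterI; last by apply: open_nbhs_nbhs; split => //; exact: (open_int BS).
  exact: (chart_fwd_near ok cy (near_norm a0 r0)).
have [|V oV VE] := ps_embedding ps (open_interior W).
  by move=> y /interior_subset[].
have yV : V (iota y0).
  have : (iota @` W^°) (iota y0) by exists y0 => //; exact: nbhs_singleton.
  by rewrite VE => -[].
pose N1 := Nb `&` V `&` ~` axis.
have N1n : nbhs (iota y0) N1.
  apply: filterI; last first.
    by apply: open_nbhs_nbhs; split; [exact: closed_openC axis_closed|exact: axis_int].
  by apply: filterI => //; exact: open_nbhs_nbhs.
have [P hP [Q hQ PQ]] := flow_near0 hphi N1n.
have [d1 d10 hd1] := norm_near hP.
pose delta := Num.min r d1; have dl0 : 0 < delta by rewrite lt_min r0.
have [dlr dld] : delta <= r /\ delta <= d1 by rewrite /delta !ge_min !lexx orbT.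
have p0 : (G (cfwd d (iota y0))) = (a0, 0) by [].
have Gn : \forall x \near iota y0, Nb x -> `|(G (cfwd d x)).1 - a0| < delta /\ `|(G (cfwd d x)).2| < delta.
  have := Gc (iota y0) (nbhs_singleton Nbn) [set q | `|q.1 - a0| < delta /\ `|q.2| < delta].
  apply; rewrite /= p0; apply: filterS (near_norm (a0, (0 : R)) dl0) => -[a t].
  by rewrite pair_norm /= subr0 gt_max => /andP[].
exists delta; split=> //; first exact: le_trans dlr re.
exists (Nb `&` Q `&` [set x | Nb x -> `|(G (cfwd d x)).1 - a0| < delta /\ `|(G (cfwd d x)).2| < delta]).
  by apply: filterI => //; exact: filterI.
exists (fun x => - (G (cfwd d x)).2); split.
- apply: mapcN; apply: (mapc_comp (B := setT) (g := snd)) => //; last by apply: mapc_cont => q; exact: cvg_snd.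
  by apply: mapc_sub Gc => x [[]].
- by rewrite p0 oppr0.
- move=> x [[Nbx Qx] /(_ Nbx)[h1 h2]]; rewrite normrN opprK; split=> //.
  have [k1 k2 k3] := Nx x Nbx; exists (G (cfwd d x)).1 => //.
  rewrite {1}k3; congr (phi _ _).
  have [|c1 c2 c3 ->] := hr1 (G (cfwd d x)).1; first exact: lt_le_trans k1 rr1.
  by rewrite (chart_cancel (atlas_chart AM dA)).
- move=> x s [[Nbx Qx] _] sd; have [k1 k2 k3] := Nx x Nbx; split.
    move=> hs; have Ps : P s by apply: hd1; rewrite subr0; exact: lt_le_trans sd dld.
    have [[n1 n2] n3] := PQ s x Ps Qx.
    have [y ny ey] := range_axis hs n3.
    have : (V `&` iota @` (~` bd B)) (phi s x) by split => //; exists y.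
    rewrite -VE => -[y' /interior_subset[[cy' yr'] _] ey'].
    have xE : x = phi (- s) (cinv d (g (cfwd c y'))).
      have [|c1 c2 c3 ->] := hr1 (cfwd c y'); first exact: lt_le_trans yr' rr1.
      by rewrite (chart_cancel ok cy') in c3 *; rewrite (chart_cancel (atlas_chart AM dA)) // ey' flowK.
    have sr : `|- s| < r by rewrite normrN; exact: lt_le_trans sd dlr.
    by rewrite (Nu x _ _ Nbx yr' sr xE) /= opprK.
  move=> ->; rewrite {2}k3 flowK.
  have [|c1 c2 c3 ->] := hr1 (G (cfwd d x)).1; first exact: lt_le_trans k1 rr1.
  by rewrite (chart_cancel (atlas_chart AM dA)) //; exists (cinv c (G (cfwd d x)).1).
Qed.

End Sections.

(** * Hitting times and the phase of a Birkhoff section *)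

Lemma least_time (R : realType) (Q : set R) (a b : R) : closed Q -> a <= b -> Q b ->
  exists m : R, [/\ a <= m, m <= b, Q m & forall s, a <= s -> s < m -> ~ Q s].
Proof.
move=> cQ ab Qb; pose E := [set t : R | a <= t /\ t <= b] `&` Q.
have Eb : E b by split.
have Elb : has_inf E by split; [exists b|exists a => t [[]]].
have lb t : E t -> inf E <= t by apply: ge_inf; exact: Elb.2.
have am : a <= inf E by apply: lb_le_inf; [exists b|move=> t [[]]].
have QE : Q (inf E).
  apply: cQ => V /nbhs_ballP[e e0 he]; have e0' : 0 < e by [].
  have [t Et te] := inf_adherent e0' Elb.
  exists t; split; first by case: Et.
  by apply: he; rewrite /ball /= ltr_norml; have := lb t Et; slra.
exists (inf E); split=> //; first exact: lb.
move=> s sa sm Qs; have := lb s; have := lb b Eb => h1 h2.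
by have : E s; [split => //; split=> //; slra|move=> /h2; slra].
Qed.

Section Hits.
Variables (R : realType) (M : topologicalType) (A : set (chart R 3 M)) (phi : R -> M -> M).
Hypothesis hM : closed_oriented_3manifold A.
Hypothesis hphi : smooth_flow A phi.
Variables (S : topologicalType) (B : set (chart R 2 S)) (iota : S -> M).
Hypothesis bk : birkhoff_section A phi B iota.
Let AM := manifold_atlas hM.
Let ps := bk.1.
Let BS := manifold_atlas (ps_surface ps).
Local Notation axis := (axis B iota).
Implicit Types (x : M) (s t a b : R).

Definition hit x : Prop := range iota x.

Lemma hit_local x : ~ axis x -> hit x -> forall e : R, 0 < e -> exists delta : R,
  [/\ 0 < delta, delta <= e & exists2 N, nbhs x N & exists h : M -> R,
    [/\ mapc N h, h x = 0, forall x', N x' -> `|h x'| < delta &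
      forall x' s, N x' -> `|s| < delta -> (hit (phi s x') <-> s = h x')]].
Proof.
move=> nx /range_axis /(_ nx)[y ny <-] e e0.
have [c cB cy] := atlas_cover BS y; have [d dA dy] := atlas_cover AM (iota y).
have [U [g [ext Uy [r r0 hr]]]] := section_chart hM ps cB dA cy dy.
have D0 := extends_det ps cB dA cy dy ny ext Uy; have [Uo gC gf] := ext.
have gn : \forall a \near cfwd c y, [/\ cdom c (cinv c a), cfwd c (cinv c a) = a,
    cdom d (iota (cinv c a)) & g a = cfwd d (iota (cinv c a))].
  apply: filterS2 (near_norm (cfwd c y) r0) (half_near (int_coord BS cB cy ny)) => a ar a0.
  by apply: (hr a ar).2; exact: ltW.
have [delta [d0 de [N Nn [h [h1 h2 h3 h4]]]]] :=
  hit_box hM hphi ps cB dA cy dy ny (C1_row Uo Uy (gC 1)) (lt0r_neq0 D0) gn e0.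
by exists delta; split=> //; exists N => //; exists h; split=> // x' /h3[].
Qed.

Lemma hit_closed : closed (hit : set M).
Proof. exact: (range_closed hM ps). Qed.

Lemma hit_orbit_closed x : closed [set t | hit (phi t x)].
Proof.
have -> : [set t | hit (phi t x)] = (fun t => phi t x) @^-1` (hit : set M) by [].
by apply: closed_comp => [t _|]; [exact: (orbit_cont hphi)|exact: hit_closed].
Qed.

(** Each point of an orbit is reached from the section in a time at most T. *)
Lemma hits_exist : exists2 T : R, 0 < T & forall x s, exists t, [/\ s <= t, t <= s + T & hit (phi t x)].
Proof.
have [T T0 cov] := bk.2; exists T => // x s.
have : [set: M] (phi (s + T) x) by [].
rewrite -cov => -[t /=]; rewrite in_itv /= => /andP[t0 tT] [_ [y _ <-] e].
exists (s + T - t); split; [slra|slra|exists y => //].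
by rewrite addrC (flowD hphi) -e (flowK hphi).
Qed.

(** The times a since the last hit and b until the next one. *)
Definition times x a b : Prop := [/\ 0 <= a, 0 < b, hit (phi (- a) x), hit (phi b x) &
  forall s, - a < s -> s < b -> ~ hit (phi s x)].

Lemma times_uniq x a b a' b' : times x a b -> times x a' b' -> a = a' /\ b = b'.
Proof.
have key u v u' v' : times x u v -> times x u' v' -> u' <= u /\ v' <= v.
  move=> [u0 v0 hu hv _] [u0' v0' _ _ n]; split; rewrite leNgt; apply/negP => h.
    by apply: (n (- u)) => //; slra.
  by apply: (n v) => //; slra.
move=> h h'; have [h1 h2] := key _ _ _ _ h h'; have [h3 h4] := key _ _ _ _ h' h.
by split; apply/eqP; rewrite eq_le ?h1 ?h2 ?h3 ?h4.
Qed.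

(** The hits of an orbit form a closed set of times, unbounded in both
    directions, and hits are isolated off the axis. *)
Lemma times_exist x : ~ axis x -> exists a b, times x a b.
Proof.
move=> nx; have [T T0 ex] := hits_exist.
have [t1 [t1l t1r h1]] := ex x (- T).
have cN : closed [set t | hit (phi (- t) x)].
  have -> : [set t | hit (phi (- t) x)] = (fun t : R => - t) @^-1` [set t | hit (phi t x)] by [].
  by apply: closed_comp => [t _|]; [exact: opp_continuous|exact: hit_orbit_closed].
have [||a [a0 _ ha an]] := @least_time R _ 0 (- t1) cN; [slra|by rewrite /= opprK|].
have [d d0 hd] : exists2 d : R, 0 < d & forall s, 0 < s -> s < d -> ~ hit (phi s x).
  have [hx|hx] := pselect (hit x).
    have [d [d0 _ [N Nn [h [_ hx0 _ hs]]]]] := hit_local nx hx ltr01.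
    exists d => // s s0 sd hit_s; have : s = h x by apply/(hs x s (nbhs_singleton Nn)) => //; rewrite gtr0_norm.
    by rewrite hx0; slra.
  have : nbhs (0 : R) [set t | ~ hit (phi t x)].
    apply: open_nbhs_nbhs; split; last by rewrite /= (flow0 hphi).
    exact: closed_openC (@hit_orbit_closed x).
  move=> /norm_near[d d0 hd]; exists d => // s s0 sd; apply: hd.
  by rewrite subr0 gtr0_norm.
have [t2 [t2l _ h2]] := ex x (d / 2).
have [|b [b0 _ hb bn]] := @least_time R _ (d / 2) t2 (@hit_orbit_closed x) _ h2; first slra.
exists a, b; split=> //; first slra.
move=> s sa sb hs; have [s0|s0] := leP s 0.
  by apply: (an (- s)); rewrite /= ?opprK //; slra.
have [sd|sd] := ltP s (d / 2); first by apply: (hd s) => //; slra.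
exact: (bn s).
Qed.

Lemma times_flow x a b t : times x a b -> 0 <= t -> t < b -> times (phi t x) (a + t) (b - t).
Proof.
move=> [a0 b0 ha hb n] t0 tb; split; [slra|slra|..].
- by rewrite -(flowD hphi) (_ : - (a + t) + t = - a) //; ring.
- by rewrite -(flowD hphi) (_ : b - t + t = b) //; ring.
- by move=> s s1 s2; rewrite -(flowD hphi); apply: n; slra.
Qed.

(** The circle-valued function of the section: the fraction, between two hits, of
    the time that has elapsed since the first of them. *)
Definition phase x : R := xget 0 [set r | exists a b, times x a b /\ r = a / (a + b)].

Lemma phaseE x a b : times x a b -> phase x = a / (a + b).
Proof.
move=> h; rewrite /phase; case: xgetP => [r _ [a' [b' [h' ->]]]|/(_ (a / (a + b)))].
  by have [-> ->] := times_uniq h' h.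
by case; exists a, b.
Qed.

Lemma phase_range x : 0 <= phase x /\ phase x < 1.
Proof.
rewrite /phase; case: xgetP => [r _ [a [b [[a0 b0 _ _ _] ->]]]|_]; last by rewrite lexx ltr01.
by rewrite divr_ge0 ?ltr_pdivrMr; slra.
Qed.

Lemma phase_hit x : ~ axis x -> hit x -> phase x = 0.
Proof.
move=> /times_exist[a [b h]] hx; rewrite (phaseE h); have [a0 b0 _ _ n] := h.
have [<-|a1] := eqVneq 0 a; first by rewrite mul0r.
have ap : 0 < a by rewrite lt_neqAle a1.
by case: (n 0); rewrite ?(flow0 hphi) //; slra.
Qed.

(** Just before a hit the elapsed fraction is close to 1 and just after it is
    close to 0, because no other hit occurs within the time delta. *)
Lemma phase_near_hit x (delta : R) N (h : M -> R) : ~ axis x -> 0 < delta -> nbhs x N -> mapc N h ->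
  h x = 0 -> (forall x', N x' -> `|h x'| < delta) ->
  (forall x' s, N x' -> `|s| < delta -> (hit (phi s x') <-> s = h x')) ->
  forall e : R, 0 < e -> \forall x' \near x,
    [/\ ~ axis x', N x', h x' <= 0 -> phase x' < e & 0 < h x' -> 1 - e < phase x'].
Proof.
move=> nx d0 Nn hc hx hd hs e e0.
have nn : nbhs x (~` axis) by apply: open_nbhs_nbhs; split; [exact: closed_openC (axis_closed hM ps)|].
have ed : 0 < e * delta by rewrite mulr_gt0.
have hn : \forall x' \near x, N x' -> `|h x'| < e * delta.
  have /mapcR k := hc; apply: filterS (k x (nbhs_singleton Nn) _ ed) => x' k1 k2.
  by have := k1 k2; rewrite hx subr0.
apply: filterS3 nn Nn hn => x' nx' Nx' /(_ Nx') hx'; split=> //.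
  move=> h0; have [a [b t]] := times_exist nx'; rewrite (phaseE t); have [a0 b0 ha hb n] := t.
  have hh : hit (phi (h x') x') by apply/(hs x' _ Nx'); [exact: hd|].
  have al : a <= - h x' by rewrite leNgt; apply/negP => ?; apply: (n (h x')) => //; slra.
  have bd : delta <= b.
    rewrite leNgt; apply/negP => bd; have /(hs x' b Nx') : hit (phi b x') by [].
    by rewrite gtr0_norm // => /(_ bd); slra.
  rewrite ltr_pdivrMr; last slra.
  by rewrite ler0_norm // in hx'; snra.
move=> h0; have [a [b t]] := times_exist nx'; rewrite (phaseE t); have [a0 b0 ha hb n] := t.
have hh : hit (phi (h x') x') by apply/(hs x' _ Nx'); [exact: hd|].
have bl : b <= h x' by rewrite leNgt; apply/negP => ?; apply: (n (h x')) => //; slra.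
have ad : delta <= a.
  rewrite leNgt; apply/negP => bd; have /(hs x' (- a) Nx') : hit (phi (- a) x') by [].
  by rewrite normrN ger0_norm // => /(_ bd); slra.
rewrite ltr_pdivlMr; last slra.
by rewrite gtr0_norm // in hx'; snra.
Qed.

Lemma quotient_close (a b a' b' e : R) : 0 < a -> 0 < b -> 0 < e -> e <= (a + b) / 4 ->
  `|a' - a| < e -> `|b' - b| < e -> `|a' / (a' + b') - a / (a + b)| < 2 * e / (a + b).
Proof.
move=> a0 b0 e0 es; rewrite !ltr_norml => /andP[h1 h2] /andP[h3 h4].
have s0 : 0 < a + b by slra.
have s1 : (a + b) / 2 < a' + b' by slra.
have s2 : 0 < a' + b' by slra.
have -> : a' / (a' + b') - a / (a + b) = ((a' - a) * b - a * (b' - b)) / (a' + b') / (a + b).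
  by field; rewrite !gt_eqF.
have k : (a + b) * e < (a' + b') * (2 * e) by snra.
apply/andP; split.
  rewrite -mulNr ltr_pM2r ?invr_gt0 // ltr_pdivlMr //; snra.
rewrite ltr_pM2r ?invr_gt0 // ltr_pdivrMr //; snra.
Qed.

(** The last and the next hits persist, by hit_local, and no new hit appears in
    between, by compactness of the time interval. *)
Lemma phase_cont x : ~ axis x -> ~ hit x -> forall e : R, 0 < e ->
  \forall x' \near x, `|phase x' - phase x| < e.
Proof.
move=> nx hx e e0; have [a [b t]] := times_exist nx; rewrite (phaseE t).
have [a0 b0 ha hb n] := t.
have ap : 0 < a.
  rewrite lt_neqAle a0 andbT; apply/eqP => z; apply: hx.
  by rewrite -z oppr0 (flow0 hphi) in ha.
pose k := Num.min (Num.min (a / 2) (b / 2)) (Num.min ((a + b) / 4) (e * (a + b) / 2)).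
have k0 : 0 < k by rewrite !lt_min !divr_gt0 ?mulr_gt0 //; slra.
have [ka kb ks ke] : [/\ k <= a / 2, k <= b / 2, k <= (a + b) / 4 & k <= e * (a + b) / 2].
  by rewrite /k !ge_min !lexx !orbT.
have nn : nbhs x (~` axis) by apply: open_nbhs_nbhs; split; [exact: closed_openC (axis_closed hM ps)|].
have near_hit u : hit (phi u x) -> \forall x' \near x, exists2 s, `|s - u| < k & hit (phi s x').
  move=> hu; have [d [d0 de [N Nn [h [hc h0 hd hs]]]]] := hit_local (axis_flowN hphi ps (t := u) nx) hu k0.
  have : nbhs x (phi u @^-1` N) by exact: (flow_cont_at hphi Nn).
  apply: filterS => x' Nx'.
  exists (u + h (phi u x')); first by rewrite addrAC subrr add0r; apply: lt_le_trans (hd _ Nx') de.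
  by rewrite addrC (flowD hphi); apply/(hs _ _ Nx'); [exact: hd|].
have noh : \forall x' \near x, itv (- a + k) (b - k) `<=` (fun s => ~ hit (phi s x')).
  have cK := @compact_itv R (- a + k) (b - k).
  apply: (((compact_near_coveringP _).1 cK) M (nbhs x) (fun x' s => ~ hit (phi s x'))) => s /andP[s1 s2].
  have V : nbhs (phi s x) (~` hit).
    by apply: open_nbhs_nbhs; split; [exact: closed_openC hit_closed|apply: n; slra].
  have [P hP [Q hQ PQ]] := flow_near hphi V.
  by exists (P, Q) => // -[s' x'] /= [Ps Qx]; exact: PQ.
apply: filterS3 (near_hit _ ha) (near_hit _ hb) (filterI nn noh) => x' [s1 s1k h1] [s2 s2k h2] [nx' nk].
have [a' [b' t']] := times_exist nx'; rewrite (phaseE t'); have [a0' b0' ha' hb' n'] := t'.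
move: s1k s2k; rewrite !ltr_norml => /andP[u1 u2] /andP[u3 u4].
have a1 : a' <= - s1 by rewrite leNgt; apply/negP => ?; apply: (n' s1) => //; slra.
have b1 : b' <= s2 by rewrite leNgt; apply/negP => ?; apply: (n' s2) => //; slra.
have a2 : a - k < a'.
  rewrite ltNge; apply/negP => h; apply: (nk (- a')) => //; rewrite /itv /=; slra.
have b2 : b - k < b'.
  rewrite ltNge; apply/negP => h; apply: (nk b') => //; rewrite /itv /=; slra.
have c1 : `|a' - a| < k by rewrite ltr_norml; slra.
have c2 : `|b' - b| < k by rewrite ltr_norml; slra.
rewrite -ltr_norml; apply: (lt_le_trans (quotient_close ap b0 k0 ks c1 c2)).
by rewrite ler_pdivrMr; slra.
Qed.

Lemma phase_zc : zc (~` axis) phase.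
Proof.
move=> x nx e e0; have [hx|hx] := pselect (hit x); last first.
  apply: filterS (phase_cont nx hx e0) => x' h _; exists 0; [exact: rpred0|by rewrite subr0].
rewrite (phase_hit nx hx).
have [d [d0 _ [N Nn [h [h1 h2 h3 h4]]]]] := hit_local nx hx ltr01.
apply: filterS (phase_near_hit nx d0 Nn h1 h2 h3 h4 e0) => x' [_ _ k1 k2] _; rewrite subr0.
have [p0 p1] := phase_range x'.
have [h0|h0] := leP (h x') 0.
  by exists 0; [exact: rpred0|rewrite subr0 ger0_norm //; exact: k1].
exists 1; first exact: rpred1.
by have := k2 h0; rewrite ltr_norml; slra.
Qed.

Lemma orbit_zc x (C : set R) : ~ axis x -> zc C (fun t => phase (phi t x)).
Proof.
move=> nx; apply: (zc_comp (g := fun t => phi t x) _ _ phase_zc).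
  by move=> t _; exact: (axis_flowN hphi ps).
by apply: mapc_cont; exact: (orbit_cont hphi).
Qed.

(** Between two hits the phase is affine with positive slope; so a lift has
    larger values just to the right of each time. *)
Lemma orbit_increasing x u v F : ~ axis x -> u < v -> islift (itv u v) (fun t => phase (phi t x)) F ->
  F u < F v.
Proof.
move=> nx uv Fl; apply: right_increasing => //; first exact: Fl.1.
move=> s /andP[us sv]; have [a [b t]] := times_exist (axis_flowN hphi ps (t := s) nx).
have [a0 b0 _ _ _] := t; exists b => // y sy yb yv.
have s0 : 0 < a + b by slra.
pose k z := F z - F s - (z - s) / (a + b).
have kk : k y = k s.
  apply: (@connected_int R R (itv s y)).
  - exact: connected_itv.
  - apply: mapcB; first apply: mapcB.
    + by apply: mapc_sub Fl.1 => z; rewrite /itv /=; slra.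
    + exact: mapc_cst.
    + apply: mapcM; last exact: mapc_cst.
      by apply: mapcB; [exact: mapc_id|exact: mapc_cst].
  - move=> z /andP[sz zy].
    have i1 : isint (phase (phi z x) - F z) by apply: Fl.2; rewrite /itv /=; slra.
    have i2 : isint (phase (phi s x) - F s) by apply: Fl.2; rewrite /itv /=; slra.
    have pz : phase (phi z x) = phase (phi s x) + (z - s) / (a + b).
      have -> : phi z x = phi (z - s) (phi s x) by rewrite -(flowD hphi) subrK.
      have tz : times (phi (z - s) (phi s x)) (a + (z - s)) (b - (z - s)) by apply: times_flow => //; slra.
      rewrite (phaseE tz) (phaseE t).
      have -> : a + (z - s) + (b - (z - s)) = a + b by ring.
      by rewrite mulrDl.
    have -> : k z = (phase (phi s x) - F s) - (phase (phi z x) - F z) by rewrite /k pz; ring.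
    by zit ltac:(assumption).
  - by rewrite /itv /= lexx ltW.
  - by rewrite /itv /= lexx ltW.
have : 0 < (y - s) / (a + b) by apply: divr_gt0; slra.
by move: kk; rewrite /k !subrr mul0r; slra.
Qed.

(** The lift is an integer at each hit up to a constant and is increasing, so it
    gains at least 1 in any time interval that contains two hits. *)
Lemma orbit_growth : exists2 T : R, 0 < T & forall x (n : nat) (L : R), ~ axis x -> n%:R * T <= L ->
  n%:R <= zvar 0 L (fun t => phase (phi t x)).
Proof.
have [T T0 ex] := hits_exist; exists (3 * T); first slra.
move=> x n L nx nL.
have L0 : 0 <= L by apply: le_trans nL; rewrite mulr_ge0 //; slra.
have [F Fl] := lift_itv L0 (orbit_zc (C := itv 0 L) nx); rewrite (zvarE L0 Fl).
have mono u v : 0 <= u -> u <= v -> v <= L -> F u <= F v.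
  move=> u0; rewrite le_eqVlt => /orP[/eqP -> //|uv] vL; apply/ltW/(orbit_increasing nx uv).
  by apply: islift_sub Fl => z; rewrite /itv /=; slra.
(* there are hits in [u, u + T] and in [u + 2 T, u + 3 T] *)
have step u : 0 <= u -> u + 3 * T <= L -> F u + 1 <= F (u + 3 * T).
  move=> u0 uL; have [t1 [t1l t1r h1]] := ex x u; have [t2 [t2l t2r h2]] := ex x (u + 2 * T).
  have m1 := mono u t1 u0 t1l; have m2 := mono t2 (u + 3 * T).
  have lt12 : F t1 < F t2.
    apply: (orbit_increasing nx); first slra.
    by apply: islift_sub Fl => z; rewrite /itv /=; slra.
  have i1 : isint (phase (phi t1 x) - F t1) by apply: Fl.2; rewrite /itv /=; slra.
  have i2 : isint (phase (phi t2 x) - F t2) by apply: Fl.2; rewrite /itv /=; slra.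
  rewrite (phase_hit (axis_flowN hphi ps (t := t1) nx) h1) in i1.
  rewrite (phase_hit (axis_flowN hphi ps (t := t2) nx) h2) in i2.
  have : isint (F t2 - F t1).
    have -> : F t2 - F t1 = (0 - F t1) - (0 - F t2) by ring.
    by zit ltac:(assumption).
  move=> /intrP[z e]; have : 0 < z%:~R :> R by slra.
  rewrite ltr0z => z0; have : 1 <= z%:~R :> R by rewrite ler1z.
  have := m1 ltac:(slra); have := m2 ltac:(slra) ltac:(slra) ltac:(slra); slra.
have k m : (m <= n)%N -> F 0 + m%:R <= F (m%:R * (3 * T)).
  elim: m => [|m IH] mn; first by rewrite mul0r addr0.
  have mL : (m%:R + 1) * (3 * T) <= L.
    by apply: le_trans nL; rewrite ler_pM2r ?natr1 ?ler_nat //; slra.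
  have := step (m%:R * (3 * T)); have := IH (ltnW mn).
  rewrite -[m.+1%:R]natr1 [(m%:R + 1) * (3 * T)]mulrDl mul1r => h1 h2.
  have h3 : 0 <= m%:R * (3 * T) by rewrite mulr_ge0 //; slra.
  have := h2 h3; slra.
have := k n (leqnn n); have := mono (n%:R * (3 * T)) L; have : 0 <= n%:R * (3 * T).
  by rewrite mulr_ge0 //; slra.
move=> h1 h2 h3; have := h2 h1 nL (lexx L); slra.
Qed.

End Hits.

(** * Coordinates transverse to a flow line *)

Section ArgumentJump.
Variable R : realType.

Lemma sn_ge0 (t : R) : 0 <= t -> t <= 1 / 2 -> 0 <= sn t.
Proof.
move=> t0 t2; have p0 := pi_gt0 R; rewrite /sn; apply: sin_ge0_pi; rewrite -mulr_natl; apply/andP; snra.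
Qed.

Lemma arg_upper (x y : R) : (x, y) <> (0, 0) -> 0 <= y -> arg x y <= 1 / 2.
Proof.
move=> h y0; have [/andP[a0 a1] xa ya] := argP h; have r0 := rad_gt0 h.
rewrite leNgt; apply/negP => a2; set a := arg x y in a0 a1 xa ya a2.
have s0 : 0 <= sn (1 - a) by apply: sn_ge0; slra.
have sE : sn a = - sn (1 - a) by rewrite -snN opprB -(snD1 (a - 1)) subrK.
have sa : 0 <= sn a by rewrite -(pmulr_rge0 _ r0) -ya.
have z : sn a = 0 by slra.
have y00 : y = 0 by rewrite ya z mulr0.
have c1 := cs2sn2 a; rewrite z expr0n addr0 in c1.
have : cs a < cs (1 / 2) \/ cs (1 - a) < cs 0 by right; rewrite cs_lt; slra.
rewrite cs_half cs0.
have cE : cs a = cs (1 - a) by rewrite -(csN (1 - a)) opprB -(csD1 (a - 1)) subrK.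
rewrite -cE => -[]; first by move: c1 => /eqP; rewrite sqrf_eq1 => /orP[/eqP ->|/eqP ->]; slra.
move=> c0; move: c1 => /eqP; rewrite sqrf_eq1 => /orP[/eqP c1|/eqP c1]; first by rewrite c1 ltxx in c0.
have : cs (1 / 2) < cs (1 - a) by rewrite cs_lt; slra.
by rewrite cs_half -cE c1 ltxx.
Qed.

Lemma arg_lower (x y : R) : (x, y) <> (0, 0) -> y < 0 -> 1 / 2 < arg x y.
Proof.
move=> h y0; have [/andP[a0 a1] xa ya] := argP h; have r0 := rad_gt0 h.
rewrite ltNge; apply/negP => a2; have := sn_ge0 a0 a2.
by rewrite -(pmulr_rge0 _ r0) -ya; slra.
Qed.

Lemma znear_rep (a b e : R) : 0 <= a < 1 -> 0 <= b < 1 -> 0 < e -> znear e (a - b) ->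
  (e <= b -> e <= 1 - b -> `|a - b| < e).
Proof.
move=> /andP[a0 a1] /andP[b0 b1] e0 [_ /intrP[k ->] h] h1 h2.
move: h; rewrite ltr_norml => /andP[k1 k2].
have : -1 < k%:~R :> R by slra.
have : k%:~R < 1 :> R by slra.
rewrite ltrz1 (_ : -1 = (-1)%:~R) // ltr_int => u1 u2.
have k0 : k = 0 by lia.
by move: k1 k2; rewrite k0 mulr0z subr0 ltr_norml => -> ->.
Qed.

Lemma znear0_rep (a e : R) : 0 <= a < 1 -> 0 < e -> e <= 1 / 2 -> znear e a ->
  (a <= 1 / 2 -> a < e) /\ (1 / 2 < a -> 1 - e < a).
Proof.
move=> /andP[a0 a1] e0 e2 [_ /intrP[k ->] h].
move: h; rewrite ltr_norml => /andP[k1 k2].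
have : -1 < k%:~R :> R by slra.
have : k%:~R < 2 :> R by slra.
rewrite (_ : 2 = 2%:~R) // (_ : -1 = (-1)%:~R) // !ltr_int => u1 u2.
have [k0|k0] : k = 0 \/ k = 1 by lia.
  by move: k1 k2; rewrite k0 mulr0z subr0 => ? ?; split; slra.
by move: k1 k2; rewrite k0 => ? ?; split; slra.
Qed.

Lemma arg_cont (x y : R) : (x, y) <> (0, 0) -> ~ (0 < x /\ y = 0) -> forall e : R, 0 < e ->
  \forall p \near (x, y), p <> (0, 0) -> `|arg p.1 p.2 - arg x y| < e.
Proof.
move=> h nj e e0; have [a01 _ _] := argP h; have /andP[a0 a1] := a01.
have ap : 0 < arg x y.
  by rewrite lt_neqAle a0 andbT eq_sym; apply/eqP => /(arg_eq0 h).
pose k := Num.min e (Num.min (arg x y) (1 - arg x y)).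
have k0 : 0 < k by rewrite !lt_min e0 ap; slra.
have [ke ka k1] : [/\ k <= e, k <= arg x y & k <= 1 - arg x y] by rewrite /k !ge_min !lexx !orbT.
have := @arg_zc R (x, y) h k k0; apply: filterS => p hp p0.
have [b01 _ _] : [/\ 0 <= arg p.1 p.2 < 1, p.1 = rad p.1 p.2 * cs (arg p.1 p.2) & p.2 = rad p.1 p.2 * sn (arg p.1 p.2)].
  by apply: argP; case: p p0 {hp}.
apply: lt_le_trans ke; exact: znear_rep (hp p0) _ _.
Qed.

(** The representative of the argument in [0, 1[ drops from 1 to 0 when the
    positive half-axis is crossed upwards, exactly as the phase does at a hit. *)
Lemma arg_jump (x : R) : 0 < x -> forall e : R, 0 < e -> \forall p \near (x, (0 : R)), p <> (0, 0) ->
  (0 <= p.2 -> arg p.1 p.2 < e) /\ (p.2 < 0 -> 1 - e < arg p.1 p.2).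
Proof.
move=> x0 e e0; have h : (x, (0 : R)) <> (0, 0) by move=> [z]; slra.
pose k := Num.min e (1 / 2); have k0 : 0 < k by rewrite lt_min e0; slra.
have [ke k2] : k <= e /\ k <= 1 / 2 by rewrite /k !ge_min !lexx !orbT.
have := @arg_zc R (x, 0) h k k0; apply: filterS => -[u v] /= hp p0.
have [b01 _ _] := argP p0.
have := hp p0; rewrite (arg_pos x0 erefl) subr0 => /(znear0_rep b01 k0 k2)[h1 h2].
split=> v0; first by apply: lt_le_trans (h1 _) ke; exact: arg_upper.
by have := h2 (arg_lower p0 v0); slra.
Qed.

End ArgumentJump.

Section NormalCoordinate.
Variables (R : realType) (M : topologicalType) (A : set (chart R 3 M)) (phi : R -> M -> M).
Hypothesis AM : oriented_atlas setT A.
Hypothesis hphi : smooth_flow A phi.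
Implicit Types (d : chart R 3 M) (p x : M).

Let flowK s x : phi (- s) (phi s x) = x.
Proof. by rewrite -(flowD hphi) addNr (flow0 hphi). Qed.

(** The distance covered in time s is at most n times the distance covered in
    time s / n, up to a factor, and the latter is o(1 / n). *)
Lemma rest_point d p : A d -> cdom d p -> velocity phi d p = 0 ->
  exists2 r : R, 0 < r & forall s, `|s| < r -> phi s p = p.
Proof.
move=> dA dp v0; have ok := atlas_chart AM dA; set u0 := cfwd d p.
have [r1 r10 h1] := flow_chart_sdiff AM hphi dA dp ltr01.
have [r2 r20 h2] := flow_in_near AM hphi dA dp filterT.
have dn : nbhs p [set x | cdom d x /\ `|cfwd d x - u0| < Num.min r1 r2].
  have r12 : 0 < Num.min r1 r2 by rewrite lt_min r10.
  exact: (chart_fwd_near ok dp (near_norm u0 r12)).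
have [P hP [Q hQ PQ]] := flow_near0 hphi dn.
have [r3 r30 h3] := norm_near hP.
pose r := Num.min (Num.min r1 r2) r3; have r0 : 0 < r by rewrite !lt_min r10 r20.
have [rr1 rr2 rr3] : [/\ r <= r1, r <= r2 & r <= r3] by rewrite /r !ge_min !lexx !orbT.
exists r => // s sr.
have near t : `|t| <= `|s| -> [/\ cdom d (phi t p), `|cfwd d (phi t p) - u0| < r1 & `|cfwd d (phi t p) - u0| < r2].
  move=> ts; have Pt : P t by apply: h3; rewrite subr0; slra.
  by have [h4] := PQ t p Pt (nbhs_singleton hQ); rewrite lt_min => /andP[].
have step t h : `|t| <= `|s| -> `|h| <= `|s| -> `|t + h| <= `|s| ->
    `|cfwd d (phi (t + h) p) - cfwd d (phi t p)| <= 2 * `|cfwd d (phi h p) - u0|.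
  move=> ts hs ths; have [dh hr1 hr2] := near h hs.
  have := h1 (t, cfwd d (phi h p)) (t, u0).
  rewrite !pair_norm /= !subr0 !subrr !gt_max normr0.
  rewrite hr1 r10 (_ : `|t| < r1) ?(le_lt_trans ts) ?(lt_le_trans sr) //=.
  move=> /(_ isT isT).
  rewrite /flow_in /= (chart_cancel ok dh) (chart_cancel ok dp) -(flowD hphi) scale0r add0r.
  have m : Num.max `|(0 : R)| `|cfwd d (phi h p) - u0| = `|cfwd d (phi h p) - u0|.
    by rewrite normr0; apply/max_idPr.
  rewrite m mul1r => k; set X := cfwd d (phi (t + h) p) - _ in k *; set Y := cfwd d (phi h p) - u0 in k *.
  by rewrite -(subrK Y X); apply: (le_trans (ler_normD _ _)); slra.
have [ds _ _] := near s (lexx _).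
suff e : cfwd d (phi s p) = u0 by rewrite -(chart_cancel ok ds) e (chart_cancel ok dp).
apply/eqP; rewrite -subr_eq0 -normr_eq0 eq_le normr_ge0 andbT.
apply/ler_addgt0Pr => e e0; rewrite add0r.
pose e1 := e / (2 * (`|s| + 1)).
have e10 : 0 < e1 by rewrite divr_gt0 // mulr_gt0 // ltr_wpDl.
have [r4 r40 h4] := norm_near (velocity_flow AM hphi dA dp e10).
pose n := (Num.bound (`|s| / r4)).+1.
have n0 : 0 < n%:R :> R by rewrite ltr0n.
have nb : `|s / n%:R| < r4.
  rewrite normrM normfV (gtr0_norm n0) ltr_pdivrMr // mulrC -ltr_pdivrMr //.
  apply: (@lt_le_trans _ _ (Num.bound (`|s| / r4))%:R); first by apply: archi_boundP; rewrite divr_ge0 // ltW.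
  by rewrite ler_nat.
have small : `|cfwd d (phi (s / n%:R) p) - u0| <= e1 * (`|s| / n%:R).
  have := h4 (s / n%:R); rewrite subr0 => /(_ nb); rewrite v0 scaler0 subr0.
  by rewrite normrM normfV (gtr0_norm n0).
have bnd k : (k <= n)%N -> `|k%:R * (s / n%:R)| <= `|s|.
  move=> kn; rewrite mulrCA normrM -[leRHS]mulr1 ler_wpM2l // ger0_norm ?divr_ge0 //.
  by rewrite ler_pdivrMr // mul1r ler_nat.
have tot k : (k <= n)%N -> `|cfwd d (phi (k%:R * (s / n%:R)) p) - u0| <= k%:R * (2 * (e1 * (`|s| / n%:R))).
  elim: k => [|k IH] kn; first by rewrite !mul0r (flow0 hphi) subrr normr0.
  have := step (k%:R * (s / n%:R)) (s / n%:R) (bnd k (ltnW kn)).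
  have hs1 : `|s / n%:R| <= `|s| by have := bnd 1%N (leq_ltn_trans (leq0n _) (leqnn _)); rewrite mul1r.
  have ts1 : `|k%:R * (s / n%:R) + s / n%:R| <= `|s|.
    by have := bnd k.+1 kn; rewrite -[k.+1%:R]natr1 [(k%:R + 1) * (s / n%:R)]mulrDl mul1r.
  move=> /(_ hs1 ts1); rewrite -[k.+1%:R]natr1 [(k%:R + 1) * (s / n%:R)]mulrDl mul1r => k1.
  have k2 := IH (ltnW kn).
  set X := cfwd d (phi (k%:R * (s / n%:R) + s / n%:R) p) in k1 *; set Y := cfwd d (phi (k%:R * _) p) in k1 k2 *.
  rewrite -(subrK Y X) -addrA; apply: (le_trans (ler_normD _ _)); slra.
have := tot n (leqnn n); rewrite (_ : n%:R * (s / n%:R) = s); last by field; rewrite gt_eqF.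
move=> /le_trans; apply.
have -> : n%:R * (2 * (e1 * (`|s| / n%:R))) = e1 * (2 * `|s|) by field; rewrite gt_eqF.
rewrite /e1 mulrAC ler_pdivrMr ?mulr_gt0 ?ltr_wpDl //.
by rewrite ler_wpM2l ?(ltW e0) //; slra.
Qed.

(** A coordinate om in a plane transverse to the flow line of p, whose zeros near p
    are the flow line (nc_near bounds the distance of x to a point of the flow
    line by om x), oriented by nc_det and nc_diff. *)
Record ncoord d p (N : 'M[R]_(2, 3)) (om : 'rV[R]_3 -> 'rV[R]_2) : Prop := {
  nc_det : 0 < \det (framemx (velocity phi d p) N);
  nc_diff : sdiff om (cfwd d p) (fun k => k *m normal_mx (velocity phi d p) N);
  nc_near : exists2 C : R, 0 < C & forall e : R, 0 < e -> exists r : R, [/\ 0 < r, r <= e &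
    exists2 W, nbhs p W & [/\ W `<=` cdom d, mapc W (om \o cfwd d),
      forall x, W x -> exists t, [/\ cdom d (phi t p), `|cfwd d (phi t p) - cfwd d p| < e,
        `|t| < e, om (cfwd d (phi t p)) = 0 & `|cfwd d x - cfwd d (phi t p)| <= C * `|om (cfwd d x)|] &
      forall x t, W x -> `|t| < r -> x = phi t p -> om (cfwd d x) = 0]] }.

(** The disc coordinate of the flow box of the disc spanned by N. *)
Lemma ncoord_exists d p N : A d -> cdom d p -> 0 < \det (framemx (velocity phi d p) N) ->
  exists om, ncoord d p N om.
Proof.
move=> dA dp D0; have ok := atlas_chart AM dA; set u0 := cfwd d p.
pose g (a : 'rV[R]_2) := u0 + a *m N.
have g0 : g 0 = u0 by rewrite /g mul0mx addr0.
have gs : sdiff g 0 (fun h => h *m N).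
  move=> e e0; exists 1 => // x y _ _.
  by rewrite /g opprD addrACA subrr add0r -mulmxBl subrr normr0 mulr_ge0 // ltW.
have [G [G0 Gs box]] := flow_box AM hphi dA dp g0 gs (lt0r_neq0 D0).
exists (fst \o G); split=> //.
  have lfst : blin (@fst 'rV[R]_2 R).
    by split=> // ; exists 1 => // -[a t]; rewrite mul1r pair_norm /= le_max lexx.
  have fs : sdiff (@fst 'rV[R]_2 R) (G (cfwd d p)) fst.
    by move=> e e0; exists 1 => // x y _ _; rewrite subrr normr0 mulr_ge0 // ltW.
  have := sdiff_comp (blin_coframe _ _) lfst Gs fs; apply: sdiff_eqA => k.
  by rewrite /= /normal_mx (@mulmx_rsub R _ 3 1 2).
have [C1 C10 [r1 r10 lip]] : exists2 C1 : R, 0 < C1 & exists2 r1 : R, 0 < r1 & forall x y : R * 'rV[R]_3,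
    `|x - (0, u0)| < r1 -> `|y - (0, u0)| < r1 -> `|flow_in phi d x - flow_in phi d y| <= C1 * `|x - y|.
  apply: sdiff_lip (flow_chart_sdiff AM hphi dA dp).
  split=> [h k|]; first by rewrite /= scalerBl opprD addrACA.
  exists (`|velocity phi d p| + 1); first by rewrite ltr_wpDl.
  move=> [t w]; rewrite pair_norm /=; apply: (le_trans (ler_normD _ _)); rewrite mulrDl mul1r normrZ.
  apply: lerD; last by rewrite le_max lexx orbT.
  by rewrite mulrC ler_wpM2l // le_max lexx.
have [_ [C2 C20 Nb]] := blin_mulmx N.
exists (C1 * C2); first exact: mulr_gt0.
move=> e e0.
have [ra [ra0 rae [Wa Wan [_ _ _ Wau]]]] := box e e0.
have en : nbhs p ([set x | cdom d x /\ `|cfwd d x - u0| < e] `&` Wa).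
  by apply: filterI => //; exact: (chart_fwd_near ok dp (near_norm u0 e0)).
have [r2 r20 h2] := flow_in_near AM hphi dA dp en.
have [|r [r0 rle [W Wn [Wd Gc Wx Wu]]]] := box (Num.min (Num.min ra r2) (Num.min r1 (r1 / C2))).
  by rewrite !lt_min ra0 r20 r10 divr_gt0.
have [rra rr2 rr1 rr3] : [/\ r <= ra, r <= r2, r <= r1 & r <= r1 / C2].
  by move: rle; rewrite !le_min => /andP[/andP[-> ->] /andP[-> ->]].
have re := le_trans rra rae.
have c0 : `|(0 : 'rV[R]_2) - 0| < ra by rewrite subrr normr0.
exists r; split=> //; exists W => //; split=> //.
- apply: (mapc_comp (B := setT) (g := fst)) Gc _ => //.
  by apply: mapc_cont => q; exact: cvg_fst.
- move=> x Wx'; move: (Wx x Wx') => /=; case: (G (cfwd d x)) => a t [] /=; rewrite subr0 => ar tr xE.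
  have u0n : `|u0 - u0| < r2 by rewrite subrr normr0.
  have [_ _ h5 [[h6 h7] h8]] := h2 t u0 (lt_le_trans tr rr2) u0n.
  rewrite (chart_cancel ok dp) in h5 h6 h7 h8.
  have Gt : (G (cfwd d (phi t p))).1 = 0.
    by rewrite (Wau _ 0 t h8 c0 (lt_le_trans tr rra)) // g0 (chart_cancel ok dp).
  exists t; split=> //; first exact: lt_le_trans tr re.
  have aN : `|g a - u0| < r1.
    rewrite /g addrAC subrr add0r; apply: (le_lt_trans (Nb a)).
    by rewrite mulrC -ltr_pdivlMr //; exact: lt_le_trans ar rr3.
  have n1 : `|(t, g a) - (0, u0)| < r1.
    by rewrite pair_norm /= subr0 gt_max aN (lt_le_trans tr rr1).
  have n2 : `|(t, u0) - (0, u0)| < r1.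
    by rewrite pair_norm /= subr0 subrr normr0 gt_max r10 (lt_le_trans tr rr1).
  have := lip _ _ n1 n2; rewrite /flow_in /= -xE (chart_cancel ok dp) pair_norm /= !subrr normr0.
  rewrite /g addrAC subrr add0r (_ : Num.max 0 _ = `|a *m N|); last by apply/max_idPr.
  by move=> /le_trans; apply; rewrite -mulrA ler_wpM2l ?(ltW C10).
- move=> x t Wx' tr xE; have := Wu x 0 t Wx'; rewrite subrr normr0 => /(_ r0 tr) /= -> //.
  by rewrite g0 (chart_cancel ok dp).
Qed.

Definition argr (u : 'rV[R]_2) : R := arg (u 0 0) (u 0 1).

Lemma row2_neq0 (u : 'rV[R]_2) : u != 0 <-> (u 0 0, u 0 1) <> (0, 0).
Proof.
split=> [u0 [e1 e2]|h]; last by apply/eqP => e; apply: h; rewrite e !mxE.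
case/eqP: u0; apply/rowP => j; rewrite mxE.
by case: j => -[|[|//]] i; [rewrite -[RHS]e1|rewrite -[RHS]e2]; congr (u 0 _); exact: val_inj.
Qed.

Lemma row2_norm (u : 'rV[R]_2) : `|u| <= `|u 0 0| + `|u 0 1|.
Proof.
apply: row_norm_le => [|j]; first by rewrite addr_ge0.
case: j => -[|[|//]] i.
  by rewrite (_ : Ordinal i = 0) ?lerDl //; exact: val_inj.
by rewrite (_ : Ordinal i = 1) ?lerDr //; exact: val_inj.
Qed.

Lemma mapc_coord (T : topologicalType) n (C : set T) (f : T -> 'rV[R]_n) j :
  mapc C f -> mapc C (fun z => f z 0 j).
Proof.
move=> fc; apply: (mapc_comp (B := setT) (g := fun u : 'rV[R]_n => u 0 j)) fc _ => //.
apply: mapc_cont => u V hV; exact: (coord_near (P := V)).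
Qed.

(** To first order om' is a linear image of om, of positive determinant, at each
    point close to p and not only at p: x is compared with the point of the flow
    line that is closest in the sense of nc_near, where both coordinates vanish.
    Then arg_linear applies. *)
Lemma ncoord_compare d p N om om' (A' : 'M[R]_(3, 2)) (delta : R) W' : A d -> cdom d p ->
  ncoord d p N om -> sdiff om' (cfwd d p) (fun k => k *m A') -> velocity phi d p *m A' = 0 ->
  0 < \det (N *m A') -> 0 < delta ->
  (forall t, `|t| < delta -> cdom d (phi t p) -> om' (cfwd d (phi t p)) = 0) ->
  nbhs p W' -> W' `<=` cdom d -> mapc W' (om' \o cfwd d) ->
  exists W, [/\ nbhs p W, W `<=` W', forall x, W x -> om (cfwd d x) != 0 -> om' (cfwd d x) != 0 &
    exists h, islift (W `&` [set x | om (cfwd d x) != 0])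
      (fun x => argr (om' (cfwd d x)) - argr (om (cfwd d x))) h /\ forall x, `|h x| <= 1].
Proof.
move=> dA dp nc os vA D0 delta0 oz Wn' Wd' oc; have ok := atlas_chart AM dA.
set u0 := cfwd d p in os *; set v := velocity phi d p in vA.
set L := N *m A' in D0.
have A'E (k : 'rV[R]_3) : k *m A' = k *m normal_mx v N *m L.
  have := coframeK (lt0r_neq0 (nc_det nc)) k; rewrite /frame => e.
  rewrite -{1}e mulmxDl -scalemxAl vA scaler0 addr0 -mulmxA /L.
  by rewrite /coframe /= /normal_mx (@mulmx_rsub R _ 3 1 2).
have LD : 0 < L 0 0 * L 1 1 - L 1 0 * L 0 1 by rewrite det2 in D0; slra.
have [eta eta0 heta] := arg_linear LD.
have [C C0 near] := nc_near nc.
have [_ [CL CL0 Lb]] := blin_mulmx L.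
pose e1 := eta / ((1 + CL) * C).
have e10 : 0 < e1 by rewrite divr_gt0 // mulr_gt0 // addr_gt0.
have [r1 r10 h1] := os _ e10; have [r2 r20 h2] := nc_diff nc e10.
have r12 : 0 < Num.min r1 r2 by rewrite lt_min r10.
have [|r [r0 re [W Wn [Wd Wc Wt Wz]]]] := near (Num.min delta (Num.min r1 r2)).
  by rewrite lt_min delta0.
pose W1 := W `&` W' `&` [set x | cdom d x /\ `|cfwd d x - u0| < Num.min r1 r2].
have W1n : nbhs p W1.
  apply: filterI; first exact: filterI.
  exact: (chart_fwd_near ok dp (near_norm u0 r12)).
have close x : W1 x -> `|om' (cfwd d x) - om (cfwd d x) *m L| <= eta * `|om (cfwd d x)|.
  move=> [[Wx W'x] [dx]]; rewrite lt_min => /andP[x1 x2].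
  have [t [dt]] := Wt x Wx; rewrite !lt_min => /and3P[_ t1 t2] /andP[td _] omt xt.
  set X := cfwd d x in x1 x2 xt *; set Y := cfwd d (phi t p) in t1 t2 omt xt.
  have k1 := h1 X Y x1 t1; have k2 := h2 X Y x2 t2.
  rewrite (oz t td dt) subr0 A'E in k1; rewrite omt subr0 in k2.
  set Z := (X - Y) *m normal_mx v N in k1 k2.
  have -> : om' X - om X *m L = (om' X - Z *m L) - (om X - Z) *m L.
    by rewrite mulmxBl opprB addrA subrK.
  apply: (le_trans (ler_normB _ _)).
  have k3 := Lb (om X - Z).
  have k4 : CL * `|om X - Z| <= CL * (e1 * `|X - Y|) by rewrite ler_wpM2l // ltW.
  have k5 : e1 * (1 + CL) * `|X - Y| <= e1 * (1 + CL) * (C * `|om X|).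
    by rewrite ler_wpM2l // mulr_ge0 ?(ltW e10) // addr_ge0 // ltW.
  have m : e1 * (1 + CL) * (C * `|om X|) = eta * `|om X|.
    by rewrite /e1; field; rewrite !gt_eqF // addr_gt0.
  rewrite m in k5; set a := `|om' X - _| in k1 *; set b := `|(om X - Z) *m L| in k3 *.
  set q := `|om X - Z| in k2 k3 k4; set z := `|X - Y| in k1 k2 k4 k5; snra.
have coordL u j : (u *m L) 0 j = L 0 j * u 0 0 + L 1 j * u 0 1.
  rewrite mxE !big_ord_recl big_ord0 addr0 ![L _ j * _]mulrC.
  by rewrite (_ : lift ord0 ord0 = 1) //; exact: val_inj.
have coordB (a b : 'rV[R]_2) j : (a - b) 0 j = a 0 j - b 0 j by rewrite !mxE.
pose D := W1 `&` [set x | om (cfwd d x) != 0].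
have omc : mapc D (om \o cfwd d) by apply: mapc_sub Wc => x [[[]]].
have om'c : mapc D (om' \o cfwd d) by apply: mapc_sub oc => x [[[]]].
have bnd x j : D x -> `|om' (cfwd d x) 0 j - (om (cfwd d x) *m L) 0 j| <=
    eta * (`|om (cfwd d x) 0 0| + `|om (cfwd d x) 0 1|).
  move=> [/close k _]; have := row_norm_ge (om' (cfwd d x) - om (cfwd d x) *m L) j.
  rewrite coordB => /le_trans; apply; apply: (le_trans k).
  by rewrite ler_wpM2l ?(ltW eta0) //; exact: row2_norm.
have [||||x Dx|x Dx|x Dx|nz [h [hl hb]]] := heta M D (fun x => om (cfwd d x) 0 0) (fun x => om (cfwd d x) 0 1)
  (fun x => om' (cfwd d x) 0 0) (fun x => om' (cfwd d x) 0 1).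
- exact: (mapc_coord (f := om \o cfwd d)).
- exact: (mapc_coord (f := om \o cfwd d)).
- exact: (mapc_coord (f := om' \o cfwd d)).
- exact: (mapc_coord (f := om' \o cfwd d)).
- by apply/row2_neq0; case: Dx.
- by rewrite -coordL; exact: bnd.
- by rewrite -coordL; exact: bnd.
exists W1; split=> //.
- by move=> x [[]].
- by move=> x W1x ox; apply/row2_neq0; exact: nz.
- by exists h.
Qed.

End NormalCoordinate.

(** * Frame determinants and rates of curves *)

Section FrameAlgebra.
Variable R : realType.
Implicit Types (v w : 'rV[R]_3) (J N : 'M[R]_(2, 3)).

Lemma framemx0 v J j : framemx v J 0 j = v 0 j.
Proof.
rewrite /framemx; have := @col_mxEu R 1 2 3 v J (0 : 'I_1) j.
by rewrite (_ : lshift 2 (0 : 'I_1) = 0 :> 'I_3) //; exact: val_inj.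
Qed.

Lemma framemx1 v J j : framemx v J 1 j = J 0 j.
Proof.
rewrite /framemx; have := @col_mxEd R 1 2 3 v J (0 : 'I_2) j.
by rewrite (_ : rshift 1 (0 : 'I_2) = 1 :> 'I_3) //; exact: val_inj.
Qed.

Lemma framemx2 v J j : framemx v J 2 j = J 1 j.
Proof.
rewrite /framemx; have := @col_mxEd R 1 2 3 v J (1 : 'I_2) j.
by rewrite (_ : rshift 1 (1 : 'I_2) = 2 :> 'I_3) //; exact: val_inj.
Qed.

Definition framemxE := (framemx0, framemx1, framemx2).

Lemma ord3P (P : 'I_3 -> Prop) : P 0 -> P 1 -> P 2 -> forall i, P i.
Proof.
move=> P0 P1 P2 [[|[|[|//]]] i].
- by rewrite (_ : Ordinal i = 0) //; exact: val_inj.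
- by rewrite (_ : Ordinal i = 1) //; exact: val_inj.
- by rewrite (_ : Ordinal i = 2) //; exact: val_inj.
Qed.

Lemma frame_exists v : v != 0 -> exists N, 0 < \det (framemx v N).
Proof.
move=> v0; have [k vk] : exists k, v 0 k != 0.
  by apply/existsP; apply: contraNT v0; rewrite negb_exists => /forallP h;
     apply/eqP/rowP => j; rewrite mxE; apply/eqP; rewrite -[_ == _]negbK; exact: h.
have sq : 0 < v 0 k * v 0 k by rewrite -expr2 exprn_even_gt0.
pose Nf (f g : 'I_3) : 'M[R]_(2, 3) := \matrix_(i, j) (if i == 0 then (j == f)%:R else v 0 k * (j == g)%:R).
suff [f [g h]] : exists f g, \det (framemx v (Nf f g)) = v 0 k * v 0 k by exists (Nf f g); rewrite h.
move: vk sq @Nf; elim/ord3P: k => vk sq Nf.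
- by exists 1, 2; rewrite det3 !framemxE !mxE /=; ring.
- by exists 2, 0; rewrite det3 !framemxE !mxE /=; ring.
- by exists 0, 1; rewrite det3 !framemxE !mxE /=; ring.
Qed.

Lemma rank_frame J : \rank J = 2%N -> exists w, 0 < \det (framemx w J).
Proof.
move=> rJ; have Jf : row_free J by rewrite /row_free rJ.
have [w nw] : exists w : 'rV[R]_3, ~~ (w <= J)%MS.
  have nf : ~~ (1%:M <= J)%MS by rewrite sub1mx /row_full rJ.
  by have /row_subPn[i hi] := nf; exists (row i 1%:M).
have d0 : \det (framemx w J) != 0.
  apply/negP => /det0P[z z0 zJ]; pose z' : 'rV[R]_(1 + 2) := z.
  have e : lsubmx z' *m w + rsubmx z' *m J = 0.
    by rewrite -(@mul_row_col R 1 1 2 3) hsubmxK.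
  have [l0|l0] := eqVneq (lsubmx z' 0 0) 0.
    have l0' : lsubmx z' = 0 by rewrite [lsubmx z']mx11_scalar l0 raddf0.
    have [K JK] := row_freeP Jf.
    have r0 : rsubmx z' = 0.
      by move: e; rewrite l0' mul0mx add0r => e; rewrite -[rsubmx z']mulmx1 -JK mulmxA e mul0mx.
    by case/eqP: z0; rewrite -[z](@hsubmxK R 1 1 2) -/z' l0' r0 row_mx0.
  case/negP: nw; have -> : w = (- (lsubmx z' 0 0)^-1 *: rsubmx z') *m J.
    move: e; rewrite {1}[lsubmx z']mx11_scalar mul_scalar_mx => /eqP; rewrite addr_eq0 => /eqP e.
    by rewrite -scalemxAl scaleNr -scalerN -e scalerA mulVf // scale1r.
  exact: submxMl.
have [p|n] := ltP 0 (\det (framemx w J)); first by exists w.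
exists (- w); have -> : \det (framemx (- w) J) = - \det (framemx w J).
  by rewrite !det3 !framemxE !mxE; ring.
by rewrite oppr_gt0 lt_neqAle d0.
Qed.

Lemma det_frame_change v w J : \det (framemx w J) != 0 ->
  \det (framemx v J) = (coframe J w v).2 * \det (framemx w J).
Proof.
move=> d0; have := coframeK d0 v; rewrite /frame; case: (coframe J w v) => a k /= e.
rewrite !det3 !framemxE.
have vE j : v 0 j = a 0 0 * J 0 j + a 0 1 * J 1 j + k * w 0 j.
  rewrite -e !mxE !big_ord_recl big_ord0 addr0.
  by rewrite (_ : lift ord0 ord0 = 1) //; exact: val_inj.
rewrite !vE; ring.
Qed.

End FrameAlgebra.

Section Rates.
Variable R : realType.

(** Compared in a coordinate where v does not vanish, the ratio t / y has a
    limit, which is the coefficient of J on v. *)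
Lemma parallel_rates n (J v : 'rV[R]_n) (F : set_system R) (FF : ProperFilter F) (y t : R -> R) :
  v != 0 -> J != 0 -> (forall e : R, 0 < e -> \forall s \near F, `|y s *: J - t s *: v| <= e * (`|y s| + `|t s|)) ->
  (\forall s \near F, y s != 0) ->
  exists2 k : R, k != 0 & J = k *: v /\ \forall s \near F, 0 < k * (t s * y s).
Proof.
move=> v0 J0 H y0.
have [l vl] : exists l, v 0 l != 0.
  by apply/existsP; apply: contraNT v0; rewrite negb_exists => /forallP h;
     apply/eqP/rowP => j; rewrite mxE; apply/eqP; rewrite -[_ == _]negbK; exact: h.
set a := `|v 0 l|; have a0 : 0 < a by rewrite normr_gt0.
pose C := 2 * (`|J 0 l| + 1) / a.
have C0 : 0 < C by rewrite divr_gt0 // mulr_gt0 // ltr_wpDl.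
have comp e (s : R) j : `|y s *: J - t s *: v| <= e * (`|y s| + `|t s|) ->
    `|y s * J 0 j - t s * v 0 j| <= e * (`|y s| + `|t s|).
  by apply: le_trans; have := row_norm_ge (y s *: J - t s *: v) j; rewrite !mxE.
have tC : \forall s \near F, `|t s| <= C * `|y s|.
  pose e := Num.min 1 (a / 2); have e0 : 0 < e by rewrite lt_min ltr01; slra.
  have [e1 e2] : e <= 1 /\ e <= a / 2 by rewrite /e !ge_min !lexx !orbT.
  apply: filterS (H e e0) => s /(comp _ _ l) h.
  have k1 : `|t s| * a <= `|y s| * `|J 0 l| + `|y s * J 0 l - t s * v 0 l|.
    have -> : `|t s| * a = `|y s * J 0 l - (y s * J 0 l - t s * v 0 l)| by rewrite subKr normrM.
    by rewrite -normrM; exact: ler_normB.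
  have y1 := normr_ge0 (y s); have t1 := normr_ge0 (t s).
  have k2 : e * (`|y s| + `|t s|) <= `|y s| + a / 2 * `|t s| by snra.
  rewrite /C mulrAC ler_pdivlMr //; snra.
have rate (e : R) : 0 < e -> \forall s \near F, [/\ y s != 0 & forall j, `|J 0 j - t s / y s * v 0 j| <= e].
  move=> e0; have e1 : 0 < e / (1 + C) by rewrite divr_gt0 // addr_gt0.
  apply: filterS3 y0 tC (H _ e1) => s ys ts h; split=> // j.
  have yp : 0 < `|y s| by rewrite normr_gt0.
  have -> : J 0 j - t s / y s * v 0 j = (y s * J 0 j - t s * v 0 j) / y s by field.
  rewrite normrM normfV ler_pdivrMr //; apply: (le_trans (comp _ _ j h)).
  have -> : e * `|y s| = e / (1 + C) * ((1 + C) * `|y s|) by field; rewrite gt_eqF // addr_gt0.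
  by rewrite ler_wpM2l ?(ltW e1) //; slra.
pose k := J 0 l / v 0 l.
have lam (e : R) : 0 < e -> \forall s \near F, [/\ y s != 0, `|k - t s / y s| <= e & forall j, `|J 0 j - t s / y s * v 0 j| <= e].
  move=> e0; pose e1 := Num.min e (e * a); have e10 : 0 < e1 by rewrite lt_min e0 mulr_gt0.
  have [e11 e12] : e1 <= e /\ e1 <= e * a by rewrite /e1 !ge_min !lexx !orbT.
  apply: filterS (rate _ e10) => s [ys h]; split=> // [|j]; last exact: le_trans (h j) e11.
  have -> : k - t s / y s = (J 0 l - t s / y s * v 0 l) / v 0 l by rewrite /k; field; rewrite ?ys ?vl.
  by rewrite normrM normfV ler_pdivrMr //; exact: le_trans (h l) e12.
have Jk : J = k *: v.
  apply/rowP => j; rewrite mxE; apply/eqP; rewrite -subr_eq0 -normr_eq0 eq_le normr_ge0 andbT.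
  apply/ler_addgt0Pr => e e0; rewrite add0r.
  have e1 : 0 < e / (1 + `|v 0 j|) by rewrite divr_gt0 // ltr_pwDl.
  have [s [ys h1 h2]] := filter_ex (lam _ e1).
  have -> : J 0 j - k * v 0 j = (J 0 j - t s / y s * v 0 j) - (k - t s / y s) * v 0 j by ring.
  apply: (le_trans (ler_normB _ _)); rewrite normrM.
  have -> : e = e / (1 + `|v 0 j|) + e / (1 + `|v 0 j|) * `|v 0 j| by field; rewrite gt_eqF // ltr_pwDl.
  by apply: lerD; [exact: h2|rewrite ler_wpM2r].
have k0 : k != 0 by apply/eqP => z; move: J0; rewrite Jk z scale0r eqxx.
exists k => //; split=> //.
have kn : 0 < `|k| by rewrite normr_gt0.
have k2 : 0 < `|k| / 2 by slra.
apply: filterS (lam _ k2) => s [ys h _].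
have -> : k * (t s * y s) = k * (t s / y s) * (y s * y s) by field.
have yy : 0 < y s * y s by rewrite -expr2 exprn_even_gt0.
rewrite pmulr_lgt0 //; set rr := t s / y s in h *.
move: h kn; rewrite ler_norml; case: (ltrgt0P k) k0 => // kk _ h _; snra.
Qed.

(** Otherwise the minimum of eps * th over the period after s would be interior,
    and th would not be monotone there. *)
Lemma crossing_sign (th : R -> R) (eps q : R) : continuous th -> (forall s, th (s + 1) = th s + q) ->
  0 < eps * q ->
  (forall s, exists2 k : R, k != 0 & \forall s' \near s^', 0 < k * ((th s' - th s) * (s' - s))) ->
  forall s k, k != 0 -> (\forall s' \near s^', 0 < k * ((th s' - th s) * (s' - s))) -> 0 < eps * k.
Proof.
move=> thc th1 eq0 cross s k k0 hk.
have ne (u : R) (P : set R) : (\forall u' \near u^', P u') -> exists2 r : R, 0 < r &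
    forall u', u' != u -> `|u' - u| < r -> P u'.
  move=> /nbhs_ballP[r r0 h]; exists r => // u' u'u ur; apply: h => //.
  by rewrite /ball /= distrC.
rewrite ltNge; apply/negP => ek.
have ek' : eps * k < 0.
  rewrite lt_neqAle ek andbT mulf_eq0 negb_or k0 andbT.
  by apply/eqP => z; rewrite z mul0r ltxx in eq0.
have [r r0 hr] := ne _ _ hk.
pose d := Num.min (r / 2) (1 / 2); have d0 : 0 < d by rewrite lt_min; slra.
have [dr d1] : d <= r / 2 /\ d <= 1 / 2 by rewrite /d !ge_min !lexx !orbT.
have low : eps * th (s + d) < eps * th s.
  have := hr (s + d); rewrite -subr_eq0 addrAC subrr add0r gt_eqF // gtr0_norm // => /(_ isT ltac:(slra)).
  move=> hh; have : (k * k) * d * (eps * (th (s + d) - th s)) < 0.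
    have -> : k * k * d * (eps * (th (s + d) - th s)) = (eps * k) * (k * ((th (s + d) - th s) * d)) by ring.
    by rewrite pmulr_llt0.
  have kk : 0 < k * k * d by rewrite mulr_gt0 // -expr2 exprn_even_gt0.
  by rewrite pmulr_rlt0 // mulrBr subr_lt0.
(* eps * th decreases after s and is larger at s + 1: its minimum is interior *)
have [||c] := @EVT_min R (fun u => eps * th u) s (s + 1).
- slra.
- by apply: continuous_subspaceT => u; apply: cvgM; [exact: cvg_cst|exact: thc].
rewrite in_itv /= => /andP[c0 c1] cm.
have m1 : eps * th c <= eps * th (s + d) by apply: cm; rewrite in_itv /=; slra.
have cs' : c != s by apply/eqP => z; rewrite z in m1; slra.
have cs1 : c != s + 1 by apply/eqP => z; rewrite z th1 mulrDr in m1; slra.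
have cl : s < c by rewrite lt_neqAle eq_sym cs'.
have cr : c < s + 1 by rewrite lt_neqAle cs1.
have [kc kc0 /ne[rc rc0 hc]] := cross c.
pose e := Num.min (rc / 2) (Num.min (c - s) (s + 1 - c)).
have e0 : 0 < e by rewrite !lt_min; apply/and3P; split; slra.
have [er es es1] : [/\ e <= rc / 2, e <= c - s & e <= s + 1 - c] by rewrite /e !ge_min !lexx !orbT.
have h1 := hc (c + e); rewrite -subr_eq0 addrAC subrr add0r gt_eqF // gtr0_norm // in h1.
have h2 := hc (c - e); rewrite -subr_eq0 addrAC subrr add0r oppr_eq0 gt_eqF // normrN gtr0_norm // in h2.
have {}h1 := h1 isT ltac:(slra); have {}h2 := h2 isT ltac:(slra).
have m2 : eps * th c <= eps * th (c + e) by apply: cm; rewrite in_itv /=; slra.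
have m3 : eps * th c <= eps * th (c - e) by apply: cm; rewrite in_itv /=; slra.
have g1 : 0 < kc * (th (c + e) - th c) by rewrite mulrA pmulr_lgt0 in h1.
have g2 : 0 < - (kc * (th (c - e) - th c)) by rewrite mulrA mulrN -mulNr pmulr_lgt0 in h2.
have ep : eps != 0 by apply/eqP => z; rewrite z mul0r ltxx in eq0.
have e2 : 0 < eps * eps by rewrite -expr2 exprn_even_gt0.
have n1 : 0 <= (eps * kc) * (kc * (th (c + e) - th c)) \/ eps * kc < 0.
  by have [|] := leP 0 (eps * kc); [left; apply: mulr_ge0 => //; exact: ltW|right].
have kk : 0 < kc * kc by rewrite -expr2 exprn_even_gt0.
have m2' : 0 <= eps * (th (c + e) - th c) by rewrite mulrBr; slra.
have m3' : 0 <= eps * (th (c - e) - th c) by rewrite mulrBr; slra.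
have q1 : 0 < kc * kc * (eps * eps) by exact: mulr_gt0.
have p1 : 0 <= (eps * (th (c + e) - th c)) * (eps * (th (c - e) - th c)) by exact: mulr_ge0.
have p2 : 0 < (kc * (th (c + e) - th c)) * (- (kc * (th (c - e) - th c))) by exact: mulr_gt0.
have E1 : (kc * (th (c + e) - th c)) * (- (kc * (th (c - e) - th c))) =
  - (kc * kc) * ((th (c + e) - th c) * (th (c - e) - th c)) by ring.
have E2 : (eps * (th (c + e) - th c)) * (eps * (th (c - e) - th c)) =
  (eps * eps) * ((th (c + e) - th c) * (th (c - e) - th c)) by ring.
rewrite E2 pmulr_rge0 // in p1; rewrite E1 mulNr oppr_gt0 pmulr_rlt0 // in p2; slra.
Qed.

End Rates.

(** * The sheets of a section along its boundary *)

(** The inverse function theorem with the inverse packaged as a function that is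
    strictly differentiable wherever the original function is invertible to
    first order. *)
Lemma local_inverse (R : realType) (V : normedModType R) (W : completeNormedModType R) (f : V -> W) u w A A' :
  blin A -> blin A' -> (forall h, A' (A h) = h) -> (forall k, A (A' k) = k) -> f u = w -> sdiff f u A ->
  exists2 G : W -> V, G w = u & exists2 r : R, 0 < r & exists2 C : R, 0 < C & exists2 s : R, 0 < s &
   [/\ forall z, `|z - w| < s -> `|G z - u| < r /\ f (G z) = z,
    forall x, `|x - u| < r -> `|f x - w| < s -> G (f x) = x,
    forall z z', `|z - w| < s -> `|z' - w| < s -> `|G z - G z'| <= C * `|z - z'| &
    forall z A1 A1', `|z - w| < s -> blin A1' -> (forall h, A1' (A1 h) = h) -> sdiff f (G z) A1 -> sdiff G z A1'].
Proof.
move=> lA lA' A'A AA' fu fs; have [r r0 [C C0 [inj sur]]] := sdiff_invertible lA lA' A'A AA' fs.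
rewrite fu in sur; have [s s0 hs] := sur r r0.
have /choice[G hG] : forall z, exists q, (exists2 q', `|q' - u| < r & f q' = z) -> `|q - u| < r /\ f q = z.
  move=> z; have [[q h1 h2]|n] := pselect (exists2 q', `|q' - u| < r & f q' = z); first by exists q.
  by exists u.
have GP z : `|z - w| < s -> `|G z - u| < r /\ f (G z) = z by move=> /hs[q q1 q2]; apply: hG; exists q.
have uniq q q' : `|q - u| < r -> `|q' - u| < r -> f q = f q' -> q = q'.
  move=> h1 h2 e; have := inj _ _ h1 h2; rewrite e subrr normr0 mulr0 normr_le0 subr_eq0.
  by move/eqP.
have ur : `|u - u| < r by rewrite subrr normr0.
have Gl z z' : `|z - w| < s -> `|z' - w| < s -> `|G z - G z'| <= C * `|z - z'|.
  by move=> /GP[a1 a2] /GP[b1 b2]; have := inj _ _ a1 b1; rewrite a2 b2.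
exists G.
  have [|h1 h2] := GP w; first by rewrite subrr normr0.
  by apply: uniq => //; rewrite h2.
exists r => //; exists C => //; exists s => //; split=> //.
- by move=> x xr xs; have [h1 h2] := GP _ xs; exact: uniq.
- move=> z A1 A1' zs lA1' A1K fz.
  pose s1 := s - `|z - w|; have s10 : 0 < s1 by rewrite subr_gt0.
  have sub x : `|x - z| < s1 -> `|x - w| < s.
    move=> xz; rewrite -(subrK z x) -addrA; apply: (le_lt_trans (ler_normD _ _)).
    by rewrite /s1 in xz; lra.
  apply: (sdiff_inverse lA1' A1K s10 C0 _ _ fz) => [x y /sub xs /sub ys|x /sub /GP[]//].
  exact: Gl.
Qed.

Section Sheets.
Variables (R : realType) (M : topologicalType) (A : set (chart R 3 M)) (phi : R -> M -> M).
Hypothesis hM : closed_oriented_3manifold A.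
Hypothesis hphi : smooth_flow A phi.
Variables (S : topologicalType) (B : set (chart R 2 S)) (iota : S -> M).
Hypothesis bk : birkhoff_section A phi B iota.
Variable eps : R.
Hypothesis eps1 : eps * eps = 1.
Hypothesis signed : forall C, boundary_component B C ->
  exists2 m, multiplicity phi B iota C m & 0 < eps * m%:~R.
Let AM := manifold_atlas hM.
Let ps := bk.1.
Let BS := manifold_atlas (ps_surface ps).
Local Notation axis := (axis B iota).
Implicit Types (x p : M) (y : S).

(** The boundary component of y with the data that its multiplicity provides: a
    parametrization g, and the position th of its image along the closed orbit. *)
Lemma boundary_curve y : bd B y -> exists (g : R -> S) (th : R -> R) (p0 : M) (q : R) (s0 : R),
  [/\ continuous g, forall s, bd B (g s), g s0 = y &
   [/\ continuous th, forall s, iota (g s) = phi (th s) p0, forall s, th (s + 1) = th s + q, 0 < eps * q &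
    (exists T, minimal_period phi p0 T) /\
    forall c s, B c -> cdom c (g s) -> derivable (cfwd c \o g) s 1 /\ 0 < derive1 (cfwd c \o g) s 0 1]].
Proof.
move=> yb; have bc : boundary_component B (connected_component (bd B) y) by exists y.
have [m [g [p0 [T [th [[gc gr gp gd] mp thc thE th1]]]]] em] := signed bc.
have yC : connected_component (bd B) y y by exact: connected_component_refl.
rewrite -gr in yC; have [s0 _ gs0] := yC.
have T0 : 0 < T by case: mp.
exists g, th, p0, (m%:~R * T), s0; split=> //.
  move=> s; apply: (connected_component_sub (x := y)); rewrite -gr; by exists s.
split=> //; first by rewrite mulrA mulr_gt0.
by split=> //; exists T.
Qed.

(** A rest point has no minimal period. *)
Lemma periodic_moves p0 T t d : A d -> minimal_period phi p0 T -> cdom d (phi t p0) ->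
  velocity phi d (phi t p0) != 0.
Proof.
move=> dA [T0 _ nT] dp; apply/eqP => v0; have [r r0 h] := rest_point AM hphi dA dp v0.
pose s := Num.min (r / 2) (T / 2); have s0 : 0 < s by rewrite lt_min; lra.
have [sr sT] : s <= r / 2 /\ s <= T / 2 by rewrite /s !ge_min !lexx !orbT.
apply: (nT s); first lra.
have := h s; rewrite gtr0_norm // => /(_ ltac:(lra)) e.
by rewrite -[LHS](flowK hphi t) -(flowD hphi t s) (addrC t s) (flowD hphi s t) e (flowK hphi).
Qed.

(** The boundary curve climbs in the chart c, and its image follows the flow
    line: hence the direction J_1 of the boundary is a multiple of the velocity. *)
Lemma edge_rate (g : R -> S) (th : R -> R) p0 s0 c d U gE : B c -> A d ->
  continuous g -> (forall s, bd B (g s)) -> continuous th -> (forall s, iota (g s) = phi (th s) p0) ->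
  (exists T, minimal_period phi p0 T) ->
  (derivable (cfwd c \o g) s0 1 /\ 0 < derive1 (cfwd c \o g) s0 0 1) ->
  cdom c (g s0) -> cdom d (iota (g s0)) -> extends iota c d U gE -> U (cfwd c (g s0)) ->
  exists2 k : R, k != 0 & row 1 ('J gE (cfwd c (g s0))) = k *: velocity phi d (iota (g s0)) /\
    \forall s \near s0^', 0 < k * ((th s - th s0) * (s - s0)).
Proof.
move=> cB dA gc gb thc thE [T mp] [gder gpos] cg dg ext Ua; have [Uo gC gf] := ext.
set y0 := g s0 in cg dg Ua gpos *; set a0 := cfwd c y0 in Ua *; set J := 'J gE a0.
set v := velocity phi d (iota y0).
have v0 : v != 0 by rewrite /v /y0 thE; apply: (periodic_moves dA mp); rewrite -thE.
have rJ : \rank J = 2%N by exact: (extends_rank ps cB dA cg dg ext Ua).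
have J0 : row 1 J != 0.
  apply/eqP => z; have Jf : row_free J by rewrite /row_free rJ.
  have [K JK] := row_freeP Jf.
  have : row 1 (J *m K) = 0 by rewrite row_mul z mul0mx.
  rewrite JK => /rowP/(_ 1); rewrite !mxE eqxx /= => /eqP; rewrite oner_eq0 //.
pose ys s := cfwd c (g s) 0 1 - a0 0 1; pose ts s := th s - th s0.
have gn (P : set S) : nbhs y0 P -> \forall s \near s0, P (g s) by move=> hP; exact: gc hP.
have cn : nbhs y0 (cdom c) by apply: open_nbhs_nbhs; split => //; exact: chart_open (atlas_chart BS cB).
have dn : nbhs y0 (iota @^-1` cdom d).
  apply: (iota_cont ps); apply: open_nbhs_nbhs; split => //; exact: chart_open (atlas_chart AM dA).
have aE s : cdom c (g s) -> cfwd c (g s) - a0 = ys s *: delta_mx 0 1.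
  move=> cs; apply/rowP => j; rewrite !mxE eqxx /=.
  have b0 : a0 0 0 = 0 by apply/(bd_chart BS cB cg); exact: gb.
  have bs0 : cfwd c (g s) 0 0 = 0 by apply/(bd_chart BS cB cs); exact: gb.
  case: j => -[|[|//]] i.
    by rewrite (_ : Ordinal i = 0) ?bs0 ?b0 ?subr0 ?mulr0 //; exact: val_inj.
  by rewrite (_ : Ordinal i = 1) ?mulr1 //; exact: val_inj.
have ysgn : \forall s \near s0^', 0 < ys s * (s - s0).
  have D : (fun h : R => h^-1 *: ((cfwd c \o g) (h *: 1 + s0) - (cfwd c \o g) s0)) @ 0^' --> derive1 (cfwd c \o g) s0.
    by rewrite derive1E; exact: gder.
  set Dv := derive1 _ _ in D gpos.
  have /D h : nbhs Dv [set w : 'rV[R]_2 | 0 < w 0 1] by apply: (coord_near (P := [set t | 0 < t])); exact: lt_nbhsr.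
  move: h => /nbhs_ballP[r r0 hr]; apply/nbhs_ballP; exists r => // s; rewrite /ball /= => sr ss.
  have h1 : s - s0 != 0 by rewrite subr_eq0.
  have := hr (s - s0); rewrite /ball /= sub0r opprB => /(_ sr h1); rewrite /= !mxE [_ *: 1]mulr1 subrK.
  rewrite -/y0 -/a0 -/(ys s) => h2.
  have -> : ys s * (s - s0) = (s - s0)^-1 * ys s * ((s - s0) * (s - s0)) by field.
  by rewrite mulr_gt0 // -expr2 exprn_even_gt0.
have [||k k0 [Jk hk]] := @parallel_rates R 3 (row 1 J) v s0^' _ ys ts v0 J0.
- move=> e e0; have gs := C1_row Uo Ua (gC 1).
  have [r r0 h] := gs e e0; have vn := velocity_flow AM hphi dA dg e0.
  have tn : \forall s \near s0, `|cfwd d (phi (ts s) (iota y0)) - cfwd d (iota y0) - ts s *: v| <= e * `|ts s|.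
    have tc : ts s @[s --> s0] --> (0 : R).
      by have := cvgB (thc s0) (cvg_cst (th s0)); rewrite subrr; apply.
    exact: tc vn.
  have an : \forall s \near s0, [/\ cdom c (g s), cdom d (iota (g s)), U (cfwd c (g s)) & `|cfwd c (g s) - a0| < r].
    have Un : nbhs a0 U by apply: open_nbhs_nbhs.
    have n1 : nbhs a0 (U `&` [set a : 'rV[R]_2 | `|a - a0| < r]).
      by have := near_norm a0 r0; exact: filterI.
    have n2 : nbhs y0 (iota @^-1` cdom d `&` [set y | cdom c y /\ (U `&` [set a : 'rV[R]_2 | `|a - a0| < r]) (cfwd c y)]).
      by apply: filterI => //; exact: (chart_fwd_near (atlas_chart BS cB) cg n1).
    by have := gn _ n2; apply: filterS => s [h1 [h2 [h3 h4]]].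
  have : \forall s \near s0, `|ys s *: row 1 J - ts s *: v| <= e * (`|ys s| + `|ts s|).
    apply: filterS2 tn an => s h1 [h2 h3 h4 h5].
    have a00 : `|a0 - a0| < r by rewrite subrr normr0.
    have := h _ _ h5 a00; rewrite (aE s h2).
    have gE1 s' : cdom c (g s') -> cdom d (iota (g s')) -> U (cfwd c (g s')) -> gE (cfwd c (g s')) = cfwd d (iota (g s')).
      move=> c1 c2 c3; rewrite gf // /rep /=; last by exists (g s').
      by rewrite (chart_cancel (atlas_chart BS cB)).
    rewrite (gE1 s) // [gE a0](gE1 s0) // -/y0.
    have iE : iota (g s) = phi (ts s) (iota y0).
      by rewrite /y0 !thE -(flowD hphi) subrK.
    rewrite -iE in h1; rewrite -scalemxAl -rowE => k1.
    have n1 : `|ys s *: delta_mx 0 1 : 'rV[R]_2| <= `|ys s|.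
      rewrite normrZ -[leRHS]mulr1 ler_wpM2l //; apply: row_norm_le => // j.
      by rewrite mxE eqxx /=; case: (j == 1); rewrite ?normr1 ?normr0.
    have k2 : e * `|ys s *: delta_mx 0 1 : 'rV[R]_2| <= e * `|ys s| by rewrite ler_wpM2l // ltW.
    set X := cfwd d (iota (g s)) - cfwd d (iota y0) in h1 k1.
    have -> : ys s *: row 1 J - ts s *: v = (X - ts s *: v) - (X - ys s *: row 1 J).
      by rewrite opprB [RHS]addrC addrA subrK.
    apply: (le_trans (ler_normB _ _)); rewrite mulrDr; lra.
  by apply: nbhs_dnbhs.
- by apply: filterS ysgn => s; apply: contraTneq => ->; rewrite mul0r ltxx.
- exists k => //; split=> //; apply: filterS2 ysgn hk => s h1 h2.
  have y2 : 0 < ys s * ys s.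
    by rewrite -expr2 exprn_even_gt0 //=; apply/eqP => z; rewrite z mul0r ltxx in h1.
  have : 0 < k * (ts s * ys s) * (ys s * (s - s0)) by exact: mulr_gt0.
  have -> : k * (ts s * ys s) * (ys s * (s - s0)) = k * (ts s * (s - s0)) * (ys s * ys s) by ring.
  by rewrite pmulr_lgt0.
Qed.

(** By crossing_sign the multiple has the sign of the multiplicity.  The last
    part, that boundary points cover the flow line near iota y, is the
    intermediate value theorem for th. *)
Lemma edge_direction y c d U gE : bd B y -> B c -> A d -> cdom c y -> cdom d (iota y) ->
  extends iota c d U gE -> U (cfwd c y) -> exists2 k : R, 0 < eps * k &
  row 1 ('J gE (cfwd c y)) = k *: velocity phi d (iota y) /\
  velocity phi d (iota y) != 0 /\
  forall W, nbhs y W -> exists2 r : R, 0 < r & forall t, `|t| < r ->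
    exists2 z, W z & bd B z /\ iota z = phi t (iota y).
Proof.
move=> yb cB dA cy dy ext Uy.
have [g [th [p0 [q [s0 [gc gb gs0 [thc thE th1 eq0 [mp gd]]]]]]]] := boundary_curve yb.
have cross s : exists2 k : R, k != 0 & \forall s' \near s^', 0 < k * ((th s' - th s) * (s' - s)).
  have [c' cB' cy'] := atlas_cover BS (g s); have [d' dA' dy'] := atlas_cover AM (iota (g s)).
  have [U' [g' [ext' Uy' _]]] := section_chart hM ps cB' dA' cy' dy'.
  have [k k0 [_ hk]] := edge_rate cB' dA' gc gb thc thE mp (gd c' s cB' cy') cy' dy' ext' Uy'.
  by exists k.
have cs : cdom c (g s0) by rewrite gs0.
have ds : cdom d (iota (g s0)) by rewrite gs0.
have Us : U (cfwd c (g s0)) by rewrite gs0.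
have [k k0 [Jk hk]] := edge_rate cB dA gc gb thc thE mp (gd c s0 cB cs) cs ds ext Us.
have ek := crossing_sign thc th1 eq0 cross k0 hk.
rewrite gs0 in Jk; exists k => //; split=> //; split.
  have [T mpT] := mp; have yE : iota y = phi (th s0) p0 by rewrite -thE gs0.
  by rewrite yE; apply: (periodic_moves dA mpT); rewrite -yE.
move=> W hW; rewrite -gs0 in hW.
have [r1 r10 h1] := norm_near (gc s0 _ hW).
move: hk => /nbhs_ballP[r2 r20 h2].
pose r := Num.min r1 r2 / 2; have r0 : 0 < r by rewrite divr_gt0 // lt_min r10.
have [rr1 rr2] : r < r1 /\ r < r2.
  have : Num.min r1 r2 <= r1 /\ Num.min r1 r2 <= r2 by rewrite !ge_min !lexx orbT.
  by rewrite /r in r0 *; lra.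
have hp : 0 < k * (th (s0 + r) - th s0).
  have := h2 (s0 + r); rewrite /ball /= opprD addrA subrr sub0r normrN gtr0_norm // => /(_ rr2).
  rewrite -subr_eq0 addrAC subrr add0r gt_eqF // => /(_ isT).
  by rewrite mulrA pmulr_lgt0.
have hm : 0 < - (k * (th (s0 - r) - th s0)).
  have := h2 (s0 - r); rewrite /ball /= opprB addrCA subrr addr0 gtr0_norm // => /(_ rr2).
  rewrite -subr_eq0 addrAC subrr add0r oppr_eq0 gt_eqF // => /(_ isT).
  by rewrite mulrA mulrN -mulNr pmulr_lgt0.
pose f s := k * (th s - th s0).
have fc : {within `[s0 - r, s0 + r], continuous f}.
  apply: continuous_subspaceT => s; apply: cvgM; first exact: cvg_cst.
  by apply: cvgB; [exact: thc|exact: cvg_cst].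
have kn : 0 < `|k| by rewrite normr_gt0.
pose rho := Num.min (f (s0 + r)) (- f (s0 - r)) / `|k|.
have rho0 : 0 < rho by rewrite divr_gt0 // lt_min /f hp hm.
exists rho => // t tr.
have kt : `|k * t| < Num.min (f (s0 + r)) (- f (s0 - r)).
  by rewrite normrM mulrC -ltr_pdivlMr.
move: kt; rewrite lt_min !ltr_norml => /andP[/andP[t1 t2] /andP[t3 t4]].
have le : s0 - r <= s0 + r by lra.
have [|s] := @IVT R f (s0 - r) (s0 + r) (k * t) le fc.
  have fl : f (s0 - r) <= f (s0 + r) by rewrite /f in hp hm *; lra.
  rewrite (min_idPl fl) (max_idPr fl); lra.
rewrite in_itv /= => /andP[sl sr] fs.
have te : th s - th s0 = t by apply: (mulfI k0).
exists (g s); first by apply: h1; apply: le_lt_trans rr1; rewrite ler_norml; lra.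
by split=> //; rewrite -gs0 !thE -(flowD hphi) -te subrK.
Qed.

Lemma islift_eqf (T : topologicalType) (C : set T) (f f' h : T -> R) :
  (forall z, C z -> f z = f' z) -> islift C f h -> islift C f' h.
Proof. by move=> e [h1 h2]; split=> // x Cx; rewrite -e //; exact: h2. Qed.

(** The sheet of the section that ends at a boundary point, in coordinates (X, Y)
    on M in which it is the half-plane X >= 0, Y = 0.  Orbits cross it from
    Y < 0 to Y > 0 (sh_sign, where h is the time to the hit), and eps tells
    whether (X, Y) is positively oriented around the axis, compared with a
    transverse coordinate om (sh_arg). *)
Record sheet d p (X Y : M -> R) (W : set S) (V : set M) : Prop := {
  sh_dom : V `<=` cdom d;
  sh_X : mapc V X;
  sh_Y : mapc V Y;
  sh_inj : forall z z', W z -> W z' -> V (iota z) -> iota z = iota z' -> z = z';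
  sh_axis : forall x, V x -> X x = 0 -> Y x = 0 -> axis x;
  sh_hit : forall x, V x -> 0 < X x -> Y x = 0 -> exists2 z, W z & ~ bd B z /\ iota z = x;
  sh_in : forall z, W z -> V (iota z) ->
    [/\ Y (iota z) = 0, ~ bd B z -> 0 < X (iota z) & bd B z -> X (iota z) = 0];
  sh_sign : forall z, W z -> ~ bd B z -> V (iota z) -> exists (delta : R) (N : set M) (h : M -> R),
    [/\ 0 < delta, nbhs (iota z) N, mapc N h, h (iota z) = 0 &
     [/\ forall x, N x -> `|h x| < delta,
      forall x s, N x -> `|s| < delta -> (hit iota (phi s x) <-> s = h x) &
      forall x, N x -> (h x <= 0 -> 0 <= Y x) /\ (0 < h x -> Y x < 0)]];
  sh_arg : forall N om, ncoord phi d p N om -> exists V', [/\ nbhs p V', V' `<=` V,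
    forall x, V' x -> om (cfwd d x) != 0 -> (X x, Y x) <> (0, 0) &
    exists h, islift (V' `&` [set x | om (cfwd d x) != 0])
      (fun x => arg (X x) (eps * Y x) - argr (om (cfwd d x))) h /\ forall x, `|h x| <= 1] }.

Lemma ball_nbhs (V : normedModType R) (u w : V) (r : R) : `|w - u| < r -> nbhs w [set x | `|x - u| < r].
Proof.
move=> wr; have r0 : 0 < r - `|w - u| by rewrite subr_gt0.
apply: filterS (near_norm w r0) => x xw; rewrite /= -(subrK w x) -addrA.
by apply: (le_lt_trans (ler_normD _ _)); lra.
Qed.

Lemma blin_cont (V W : normedModType R) (L : V -> W) : blin L -> continuous L.
Proof.
move=> [L1 [C C0 Lb]] u P /norm_near[r r0 h]; apply: filterS (near_norm u (divr_gt0 r0 C0)) => x xr.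
by apply: h; rewrite -L1; apply: (le_lt_trans (Lb _)); rewrite mulrC -ltr_pdivlMr.
Qed.

(** The determinant of the frame (w, J) varies continuously with the point of
    the surface. *)
Lemma jacobian_frame_near (U : set 'rV[R]_2) (gE : 'rV[R]_2 -> 'rV[R]_3) a0 w : open U -> U a0 ->
  Ck 1 U gE -> 0 < \det (framemx w ('J gE a0)) ->
  \forall a \near a0, 0 < \det (framemx w ('J gE a)).
Proof.
move=> Uo Ua [gd gc] D0.
have Jc i j : mapc U (fun a => 'J gE a i j).
  apply: (mapc_eq (f := fun a => ('D_(delta_mx 0 i) gE a) 0 j)) => [a Ua'|].
    by rewrite deriveEjacobian -?rowE ?mxE //; exact: gd.
  apply: (mapc_coord (f := fun a => 'D_(delta_mx 0 i) gE a)) => a Ua' P hP.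
  have h : nbhs a [set b | P ('D_(delta_mx 0 i) gE b)] by exact: (gc (delta_mx 0 i) a Ua' P hP).
  by apply: filterS h.
have Dc : mapc U (fun a => \det (framemx w ('J gE a))).
  apply: (mapc_eq (f := fun a =>
    w 0 0 * ('J gE a 0 1 * 'J gE a 1 2 - 'J gE a 0 2 * 'J gE a 1 1)
    - w 0 1 * ('J gE a 0 0 * 'J gE a 1 2 - 'J gE a 0 2 * 'J gE a 1 0)
    + w 0 2 * ('J gE a 0 0 * 'J gE a 1 1 - 'J gE a 0 1 * 'J gE a 1 0))) => [a _|].
    by rewrite det3 !framemxE.
  by apply: mapcD; [apply: mapcB|]; apply: mapcM;
     [exact: mapc_cst| | exact: mapc_cst| |exact: mapc_cst| ]; apply: mapcB; apply: mapcM; exact: Jc.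
have Un : nbhs a0 U by apply: open_nbhs_nbhs.
have := Dc a0 Ua [set t | 0 < t]; rewrite /= => /(_ (lt_nbhsr D0)).
by apply: filterS2 Un => a h; apply.
Qed.

Lemma sign_rate (y h k : R) : 0 < k -> `|y - - h * k| <= k / 2 * `|h| ->
  (h <= 0 -> 0 <= y) /\ (0 < h -> y < 0).
Proof.
move=> k0 hh; split=> hs; move: hh; first by rewrite (ler0_norm hs) ler_norml => /andP[]; nra.
by rewrite (gtr0_norm hs) ler_norml => /andP[]; nra.
Qed.

(** The extension gE of the surface beyond its edge, followed in a direction w
    transverse to it, gives coordinates (a, tau) with Y = tau and X = - a_0.
    The flow crosses the surface in the direction of w, by comparison of the two
    frame determinants, both positive.  The axis is X = Y = 0, in the direction
    J_1 which is eps times the velocity up to a positive factor; this gives the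
    sign eps in the comparison of the arguments. *)
Lemma sheet_exists y d (Z : set S) : bd B y -> A d -> cdom d (iota y) -> nbhs y Z ->
  exists (X Y : M -> R) (W : set S) (V : set M),
    [/\ nbhs y W, W `<=` Z, nbhs (iota y) V & sheet d (iota y) X Y W V].
Proof.
move=> yb dA dy hZ; have okd := atlas_chart AM dA.
have [c cB cy] := atlas_cover BS y; have okc := atlas_chart BS cB.
have [U [gE [ext Uy [r1 r10 hr1]]]] := section_chart hM ps cB dA cy dy; have [Uo gC gf] := ext.
set a0 := cfwd c y in Uy hr1; set p := iota y in dy *; set u0 := cfwd d p.
have [w D0] := rank_frame (extends_rank ps cB dA cy dy ext Uy).
have a00 : a0 0 0 = 0 by apply/(bd_chart BS cB cy).
have [r2 r20 hr2] := norm_near (jacobian_frame_near Uo Uy (gC 1) D0).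
have [r3 r30 hr3] := norm_near (chart_inv_near okc cy hZ).
pose Psi (q : 'rV[R]_2 * R) := gE q.1 + q.2 *: w.
have Ps a : U a -> sdiff Psi (a, 0) (frame ('J gE a) w).
  move=> Ua e e0; have [r r0 h] := C1_row Uo Ua (gC 1) e0; exists r => // -[b t] [b' t'].
  rewrite !pair_norm /= !gt_max => /andP[b1 _] /andP[b1' _].
  rewrite /Psi /frame /= (_ : _ - _ - _ = gE b - gE b' - (b - b') *m 'J gE a).
    by apply: (le_trans (h _ _ b1 b1')); rewrite ler_wpM2l ?(ltW e0) // le_max lexx.
  by apply/rowP => j; rewrite !mxE; ring.
have Psi0 : Psi (a0, 0) = u0.
  have [|_ h] := hr1 a0; first by rewrite subrr normr0.
  by rewrite /Psi /= scale0r addr0; have [|_ _ _ ->] := h; rewrite ?a00 // (chart_cancel okc cy).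
have [G G0 [rG rG0 [C C0 [s s0 [GP Gu Gl Gd]]]]] := local_inverse (blin_frame _ _) (blin_coframe _ _)
  (frameK (lt0r_neq0 D0)) (coframeK (lt0r_neq0 D0)) Psi0 (Ps a0 Uy).
pose rho := Num.min (Num.min r1 r2) (Num.min r3 rG).
have rho0 : 0 < rho by rewrite !lt_min r10 r20 r30.
have [ro1 ro2 ro3 roG] : [/\ rho <= r1, rho <= r2, rho <= r3 & rho <= rG] by rewrite /rho !ge_min !lexx !orbT.
pose s1 := Num.min s (rho / C); have s10 : 0 < s1 by rewrite lt_min s0 divr_gt0.
have [s1s s1r] : s1 <= s /\ s1 <= rho / C by rewrite /s1 !ge_min !lexx orbT.
pose V := [set x | cdom d x /\ `|cfwd d x - u0| < s1].
pose W := [set z | [/\ cdom c z, `|cfwd c z - a0| < rho & Z z]].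
pose X x := - (G (cfwd d x)).1 0 0; pose Y x := (G (cfwd d x)).2.
have u0s : `|u0 - u0| < s by rewrite subrr normr0.
have GV x : V x -> [/\ `|(G (cfwd d x)).1 - a0| < rho, Psi (G (cfwd d x)) = cfwd d x & `|cfwd d x - u0| < s].
  move=> [dx xs]; have xs' := lt_le_trans xs s1s; have [_ h2] := GP _ xs'; split=> //.
  have := Gl _ _ xs' u0s; rewrite G0; case: (G (cfwd d x)) => a t.
  rewrite pair_norm /= => /(le_trans _) h; apply: (le_lt_trans (h _ _)); first by rewrite le_max lexx.
  by rewrite mulrC -ltr_pdivlMr //; exact: lt_le_trans xs s1r.
have inv a : `|a - a0| < rho -> a 0 0 <= 0 -> [/\ W (cinv c a), cfwd c (cinv c a) = a, cdom d (iota (cinv c a)),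
    gE a = cfwd d (iota (cinv c a)) & cdom c (cinv c a)].
  move=> ar al; have [_ /(_ al)[h1 h2 h3 h4]] := hr1 a (lt_le_trans ar ro1).
  have [_ _ h5] := hr3 a (lt_le_trans ar ro3) al.
  by split=> //; split=> //; rewrite h2.
have onsheet x : V x -> Y x = 0 -> 0 <= X x -> exists2 z, W z & [/\ iota z = x, cdom c z & X x = - cfwd c z 0 0].
  move=> Vx Yx Xx; have [g1 g2 _] := GV x Vx; have [dx _] := Vx.
  have al : (G (cfwd d x)).1 0 0 <= 0 by rewrite /X in Xx; lra.
  have [w1 w2 w3 w4 w5] := inv _ g1 al; exists (cinv c (G (cfwd d x)).1) => //; split=> //; last by rewrite w2.
  have gx : gE (G (cfwd d x)).1 = cfwd d x by rewrite -{2}g2 /Psi -/(Y x) Yx scale0r addr0.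
  by rewrite -[RHS](chart_cancel okd dx) -[LHS](chart_cancel okd w3) -w4 gx.
have inW z : W z -> V (iota z) -> G (cfwd d (iota z)) = (cfwd c z, 0).
  move=> [cz zr Zz] [dz zs]; have z0 := cfwd_le0 BS cB cz.
  have [w1 w2 w3 w4 w5] := inv _ zr z0; rewrite (chart_cancel okc cz) in w4.
  have E : Psi (cfwd c z, 0) = cfwd d (iota z) by rewrite /Psi /= scale0r addr0.
  rewrite -{1}E; apply: Gu; last by rewrite E; exact: lt_le_trans zs s1s.
  by rewrite pair_norm /= subrr normr0 gt_max (lt_le_trans zr roG).
have Gc : mapc V (G \o cfwd d).
  apply: (mapc_comp (B := [set k | `|k - u0| < s])).
  - by move=> x /GV[].
  - by have /mapcP h := chart_fwd_cont okd; apply: mapc_sub h => x [].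
  - move=> k ks P /norm_near[e e0 he].
    apply: filterS (near_norm k (divr_gt0 e0 C0)) => k' k'e k's; apply: he.
    by apply: (le_lt_trans (Gl _ _ k's ks)); rewrite mulrC -ltr_pdivlMr.
exists X, Y, W, V; split.
- have := chart_fwd_near okc cy (near_norm a0 rho0); apply: filterS2 hZ => z Zz [h1 h2].
  by split.
- by move=> z [].
- exact: (chart_fwd_near okd dy (near_norm u0 s10)).
split.
- by move=> x [].
- apply: mapcN; apply: (mapc_coord (f := fun x => (G (cfwd d x)).1)).
  apply: (mapc_comp (B := setT) (g := fst)) Gc _ => //; by apply: mapc_cont => q; exact: cvg_fst.
- by apply: (mapc_comp (B := setT) (g := snd)) Gc _ => //; by apply: mapc_cont => q; exact: cvg_snd.
- move=> z z' Wz Wz' Vz e; have := inW z Wz Vz; rewrite e in Vz *; rewrite (inW z' Wz' Vz) => -[ee].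
  have [cz _ _] := Wz; have [cz' _ _] := Wz'.
  by rewrite -(chart_cancel okc cz) -(chart_cancel okc cz') ee.
- move=> x Vx Xx Yx; have [|z Wz [zx cz xz]] := onsheet x Vx Yx; first by rewrite Xx.
  by exists z => //; apply/(bd_chart BS cB cz)/eqP; rewrite -oppr_eq0 -xz Xx.
- move=> x Vx Xx Yx; have [|z Wz [zx cz xz]] := onsheet x Vx Yx; first exact: ltW.
  by exists z => //; split=> // /(bd_chart BS cB cz) e; rewrite xz e oppr0 ltxx in Xx.
- move=> z Wz Vz; have E := inW z Wz Vz; have [cz zr Zz] := Wz; rewrite /X /Y E /=; split=> //.
    by move=> nz; rewrite oppr_gt0; exact: (int_coord BS cB cz).
  by move=> /(bd_chart BS cB cz) ->; rewrite oppr0.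
- move=> z Wz nz Vz; have E := inW z Wz Vz; have [cz zr Zz] := Wz; have [dz zs] := Vz.
  set a1 := cfwd c z in zr E; have z0 : a1 0 0 < 0 by exact: (int_coord BS cB cz).
  have Ua1 : U a1 by have [] := hr1 a1 (lt_le_trans zr ro1).
  pose J1 := 'J gE a1; set vel := velocity phi d (iota z).
  have D1 : 0 < \det (framemx w J1) by apply: hr2; exact: lt_le_trans zr ro2.
  have D2 : 0 < \det (framemx vel J1) by exact: (extends_det ps cB dA cz dz nz ext Ua1).
  have [k k0 kE] : exists2 k : R, 0 < k & (coframe J1 w vel).2 = k.
    by exists (coframe J1 w vel).2 => //; move: D2; rewrite (det_frame_change vel (lt0r_neq0 D1)) pmulr_lgt0.
  have [w1 w2 w3 w4 w5] := inv a1 zr (ltW z0).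
  have gz : gE a1 = cfwd d (iota z) by rewrite w4 (chart_cancel okc cz).
  have gs1 := C1_row Uo Ua1 (gC 1).
  have Fs := flow_disc_sdiff AM hphi dA dz gz gs1.
  have F0 : flow_in phi d ((a1, (0 : R)).2, gE (a1, (0 : R)).1) = cfwd d (iota z).
    by rewrite /flow_in /= gz (chart_cancel okd dz) (flow0 hphi).
  have Gs : sdiff G (flow_in phi d ((a1, (0 : R)).2, gE (a1, (0 : R)).1)) (coframe J1 w).
    rewrite F0; apply: (Gd _ (frame J1 w)).
    - exact: lt_le_trans zs s1s.
    - exact: blin_coframe.
    - exact: (frameK (lt0r_neq0 D1)).
    - by rewrite E; exact: Ps.
  have lsnd : blin (@snd 'rV[R]_2 R).
    by split=> // ; exists 1 => // -[a t]; rewrite mul1r pair_norm /= le_max lexx orbT.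
  have ss u : sdiff (@snd 'rV[R]_2 R) u snd.
    by move=> e e0; exists 1 => // x x' _ _; rewrite subrr normr0 mulr_ge0 // ltW.
  have Qs := sdiff_comp (blin_comp (blin_frame _ _) (blin_coframe _ _)) lsnd
    (sdiff_comp (blin_frame _ _) (blin_coframe _ _) Fs Gs) (ss _).
  set Q := (snd \o _) in Qs.
  have QA (h : 'rV[R]_2 * R) : (coframe J1 w (frame J1 vel h)).2 = h.2 * k.
    have -> : frame J1 vel h = frame J1 w (h.1, 0) - (- h.2) *: vel.
      by rewrite /frame /= scale0r addr0 scaleNr opprK.
    have e2 (q : 'rV[R]_2 * R) : ((h.1, 0) - q).2 = - q.2 by rewrite /= sub0r.
    rewrite (blin_coframe J1 w).1 (frameK (lt0r_neq0 D1)) e2.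
    have -> : (coframe J1 w ((- h.2) *: vel)).2 = - h.2 * k.
      by rewrite -kE /coframe /= -scalemxAl !mxE.
    by rewrite mulNr opprK.
  have k2 : 0 < k / 2 by rewrite divr_gt0.
  have Qs' : sdiff Q (a1, 0) (fun h : 'rV[R]_2 * R => h.2 * k) := sdiff_eqA QA Qs.
  have [r5 r50 hr5] := Qs' _ k2.
  have an : \forall a \near a1, [/\ `|a - a0| < rho, a 0 0 < 0 & `|gE a - u0| < s].
    have [rc rc0 gcont] := sdiff_cont (blin_mulmx _) gs1.
    have gn : nbhs (gE a1) [set q | `|q - u0| < s].
      by apply: ball_nbhs; rewrite gz; exact: lt_le_trans zs s1s.
    have a1r : `|a1 - a1| < rc by rewrite subrr normr0.
    apply: filterS3 (ball_nbhs zr) (half_near z0) (filterI (gcont a1 a1r _ gn) (near_norm a1 rc0)) => a h1 h2 [h3 h4].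
    by split=> //; exact: h3.
  have [r6 r60 hr6] := norm_near an.
  have gn : \forall a \near a1, [/\ cdom c (cinv c a), cfwd c (cinv c a) = a, cdom d (iota (cinv c a)) &
      gE a = cfwd d (iota (cinv c a))].
    by apply: filterS an => a [h1 h2 _]; have [q1 q2 q3 q4 q5] := inv a h1 (ltW h2).
  have e0 : 0 < Num.min r5 r6 by rewrite lt_min r50.
  have [delta [d0 de [N Nn [h [hc hz hN hhit]]]]] :=
    hit_box hM hphi ps cB dA cz dz nz gs1 (lt0r_neq0 D2) gn e0.
  have [d5 d6] : delta <= r5 /\ delta <= r6 by move: de; rewrite le_min => /andP[].
  exists delta, N, h; split=> //; split; [by move=> x /hN[]|exact: hhit|move=> x Nx].
  have [hx [a ar xE]] := hN x Nx.
  have [h1 h2 h3] := hr6 a (lt_le_trans ar d6).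
  have [q1 q2 q3 q4 q5] := inv a h1 (ltW h2).
  have ga : cinv d (gE a) = iota (cinv c a) by rewrite q4 (chart_cancel okd q3).
  have Qa0 : Q (a, 0) = 0.
    rewrite /Q /= /flow_in /= ga (flow0 hphi) -q4.
    have -> : gE a = Psi (a, 0) by rewrite /Psi /= scale0r addr0.
    rewrite Gu //; last by rewrite /Psi /= scale0r addr0.
    by rewrite pair_norm /= subrr normr0 gt_max (lt_le_trans h1 roG).
  have Qax : Q (a, - h x) = Y x by rewrite /Q /= /flow_in /= ga -xE.
  have n1 : `|(a, - h x) - (a1, 0)| < r5.
    by rewrite pair_norm /= subr0 normrN gt_max !(lt_le_trans _ d5).
  have n2 : `|(a, (0 : R)) - (a1, 0)| < r5.
    by rewrite pair_norm /= subrr normr0 gt_max (lt_le_trans _ d5).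
  have := hr5 _ _ n1 n2; rewrite Qa0 Qax pair_norm /= !subrr !subr0 normr0 normrN.
  rewrite (_ : Num.max 0 `|h x| = `|h x|); last by apply/max_idPr.
  exact: sign_rate.
- move=> N om nc; have okN := nc_det nc.
  have [k ek [Jk [v0 cov]]] := edge_direction yb cB dA cy dy ext Uy.
  set v := velocity phi d (iota y) in okN Jk v0; set J := 'J gE (cfwd c y) in D0 Jk.
  pose inv0 := invmx (framemx w J).
  have un : framemx w J \in unitmx by rewrite unitmxE unitfE gt_eqF.
  (* the matrix that yields (X, eps * Y) from the coordinates in the frame (w, J) *)
  pose E : 'M[R]_(3, 2) := \matrix_(i, j) (if i == 0 then (j == 1)%:R * eps
                                          else if i == 1 then - (j == 0)%:R else 0).
  pose Ef (q : 'rV[R]_2 * R) : 'rV[R]_2 := \row_j (if j == 0 then - q.1 0 0 else eps * q.2).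
  have lE : blin Ef.
    split=> [q q'|]; first by apply/rowP => j; rewrite !mxE /=; case: ifP => _; rewrite ?mxE; ring.
    exists (1 + `|eps|); first by rewrite ltr_pwDl.
    move=> [a t]; apply: row_norm_le => [|j]; first by rewrite mulr_ge0 ?addr_ge0.
    rewrite mxE pair_norm /=; have m1 : `|a| <= Num.max `|a| `|t| by rewrite le_max lexx.
    have m2 : `|t| <= Num.max `|a| `|t| by rewrite le_max lexx orbT.
    have e1 := normr_ge0 eps; have t1 := normr_ge0 t; have a1 := normr_ge0 a.
    case: ifP => _; first by rewrite normrN; have := row_norm_ge a 0; nra.
    by rewrite normrM; nra.
  have Es q : sdiff Ef q Ef.
    by move=> e e0; exists 1 => // x x' _ _; rewrite lE.1 subrr normr0 mulr_ge0 // ltW.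
  pose om' := Ef \o G; pose A' := inv0 *m E.
  have Gs : sdiff G (cfwd d p) (coframe J w).
    by apply: (Gd _ (frame J w)) => //; [exact: blin_coframe|exact: (frameK (lt0r_neq0 D0))|rewrite G0; exact: Ps].
  have EfE (z : 'rV[R]_3) : Ef (coframe J w z) = z *m A'.
    rewrite /A' mulmxA /coframe -/inv0; move: (z *m inv0) => u.
    have u1 : @rsubmx R 1 1 2 u 0 0 = u 0 1.
      by rewrite mxE; congr (u 0 _); exact: val_inj.
    have u2 : @lsubmx R 1 1 2 u 0 0 = u 0 0.
      by rewrite mxE; congr (u 0 _); exact: val_inj.
    apply/rowP => j; rewrite [LHS]mxE /= u1 u2 mxE !big_ord_recl big_ord0 !mxE /=.
    rewrite (_ : lift ord0 ord0 = 1); last exact: val_inj.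
    by case: j => -[|[|//]] i /=; rewrite ?mulr0 ?mul0r ?mul1r ?addr0 ?add0r ?mulrN1 ?oppr0 ?mulr0 ?add0r ?addr0 1?mulrC.
  have os : sdiff om' (cfwd d p) (fun k => k *m A').
    by have := sdiff_comp (blin_coframe _ _) lE Gs (Es _); apply: sdiff_eqA.
  have k0 : k != 0 by apply/eqP => z; rewrite z mulr0 ltxx in ek.
  have row2 : row 1 J *m inv0 = row 2 1%:M.
    have -> : row 1 J = row 2 (framemx w J) by apply/rowP => j; rewrite [LHS]mxE [RHS]mxE framemx2.
    by rewrite -row_mul mulmxV.
  have vI : v *m inv0 = k^-1 *: row 2 1%:M by rewrite -row2 Jk -scalemxAl scalerA mulVf // scale1r.
  have vA : v *m A' = 0.
    rewrite /A' mulmxA vI -scalemxAl -row_mul mul1mx.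
    by apply/rowP => j; rewrite !mxE /= mulr0.
  have DA : 0 < \det (N *m A').
    pose Q := framemx v N *m inv0.
    have dQ : 0 < \det Q by rewrite det_mulmx det_inv mulr_gt0 // invr_gt0.
    have Q0 j : Q 0 j = k^-1 * (2 == j)%:R.
      have -> : Q 0 j = (v *m inv0) 0 j.
        by rewrite /Q [LHS]mxE [RHS]mxE; apply: eq_bigr => i _; rewrite framemx0.
      by rewrite vI !mxE.
    have Q1 j : Q 1 j = (N *m inv0) 0 j.
      by rewrite /Q [LHS]mxE [RHS]mxE; apply: eq_bigr => i _; rewrite framemx1.
    have Q2 j : Q 2 j = (N *m inv0) 1 j.
      by rewrite /Q [LHS]mxE [RHS]mxE; apply: eq_bigr => i _; rewrite framemx2.
    rewrite det3 !Q0 /= !mulr0 !mul0r subrr add0r mulr1 !Q1 !Q2 in dQ.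
    set u := N *m inv0 in dQ.
    have NA i j : (N *m A') i j = u i 0 * ((j == 1)%:R * eps) - u i 1 * (j == 0)%:R.
      rewrite /A' mulmxA -/u mxE !big_ord_recl big_ord0 !mxE /=.
      rewrite (_ : lift ord0 ord0 = 1); last exact: val_inj.
      by rewrite mulr0 !addr0 mulrN.
    rewrite det2 !NA /= !mul0r !mulr0 !mul1r !mulr1 !sub0r !subr0.
    have -> : - u 0 1 * (u 1 0 * eps) - u 0 0 * eps * - u 1 1 =
      (eps * k) * (k^-1 * (u 0 0 * u 1 1 - u 0 1 * u 1 0)) by field.
    exact: mulr_gt0.
  have Wn : nbhs y (W `&` iota @^-1` V).
    apply: filterI; last by apply: (iota_cont ps); exact: (chart_fwd_near okd dy (near_norm u0 s10)).
    by have := chart_fwd_near okc cy (near_norm a0 rho0); apply: filterS2 hZ => z Zz [h1 h2].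
  have [delta d0 hd] := cov _ Wn.
  have oz t : `|t| < delta -> cdom d (phi t p) -> om' (cfwd d (phi t p)) = 0.
    move=> td dt; have [z [Wz Vz] [zb zE]] := hd t td.
    rewrite /om' /= -zE (inW z Wz Vz); apply/rowP => j; rewrite !mxE /=.
    by have [cz _ _] := Wz; rewrite ((bd_chart BS cB cz).1 zb) oppr0 mulr0; case: ifP.
  have Vn : nbhs p V by exact: (chart_fwd_near okd dy (near_norm u0 s10)).
  have oc : mapc V (om' \o cfwd d).
    by apply: (mapc_comp (B := setT) (g := Ef)) Gc _ => //; apply: mapc_cont; exact: blin_cont.
  have Vd : V `<=` cdom d by move=> x [].
  have [V' [V'n V'V nz [h [hl hb]]]] := ncoord_compare AM dA dy nc os vA DA d0 oz Vn Vd oc.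
  exists V'; split=> //.
    move=> x V'x ox; have := (row2_neq0 _).1 (nz x V'x ox); rewrite /om' /= !mxE /= => h1 [h2 h3].
    by apply: h1; rewrite -/(X x) -/(Y x) h2 h3 mulr0.
  exists h; split=> //; apply: islift_eqf hl => x _.
  by rewrite /argr /om' /= !mxE.
Qed.

End Sheets.

(** * The phase near the axis *)

Section RelativeContinuity.
Variables (R : realType) (T : topologicalType) (C : set T) (x : T).
Implicit Types f g : T -> R.

Definition contat f : Prop := forall e : R, 0 < e -> \forall y \near x, C y -> `|f y - f x| < e.

Lemma contatB f g : contat f -> contat g -> contat (fun y => f y - g y).
Proof.
move=> hf hg e e0; have e2 : 0 < e / 2 by rewrite divr_gt0.
apply: filterS2 (hf _ e2) (hg _ e2) => y h1 h2 Cy; have := h1 Cy; have := h2 Cy.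
by rewrite !ltr_norml; lra.
Qed.

Lemma contat_sum (I : eqType) (s : seq I) (P : pred I) (F : I -> T -> R) :
  (forall i, i \in s -> P i -> contat (F i)) -> contat (fun y => \sum_(i <- s | P i) F i y).
Proof.
elim: s => [|i s IH] h e e0.
  by apply: filterE => y _; rewrite !big_nil subrr normr0.
have e2 : 0 < e / 2 by rewrite divr_gt0.
have {}IH := IH (fun j js => h j (mem_behead (s := i :: s) js)) _ e2.
have [Pi|nP] := boolP (P i); last first.
  apply: filterS IH => y h1 Cy; rewrite !big_cons (negbTE nP); have := h1 Cy; lra.
apply: filterS2 IH (h i (mem_head _ _) Pi _ e2) => y h1 h2 Cy; rewrite !big_cons Pi.
by have := h1 Cy; have := h2 Cy; rewrite !ltr_norml; lra.
Qed.

End RelativeContinuity.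

Lemma separate (T : topologicalType) (s : seq T) : hausdorff_space T -> exists Z : T -> set T,
  (forall y, y \in s -> nbhs y (Z y)) /\
  forall y y' z, y \in s -> y' \in s -> Z y z -> Z y' z -> y = y'.
Proof.
move=> hT; pose Good (p : T * T) (Q : set T * set T) := p.1 <> p.2 ->
  [/\ nbhs p.1 Q.1, nbhs p.2 Q.2 & Q.1 `&` Q.2 `<=` set0].
have /choice[D hD] : forall p, exists Q, Good p Q.
  move=> [y y']; have [->|/eqP ne] := pselect (y = y'); first by exists (setT, setT).
  have := hT; rewrite open_hausdorff => /(_ y y' ne)[[U V] /= [yU yV] [oU oV /eqP e]].
  exists (U, V) => _; rewrite !inE in yU yV; split=> /=; try exact: open_nbhs_nbhs.
  by rewrite e.
pose Z y := [set z | forall y', y' \in s -> y <> y' -> (D (y, y')).1 z /\ (D (y', y)).2 z].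
exists Z; split=> [y ys|y y' z ys ys' zy zy'].
  have : forall s' : seq T, \forall z \near y, forall y', y' \in s' -> y <> y' -> (D (y, y')).1 z /\ (D (y', y)).2 z.
    elim=> [|y' s' IH]; first exact: filterE.
    have [e|ne] := pselect (y = y').
      by apply: filterS IH => z h y1; rewrite inE => /orP[/eqP ->|]; [rewrite e|exact: h].
    have [h1 _ _] := hD (y, y') ne; have [_ h2 _] := hD (y', y) (nesym ne).
    apply: filterS3 IH h1 h2 => z h3 h4 h5 y1; rewrite inE => /orP[/eqP -> _|]; first by split.
    exact: h3.
  by apply.
apply: contrapT => ne; have [_ _ e] := hD (y, y') ne.
by have [h1 _] := zy y' ys' ne; have [_ h2] := zy' y ys (nesym ne); apply: (e z).
Qed.

Section PhaseArgument.
Variables (R : realType) (M : topologicalType) (A : set (chart R 3 M)) (phi : R -> M -> M).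
Hypothesis hM : closed_oriented_3manifold A.
Hypothesis hphi : smooth_flow A phi.
Variables (S : topologicalType) (B : set (chart R 2 S)) (iota : S -> M).
Hypothesis bk : birkhoff_section A phi B iota.
Variable eps : R.
Hypothesis eps1 : eps * eps = 1.
Hypothesis signed : forall C, boundary_component B C ->
  exists2 m, multiplicity phi B iota C m & 0 < eps * m%:~R.
Let AM := manifold_atlas hM.
Let ps := bk.1.
Let BS := manifold_atlas (ps_surface ps).
Local Notation axis := (axis B iota).
Local Notation phase := (phase phi iota).
Implicit Types (x p : M) (y z : S).

(** The reflection of the plane in the horizontal axis, if eps = -1, changes the
    sign of the argument. *)
Lemma eps_arg (x y : R) : (x, y) <> (0, 0) -> isint (arg x y - eps * arg x (eps * y)).
Proof.
move=> xy; have : (eps - 1) * (eps + 1) = 0 by rewrite mulrDr mulr1 mulrBl mul1r eps1; ring.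
move=> /eqP; rewrite mulf_eq0 => /orP[]; rewrite ?subr_eq0 ?addr_eq0 => /eqP ->.
  by rewrite !mul1r subrr; apply: rpred0.
by rewrite !mulN1r opprK addrC; exact: arg_conj.
Qed.

Lemma eps_int : isint eps.
Proof.
have : (eps - 1) * (eps + 1) = 0 by rewrite mulrDr mulr1 mulrBl mul1r eps1; ring.
move=> /eqP; rewrite mulf_eq0 => /orP[]; rewrite ?subr_eq0 ?addr_eq0 => /eqP ->; first exact: rpred1.
by rewrite rpredN; exact: rpred1.
Qed.

(** A fibre of iota is compact, and discrete because iota is injective on each
    sheet and in the interior. *)
Lemma normal_preimages p d : A d -> cdom d p -> exists2 ys : seq S, uniq ys & forall y, y \in ys <-> iota y = p.
Proof.
move=> dA dp; pose K := [set y | iota y = p].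
have cK : compact K.
  apply: (subclosed_compact _ (manifold_compact (ps_surface ps))) => //.
  have -> : K = iota @^-1` [set p] by [].
  apply: closed_comp => [y _|]; first exact: (iota_cont ps).
  by apply: compact_closed (manifold_hausdorff hM) _; exact: compact_set1.
have iso y : K y -> exists2 W, nbhs y W & forall z, W z -> iota z = p -> z = y.
  move=> Ky; have [yb|nb] := pselect (bd B y); last first.
    exists (~` bd B).
      by apply: open_nbhs_nbhs; split => //; exact: (open_int BS).
    by move=> z nz zp; apply: (ps_injective ps) => //; rewrite zp Ky.
  have dy : cdom d (iota y) by rewrite Ky.
  have [X [Y [W [V [Wn _ Vn sh]]]]] := sheet_exists hM hphi bk signed yb dA dy filterT.
  exists W => // z Wz zp; have Vz : V (iota z) by rewrite zp -Ky; exact: nbhs_singleton.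
  by apply: (sh_inj sh Wz (nbhs_singleton Wn) Vz); rewrite zp Ky.
have /choice[W hW] : forall y, exists W, K y -> nbhs y W /\ forall z, W z -> iota z = p -> z = y.
  by move=> y; have [/iso[W h1 h2]|nk] := pselect (K y); [exists W|exists setT].
have [|s hs] := @compact_finite_cover S K (fun y => [set z | K y /\ W y z]) cK.
  by move=> y Ky; have [h1 _] := hW y Ky; apply: filterS h1.
exists (undup [seq y <- s | `[< K y >]]); first exact: undup_uniq.
move=> y; rewrite mem_undup mem_filter; split=> [/andP[/asboolP //]|Ky].
have [y' ys' [Ky' Wy]] := hs y Ky; have [_ h] := hW y' Ky'.
by rewrite (h y Wy Ky) ys' andbT; apply/asboolP.
Qed.

(** The sheets that end at p are half-planes around the axis.  The argument
    a_y in the coordinates of a sheet jumps from 1 to 0 when this sheet is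
    crossed along the flow, as the phase does when any of them is crossed.
    So the phase minus the sum of the a_y over all sheets is a continuous real
    function, which is bounded because its terms are in [0, 1[.  Finally each
    a_y is eps times the argument of om, up to a bounded lift.  The number K of
    sheets is 0 exactly off the axis. *)
Theorem phase_arg p d N om : A d -> cdom d p -> ncoord phi d p N om -> exists K : nat,
  (axis p -> (0 < K)%N) /\ exists (W : set M) (h : M -> R) (Cst : R),
  [/\ nbhs p W, W `<=` cdom d, forall x, W x -> om (cfwd d x) != 0 -> ~ axis x,
    islift (W `&` [set x | om (cfwd d x) != 0])
      (fun x => phase x - eps * K%:R * argr (om (cfwd d x))) h &
    forall x, W x -> om (cfwd d x) != 0 -> `|h x| <= Cst].
Proof.
move=> dA dp nc; have okd := atlas_chart AM dA.
have dn : nbhs p (cdom d) by apply: open_nbhs_nbhs; split => //; exact: chart_open okd.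
have [pa|npa] := pselect (axis p); last first.
  exists 0%N; split=> //.
  have nn : nbhs p (~` axis) by apply: open_nbhs_nbhs; split => //; exact: closed_openC (axis_closed hM ps).
  have [V Vn [h hl]] := zc_near_lift (phase_zc hM hphi bk) npa.
  have hb : \forall x \near p, (~` axis `&` V) x -> `|h x - h p| < 1.
    by have /mapcR k := hl.1; apply: k => //; split => //; exact: nbhs_singleton.
  exists (cdom d `&` (~` axis `&` V) `&` [set x | (~` axis `&` V) x -> `|h x - h p| < 1]), h, (`|h p| + 1).
  split.
  - by apply: filterI => //; apply: filterI => //; exact: filterI.
  - by move=> x [[]].
  - by move=> x [[_ []]].
  - split; first by apply: mapc_sub hl.1 => x [[[]]].
    by move=> x [[[_ hx] _] _]; rewrite mulr0 mul0r subr0; exact: hl.2.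
  - move=> x [[_ hx] h2] _; have := h2 hx => h3.
    by rewrite -(subrK (h p) (h x)); apply: (le_trans (ler_normD _ _)); lra.
have [ys uys ysP] := normal_preimages dA dp.
have [Z [Zn Zd]] := separate ys (manifold_hausdorff (ps_surface ps)).
pose dat : Type := ((M -> R) * (M -> R) * (set S) * (set M) * (set M) * (M -> R))%type.
pose dX (D : dat) := D.1.1.1.1.1; pose dY (D : dat) := D.1.1.1.1.2; pose dW (D : dat) := D.1.1.1.2.
pose dV (D : dat) := D.1.1.2; pose dV' (D : dat) := D.1.2; pose dh (D : dat) := D.2.
have /choice[F hF] : forall y, exists D : dat, y \in ys ->
    [/\ nbhs y (dW D), dW D `<=` Z y, nbhs p (dV' D), dV' D `<=` dV D &
     [/\ sheet phi B iota eps d p (dX D) (dY D) (dW D) (dV D),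
       forall x, dV' D x -> om (cfwd d x) != 0 -> (dX D x, dY D x) <> (0, 0),
       islift (dV' D `&` [set x | om (cfwd d x) != 0])
         (fun x => arg (dX D x) (eps * dY D x) - argr (om (cfwd d x))) (dh D) &
       forall x, `|dh D x| <= 1]].
  move=> y; have [yys|ny] := boolP (y \in ys); last by exists (fun=> 0, fun=> 0, set0, set0, set0, fun=> 0).
  have yp := (ysP y).1 yys.
  have yb : bd B y by apply: contrapT => nb; apply: (axis_int ps nb); rewrite yp.
  have dy : cdom d (iota y) by rewrite yp.
  have [X [Y [W [V [Wn WZ Vn sh]]]]] := sheet_exists hM hphi bk signed yb dA dy (Zn y yys).
  rewrite yp in Vn sh; have [V' [V'n V'V nz [h [hl hb]]]] := sh_arg sh nc.
  by exists (X, Y, W, V, V', h).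
pose a y x := arg (dX (F y) x) (dY (F y) x).
(* all the sheets over a small ball are among those chosen *)
pose O := \bigcup_(y in [set y | y \in ys]) (dW (F y))^°.
have On : nbhs p (~` (iota @` (~` O))).
  apply: open_nbhs_nbhs; split; last first.
    move=> [z nz zp]; have zys := (ysP z).2 zp; apply: nz; exists z => //.
    by have [h1 _ _ _ _] := hF z zys; exact: nbhs_singleton (nbhs_interior h1).
  apply: closed_openC; apply: compact_closed; first exact: (manifold_hausdorff hM).
  apply: continuous_compact; first by apply: continuous_subspaceT; exact: (iota_cont ps).
  apply: (subclosed_compact _ (manifold_compact (ps_surface ps))) => //.
  by apply: open_closedC; apply: bigcup_open => y _; exact: open_interior.
have Vall (s : seq S) : {subset s <= ys} -> nbhs p [set x | forall y, y \in s -> dV' (F y) x].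
  elim: s => [|y s IH] sub; first by apply: filterE => x y.
  have [_ _ h3 _ _] := hF y (sub _ (mem_head _ _)).
  have {}IH := IH (fun y' h => sub _ (mem_behead (s := y :: s) h)).
  by apply: filterS2 h3 IH => x h4 h5 y'; rewrite inE => /orP[/eqP ->|/h5].
pose W := cdom d `&` ~` (iota @` (~` O)) `&` [set x | forall y, y \in ys -> dV' (F y) x].
have Wn : nbhs p W.
  by apply: filterI; [exact: filterI|apply: Vall].
have WO x z : W x -> iota z = x -> exists2 y, y \in ys & dW (F y) z.
  move=> [[_ nx] _] zx; have : O z by apply: contrapT => nO; apply: nx; exists z.
  by move=> [y yys /interior_subset hz]; exists y.
pose W0 := W `&` [set x | om (cfwd d x) != 0].
have nz x y : W0 x -> y \in ys -> (dX (F y) x, dY (F y) x) <> (0, 0).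
  by move=> [[_ hx] ox] yys; have [_ _ _ _ [_ h _ _]] := hF y yys; apply: h => //; exact: hx.
have WV x y : W0 x -> y \in ys -> dV (F y) x.
  by move=> [[_ hx] ox] yys; have [_ _ _ h _] := hF y yys; apply: h; exact: hx.
have Wax x : W0 x -> ~ axis x.
  move=> W0x [z zb zx]; have [y yys hz] := WO x z W0x.1 zx.
  have [_ _ _ _ [sh _ _ _]] := hF y yys.
  have Vz : dV (F y) (iota z) by rewrite zx; exact: WV.
  have [e1 _ e2] := sh_in sh hz Vz; apply: (nz x y W0x yys).
  by rewrite -zx e1 (e2 zb).
have XYc x y (P : set (R * R)) : W0 x -> y \in ys -> nbhs (dX (F y) x, dY (F y) x) P ->
    \forall x' \near x, W0 x' -> P (dX (F y) x', dY (F y) x').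
  move=> W0x yys hP; have [_ _ _ _ [sh _ _ _]] := hF y yys.
  have := mapc_pair (sh_X sh) (sh_Y sh) (WV x y W0x yys) hP.
  by apply: filterS => x' h W0x'; apply: h; exact: WV.
have acont x y : W0 x -> y \in ys -> ~ (0 < dX (F y) x /\ dY (F y) x = 0) -> contat W0 x (a y).
  move=> W0x yys nj e e0; have h0 := nz x y W0x yys.
  have := XYc x y _ W0x yys (arg_cont h0 nj e0); apply: filterS => x' h W0x'.
  by apply: (h W0x'); exact: nz.
(* at a hit the phase and the argument of the sheet jump together *)
pose Dh x := phase x - \sum_(y <- ys) a y x.
have Dc : mapc W0 Dh.
  apply/mapcR => x W0x; change (contat W0 x Dh).
  have nax := Wax x W0x.
  have [hx|hx] := pselect (hit iota x); last first.
    apply: contatB.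
      by move=> e e0; apply: filterS (phase_cont hM hphi bk nax hx e0).
    apply: contat_sum => y yys _; apply: acont => // -[X0 Y0]; apply: hx.
    have [_ _ _ _ [sh _ _ _]] := hF y yys.
    by have [z _ [_ zx]] := sh_hit sh (WV x y W0x yys) X0 Y0; exists z.
  have [z0 nz0 z0x] := range_axis hx nax.
  have [y0 y0s hz0] := WO x z0 W0x.1 z0x.
  have [_ WZ0 _ _ [sh0 _ _ _]] := hF y0 y0s.
  have Vz0 : dV (F y0) (iota z0) by rewrite z0x; exact: WV.
  have E : Dh = fun x' => (phase x' - a y0 x') - \sum_(y <- ys | y != y0) a y x'.
    by apply/funext => x'; rewrite /Dh (bigD1_seq y0) //= opprD addrA.
  rewrite E; apply: contatB; last first.
    apply: contat_sum => y yys yy0; apply: acont => // -[X0 Y0].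
    have [_ WZ _ _ [sh _ _ _]] := hF y yys.
    have [z Wz [nzb zx]] := sh_hit sh (WV x y W0x yys) X0 Y0.
    have zz0 : z = z0 by apply: (ps_injective ps nzb nz0); rewrite zx z0x.
    by move/eqP: yy0; apply; apply: (Zd y y0 z) => //; [exact: WZ|rewrite zz0; exact: WZ0].
  have [e1 e2 _] := sh_in sh0 hz0 Vz0; have X0 := e2 nz0; rewrite z0x in e1 X0.
  have [delta [N0 [h [d0 N0n hc h0 [hN hhit hsg]]]]] := sh_sign sh0 hz0 nz0 Vz0.
  rewrite z0x in N0n h0.
  move=> e ep; have e2p : 0 < e / 2 by rewrite divr_gt0.
  have k1 := phase_near_hit hM hphi bk nax d0 N0n hc h0 hN hhit e2p.
  have XY0 : (dX (F y0) x, dY (F y0) x) = (dX (F y0) x, 0) by rewrite e1.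
  have k2 : \forall x' \near x, W0 x' -> (0 <= dY (F y0) x' -> a y0 x' < e / 2) /\
      (dY (F y0) x' < 0 -> 1 - e / 2 < a y0 x').
    have aj := arg_jump X0 e2p; rewrite -XY0 in aj.
    have := XYc x y0 _ W0x y0s aj; apply: filterS => x' h' W0x'.
    by apply: (h' W0x'); exact: nz.
  have p0 : phase x = 0 by exact: (phase_hit hM hphi bk nax hx).
  have a0 : a y0 x = 0 by rewrite /a e1 arg_pos.
  rewrite p0 a0 subr0; apply: filterS2 k1 k2 => x' [nax' Nx' q1 q2] q3 W0x'; rewrite subr0.
  have [s1 s2] := hsg x' Nx'; have [s3 s4] := q3 W0x'.
  have [b0 b1] := phase_range phi iota x'.
  have [/andP[c0 c1] _ _] := argP (nz x' y0 W0x' y0s); rewrite -/(a y0 x') in c0 c1.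
  rewrite ltr_norml; have [hs|hs] := leP (h x') 0.
    by have := q1 hs; have := s3 (s1 hs); lra.
  by have := q2 hs; have := s4 (s2 hs); lra.
exists (size ys); split.
  by move=> [y yb yp]; have := (ysP y).2 yp; case: (ys).
exists W, (fun x => Dh x + \sum_(y <- ys) eps * dh (F y) x), (1 + (size ys)%:R + (size ys)%:R).
split=> //.
- by move=> x [[]].
- by move=> x Wx ox; exact: Wax.
- split.
    apply: mapcD Dc _; rewrite -/W0.
    have : {subset ys <= ys} by []; elim: {1 3}ys => [|y s IH] sub.
      by apply: (mapc_eq (f := fun=> 0)) => [x _|]; [rewrite big_nil|exact: mapc_cst].
    apply: (mapc_eq (f := fun x => eps * dh (F y) x + \sum_(j <- s) eps * dh (F j) x)) => [x _|]; first by rewrite big_cons.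
    apply: mapcD; last by apply: IH => y' h; apply: sub; rewrite inE h orbT.
    apply: mapcM; first exact: mapc_cst.
    have ym := sub y (mem_head _ _); have [_ _ _ _ [_ _ hl _]] := hF y ym.
    by apply: mapc_sub hl.1 => x [[_ hx] ox]; split => //; exact: hx.
  move=> x W0x.
  have -> : phase x - eps * (size ys)%:R * argr (om (cfwd d x)) - (Dh x + \sum_(y <- ys) eps * dh (F y) x) =
      \sum_(y <- ys) (a y x - eps * argr (om (cfwd d x)) - eps * dh (F y) x).
    rewrite !big_split /= !sumrN /Dh big_const_seq count_predT iter_addr_0 -mulr_natr; ring.
  rewrite big_seq; apply: rpred_sum => y yys.
  have [_ _ _ _ [_ _ hl _]] := hF y yys.
  have Hx : (dV' (F y) `&` [set x | om (cfwd d x) != 0]) x by case: W0x => [[_ hx] ox]; split => //; exact: hx.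
  have i1 := hl.2 x Hx; have i2 := eps_arg (nz x y W0x yys).
  have ie : isint (eps * (arg (dX (F y) x) (eps * dY (F y) x) - argr (om (cfwd d x)) - dh (F y) x)).
    by apply: rpredM => //; exact: eps_int.
  have -> : a y x - eps * argr (om (cfwd d x)) - eps * dh (F y) x =
    (a y x - eps * arg (dX (F y) x) (eps * dY (F y) x)) +
    eps * (arg (dX (F y) x) (eps * dY (F y) x) - argr (om (cfwd d x)) - dh (F y) x) by ring.
  exact: rpredD.
- move=> x Wx ox; have W0x : W0 x by split.
  apply: (le_trans (ler_normD _ _)); apply: lerD.
    rewrite /Dh; apply: (le_trans (ler_normB _ _)); apply: lerD.
      by have [b0 b1] := phase_range phi iota x; rewrite ger0_norm // ltW.
    apply: (le_trans (ler_norm_sum _ _ _)); rewrite big_seq.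
    apply: (@le_trans _ _ (\sum_(y <- ys | y \in ys) 1)); last by rewrite -big_seq big_const_seq count_predT iter_addr_0.
    apply: ler_sum => y yys; have [/andP[c0 c1] _ _] := argP (nz x y W0x yys).
    by rewrite ger0_norm // ltW.
  apply: (le_trans (ler_norm_sum _ _ _)); rewrite big_seq.
  apply: (@le_trans _ _ (\sum_(y <- ys | y \in ys) 1)); last by rewrite -big_seq big_const_seq count_predT iter_addr_0.
  apply: ler_sum => y yys; have [_ _ _ _ [_ _ _ hb]] := hF y yys.
  have e1 : `|eps| = 1.
    apply/eqP; rewrite -(@eqrXn2 _ 2) // ?normr_ge0 // expr1n -normrX expr2 eps1 normr1 //.
  by rewrite normrM e1 mul1r.
Qed.

End PhaseArgument.

(** * Smooth atlases and circles in the boundary *)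

(** To first order G is the linear map L, of positive determinant. *)
Lemma sdiff_turn (R : realType) (S : topologicalType) (w : S -> 'rV[R]_2) q (D : set S) G (L : 'M[R]_2) :
  nbhs q D -> mapc D w -> (forall y, D y -> w y = w q -> y = q) ->
  sdiff G (w q) (fun h => h *m L) -> 0 < \det L ->
  exists W, [/\ nbhs q W, W `<=` D, forall y, W y -> y <> q -> G (w y) <> G (w q) &
    exists h, islift (W `\ q) (fun y => argr (G (w y) - G (w q)) - argr (w y - w q)) h].
Proof.
move=> Dn wc wi Gs L0; have Dq := nbhs_singleton Dn.
have LD : 0 < L 0 0 * L 1 1 - L 1 0 * L 0 1 by rewrite det2 in L0; lra.
have [eta eta0 heta] := arg_linear LD.
have [r1 r10 h1] := Gs _ eta0; have [r2 r20 Gc] := sdiff_cont (blin_mulmx L) Gs.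
have r12 : 0 < Num.min r1 r2 by rewrite lt_min r10.
pose W := D `&` [set y | `|w y - w q| < Num.min r1 r2].
have Wn : nbhs q W.
  apply: filterI => //; have h := wc q Dq _ (near_norm (w q) r12).
  by apply: filterS2 h Dn => y h3 h4; exact: h3.
have Wr y : W y -> `|w y - w q| < r1 /\ `|w y - w q| < r2.
  by move=> [_] /=; rewrite lt_min => /andP.
have wcW : mapc (W `\ q) w by apply: mapc_sub wc => y [[]].
have GcW : mapc (W `\ q) (fun y => G (w y)).
  by apply: (mapc_comp _ wcW Gc) => y [/Wr[]].
have coordL (u : 'rV[R]_2) j : (u *m L) 0 j = L 0 j * u 0 0 + L 1 j * u 0 1.
  rewrite mxE !big_ord_recl big_ord0 addr0 ![L _ j * _]mulrC.
  by rewrite (_ : lift ord0 ord0 = 1) //; exact: val_inj.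
have coordB (a b : 'rV[R]_2) j : (a - b) 0 j = a 0 j - b 0 j by rewrite !mxE.
have bnd y j : (W `\ q) y -> `|(G (w y) - G (w q)) 0 j - ((w y - w q) *m L) 0 j| <=
    eta * (`|(w y - w q) 0 0| + `|(w y - w q) 0 1|).
  move=> [/Wr[y1 _] _]; have q1 : `|w q - w q| < r1 by rewrite subrr normr0.
  have k := h1 _ _ y1 q1.
  have := row_norm_ge (G (w y) - G (w q) - (w y - w q) *m L) j.
  rewrite [X in `|X| <= _ -> _]coordB => k2; apply: (le_trans k2); apply: (le_trans k).
  by rewrite ler_wpM2l ?(ltW eta0) //; exact: row2_norm.
have cc (f : S -> 'rV[R]_2) (a : 'rV[R]_2) j : mapc (W `\ q) f -> mapc (W `\ q) (fun y => (f y - a) 0 j).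
  move=> fc0; have fc : mapc (W `\ q) (fun y => f y 0 j) by apply: mapc_coord.
  have ac : mapc (W `\ q) (fun _ => a 0 j) by apply: mapc_cst.
  have := mapcB fc ac.
  by apply: mapc_eq => y _; rewrite coordB.
have [||||y Dy|y Dy|y Dy|nz [h [hl hb]]] := heta S (W `\ q) (fun y => (w y - w q) 0 0) (fun y => (w y - w q) 0 1)
    (fun y => (G (w y) - G (w q)) 0 0) (fun y => (G (w y) - G (w q)) 0 1).
- exact: cc.
- exact: cc.
- exact: cc.
- exact: cc.
- move: (Dy) => [[Dy' _] yq]; apply/row2_neq0; rewrite subr_eq0; apply/eqP => e; apply: yq; exact: wi.
- by have := bnd y 0 Dy; rewrite coordL.
- by have := bnd y 1 Dy; rewrite coordL.
exists W; split => //; first by move=> y [].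
  move=> y Wy yq e; apply: (nz y) => //; by rewrite e subrr !mxE.
by exists h.
Qed.

Section SurfaceOfAtlas.
Variables (R : realType) (S : topologicalType) (B : set (chart R 2 S)).
Hypothesis sok : compact_oriented_surface B.
Let BS := manifold_atlas sok.

Definition rowp (p : R * R) : 'rV[R]_2 := \row_j (if j == 0 then p.1 else p.2).
Definition pairr (u : 'rV[R]_2) : R * R := (u 0 0, u 0 1).

Lemma rowpK p : pairr (rowp p) = p.
Proof. by case: p => x y; rewrite /pairr !mxE. Qed.

Lemma pairrK u : rowp (pairr u) = u.
Proof.
apply/rowP => j; rewrite !mxE; case: j => -[|[|//]] i /=; congr (u 0 _); exact: val_inj.
Qed.

Lemma rowp_cont : continuous rowp.
Proof.
move=> p V /norm_near[r r0 h]; apply/nbhs_ballP; exists r => // q [q1 q2].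
apply: h; rewrite distrC; apply: row_norm_lt => // j; rewrite !mxE.
by case: (j == 0).
Qed.

Lemma pairr_cont : continuous pairr.
Proof.
move=> u V /nbhs_ballP[r r0 h]; have r0' : 0 < r by [].
apply: filterS (near_norm u r0') => w wr; apply: h; split; rewrite /ball /= distrC.
  by have := row_norm_ge (w - u) 0; rewrite !mxE => /le_lt_trans; apply.
by have := row_norm_ge (w - u) 1; rewrite !mxE => /le_lt_trans; apply.
Qed.

Definition plane_chart (c : chart R 2 S) : hchart R S :=
  HChart (cdom c) (pairr \o cfwd c) (cinv c \o rowp).

Lemma plane_chart_ok c : B c -> hchart_ok (plane_chart c).
Proof.
move=> cB; have ok := atlas_chart BS cB; split.
- exact: chart_open ok.
- have [U Uo UE] := chart_image ok; exists (rowp @^-1` U).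
    by apply: open_comp => // p _; exact: rowp_cont.
  apply/seteqP; split => [p [x cx <-]|p [Up p0]] /=.
    have : (U `&` @half_plane R) (cfwd c x) by rewrite -UE; exists x.
    by rewrite /= pairrK => -[].
  have : (cfwd c @` cdom c) (rowp p) by rewrite UE; split => //=; rewrite /half_plane /= mxE.
  by move=> [x cx e]; exists x => //=; rewrite e rowpK.
- by move=> x cx /=; rewrite pairrK; exact: chart_cancel ok _ cx.
- apply: (mapc_comp (B := setT)) => //; first by apply/mapcP; exact: chart_fwd_cont ok.
  by apply: mapc_cont; exact: pairr_cont.
- apply: (mapc_comp (B := cfwd c @` cdom c)).
  + by move=> p [x cx <-] /=; rewrite pairrK; exists x.
  + by apply: mapc_cont; exact: rowp_cont.
  + by apply/mapcP; exact: chart_inv_cont ok.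
Qed.

Lemma chart_inj c x y : B c -> cdom c x -> cdom c y -> cfwd c x = cfwd c y -> x = y.
Proof.
move=> cB cx cy e; have ok := atlas_chart BS cB.
by rewrite -(chart_cancel ok cx) e (chart_cancel ok cy).
Qed.

(** Transition maps have positive Jacobian determinants. *)
Lemma transition_turn c c' q : B c -> B c' -> cdom c q -> cdom c' q -> ~ bd B q ->
  exists2 W, nbhs q W & exists h, islift (W `\ q)
    (fun y => argr (cfwd c' y - cfwd c' q) - argr (cfwd c y - cfwd c q)) h.
Proof.
move=> cB c'B cq c'q nq; have ok := atlas_chart BS cB.
have [sm _] := atlas_smooth BS cB c'B.
have qD : repdom setT c c' idfun (cfwd c q) by exists q.
have [U [g [Uo Uu gC gf]]] := sm (cfwd c q) qD.
have D0 : 0 < \det ('J g (cfwd c q)).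
  by apply: (atlas_oriented BS cB c'B cq c'q); exists U, g.
have gs := C1_row Uo Uu (gC 1).
have Un : nbhs (cfwd c q) U by exact: open_nbhs_nbhs.
pose D := [set y | (cdom c y /\ U (cfwd c y)) /\ cdom c' y].
have Dn : nbhs q D.
  apply: filterI; first exact: (chart_fwd_near ok cq Un).
  by apply: open_nbhs_nbhs; split => //; exact: chart_open (atlas_chart BS c'B).
have [W [Wn WD _ [h hl]]] : exists W, [/\ nbhs q W, W `<=` D, forall y, W y -> y <> q -> g (cfwd c y) <> g (cfwd c q) &
    exists h, islift (W `\ q) (fun y => argr (g (cfwd c y) - g (cfwd c q)) - argr (cfwd c y - cfwd c q)) h].
  apply: (sdiff_turn Dn _ _ gs D0).
    by apply: (@mapc_sub _ _ _ (cdom c)) => [y [[]]//|]; apply/mapcP; exact: chart_fwd_cont ok.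
  by move=> y [[cy _] _]; exact: chart_inj.
have gE y : D y -> g (cfwd c y) = cfwd c' y.
  move=> [[cy Uy] c'y]; rewrite gf //= /rep /= ?(chart_cancel ok cy) //.
  by exists y.
exists W => //; exists h; apply: islift_eqf hl => y [Wy _].
have Dy := WD _ Wy; have Dq := nbhs_singleton Dn; by rewrite (gE y Dy) (gE q Dq).
Qed.

Lemma derive1_climb n (F : R -> 'rV[R]_n) s j : derivable F s 1 -> 0 < derive1 F s 0 j ->
  \forall s' \near s^', 0 < (F s' 0 j - F s 0 j) * (s' - s).
Proof.
move=> Fd; set Dv := derive1 F s => pos.
have D : (fun h : R => h^-1 *: (F (h *: 1 + s) - F s)) @ 0^' --> Dv by rewrite /Dv derive1E; exact: Fd.
have /D h : nbhs Dv [set w : 'rV[R]_n | 0 < w 0 j].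
  by apply: (coord_near (P := [set t | 0 < t])); exact: lt_nbhsr.
move: h => /nbhs_ballP[r r0 hr]; apply/nbhs_ballP; exists r => // s'; rewrite /ball /= => sr ss.
have h1 : s' - s != 0 by rewrite subr_eq0.
have := hr (s' - s); rewrite /ball /= sub0r opprB => /(_ sr h1); rewrite /= !mxE [_ *: 1]mulr1 subrK => h2.
set y := F s' 0 j - F s 0 j in h2 *.
have -> : y * (s' - s) = (s' - s)^-1 * y * ((s' - s) * (s' - s)) by field.
by rewrite mulr_gt0 // -expr2 exprn_even_gt0.
Qed.

Lemma component_sub C : boundary_component B C -> C `<=` bd B.
Proof. by move=> [x xb ->]; exact: connected_component_sub. Qed.

(** A boundary parametrization climbs through g s in the chart, so by the
    intermediate value theorem it covers the boundary line near g s. *)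
Lemma param_open C g y : boundary_component B C -> positive_parametrization B C g -> C y ->
  exists2 W, nbhs y W & forall z, W z -> bd B z -> C z.
Proof.
move=> bC [gc gr gi gd] Cy; move: (Cy); rewrite -gr => -[s _ gs].
have [c cB cy] := atlas_cover BS y; have ok := atlas_chart BS cB.
have gb t : bd B (g t) by apply: (component_sub bC); rewrite -gr; exists t.
pose f t := cfwd c (g t) 0 1.
have [Fd Fp] : derivable (cfwd c \o g) s 1 /\ 0 < derive1 (cfwd c \o g) s 0 1.
  by apply: gd => //; rewrite gs.
have /nbhs_ballP[r1 r10 up] := derive1_climb Fd Fp.
have cn : nbhs s (g @^-1` cdom c).
  by apply: gc; rewrite gs; apply: open_nbhs_nbhs; split => //; exact: chart_open ok.
have /nbhs_ballP[r2 r20 hc] := cn.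
have r10' : 0 < r1 by []. have r20' : 0 < r2 by [].
pose d := Num.min r1 r2 / 2.
have d0 : 0 < d by rewrite divr_gt0 // lt_min r10.
have [dr1 dr2] : d < r1 /\ d < r2.
  have : Num.min r1 r2 <= r1 /\ Num.min r1 r2 <= r2 by rewrite !ge_min !lexx orbT.
  by rewrite /d; move=> [? ?]; split; lra.
have cdm t : itv (s - d) (s + d) t -> cdom c (g t).
  move=> /andP[t1 t2]; apply: hc; rewrite /ball /= ltr_norml; apply/andP; split; lra.
have fc : mapc (itv (s - d) (s + d)) f.
  apply: mapc_coord; apply: (mapc_comp cdm); first exact: mapc_cont.
  by apply/mapcP; exact: chart_fwd_cont ok.
have h1 : f (s - d) < f s.
  have := up (s - d); rewrite /ball /= opprB addrC subrK (gtr0_norm d0) => /(_ dr1).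
  rewrite lt_eqF ?ltrBlDr ?ltrDl // => /(_ isT).
  rewrite -/(f _) -/(f s) (_ : s - d - s = - d); last by ring.
  by rewrite mulrN -mulNr pmulr_lgt0 // opprB subr_gt0.
have h2 : f s < f (s + d).
  have := up (s + d); rewrite /ball /= opprD addrA subrr sub0r normrN (gtr0_norm d0) => /(_ dr1).
  rewrite gt_eqF ?ltrDl // => /(_ isT).
  rewrite -/(f _) -/(f s) (_ : s + d - s = d); last by ring.
  by rewrite pmulr_lgt0 // subr_gt0.
exists [set z | cdom c z /\ f (s - d) < cfwd c z 0 1 < f (s + d)].
  apply: (chart_fwd_near ok cy (V := [set u : 'rV[R]_2 | f (s - d) < u 0 1 < f (s + d)])).
  apply: (coord_near (P := [set t | f (s - d) < t < f (s + d)])).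
  have -> : cfwd c y 0 1 = f s by rewrite /f gs.
  have n1 : \forall t \near f s, f (s - d) < t by exact: lt_nbhsr.
  have n2 : \forall t \near f s, t < f (s + d) by exact: lt_nbhsl.
  by apply: filterS2 n1 n2 => t ? ?; apply/andP.
move=> z [cz /andP[z1 z2]] zb; have sd : s - d <= s + d by lra.
have [|t ti ft] := @itv_ivt R f (s - d) (s + d) (cfwd c z 0 1) sd fc; first by rewrite /itv /= !ltW.
have ct := cdm t ti; exists t => //; apply: (chart_inj cB ct cz).
have e1 : cfwd c (g t) 0 0 = 0 by apply/(bd_chart BS cB ct).
have e2 : cfwd c z 0 0 = 0 by apply/(bd_chart BS cB cz).
by rewrite -[LHS]pairrK -[RHS]pairrK /pairr e1 e2 -ft.
Qed.

(** The boundary components are open in the boundary, which is compact, so there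
    are finitely many of them. *)
Lemma surface_of_atlas (Q : (R -> S) -> Prop) : bd B !=set0 ->
  (forall C, boundary_component B C -> exists2 g, positive_parametrization B C g & Q g) ->
  exists m g, surface (plane_chart @` B) (bd B) m g /\ forall i, (i < m)%N -> Q (g i).
Proof.
move=> [x0 _] par.
have bcC x : bd B x -> boundary_component B (connected_component (bd B) x) by move=> xb; exists x.
have /choice[U hU] : forall x, exists U : set S, bd B x -> nbhs x U /\
    forall z, U z -> bd B z -> connected_component (bd B) x z.
  move=> x; have [xb|nx] := pselect (bd B x); last by exists setT.
  have [g gp _] := par _ (bcC x xb).
  have [W Wn hW] := param_open (bcC x xb) gp (connected_component_refl xb).
  by exists W.
have bdc : compact (bd B).
  by apply: (subclosed_compact (bd_closed BS) (manifold_compact sok)).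
have [s hs] : exists s : seq S, forall x, bd B x -> exists2 y, y \in s & bd B y /\ U y x.
  have [|s hs] := @compact_finite_cover S (bd B) (fun y x => bd B y /\ U y x) bdc.
    by move=> x xb; have [Un _] := hU x xb; apply: filterS Un => z.
  by exists s.
pose comp x := connected_component (bd B) x.
pose cs := undup [seq comp x | x <- s & `[< bd B x >]].
have csb C : C \in cs -> boundary_component B C.
  by rewrite mem_undup => /mapP[x]; rewrite mem_filter => /andP[/asboolP xb _] ->; exact: bcC.
have /choice[G hG] : forall C, exists g, C \in cs -> positive_parametrization B C g /\ Q g.
  move=> C; have [/csb bC|nC] := boolP (C \in cs); last by exists (fun=> x0).
  by have [g gp Qg] := par C bC; exists g.
pose g i := G (nth set0 cs i); exists (size cs), g.
have gP i : (i < size cs)%N -> [/\ nth set0 cs i \in cs, positive_parametrization B (nth set0 cs i) (g i) & Q (g i)].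
  by move=> im; have iC := mem_nth set0 im; have [? ?] := hG _ iC; split.
have gC i s' : (i < size cs)%N -> (nth set0 cs i) (g i s').
  by move=> /gP[_ [_ gr _ _] _]; rewrite -[X in X _]gr; exists s'.
split; last by move=> i /gP[].
split.
- exact: manifold_hausdorff sok.
- exact: manifold_compact sok.
- by move=> _ [c cB <-]; exact: plane_chart_ok.
- by move=> x; have [c cB cx] := atlas_cover BS x; exists (plane_chart c) => //; exists c.
- by move=> _ x [c cB <-] cx; exact: bd_chart.
- move=> _ _ q [c cB <-] [c' c'B <-] cq c'q nq; have [W Wn [h hl]] := transition_turn cB c'B cq c'q nq.
  by exists W => //; exists h; apply: islift_eqf hl => y _; rewrite /argr /argq /= !mxE.
- by move=> i /gP[_ []].
- move=> i s1 t /gP[_ [_ _ gi _] _]; rewrite gi; split => [[k ->]|/intrP[k ->]]; last by exists k.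
  exact: intr_int.
- by move=> i s1 im; have [iC _ _] := gP i im; apply: (component_sub (csb _ iC)); exact: gC.
- move=> i j s1 t im jm e; have [iC _ _] := gP i im; have [jC _ _] := gP j jm.
  apply/eqP; rewrite -(@nth_uniq _ set0 cs) ?undup_uniq //; apply/eqP.
  have [x xb xE] := csb _ iC; have [y yb yE] := csb _ jC.
  have gx := gC i s1 im; have gy := gC j t jm.
  rewrite xE e in gx; rewrite yE in gy *.
  by rewrite xE (same_connected_component gx) (same_connected_component gy).
- move=> x xb; have [y ys [yb Uyx]] := hs x xb.
  have yC : comp y \in cs by rewrite mem_undup; apply: map_f; rewrite mem_filter ys andbT; exact/asboolP.
  have im : (index (comp y) cs < size cs)%N by rewrite index_mem.
  have [_ [_ gr _ _] _] := gP _ im; rewrite nth_index // in gr.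
  have : comp y x by exact: (hU y yb).2.
  by rewrite -gr => -[s1 _ <-]; exists (index (comp y) cs), s1.
- move=> _ i s1 [c cB <-] im cs1; have [_ [_ _ _ gd] _] := gP i im.
  have [Fd Fp] := gd c s1 cB cs1; have /nbhs_ballP[r r0 up] := derive1_climb Fd Fp.
  exists r => // s2 s12 s2r; have := up s2; rewrite /ball /= distrC gtr0_norm ?subr_gt0 //.
  rewrite ltrBlDl s2r gt_eqF // => /(_ isT isT).
  by rewrite pmulr_lgt0 ?subr_gt0.
Qed.
End SurfaceOfAtlas.

(** * Crossings of a section with the axis of another one *)

Lemma islift_scale (R : realType) (T : topologicalType) (C : set T) (f h : T -> R) (k : R) :
  isint k -> islift C f h -> islift C (fun z => k * f z) (fun z => k * h z).
Proof.
move=> ki [hc hi]; split; first by apply: mapcM hc; apply: mapc_cst.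
by move=> x Cx; rewrite -mulrBr; apply: isintM => //; exact: hi.
Qed.

Lemma islift_add (R : realType) (T : topologicalType) (C : set T) (f h f' h' : T -> R) :
  islift C f h -> islift C f' h' -> islift C (fun z => f z + f' z) (fun z => h z + h' z).
Proof.
move=> [hc hi] [hc' hi']; split; first exact: mapcD.
by move=> x Cx; rewrite opprD addrACA; apply: isintD; [exact: hi|exact: hi'].
Qed.

Section AxisCoordinates.
Variables (R : realType) (M : topologicalType) (A : set (chart R 3 M)) (phi : R -> M -> M).
Hypothesis hM : closed_oriented_3manifold A.
Hypothesis hphi : smooth_flow A phi.
Variables (S : topologicalType) (B : set (chart R 2 S)) (iota : S -> M).
Hypothesis ps : partial_section A phi B iota.
Let AM := manifold_atlas hM.

Lemma axis_velocity p d : axis B iota p -> A d -> cdom d p -> velocity phi d p != 0.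
Proof.
move=> pa dA dp; have [F [_ FG FE]] := ps_boundary ps.
have : (iota @` bd B) p by [].
rewrite FE => -[G GF Gp]; have [x [T [mp GE]]] := FG G GF.
move: Gp; rewrite GE => -[t _ tE]; rewrite -tE in dp *.
exact: (periodic_moves hM hphi dA mp).
Qed.

Lemma ncoord_center p d N om : A d -> cdom d p -> ncoord phi d p N om -> om (cfwd d p) = 0.
Proof.
move=> dA dp nc; have [C C0 near] := nc_near nc.
have [r [r0 _ [W Wn [_ _ _ Wz]]]] := near 1 ltr01.
by apply: (Wz p 0); rewrite ?normr0 ?(flow0 hphi) //; exact: nbhs_singleton.
Qed.

(** A zero x of om near p is a point of the flow line of p, which lies in the
    axis. *)
Lemma ncoord_axis p d N om : axis B iota p -> A d -> cdom d p -> ncoord phi d p N om ->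
  exists2 W, nbhs p W & [/\ W `<=` cdom d, mapc W (om \o cfwd d) &
    forall x, W x -> om (cfwd d x) = 0 -> axis B iota x].
Proof.
move=> pa dA dp nc; have [C C0 near] := nc_near nc; have ok := atlas_chart AM dA.
have [r [r0 _ [W Wn [Wd Wc Wt _]]]] := near 1 ltr01.
exists W => //; split => // x Wx o0; have [t [dt _ _ _ le]] := Wt x Wx.
rewrite o0 normr0 mulr0 in le.
have e : cfwd d x = cfwd d (phi t p) by apply/eqP; rewrite -subr_eq0 -normr_le0.
rewrite -(chart_cancel ok (Wd _ Wx)) e (chart_cancel ok dt).
exact: (axis_flow hphi ps).
Qed.

End AxisCoordinates.

Section TwoSections.
Variables (R : realType) (M : topologicalType) (A : set (chart R 3 M)) (phi : R -> M -> M).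
Hypothesis hM : closed_oriented_3manifold A.
Hypothesis hphi : smooth_flow A phi.
Variables (S1 : topologicalType) (B1 : set (chart R 2 S1)) (iota1 : S1 -> M).
Hypothesis bk1 : birkhoff_section A phi B1 iota1.
Variable eps : R.
Hypothesis eps1 : eps * eps = 1.
Hypothesis signed1 : forall C, boundary_component B1 C ->
  exists2 m, multiplicity phi B1 iota1 C m & 0 < eps * m%:~R.
Variables (S2 : topologicalType) (B2 : set (chart R 2 S2)) (iota2 : S2 -> M).
Hypothesis ps2 : partial_section A phi B2 iota2.
Let AM := manifold_atlas hM.
Let BS := manifold_atlas (ps_surface ps2).
Let phase1 := phase phi iota1.
Let axis1 := axis B1 iota1.
Let axis2 := axis B2 iota2.

(** The transverse coordinate om of the axis of S1, restricted to S2, is a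
    chart at y to first order, and with the positive orientation, since both S2
    and the disc of om are positively transverse to the flow.  So the phase of S1
    winds around y in S2 as it winds around the axis. *)
Lemma crossing_residue c y : B2 c -> cdom c y -> ~ bd B2 y -> axis1 (iota2 y) ->
  exists2 K : nat, exists2 W, nbhs y W & forall z, W z -> z <> y -> ~ axis1 (iota2 z) &
  exists2 W, nbhs y W & exists h, islift (W `\ y) (fun z => phase1 (iota2 z) - eps * K%:R * argr (cfwd c z - cfwd c y)) h.
Proof.
move=> cB cy ny ya; set p := iota2 y in ya.
have [d dA dp] := atlas_cover AM p.
have [N N0] := frame_exists (axis_velocity hM hphi bk1.1 ya dA dp).
have [om nc] := ncoord_exists AM hphi dA dp N0.
have [K [_ [W1 [h1 [Cst [W1n W1d W1a W1l _]]]]]] := phase_arg hM hphi bk1 eps1 signed1 dA dp nc.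
have [U [g [ext Uy [r r0 gr]]]] := section_chart hM ps2 cB dA cy dp.
have [Uo gC gf] := ext; set u := cfwd c y in Uy gr *.
have gs := C1_row Uo Uy (gC 1).
have gE z : cdom c z -> cdom d (iota2 z) -> U (cfwd c z) -> g (cfwd c z) = cfwd d (iota2 z).
  move=> cz dz Uz; rewrite gf // /rep /= ?(chart_cancel (atlas_chart BS cB)) //.
  by exists z.
have gu : g u = cfwd d p by apply: gE.
set J := 'J g u in gs.
have J0 := extends_det ps2 cB dA cy dp ny ext Uy.
rewrite (det_framemx J (lt0r_neq0 N0)) pmulr_lgt0 // in J0.
have os := nc_diff nc; rewrite -gu in os.
have Gs := sdiff_comp (blin_mulmx J) (blin_mulmx _) gs os.
have {}Gs := sdiff_eqA (fun h => esym (mulmxA h J _)) Gs.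
pose D := [set z | (cdom c z /\ U (cfwd c z)) /\ W1 (iota2 z)].
have Dn : nbhs y D.
  apply: filterI; first by apply: (chart_fwd_near (atlas_chart BS cB) cy); exact: open_nbhs_nbhs.
  exact: (iota_cont ps2).
have [||W [Wn WD Wz [h hl]]] := @sdiff_turn R S2 (cfwd c) y D _ _ Dn _ _ Gs J0.
- by apply: (@mapc_sub _ _ _ (cdom c)) => [z [[]]//|]; apply/mapcP; exact: chart_fwd_cont (atlas_chart BS cB).
- by move=> z [[cz _] _]; exact: (chart_inj (ps_surface ps2)).
have oz z : W z -> om (g (cfwd c z)) = om (cfwd d (iota2 z)).
  by move=> /WD[[cz Uz] Wz1]; rewrite gE //; exact: W1d.
have o0 : om (g u) = 0 by rewrite gu; exact: (ncoord_center hphi dA dp nc).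
have ne z : W z -> z <> y -> om (cfwd d (iota2 z)) != 0.
  by move=> Wz1 zy; apply/eqP => e; apply: (Wz z) => //=; rewrite oz // e o0.
exists K.
  by exists W => // z Wz1 zy; apply: W1a; [case: (WD z Wz1)|exact: ne].
exists W => //.
have l1 : islift (W `\ y) (fun z => phase1 (iota2 z) - eps * K%:R * argr (om (cfwd d (iota2 z)))) (h1 \o iota2).
  apply: (islift_comp (s := iota2) _ _ W1l); last by apply: mapc_cont; exact: (iota_cont ps2).
  by move=> z [Wz1 zy]; split; [case: (WD z Wz1)|exact: ne].
have ki : isint (eps * K%:R) by apply: isintM; [exact: eps_int eps1|exact: natr_int].
have l2 := islift_scale ki hl.
exists (fun z => h1 (iota2 z) + eps * K%:R * h z).
apply: islift_eqf (islift_add l1 l2) => z [Wz1 zy] /=.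
by rewrite oz // o0 subr0; ring.
Qed.

(** Near iota2 y, an axis point of S1 is a zero of a coordinate transverse to
    the flow line of iota2 y by phase_arg, hence a point of this flow line, which
    the interior of S2 does not meet. *)
Lemma boundary_free y : bd B2 y -> exists2 W, nbhs y W & forall z, W z -> ~ bd B2 z -> ~ axis1 (iota2 z).
Proof.
move=> yb; have ya : axis2 (iota2 y) by exists y.
have [d dA dp] := atlas_cover AM (iota2 y).
have [N N0] := frame_exists (axis_velocity hM hphi ps2 ya dA dp).
have [om nc] := ncoord_exists AM hphi dA dp N0.
have [K [_ [W1 [h1 [Cst [W1n W1d W1a _ _]]]]]] := phase_arg hM hphi bk1 eps1 signed1 dA dp nc.
have [W2 W2n [_ _ W2a]] := ncoord_axis hM hphi ps2 ya dA dp nc.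
exists (iota2 @^-1` (W1 `&` W2)); first by apply: (iota_cont ps2); exact: filterI.
move=> z [z1 z2] nz; apply: W1a => //; apply/eqP => e.
by apply: (axis_int ps2 nz); exact: W2a.
Qed.

(** Crossings are isolated, by the residue at each of them, and stay away from
    the boundary. *)
Lemma crossings : exists L : seq S2, exists2 n : S2 -> int, uniq L &
  [/\ forall y, y \in L <-> ~ bd B2 y /\ axis1 (iota2 y),
      forall q, q \in L -> 0 <= eps * (n q)%:~R &
      forall q, q \in L -> sres (@plane_chart R S2 @` B2) (phase1 \o iota2) q (n q)].
Proof.
pose E := [set y | ~ bd B2 y /\ axis1 (iota2 y)].
have iso y : exists W, nbhs y W /\ forall z, W z -> E z -> z = y.
  have [yb|ny] := pselect (bd B2 y).
    have [W Wn h] := boundary_free yb; exists W; split => // z Wz [nz az].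
    by case: (h z Wz nz).
  have [ya|na] := pselect (axis1 (iota2 y)).
    have [c cB cy] := atlas_cover BS y.
    have [K [W Wn h] _] := crossing_residue cB cy ny ya; exists W; split => // z Wz [nz az].
    by have [//|zy] := pselect (z = y); case: (h z Wz zy).
  exists (iota2 @^-1` (~` axis1)); split; last by move=> z nz [_ az].
  apply: (iota_cont ps2); apply: open_nbhs_nbhs; split => //.
  by apply: closed_openC; exact: (axis_closed hM bk1.1).
have /choice[U hU] := iso.
have [s hs] := compact_finite_cover (manifold_compact (ps_surface ps2)) (fun x _ => (hU x).1).
pose L := undup [seq y <- s | `[< E y >]].
have LE y : y \in L <-> E y.
  rewrite mem_undup mem_filter; split => [/andP[/asboolP]//|Ey].
  have [y' ys Uy] := hs y I; have e := (hU y').2 y Uy Ey; rewrite -e in ys.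
  by rewrite ys andbT; exact/asboolP.
have res q : exists n : int, q \in L -> 0 <= eps * n%:~R /\ sres (@plane_chart R S2 @` B2) (phase1 \o iota2) q n.
  have [/LE[nq aq]|nL] := boolP (q \in L); last by exists 0.
  have [c cB cq] := atlas_cover BS q.
  have [K _ [W Wn [h hl]]] := crossing_residue cB cq nq aq.
  have /intrP[e ee] := eps_int eps1.
  exists (e * K%:Z) => _; split.
    by rewrite intrM -ee mulrA eps1 mul1r ler0n.
  exists (plane_chart c); split; [by exists c|by []|].
  exists W => //; exists h; apply: islift_eqf hl => y _.
  by rewrite intrM -ee /argr /argq /= !mxE.
have /choice[n hn] := res.
exists L, n; first exact: undup_uniq.
by split => // q qL; have [] := hn q qL.
Qed.

End TwoSections.

(** * Pushing a surface off its boundary *)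

Section Pushes.
Variables (R : realType) (S : topologicalType) (B : set (chart R 2 S)).
Hypothesis sok : compact_oriented_surface B.
Let BS := manifold_atlas sok.
Implicit Types (V U : set S) (t : R).

(** A deformation of the identity near the boundary; push_off only concerns a part
    U of the boundary, so that local deformations can be composed. *)
Record push V U (p : R -> S -> S) : Prop := {
  push0 : forall y, p 0 y = y;
  push_cont : continuous (fun z : R * S => p z.1 z.2);
  push_off : forall t y, 0 < t -> ~ bd B (p t y) \/ (p t y = y /\ ~ U y);
  push_int : forall t y, ~ bd B y -> ~ bd B (p t y);
  push_supp : exists F : set S, [/\ closed F, F `<=` V, forall t y, ~ F y -> p t y = y &
    forall t y, F y -> F (p t y)] }.

Lemma push_id V : push V set0 (fun _ y => y).
Proof.
split => //; first by move=> z; exact: cvg_snd.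
  by move=> t y _; right; split => // -[].
by exists set0; split => //; exact: closed0.
Qed.

Lemma push_comp V U U' p p' : push V U p -> push V U' p' -> push V (U `|` U') (fun t y => p' t (p t y)).
Proof.
move=> P P'; split.
- by move=> y; rewrite (push0 P) (push0 P').
- have h : mapc setT (fun z : R * S => (z.1, p z.1 z.2)).
    by apply: mapc_pair; apply: mapc_cont; [move=> z; exact: cvg_fst|exact: push_cont P].
  have h' : mapc setT (fun z : R * S => p' z.1 (p z.1 z.2)).
    apply: (mapc_comp (f := fun z : R * S => (z.1, p z.1 z.2)) (g := fun z : R * S => p' z.1 z.2) (B := setT)) => //.
    exact: mapc_cont (push_cont P').
  by move=> z W hW; have := h' z I W hW; apply: filterS => w; exact.
- move=> t y t0; have [h|[e nU]] := push_off P y t0; first by left; exact: (push_int P').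
  rewrite e; have [h|[e' nU']] := push_off P' y t0; first by left.
  by right; split => // -[].
- by move=> t y ny; apply: (push_int P'); exact: (push_int P).
- have [F [cF FV Fo Fi]] := push_supp P; have [F' [cF' FV' Fo' Fi']] := push_supp P'.
  exists (F `|` F'); split; first exact: closedU.
  + by move=> y [/FV|/FV'].
  + by move=> t y nF; rewrite Fo ?Fo' // => h; apply: nF; [right|left].
  + move=> t y Fy; have [h|h] := pselect (F' (p t y)); first by right; exact: Fi'.
    rewrite Fo' //; have [h1|h1] := pselect (F y); first by left; exact: Fi.
    by rewrite Fo //; left; case: Fy => // h2; case: h; rewrite Fo.
Qed.

Lemma clamp_gt0 t : 0 < t -> 0 < clamp t.
Proof. by move=> t0; rewrite lt_max lt_min t0 ltr01 orbT. Qed.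

Lemma continuous_max (T : topologicalType) (f g : T -> R) : continuous f -> continuous g ->
  continuous (fun x => Num.max (f x) (g x)).
Proof.
move=> fc gc; have -> : (fun x => Num.max (f x) (g x)) = (fun x => (f x + g x + `|f x - g x|) / 2).
  by apply/funext => x; rewrite maxr_absE.
move=> x; apply: cvgMl; apply: cvgD; first by apply: cvgD; [exact: fc|exact: gc].
by apply: cvg_norm; apply: cvgB; [exact: fc|exact: gc].
Qed.

(** Inside a half-disc around a boundary point, the chart image is shifted away
    from the boundary by an amount that vanishes on the rim. *)
Lemma push_local V x : bd B x -> nbhs x V -> exists U p, nbhs x U /\ push V U p.
Proof.
move=> xb Vn; have [c cB cx] := atlas_cover BS x; have ok := atlas_chart BS cB.
have hok := plane_chart_ok sok cB; set c' := plane_chart c in hok.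
have u00 : cfwd c x 0 0 = 0 by apply/(bd_chart BS cB cx).
pose v := cfwd c x 0 1.
have [r0 r00 hr] := norm_near (chart_inv_near ok cx Vn).
pose r := r0 / 2; have r1 : 0 < r by rewrite divr_gt0.
have rr0 : r < r0 by rewrite /r; lra.
pose D : set (R * R) := rect (- r) 0 (v - r) (v + r).
have DE p : D p -> [/\ - r <= p.1, p.1 <= 0, v - r <= p.2 & p.2 <= v + r].
  by move=> [/andP[? ?] /andP[? ?]].
have Dgood p : D p -> [/\ cdom c (hinv c' p), hfwd c' (hinv c' p) = p & V (hinv c' p)].
  move=> /DE[h1 h2 h3 h4].
  have near : `|rowp p - cfwd c x| < r0.
    apply: row_norm_lt => // j; rewrite !mxE; case: j => -[|[|//]] i /=.
      rewrite (_ : Ordinal i = 0) ?u00; last exact: val_inj.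
      by rewrite ltr_norml; lra.
    rewrite (_ : Ordinal i = 1) -/v; last exact: val_inj.
    by rewrite ltr_norml; lra.
  have [|k1 k2 k3] := hr _ near; first by rewrite /half_plane /= mxE.
  by split => //=; rewrite k2 rowpK.
pose F := hinv c' @` D.
have Fc : compact F.
  apply: continuous_compact; last exact: compact_rect.
  apply/mapcP; apply: mapc_sub (hinv_cont hok) => p Dp; have [k1 k2 _] := Dgood p Dp.
  by exists (hinv c' p).
have Fcl : closed F by apply: compact_closed => //; exact: manifold_hausdorff sok.
pose sg (p : R * R) : R := Num.max 0 (r - Num.max `|p.1| `|p.2 - v|) / 2.
have sg0 p : 0 <= sg p by rewrite divr_ge0 // le_max lexx.
have sgr p : D p -> sg p <= (r + p.1) / 2.
  move=> /DE[h1 h2 h3 h4]; rewrite ler_pM2r // ge_max; apply/andP; split; first lra.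
  have : `|p.1| <= Num.max `|p.1| `|p.2 - v| by rewrite le_max lexx.
  rewrite (ler0_norm h2); lra.
pose q t (p : R * R) : R * R := (p.1 - clamp t * sg p, p.2).
have tsg t p : 0 <= clamp t * sg p <= sg p.
  by have /andP[c0 c1] := clamp_bound t; rewrite mulr_ge0 //= ler_piMl.
have qD t p : D p -> D (q t p).
  move=> Dp; have k := sgr p Dp; have /andP[k1 k2] := tsg t p; have [h1 h2 h3 h4] := DE p Dp.
  by split => /=; apply/andP; split; lra.
have FD y : F y -> [/\ D (hfwd c' y), hinv c' (hfwd c' y) = y & cdom c y].
  by move=> [p Dp <-]; have [k1 k2 _] := Dgood p Dp; rewrite k2.
pose O := [set y | cdom c y /\ ball (0, v) r (hfwd c' y)].
have Oop : open O.
  rewrite openE => y [cy hy]; rewrite /interior.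
  have Wn : nbhs (cfwd c y) [set u : 'rV[R]_2 | ball ((0 : R), v) r (pairr u)].
    apply: pairr_cont; apply: open_nbhs_nbhs; split => //; exact: ball_open.
  by apply: (filterS _ (chart_fwd_near ok cy Wn)) => z [].
have Osg y : O y -> F y /\ 0 < sg (hfwd c' y).
  move=> [cy [/=]]; rewrite /ball /= sub0r normrN distrC => k1 k2.
  split; last by rewrite /sg /= divr_gt0 // lt_max subr_gt0 gt_max k1 k2 orbT.
  exists (hfwd c' y); last exact: (hcancel hok).
  have := cfwd_le0 BS cB cy; move: k1 k2; rewrite !ltr_norml => /andP[? ?] /andP[? ?] ?.
  by split => /=; apply/andP; split; lra.
have nOsg y : F y -> ~ O y -> sg (hfwd c' y) = 0.
  move=> Fy nO; have [_ _ cy] := FD y Fy; apply/eqP; rewrite mulf_eq0 invr_eq0 pnatr_eq0 orbF.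
  apply/eqP/max_idPl; rewrite subr_le0 leNgt; apply/negP; rewrite gt_max => /andP[k1 k2].
  by apply: nO; split => //; split; rewrite /ball /= ?sub0r ?normrN // distrC.
pose p t y := if `[< F y >] then hinv c' (q t (hfwd c' y)) else y.
have pF t y : F y -> p t y = hinv c' (q t (hfwd c' y)) by move=> h; rewrite /p; case: asboolP.
have pN t y : ~ F y -> p t y = y by move=> h; rewrite /p; case: asboolP.
have q0 t y : sg y = 0 -> q t y = y by move=> e; rewrite /q e mulr0 subr0; case: y e.
have pO t y : ~ O y -> p t y = y.
  move=> nO; have [Fy|/pN//] := pselect (F y); rewrite pF // q0 ?nOsg //.
  by have [] := FD y Fy.
have hp t y : F y -> [/\ cdom c (p t y), hfwd c' (p t y) = q t (hfwd c' y) & F (p t y)].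
  move=> Fy; have [Dy _ _] := FD y Fy; have [k1 k2 _] := Dgood _ (qD t _ Dy).
  by rewrite pF //; split => //; exists (q t (hfwd c' y)) => //; exact: qD.
have pbd t y : F y -> (bd B (p t y) <-> cfwd c y 0 0 - clamp t * sg (hfwd c' y) = 0).
  move=> Fy; have [k1 k2 _] := hp t y Fy; have e := bd_chart BS cB k1.
  by have k3 : cfwd c (p t y) 0 0 = cfwd c y 0 0 - clamp t * sg (hfwd c' y) := congr1 fst k2; rewrite -k3.
exists O, p; split.
  apply: open_nbhs_nbhs; split => //; split => //; split; rewrite /ball /=.
    by rewrite u00 subrr normr0.
  by rewrite subrr normr0.
split.
- move=> y; have [Fy|/pN//] := pselect (F y); rewrite pF //.
  by have [_ e _] := FD y Fy; rewrite /q (clamp_le0 (lexx 0)) mul0r subr0.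
- suff H : mapc setT (fun z : R * S => p z.1 z.2).
    move=> z W hW; have := H z I W hW; apply: filterS => w; exact.
  pose FF : set (R * S) := snd @^-1` F; pose GG : set (R * S) := snd @^-1` (~` O).
  have sndc : continuous (snd : R * S -> S) by move=> z; exact: cvg_snd.
  have fstc : continuous (fst : R * S -> R) by move=> z; exact: cvg_fst.
  have cF : closed FF by apply: preimage_closed => // z _; exact: sndc.
  have cG : closed GG.
    by apply: preimage_closed => [z _|]; [exact: sndc|exact: open_closedC].
  apply: (@mapc_sub _ _ _ (FF `|` GG)).
    by move=> [t y] _ /=; have [Oy|nO] := pselect (O y); [left; case: (Osg y Oy)|right].
  apply: mapc_closedU => //; last first.
    by apply: (@mapc_eq _ _ _ snd); [move=> [t y] /= /pO ->|exact: mapc_cont].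
  have hc : mapc FF (fun z : R * S => hfwd c' z.2).
    apply: (mapc_comp (B := cdom c) _ _ (hfwd_cont hok)); last exact: mapc_cont.
    by move=> z /FD[].
  have h1 : mapc FF (fun z : R * S => (hfwd c' z.2).1).
    by apply: (mapc_comp (B := setT) _ hc) => //; apply: mapc_cont => w; exact: cvg_fst.
  have h2 : mapc FF (fun z : R * S => (hfwd c' z.2).2).
    by apply: (mapc_comp (B := setT) _ hc) => //; apply: mapc_cont => w; exact: cvg_snd.
  have sgc : continuous sg.
    have m1 : continuous (fun w : R * R => Num.max `|w.1| `|w.2 - v|).
      apply: (continuous_max (f := fun w : R * R => `|w.1|)) => w; apply: cvg_norm; first exact: cvg_fst.
      by apply: cvgB; [exact: cvg_snd|exact: cvg_cst].
    have m2 : continuous (fun w : R * R => Num.max (0 : R) (r - Num.max `|w.1| `|w.2 - v|)).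
      apply: (@continuous_max _ (fun _ => 0)) => w; first exact: cvg_cst.
      by apply: cvgB; [exact: cvg_cst|exact: m1].
    by move=> w; apply: cvgMl; exact: m2.
  have h3 : mapc FF (fun z : R * S => sg (hfwd c' z.2)).
    by apply: (mapc_comp (B := setT) _ hc) => //; exact: mapc_cont.
  have h4 : mapc FF (fun z : R * S => clamp z.1).
    by apply: (mapc_clamp (f := fst)); exact: mapc_cont.
  apply: (@mapc_eq _ _ _ (fun z : R * S => hinv c' (q z.1 (hfwd c' z.2)))).
    by move=> z Fz; rewrite pF.
  apply: (mapc_comp (B := hfwd c' @` hdom c') _ _ (hinv_cont hok)).
    move=> z Fz; have [Dz _ _] := FD _ Fz; have [k1 k2 _] := Dgood _ (qD z.1 _ Dz).
    by exists (hinv c' (q z.1 (hfwd c' z.2))).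
  by apply: mapc_pair => //; apply: mapcB => //; exact: mapcM.
- move=> t y t0; have [Oy|nO] := pselect (O y); last by right; rewrite pO.
  left; have [Fy sy] := Osg y Oy; rewrite pbd // => e.
  have := mulr_gt0 (clamp_gt0 t0) sy; have [_ _ cy] := FD y Fy.
  have := cfwd_le0 BS cB cy; lra.
- move=> t y ny; have [Fy|/pN->//] := pselect (F y); rewrite pbd // => e.
  have [_ _ cy] := FD y Fy; have := int_coord BS cB cy ny.
  have /andP[k _] := tsg t (hfwd c' y); lra.
- exists F; split => // [y [p0 Dp <-]|t y Fy]; first by have [] := Dgood p0 Dp.
  by have [] := hp t y Fy.
Qed.

(** Local pushes along a finite cover of the boundary are composed. *)
Lemma push_boundary V : (forall y, bd B y -> nbhs y V) -> exists2 p, push V setT p & forall t y, 0 < t -> ~ bd B (p t y).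
Proof.
move=> bV.
have /choice[U hU] : forall x, exists U, bd B x -> nbhs x U /\ exists p, push V U p.
  move=> x; have [xb|nx] := pselect (bd B x); last by exists setT.
  by have [U [p [Un P]]] := push_local xb (bV x xb); exists U => _; split => //; exists p.
have [||s hs] := @compact_finite_cover S (bd B) (fun y x => bd B y /\ U y x).
- by apply: (subclosed_compact (bd_closed BS) (manifold_compact sok)).
- by move=> x xb; have [Un _] := hU x xb; apply: filterS Un => z.
have H (l : seq S) : exists U' p, push V U' p /\ forall y z, y \in l -> bd B y -> U y z -> U' z.
  elim: l => [|y l [U' [p [P hl]]]]; first by exists set0, (fun _ y => y); split => //; exact: push_id.
  have [yb|ny] := pselect (bd B y).
    have [_ [p' P']] := hU y yb; exists (U' `|` U y), (fun t z => p' t (p t z)).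
    split; first exact: push_comp.
    move=> w z; rewrite inE => /orP[/eqP -> _ h|wl wb h]; first by right.
    by left; exact: hl h.
  exists U', p; split => // w z; rewrite inE => /orP[/eqP -> //|wl wb h]; exact: hl h.
have [U' [p [P hp]]] := H s.
have off t y : 0 < t -> ~ bd B (p t y).
  move=> t0; have [//|[e nU]] := push_off P y t0; rewrite e => yb.
  by have [z zs [zb Uz]] := hs y yb; apply: nU; exact: hp Uz.
exists p => //; split; [exact: push0 P|exact: push_cont P| |exact: push_int P|exact: push_supp P].
by move=> t y t0; left; exact: off.
Qed.
End Pushes.

(** * Windings along the boundary *)

Lemma mapcT_cont (T U : topologicalType) (f : T -> U) : mapc setT f -> continuous f.
Proof. by move=> fc x V hV; apply: filterS (fc x I V hV) => y; exact. Qed.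

Section FlowVariation.
Variables (R : realType) (M : topologicalType) (A : set (chart R 3 M)) (phi : R -> M -> M).
Hypothesis hM : closed_oriented_3manifold A.
Hypothesis hphi : smooth_flow A phi.
Variables (S : topologicalType) (B : set (chart R 2 S)) (iota : S -> M).
Hypothesis bk : birkhoff_section A phi B iota.
Let ps := bk.1.
Let axis := axis B iota.
Let phase := phase phi iota.

(** For negative times the path is described backwards, which changes the sign of
    the variation. *)
Lemma flow_variation : exists2 T : R, 0 < T & forall (eps Q : R) x (n : nat), eps * eps = 1 -> 0 < eps * Q ->
  ~ axis x -> n%:R * T <= `|Q| -> n%:R <= eps * zvar 0 1 (fun l => phase (phi (l * Q) x)).
Proof.
have [T T0 gr] := orbit_growth hM hphi bk; exists T => // eps Q x n e1 eQ nx nT.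
have ec : eps = 1 \/ eps = -1.
  have /eqP : eps ^+ 2 = 1 by rewrite expr2.
  by rewrite sqrf_eq1 => /orP[/eqP|/eqP]; [left|right].
have Q0 : 0 <= `|Q| by exact: normr_ge0.
pose y := if eps == 1 then x else phi Q x.
have ny : ~ axis y by rewrite /y; case: ifP => // _; exact: (axis_flowN hphi ps).
have oz : zc (itv 0 `|Q|) (fun t => phase (phi t y)) by exact: (orbit_zc hM hphi bk).
have [h hl] := lift_itv Q0 oz.
have gE := gr y n `|Q| ny nT; rewrite (zvarE Q0 hl) in gE.
have l01 l : itv 0 1 l -> 0 <= l * `|Q| <= `|Q| /\ 0 <= (1 - l) * `|Q| <= `|Q|.
  move=> /andP[l0 l1]; split; rewrite mulr_ge0 ?subr_ge0 //= ler_piMl //.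
  by rewrite gerBl.
have lc : mapc (itv 0 1) (fun l : R => l) by exact: mapc_id.
case: ec => ec.
  have yx : y = x by rewrite /y ec eqxx.
  have Qp : Q = `|Q| by rewrite ger0_norm //; move: eQ; rewrite ec mul1r => /ltW.
  have -> : (fun l => phase (phi (l * Q) x)) = (fun t => phase (phi t y)) \o (fun l => l * `|Q|).
    by apply/funext => l /=; rewrite yx -Qp.
  rewrite (zvar_comp (h := h) (B := itv 0 `|Q|) ler01) // ?ec ?mul1r ?mul0r //.
    by move=> l /l01[].
  by apply: mapcM => //; exact: mapc_cst.
have yx : y = phi Q x by rewrite /y ec eqNr oner_eq0.
have Qp : Q = - `|Q| by rewrite ler0_norm ?opprK //; move: eQ; rewrite ec mulN1r oppr_gt0 => /ltW.
have -> : (fun l => phase (phi (l * Q) x)) = (fun t => phase (phi t y)) \o (fun l => (1 - l) * `|Q|).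
  apply/funext => l /=; rewrite yx -(flowD hphi); congr (phase (phi _ x)).
  by rewrite Qp normrN normr_id; ring.
rewrite (zvar_comp (h := h) (B := itv 0 `|Q|) ler01) //.
- by rewrite ec subr0 subrr mul0r mul1r; lra.
- by move=> l /l01[].
- by apply: mapcM; [apply: mapcB => //; exact: mapc_cst|exact: mapc_cst].
Qed.

Lemma moving_zc (T : topologicalType) (C : set T) (z : T -> M) (a : T -> R) : continuous z -> continuous a ->
  (forall s, C s -> ~ axis (z s)) -> zc C (fun s => phase (phi (a s) (z s))).
Proof.
move=> zc_ ac nz; apply: (zc_comp (g := fun s => phi (a s) (z s)) _ _ (phase_zc hM hphi bk)).
  by move=> s Cs; apply: (axis_flowN hphi ps); exact: nz.
apply: (mapc_comp (f := fun s => (a s, z s)) (g := fun w : R * M => phi w.1 w.2) (B := setT)) => //.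
  by apply: mapc_pair; exact: mapc_cont.
by apply: mapc_cont; exact: (flow_cont hphi).
Qed.

(** The flow time a is scaled from 0 to a: the rectangle of the homotopy has a
    constant left side. *)
Lemma variation_split (z : R -> M) (a : R -> R) (k : R) : 0 <= k -> continuous z -> continuous a -> a 0 = 0 ->
  (forall s, ~ axis (z s)) -> zvar 0 k (fun s => phase (phi (a s) (z s))) =
  zvar 0 k (phase \o z) + zvar 0 1 (fun l => phase (phi (l * a k) (z k))).
Proof.
move=> k0 zc_ ac a0 nz.
have f1 : continuous (fun w : R * R => z w.1).
  by move=> w; apply: (cvg_comp fst z); [exact: cvg_fst|exact: zc_].
have f2 : continuous (fun w : R * R => w.2 * a w.1).
  move=> w; apply: cvgM; first exact: cvg_snd.
  by apply: (cvg_comp fst a); [exact: cvg_fst|exact: ac].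
have fz := moving_zc (C := rect 0 k 0 1) f1 f2 (fun w _ => nz w.1).
have := zvar_rect k0 ler01 fz => /=.
rewrite (_ : (fun x => phase (phi (0 * a x) (z x))) = phase \o z); last first.
  by apply/funext => s /=; rewrite mul0r (flow0 hphi).
rewrite (_ : (fun y => phase (phi (y * a 0) (z 0))) = fun=> phase (z 0)); last first.
  by apply/funext => s /=; rewrite a0 mulr0 (flow0 hphi).
rewrite (_ : (fun x => phase (phi (1 * a x) (z x))) = fun s => phase (phi (a s) (z s))); last first.
  by apply/funext => s /=; rewrite mul1r.
move=> ->; rewrite (zvar_cont (f := fun=> phase (z 0))) // ?subrr ?add0r //.
exact: mapc_cst.
Qed.

Lemma axis_variation (W : set M) (u : M -> 'rV[R]_2) (K : R) (h : M -> R) (Cst k : R) (z : R -> M) : 0 <= k ->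
  isint K -> mapc W u -> islift (W `&` [set x | u x != 0]) (fun x => phase x - K * argr (u x)) h ->
  (forall x, W x -> u x != 0 -> `|h x| <= Cst) -> continuous z ->
  (forall s, itv 0 k s -> [/\ W (z s), u (z s) != 0 & ~ axis (z s)]) ->
  `|zvar 0 k (phase \o z) - K * zvar 0 k (fun s => argr (u (z s)))| <= 2 * Cst.
Proof.
move=> k0 /intrP[j ->] uc hl hb zc_ zW.
have zm : mapc (itv 0 k) z by exact: mapc_cont.
have pz : zc (itv 0 k) (phase \o z).
  by apply: (zc_comp _ zm (phase_zc hM hphi bk)) => s /zW[].
have uz : mapc (itv 0 k) (fun s => u (z s)) by apply: (mapc_comp _ zm uc) => s /zW[].
have az : zc (itv 0 k) (fun s => argr (u (z s))).
  apply: (zc_comp (g := fun s => (u (z s) 0 0, u (z s) 0 1)) _ _ (@arg_zc R)).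
    by move=> s /zW[_ n _]; apply/row2_neq0.
  by apply: mapc_pair; apply: mapc_coord.
have zW' s : itv 0 k s -> (W `&` [set x | u x != 0]) (z s) by move=> /zW[].
rewrite -(zvarM j k0 az) -(zvarN k0 (zcMz j az)) -(zvarD k0 pz (zcN (zcMz j az))).
rewrite (zvar_comp (s := z) k0 zW' zm hl).
have [W0 n0 _] := zW 0 (itv_l k0); have [W1 n1 _] := zW k (itv_r k0).
have := ler_normB (h (z k)) (h (z 0)); have := hb _ W0 n0; have := hb _ W1 n1; lra.
Qed.
End FlowVariation.

(** Since S2 is followed (v2 + f2 = 0), eps * f2 is large and K2 * D is therefore
    negative; both terms of eps * k * w, namely - K1 * D and eps * f1, are then
    nonnegative up to the error 2 * c1, which n1 exceeds. *)
Lemma winding_sign (R : realFieldType) (eps K1 K2 k w v1 v2 f1 f2 n1 n2 c1 c2 D : R) :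
  eps * eps = 1 -> 0 <= K1 -> 0 < K2 -> 0 < k -> k * w = v1 + f1 -> 0 = v2 + f2 ->
  n1 <= eps * f1 -> n2 <= eps * f2 -> 2 * c1 < n1 -> 2 * c2 < n2 ->
  `|v1 - - eps * K1 * D| <= 2 * c1 -> `|v2 - eps * K2 * D| <= 2 * c2 -> 0 < eps * w.
Proof.
move=> e1 K10 K20 k0 kw vf g1 g2 h1 h2 b1 b2.
have ne : `|eps| = 1.
  by apply/eqP; rewrite -(@eqrXn2 _ 2) ?normr_ge0 // -normrX expr2 e1 normr1 expr1n.
have b1' : `|eps * v1 + K1 * D| <= 2 * c1.
  have -> : eps * v1 + K1 * D = eps * (v1 - - eps * K1 * D).
    by rewrite -[K1 * D]mul1r -e1; ring.
  by rewrite normrM ne mul1r.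
have b2' : `|eps * v2 - K2 * D| <= 2 * c2.
  have -> : eps * v2 - K2 * D = eps * (v2 - eps * K2 * D).
    by rewrite -[K2 * D]mul1r -e1; ring.
  by rewrite normrM ne mul1r.
have vf' : eps * v2 = - (eps * f2) by rewrite -mulrN; congr (_ * _); lra.
have KD : K2 * D < 0 by move: b2'; rewrite ler_norml vf' => /andP[? _]; lra.
have D0 : D < 0 by rewrite -(pmulr_rlt0 _ K20).
have KD1 : K1 * D <= 0 by rewrite mulr_ge0_le0 // ltW.
have : 0 < k * (eps * w).
  rewrite mulrCA kw mulrDr; move: b1'; rewrite ler_norml => /andP[? ?]; lra.
by rewrite pmulr_rgt0.
Qed.

Section Windings.
Variables (R : realType) (M : topologicalType) (A : set (chart R 3 M)) (phi : R -> M -> M).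
Hypothesis hM : closed_oriented_3manifold A.
Hypothesis hphi : smooth_flow A phi.
Variables (eps : R) (eps1 : eps * eps = 1).
Variables (S1 : topologicalType) (B1 : set (chart R 2 S1)) (iota1 : S1 -> M).
Hypothesis bk1 : birkhoff_section A phi B1 iota1.
Hypothesis signed1 : forall C, boundary_component B1 C ->
  exists2 m, multiplicity phi B1 iota1 C m & 0 < - eps * m%:~R.
Variables (S2 : topologicalType) (B2 : set (chart R 2 S2)) (iota2 : S2 -> M).
Hypothesis bk2 : birkhoff_section A phi B2 iota2.
Hypothesis signed2 : forall C, boundary_component B2 C ->
  exists2 m, multiplicity phi B2 iota2 C m & 0 < eps * m%:~R.
Let AM := manifold_atlas hM.
Let phase1 := phase phi iota1.
Let phase2 := phase phi iota2.
Let axis1 := axis B1 iota1.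
Let axis2 := axis B2 iota2.

(** The loop s to X (s, t), for small t, is close to the closed orbit of p
    followed for a time of sign eps.  Undoing the flow over k periods leaves a
    path z close to p, which turns around the axis by some D.  The phase of the
    second section does not vary along X, which lies on this section; hence its
    variation by the flow, which is eps times a large number, is compensated by
    its variation along z, which is eps * K2 * D up to a bounded error.  So D is
    negative, and for the phase of the first section, of sign - eps, the
    variation along z, close to - eps * K1 * D, has the sign eps, as has its
    variation by the flow.  The number k of periods beats the error terms, which
    do not depend on t. *)
Lemma winding_positive (X : R * R -> M) (th : R -> R) q p : continuous X -> continuous th ->
  (forall s, th (s + 1) = th s + q) -> 0 < eps * q -> axis2 p ->
  (forall s, X (s, 0) = phi (th s - th 0) p) -> (forall s t, X (s + 1, t) = X (s, t)) ->
  (forall s t, 0 < t -> [/\ ~ axis1 (X (s, t)), ~ axis2 (X (s, t)) & hit iota2 (X (s, t))]) ->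
  exists2 t0 : R, 0 < t0 & forall t, 0 < t -> t < t0 -> 0 < eps * zvar 0 1 (fun s => phase1 (X (s, t))).
Proof.
move=> Xc thc thq eq pa X0 Xp Xok.
have [d dA dp] := atlas_cover AM p; have okd := atlas_chart AM dA.
have [N N0] := frame_exists (axis_velocity hM hphi bk2.1 pa dA dp).
have [om nc] := ncoord_exists AM hphi dA dp N0.
have eps1' : - eps * - eps = 1 by rewrite mulrNN.
have [K1 [_ [W1 [h1 [C1 [W1n W1d _ l1 b1]]]]]] := phase_arg hM hphi bk1 eps1' signed1 dA dp nc.
have [K2 [K20 [W2 [h2 [C2 [W2n W2d _ l2 b2]]]]]] := phase_arg hM hphi bk2 eps1 signed2 dA dp nc.
have [W3 W3n [_ W3c W3a]] := ncoord_axis hM hphi bk2.1 pa dA dp nc.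
pose W := W1 `&` W2 `&` W3; have Wn : nbhs p W by do 2!apply: filterI => //.
have [T1 T10 g1] := flow_variation hM hphi bk1; have [T2 T20 g2] := flow_variation hM hphi bk2.
have q0 : 0 < `|q| by rewrite normr_gt0; apply/eqP => e; move: eq; rewrite e mulr0 ltxx.
have [n1 n1C] : exists n : nat, 2 * C1 < n%:R.
  by exists (Num.bound `|2 * C1|); exact: le_lt_trans (ler_norm _) (archi_boundP (normr_ge0 _)).
have [n2 n2C] : exists n : nat, 2 * C2 < n%:R.
  by exists (Num.bound `|2 * C2|); exact: le_lt_trans (ler_norm _) (archi_boundP (normr_ge0 _)).
have [k [k0 k1 k2]] : exists k : nat, [/\ (0 < k)%N, n1%:R * T1 <= k%:R * `|q| & n2%:R * T2 <= k%:R * `|q|].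
  pose m := Num.max (n1%:R * T1 / `|q|) (n2%:R * T2 / `|q|).
  exists (Num.bound `|m|).+1; have mb : m <= (Num.bound `|m|).+1%:R.
    apply: ltW; apply: (le_lt_trans (ler_norm _)); apply: (lt_trans (archi_boundP (normr_ge0 _))).
    by rewrite ltr_nat.
  by split => //; rewrite -ler_pdivrMr //; apply: (le_trans _ mb); rewrite le_max lexx ?orbT.
have kr : (0 : R) < k%:R by rewrite ltr0n.
pose a s := th s - th 0.
have ac : continuous a by move=> s; apply: cvgB; [exact: thc|exact: cvg_cst].
have a0 : a 0 = 0 by rewrite /a subrr.
have thn n s : th (s + n%:R) = th s + n%:R * q.
  elim: n => [|n IH]; first by rewrite addr0 mul0r addr0.
  by rewrite -[n.+1%:R]natr1 addrA thq IH mulrDl mul1r addrA.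
have ak : a k%:R = k%:R * q by have := thn k 0; rewrite add0r /a => ->; rewrite addrC addKr.
(* the flow is undone: z stays at p for t = 0 *)
pose z (w : R * R) := phi (- a w.1) (X w).
have zcont : continuous z.
  apply: mapcT_cont.
  apply: (mapc_comp (f := fun w : R * R => (- a w.1, X w)) (g := fun w : R * M => phi w.1 w.2) (B := setT)) => //.
    apply: mapc_pair; last exact: mapc_cont.
    apply: mapcN; apply: mapc_cont => w; apply: (cvg_comp fst a); [exact: cvg_fst|exact: ac].
  by apply: mapc_cont; exact: (flow_cont hphi).
have z0 s : z (s, 0) = p by rewrite /z /= X0 (flowK hphi).
have near0 : \forall t \near (0 : R), itv 0 k%:R `<=` (fun s => W (z (s, t))).
  apply: ((compact_near_coveringP (itv 0 k%:R)).1 (@compact_itv R 0 k%:R) R (nbhs (0 : R)) (fun t s => W (z (s, t)))) => s _.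
  have Ws : nbhs (z (s, 0)) W by rewrite z0.
  have [[P Q] /= [Ps Q0] PQ] := zcont (s, 0) W Ws.
  by exists (P, Q) => // -[s' t'] /= h; exact: PQ.
have [t0 t00 ht0] := norm_near near0; exists t0 => // t tp tt0.
have inW s : itv 0 k%:R s -> W (z (s, t)) by apply: (ht0 t); rewrite subr0 gtr0_norm.
pose zt s := z (s, t); pose x s := X (s, t).
have ztc : continuous zt.
  apply: mapcT_cont; apply: (mapc_comp (f := fun s : R => (s, t)) (g := z) (B := setT)) => //.
    exact: mapc_hor.
  exact: mapc_cont.
have xc : continuous x.
  apply: mapcT_cont; apply: (mapc_comp (f := fun s : R => (s, t)) (g := X) (B := setT)) => //.
    exact: mapc_hor.
  exact: mapc_cont.
have n1z s : ~ axis1 (zt s).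
  by have [h _ _] := Xok s t tp; exact: (axis_flowN hphi bk1.1).
have n2z s : ~ axis2 (zt s).
  by have [_ h _] := Xok s t tp; exact: (axis_flowN hphi bk2.1).
have xE s : phi (a s) (zt s) = x s by rewrite /zt /z /= (flowNK hphi).
have inW' s : itv 0 k%:R s -> [/\ W1 (zt s), W2 (zt s), W3 (zt s) & om (cfwd d (zt s)) != 0].
  by move=> /inW[[w1 w2] w3]; split => //; apply/eqP => e; apply: (n2z s); exact: W3a.
have kr' := ltW kr.
have eQ : 0 < eps * (k%:R * q) by rewrite mulrCA mulr_gt0.
have nQ : `|k%:R * q| = k%:R * `|q| by rewrite normrM gtr0_norm.
pose D := zvar 0 k%:R (fun s => argr (om (cfwd d (zt s)))).
have ei : isint eps := eps_int eps1.
(* the loop lies on the second section, whose phase is constant along it *)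
have s2 := variation_split hM hphi bk2 kr' ztc ac a0 n2z.
rewrite ak (_ : (fun s => _) = phase2 \o x) in s2; last by apply/funext => s /=; rewrite xE.
rewrite (zvar_int0 kr') in s2; last first.
  by move=> s _ /=; have [_ h1' h2'] := Xok s t tp; rewrite /phase2 (phase_hit hM hphi bk2 h1' h2') rpred0.
have g2' := g2 eps (k%:R * q) (zt k%:R) n2 eps1 eQ (n2z _); rewrite nQ in g2'; have {}g2' := g2' k2.
have v2 : `|zvar 0 k%:R (phase2 \o zt) - eps * K2%:R * D| <= 2 * C2.
  apply: (axis_variation hM hphi bk2 (W := W2 `&` W3) (u := fun x => om (cfwd d x)) (h := h2)) => //.
  - by apply: isintM => //; exact: natr_int.
  - by apply: mapc_sub W3c => ? [].
  - by apply: islift_sub l2 => ? [[]].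
  - by move=> ? [w _]; exact: b2.
  - by move=> s /inW'[].
have s1 := variation_split hM hphi bk1 kr' ztc ac a0 n1z.
rewrite ak (_ : (fun s => _) = phase1 \o x) in s1; last by apply/funext => s /=; rewrite xE.
have xz : zc setT (phase1 \o x).
  apply: (zc_comp (g := x) _ _ (phase_zc hM hphi bk1)); last exact: mapc_cont.
  by move=> s _; have [] := Xok s t tp.
rewrite (zvar_periodicn xz) in s1; last by move=> s; rewrite /= /x Xp subrr rpred0.
have g1' := g1 eps (k%:R * q) (zt k%:R) n1 eps1 eQ (n1z _); rewrite nQ in g1'; have {}g1' := g1' k1.
have v1 : `|zvar 0 k%:R (phase1 \o zt) - - eps * K1%:R * D| <= 2 * C1.
  apply: (axis_variation hM hphi bk1 (W := W1 `&` W3) (u := fun x => om (cfwd d x)) (h := h1)) => //.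
  - by apply: isintM; [rewrite rpredN|exact: natr_int].
  - by apply: mapc_sub W3c => ? [].
  - by apply: islift_sub l1 => ? [[]].
  - by move=> ? [w _]; exact: b1.
  - by move=> s /inW'[].
have K2r : (0 : R) < K2%:R by rewrite ltr0n; exact: K20.
have K1r : (0 : R) <= K1%:R by exact: ler0n.
change (0 < eps * zvar 0 1 (phase1 \o x)).
exact: (winding_sign eps1 K1r K2r kr s1 s2 g1' g2' n1C n2C v1 v2).
Qed.
End Windings.

(** * Mutual exclusion *)

Section Exclusion.
Variables (R : realType) (M : topologicalType) (A : set (chart R 3 M)) (phi : R -> M -> M).
Hypothesis hM : closed_oriented_3manifold A.
Hypothesis hphi : smooth_flow A phi.

Lemma common_threshold m (P : nat -> R -> Prop) :
  (forall i, (i < m)%N -> exists2 t0 : R, 0 < t0 & forall t, 0 < t -> t < t0 -> P i t) ->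
  exists2 t : R, 0 < t & forall i, (i < m)%N -> P i t.
Proof.
move=> h; suff [t0 t00 H] : exists2 t0 : R, 0 < t0 & forall t, 0 < t -> t < t0 -> forall i, (i < m)%N -> P i t.
  by exists (t0 / 2); [rewrite divr_gt0|apply: H; [rewrite divr_gt0|lra]].
elim: m h => [|m IH] h; first by exists 1.
have [t1 t10 h1] := IH (fun i im => h i (ltnW im)); have [t2 t20 h2] := h m (ltnSn m).
exists (Num.min t1 t2); first by rewrite lt_min t10.
move=> t tp; rewrite lt_min => /andP[k1 k2] i; rewrite ltnS leq_eqVlt => /orP[/eqP ->|im].
  exact: h2.
exact: h1.
Qed.

(** The phase of the first section, restricted to the second one pushed off its
    boundary, violates Stokes' theorem: eps times the residues is nonpositive
    and eps times each winding is positive. *)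
Lemma opposite_sections (eps : R) (S1 : topologicalType) (B1 : set (chart R 2 S1)) (iota1 : S1 -> M)
    (S2 : topologicalType) (B2 : set (chart R 2 S2)) (iota2 : S2 -> M) :
  eps * eps = 1 -> birkhoff_section A phi B1 iota1 -> birkhoff_section A phi B2 iota2 ->
  (forall C, boundary_component B1 C -> exists2 m, multiplicity phi B1 iota1 C m & 0 < - eps * m%:~R) ->
  (forall C, boundary_component B2 C -> exists2 m, multiplicity phi B2 iota2 C m & 0 < eps * m%:~R) ->
  bd B2 !=set0 -> False.
Proof.
move=> e1 bk1 bk2 sg1 sg2 ne.
have e1' : - eps * - eps = 1 by rewrite mulrNN.
have ps2 := bk2.1; have sok := ps_surface ps2.
pose Q (g : R -> S2) := exists (th : R -> R) (p0 : M) (q : R),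
  [/\ continuous th, forall s, iota2 (g s) = phi (th s) p0, forall s, th (s + 1) = th s + q & 0 < eps * q].
have par C : boundary_component B2 C -> exists2 g, positive_parametrization B2 C g & Q g.
  move=> bC; have [m [g [p [T [th [gp [T0 _ _] thc gE thq]]]]] m0] := sg2 C bC.
  by exists g => //; exists th, p, (m%:~R * T); split => //; rewrite mulrA mulr_gt0.
have [m [g [Sok gQ]]] := surface_of_atlas sok ne par.
have [L [n Lu [LE Lpos Lres]]] := crossings hM hphi bk1 e1' sg1 ps2.
have bL y : bd B2 y -> nbhs y (~` [set` L]).
  by move=> yb; apply: (finite_far Sok); apply/negP => /LE[].
have [kap P off] := push_boundary sok bL.
have [F [Fcl FL Fo Fi]] := push_supp P.
have inL t y : 0 < t -> axis B1 iota1 (iota2 (kap t y)) -> kap t y \in L.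
  by move=> t0 h; apply/LE; split => //; exact: off.
have stay t y : kap t y \in L -> kap t y = y.
  move=> h; apply: Fo => Fy; exact: (FL _ (Fi t y Fy) h).
have [t t0 wind] : exists2 t : R, 0 < t & forall i, (i < m)%N ->
    0 < eps * zvar 0 1 (fun s => phase phi iota1 (iota2 (kap t (g i s)))).
  apply: (common_threshold (P := fun i t => 0 < eps * zvar 0 1 (fun s => phase phi iota1 (iota2 (kap t (g i s)))))).
  move=> i im; have [th [p0 [q [thc gE thq eq]]]] := gQ i im.
  pose X (w : R * R) := iota2 (kap w.2 (g i w.1)).
  apply: (winding_positive hM hphi e1 bk1 sg1 bk2 sg2 (X := X) (p := iota2 (g i 0)) (th := th) _ thc thq eq).
  - apply: mapcT_cont; apply: (mapc_comp (f := fun w : R * R => kap w.2 (g i w.1)) (B := setT)) => //; last first.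
      by apply: mapc_cont; exact: (iota_cont ps2).
    apply: (mapc_comp (f := fun w : R * R => (w.2, g i w.1)) (g := fun z : R * S2 => kap z.1 z.2) (B := setT)) => //.
      apply: mapc_pair; first by apply: mapc_cont => w; exact: cvg_snd.
      apply: (mapc_comp (f := fst) (B := setT)) => //; first by apply: mapc_cont => w; exact: cvg_fst.
      by apply: mapc_cont; exact: (s_loop Sok im).
    by apply: mapc_cont; exact: (push_cont P).
  - by exists (g i 0) => //; exact: (s_loopb Sok).
  - by move=> s; rewrite /X /= (push0 P) !gE -(flowD hphi) subrK.
  - move=> s t; rewrite /X /=; congr (iota2 (kap _ _)); apply/(s_loop1 Sok) => //.
    by rewrite addrC addKr rpred1.
  - move=> s t tp; rewrite /X /=; split; last by exists (kap t (g i s)).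
      move=> h; have h1 := inL _ _ tp h; have h2 := stay _ _ h1.
      by apply: (off t (g i s) tp); rewrite h2; exact: (s_loopb Sok).
    by apply: (axis_int ps2); exact: off.
pose b y := phase phi iota1 (iota2 (kap t y)).
have kc : continuous (kap t).
  apply: mapcT_cont; apply: (mapc_comp (f := fun y => (t, y)) (g := fun z : R * S2 => kap z.1 z.2) (B := setT)) => //.
    by apply: mapc_pair; [exact: mapc_cst|exact: mapc_id].
  by apply: mapc_cont; exact: (push_cont P).
have sb : sing (@plane_chart R S2 @` B2) (bd B2) b L n.
  split => //; first by move=> q /LE[].
    apply: (zc_comp (g := iota2 \o kap t) _ _ (phase_zc hM hphi bk1)).
      move=> y yL h; apply: yL; have h1 := inL _ _ t0 h; by rewrite /= -(stay _ _ h1).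
    apply: (mapc_comp (B := setT)) => //; first exact: mapc_cont.
    by apply: mapc_cont; exact: (iota_cont ps2).
  move=> q qL; have [c [cB cq [W Wn [h hl]]]] := Lres q qL; exists c; split => //.
  have nF : nbhs q (~` F).
    apply: open_nbhs_nbhs; split; first exact: closed_openC.
    by move=> Fq; exact: (FL _ Fq).
  exists (W `&` ~` F); first exact: filterI.
  exists h; have hl' := islift_sub (A := (W `&` ~` F) `\ q) (B := W `\ q) (fun y Wy => conj Wy.1.1 Wy.2) hl.
  by apply: islift_eqf hl' => y [[_ nFy] _]; rewrite /b Fo.
have := surface_stokes Sok sb => st.
have h1 : eps * (\sum_(q <- L) n q)%:~R <= 0.
  rewrite rmorph_sum /= mulr_sumr big_seq; apply: sumr_le0 => q qL.
  by have := Lpos q qL; rewrite mulNr oppr_ge0.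
have m0 : (0 < m)%N.
  by have [x xb] := ne; have [i [s [im _]]] := s_bcover Sok xb; exact: leq_ltn_trans im.
have : 0 < eps * (\sum_(q <- L) n q)%:~R.
  rewrite st mulr_sumr; case: m m0 wind {Sok gQ sb st} => // m _ wind.
  rewrite big_ord_recl; apply: ltr_wpDr; last exact: (wind 0%N).
  by apply: sumr_ge0 => i _; apply: ltW; exact: (wind (lift ord0 i)).
by rewrite ltNge h1.
Qed.

Lemma negative_signed (S : topologicalType) (B : set (chart R 2 S)) (iota : S -> M) :
  negative_section phi B iota ->
  forall C, boundary_component B C -> exists2 m, multiplicity phi B iota C m & 0 < -1 * m%:~R :> R.
Proof. by move=> [_ h] C /h[m mm m0]; exists m; rewrite // mulN1r oppr_gt0 ltrz0. Qed.

Lemma positive_signed (S : topologicalType) (B : set (chart R 2 S)) (iota : S -> M) :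
  positive_section phi B iota ->
  forall C, boundary_component B C -> exists2 m, multiplicity phi B iota C m & 0 < 1 * m%:~R :> R.
Proof. by move=> [_ h] C /h[m mm m0]; exists m; rewrite // mul1r ltr0z. Qed.

Lemma closed_signed (eps : R) (S : topologicalType) (B : set (chart R 2 S)) (iota : S -> M) : bd B = set0 ->
  forall C, boundary_component B C -> exists2 m, multiplicity phi B iota C m & 0 < eps * m%:~R.
Proof. by move=> e C [x]; rewrite e. Qed.
End Exclusion.

Theorem corollary5 (R : realType) (M : topologicalType)
    (A : set (chart R 3 M)) (hM : closed_oriented_3manifold A)
    (phi : R -> M -> M) (hphi : smooth_flow A phi) :
  [/\ ~ (flat A phi /\ positively_twisted A phi),
      ~ (flat A phi /\ negatively_twisted A phi) &
      ~ (positively_twisted A phi /\ negatively_twisted A phi)].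
Proof.
have e1 : (1 : R) * 1 = 1 by rewrite mulr1.
have e2 : (-1 : R) * -1 = 1 by rewrite mulrNN mulr1.
split.
- move=> [[S1 [B1 [i1 [bk1 b0]]]] [S2 [B2 [i2 [bk2 p2]]]]].
  apply: (opposite_sections hM hphi e1 bk1 bk2 _ (positive_signed p2) p2.1).
  exact: closed_signed.
- move=> [[S1 [B1 [i1 [bk1 b0]]]] [S2 [B2 [i2 [bk2 p2]]]]].
  apply: (opposite_sections hM hphi e2 bk1 bk2 _ (negative_signed p2) p2.1).
  exact: closed_signed.
- move=> [[S1 [B1 [i1 [bk1 p1]]]] [S2 [B2 [i2 [bk2 p2]]]]].
  apply: (opposite_sections hM hphi e2 bk1 bk2 _ (negative_signed p2) p2.1).
  by rewrite opprK; exact: positive_signed p1.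
Qed.
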